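(* Let $g:\mathbb{R}^d\to\mathbb{R}$ be bounded and uniformly continuous. For a control $\alpha=(\alpha^0,\alpha^1)\in\mathcal{A}$ let $$X^\alpha_s:=\int_0^s\alpha^0_t\,dt+\int_0^s\alpha^1_t\,dB_t,\qquad s\in[0,T]$$ (same notation for deterministic controls in $\mathcal{D}_h$), and define $$u_0:=\sup_{\alpha\in\mathcal{A},\,\tau\in\mathcal{T}_T}\mathbb{E}^{\mathbb{P}_0}\big[g(X^\alpha_\tau)\big],$$ $$v^h:=\inf_{\varphi\in\mathcal{U}}\mathbb{E}^{\mathbb{P}_0}\Big[\sup_{\alpha\in\mathcal{D}_h,\ t\in[0,T]}\Big\{g(X^\alpha_t)-\int_0^t\varphi_s(X^\alpha)^{\intercal}\alpha^1_s\,dB_s\Big\}\Big],\qquad h>0 .$$ Then $$u_0=\lim_{h\to0}v^h .$$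
   Context: Let $T>0$ and $d,m\in\mathbb{N}$. For $j\in\mathbb{N}$ let $\Omega^j:=\{\omega\in C([0,T],\mathbb{R}^j):\omega_0=0\}$. $B$ is the canonical process on $\Omega^m$, $\mathbb{F}$ the filtration it generates, and $\mathbb{P}_0$ the Wiener measure on $\Omega^m$ (so $B$ is an $m$-dimensional Brownian motion). $A$ is a nonempty compact subset of $\mathbb{R}^d\times\mathbb{R}^{d\times m}$; its elements are written $(b^0,b^1)$. For each $h>0$, fix a finite partition $0=t^h_0<t^h_1<\dots<t^h_{n_h}=T$ of $[0,T]$ with $t^h_{i+1}-t^h_i\le h$ for all $i$, and a finite $h$-net $N^h\subset A$ of $A$ (a finite set such that every point of $A$ is within distance $h$ of some point of $N^h$). The partitions are assumed nested: $\{t^h_i\}_{i\le n_h}\subset\{t^{h'}_i\}_{i\le n_{h'}}$ whenever $h>h'$. $\mathcal{A}$ is the set of jointly measurable $\mathbb{F}$-adapted processes $\alpha=(\alpha^0,\alpha^1)$ on $[0,T]\times\Omega^m$ with values in $A$. $\mathcal{T}_T$ is the set of $\mathbb{F}$-stopping times $\tau\le T$. $\mathcal{U}$ is the set of bounded jointly measurable functions $\varphi:[0,T]\times\Omega^d\to\mathbb{R}^d$ that are adapted to the canonical filtration of $\Omega^d$; $\varphi_t(X^\alpha)$ denotes $\varphi$ evaluated along the path of $X^\alpha$. $\mathcal{D}_h$ is the finite set of deterministic functions $[0,T]\to N^h$ that are constant on each $[t^h_i,t^h_{i+1})$. Stochastic integrals are taken in their continuous versions. *)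

(* Defs.v *)
From HB Require Import structures.
From mathcomp Require Import all_boot all_order all_algebra.
From mathcomp Require Import all_classical all_reals all_analysis.

Set Implicit Arguments.
Unset Strict Implicit.
Unset Printing Implicit Defensive.

Import Order.TTheory GRing.Theory Num.Theory.
Import numFieldNormedType.Exports.

Local Open Scope classical_set_scope.
Local Open Scope ring_scope.

(* Functions on [0, T] are represented by functions on the whole line. When the
   function itself matters (paths, deterministic controls) it is required to be
   the constant extension of its restriction, which makes the encoding
   bijective; processes are only ever inspected at times in [0, T]. *)
Definition clamp (R : realType) (T t : R) : R := Num.max 0 (Num.min t T).

Definition frob (R : realType) (p q : nat) (M : 'M[R]_(p, q)) : R :=
  Num.sqrt (\sum_(i < p) \sum_(j < q) M i j ^+ 2).

Section PathSpace.
Variables (R : realType) (T : R).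

Record path_fun (j : nat) := PathFun {
  path_val :> R -> 'cV[R]_j ;
  path_cont : continuous path_val ;
  path_start : path_val 0 = 0 ;
  path_clamp : forall t, path_val t = path_val (clamp T t) }.

HB.instance Definition _ j := gen_eqMixin (path_fun j).
HB.instance Definition _ j := gen_choiceMixin (path_fun j).

Definition zero_path (j : nat) : path_fun j :=
  @PathFun j (fun=> 0) (fun x => cvg_cst _) erefl (fun=> erefl).

HB.instance Definition _ j := isPointed.Build (path_fun j) (zero_path j).

Definition cylinders (j : nat) (t : R) : set (set (path_fun j)) :=
  [set C | exists (s : R) (i : 'I_j) (B : set R),
     [/\ 0 <= s <= t, measurable B & C = [set w : path_fun j | B (w s i 0)]]].

(* Omega^j, with the sigma-algebra generated by its canonical process *)
Definition Omega (j : nat) := g_sigma_algebraType (@cylinders j T).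

HB.instance Definition _ j := Measurable.on (Omega j).

Definition ev (j : nat) (w : Omega j) : R -> 'cV[R]_j := path_val w.

(* raw (not augmented) filtration of the canonical process, for t in [0, T] *)
Definition filt (j : nat) (t : R) : set (set (Omega j)) := <<s @cylinders j t >>.

Definition filt_measurable (j : nat) (t : R) (p q : nat)
    (f : Omega j -> 'M[R]_(p, q)) : Prop :=
  forall (i : 'I_p) (k : 'I_q) (B : set R), measurable B ->
    filt t [set w | B (f w i k)].

Definition adapted (j p q : nat) (H : R -> Omega j -> 'M[R]_(p, q)) : Prop :=
  forall t, 0 <= t <= T -> filt_measurable t (H t).

Definition jointly_measurable (j p q : nat)
    (H : R -> Omega j -> 'M[R]_(p, q)) : Prop :=
  forall (i : 'I_p) (k : 'I_q),
    measurable_fun (`[0, T] `*` [set: Omega j])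
      (fun x : R * Omega j => H x.1 x.2 i k).

Definition stopping_time (j : nat) (tau : Omega j -> R) : Prop :=
  (forall w, 0 <= tau w <= T) /\
  (forall t, 0 <= t <= T -> filt t [set w | tau w <= t]).

(* B_t - B_s is independent of F_s with law N(0, (t - s) I_m); B_0 = 0 holds by
   definition of Omega^m. This determines the probability measure uniquely. *)
Definition wiener_measure (m : nat) (P : probability (Omega m) R) : Prop :=
  forall (s t : R) (F : set (Omega m)) (C : 'I_m -> set R),
    0 <= s -> s < t -> t <= T -> filt s F -> (forall i, measurable (C i)) ->
    P (F `&` [set w | forall i, C i (ev w t i 0 - ev w s i 0)]) =
    (P F * \prod_(i < m) normal_prob 0 (Num.sqrt (t - s)) (C i))%E.

(* the path that agrees with f on [0, T]; the zero path if there is none *)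
Definition path_of (j : nat) (f : R -> 'cV[R]_j) : Omega j :=
  xget point [set w | forall t, 0 <= t <= T -> ev w t = f t].

(* sum_(i < size) coef_i 1_(time_i, time_(i+1)] *)
Record simple_process (m k : nat) := SimpleProcess {
  sp_size : nat ;
  sp_time : nat -> R ;
  sp_coef : nat -> Omega m -> 'M[R]_(k, m) ;
  sp_time_ge0 : 0 <= sp_time 0%N ;
  sp_time_leT : sp_time sp_size <= T ;
  sp_time_le : forall i, (i < sp_size)%N -> sp_time i <= sp_time i.+1 ;
  sp_coef_meas : forall i, (i < sp_size)%N ->
    filt_measurable (sp_time i) (sp_coef i) ;
  sp_coef_bnd : forall i, (i < sp_size)%N ->
    exists K : R, forall w, frob (sp_coef i w) <= K }.

Definition sp_process (m k : nat) (S : simple_process m k)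
    (t : R) (w : Omega m) : 'M[R]_(k, m) :=
  \sum_(i < sp_size S | sp_time S i < t <= sp_time S i.+1) sp_coef S i w.

Definition sp_integral (m k : nat) (S : simple_process m k)
    (t : R) (w : Omega m) : 'cV[R]_k :=
  \sum_(i < sp_size S) sp_coef S i w *m
    (ev w (Num.min (sp_time S i.+1) t) - ev w (Num.min (sp_time S i) t)).

(* I is a continuous version of the Ito integral of H with respect to the
   canonical process: H is approximated in L^2(dt x P) by simple processes whose
   integrals up to t converge in L^2(P) to I_t, for every t in [0, T]. *)
Definition is_ito (m k : nat) (P : probability (Omega m) R)
    (H : R -> Omega m -> 'M[R]_(k, m)) (I : Omega m -> Omega k) : Prop :=
  measurable_fun [set: Omega m] I /\
  exists S : nat -> simple_process m k,
    (\int[P]_w \int[lebesgue_measure]_(t in `[0%R, T])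
        (frob (H t w - sp_process (S n) t w) ^+ 2)%:E)%E
      @[n --> \oo] --> 0%E /\
    forall t, 0 <= t <= T ->
      ('E_P[fun w => (frob (ev (I w) t - sp_integral (S n) t w) ^+ 2)%R])%E
        @[n --> \oo] --> 0%E.

(* Unique up to indistinguishability; it exists for every bounded, jointly
   measurable and adapted H. The value is irrelevant for other integrands. *)
Definition ito (m k : nat) (P : probability (Omega m) R)
    (H : R -> Omega m -> 'M[R]_(k, m)) : Omega m -> Omega k :=
  xget (fun=> point) [set I | is_ito P H I].

Definition control (d m : nat) : Type := ('cV[R]_d * 'M[R]_(d, m))%type.

Definition cdist (d m : nat) (a b : control d m) : R :=
  Num.sqrt (frob (a.1 - b.1) ^+ 2 + frob (a.2 - b.2) ^+ 2).

Definition admissible (d m : nat) (A : set (control d m))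
    (a : R -> Omega m -> control d m) : Prop :=
  [/\ forall t w, 0 <= t <= T -> A (a t w),
      jointly_measurable (fun t w => (a t w).1),
      jointly_measurable (fun t w => (a t w).2),
      adapted (fun t w => (a t w).1) &
      adapted (fun t w => (a t w).2)].

Definition state (d m : nat) (P : probability (Omega m) R)
    (a : R -> Omega m -> control d m) (w : Omega m) : Omega d :=
  path_of (fun s =>
    (\col_(i < d) \int[lebesgue_measure]_(t in `[0, s]) ((a t w).1 i 0)) +
    ev (ito P (fun t w' => (a t w').2) w) s).

Definition primal_value (d m : nat) (P : probability (Omega m) R)
    (A : set (control d m)) (g : 'cV[R]_d -> R) : \bar R :=
  ereal_sup [set y | exists a tau, [/\ admissible A a, stopping_time tau &
    y = ('E_P[fun w => g (ev (state P a w) (tau w))])%E]].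

Definition hedge (d : nat) (phi : R -> Omega d -> 'cV[R]_d) : Prop :=
  [/\ exists K : R, forall t x, 0 <= t <= T -> frob (phi t x) <= K,
      jointly_measurable phi & adapted phi].

(* finite when N is finite, since values outside [0, T] are determined *)
Definition step_control (d m : nat) (n : nat) (ts : nat -> R)
    (N : set (control d m)) (a : R -> control d m) : Prop :=
  [/\ forall t, 0 <= t <= T -> N (a t),
      forall i t, (i < n)%N -> ts i <= t < ts i.+1 -> a t = a (ts i) &
      forall t, a t = a (clamp T t)].

Definition dual_payoff (d m : nat) (P : probability (Omega m) R)
    (g : 'cV[R]_d -> R) (n : nat) (ts : nat -> R) (N : set (control d m))
    (phi : R -> Omega d -> 'cV[R]_d) (w : Omega m) : \bar R :=
  ereal_sup [set z | exists a t, [/\ step_control n ts N a, 0 <= t <= T &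
    let X := state P (fun s (_ : Omega m) => a s) in
    let I := ito P (fun s w' => (phi s (X w'))^T *m (a s).2) in
    z = (g (ev (X w) t) - ev (I w) t 0 0)%:E]].

Definition dual_value (d m : nat) (P : probability (Omega m) R)
    (g : 'cV[R]_d -> R) (n : nat) (ts : nat -> R) (N : set (control d m)) :
    \bar R :=
  ereal_inf [set y | exists2 phi, hedge phi &
    y = (\int[P]_w dual_payoff P g n ts N phi w)%E].

Definition is_partition (n : nat) (ts : nat -> R) (h : R) : Prop :=
  [/\ ts 0%N = 0, ts n = T, forall i, (i < n)%N -> ts i < ts i.+1 &
      forall i, (i < n)%N -> ts i.+1 - ts i <= h].

Definition finite_net (d m : nat) (A N : set (control d m)) (h : R) : Prop :=
  [/\ finite_set N, N `<=` A &
      forall a, A a -> exists2 b, N b & cdist a b <= h].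

End PathSpace.

Arguments step_control {R} T {d m}.
Arguments is_partition {R} T.

(* Main.v *)
(** Lower bound. Fix a control and a stopping time. The stopping time is rounded
    up to a coarse grid, and the control is replaced by the net point nearest to
    its average over a short past interval, frozen on the cells of a fine grid;
    the resulting random step control is adapted and its state converges to the
    given one. Choosing this step control and this time in the supremum, the
    gain of any hedge has mean zero: on a cell it depends only on the prefix of
    the control, which is known when the cell starts.

    Upper bound. Replace [g] by a Lipschitz majorant. On a finer partition of the
    nested family, with controls in the fixed net, backward induction gives value
    functions [U_k] with [U_0 0] at most the primal value, by feedback controls
    and a first exit time. Averaging translates of [U_k] over a small finite cube
    gives supersolutions [V_k] with a Taylor expansion that is uniformly accurate
    to second order. Hedging with the difference quotients of [V_(k+1)] on cell
    [k] leaves the martingale of the centred Taylor remainders, whose second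
    moment is of the order of the mesh. Doob's inequality controls its maximum,
    simultaneously for the finitely many controls of the coarse grid, and the
    oscillation of the paths inside the cells vanishes by dominated convergence. *)
Require Import Defs.
From HB Require Import structures.
From mathcomp Require Import all_boot all_order all_algebra.
From mathcomp Require Import all_classical all_reals all_analysis.
From mathcomp Require Import measurable_realfun ring lra.

Set Implicit Arguments.
Unset Strict Implicit.
Unset Printing Implicit Defensive.

Import Order.TTheory GRing.Theory Num.Theory.
Import numFieldNormedType.Exports.

Local Open Scope classical_set_scope.
Local Open Scope ring_scope.

(** * Integration *)

(** The upper bound is not asymptotic: for every [h] the dual value is at most the primal value,
    because a hedge may rebalance on a grid as fine as desired while the controls in the supremum
    stay those of [h]. The obstacle is regularity: the functions U_k are Lipschitz and no better, so
    Ito's formula does not apply to them. An average of translates is a finite sum, hence commutes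
    with the Gaussian transitions and keeps the supersolution inequality. When the step of the
    difference quotients equals the spacing of the cube, the sums telescope, and the Lipschitz
    constant of the quotients depends on the width of the cube alone. The spacing can therefore be
    chosen last, after the number of cells, and this keeps the accumulated Taylor error small. A
    single hedge serves all controls because it reads the current state off its own argument, the
    path of X. The dual payoff is a supremum over all times, and states and integrals are picked by
    [xget]; integrals are therefore compared through inequalities in which only one side has to be
    measurable. *)

Section Monotonicity.
Context d (X : measurableType d) (R : realType).
Variable mu : {measure set X -> \bar R}.
Implicit Types (D : set X) (f g : X -> \bar R).

(* No measurability is required: the integral is defined for every function. *)
Lemma le_integral_pointwise D f g : (forall x, D x -> f x <= g x)%E ->
  (\int[mu]_(x in D) f x <= \int[mu]_(x in D) g x)%E.
Proof.
move=> fg; have fg' x : ((f \_ D) x <= (g \_ D) x)%E.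
  by rewrite /patch; case: ifPn => // /set_mem /fg.
rewrite /integral; apply: leeB; apply: ereal_sup_le => _ [h /= hf <-];
  exists h => //= x; apply: (le_trans (hf x)).
  by rewrite !funeposE ge_max !le_max lexx fg' orbT.
by rewrite !funenegE ge_max !le_max lexx leeN2 fg' orbT.
Qed.

(** Only the larger function is measurable, since the left side will be a supremum over all times.
    Raising [g] to [+oo] on the exceptional null set makes the comparison pointwise and keeps its
    integral. *)
Lemma ae_le_integral_r f g :
  {ae mu, forall x, (f x <= g x)%E} -> measurable_fun setT g ->
  (\int[mu]_x f x <= \int[mu]_x g x)%E.
Proof.
move=> [M [mM M0 sM]] mg.
pose g' x := if x \in M then +oo%E else g x.
have mg' : measurable_fun setT g'.
  apply: measurable_fun_ifT => //.
  by apply: (measurable_fun_bool true); rewrite setTI preimage_mem_true.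
rewrite (_ : (\int[mu]_x g x)%E = (\int[mu]_x g' x)%E).
  apply: le_integral_pointwise => x _; rewrite /g'; case: ifPn => [_|/negP xM].
    exact: leey.
  by apply: contrapT => h; apply: xM; apply/mem_set/sM.
apply: ae_eq_integral => //; exists M; split => // x /= h; apply: contrapT => xM.
by apply: h => _; rewrite /g' memNset.
Qed.

(** The mirror image, for lower bounds on a payoff: [f] drops to [-oo] on the null set. *)
Lemma ae_le_integral_l f g :
  {ae mu, forall x, (f x <= g x)%E} -> measurable_fun setT f ->
  (\int[mu]_x f x <= \int[mu]_x g x)%E.
Proof.
move=> [M [mM M0 sM]] mg.
pose f' x := if x \in M then -oo%E else f x.
have mf' : measurable_fun setT f'.
  apply: measurable_fun_ifT => //.
  by apply: (measurable_fun_bool true); rewrite setTI preimage_mem_true.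
rewrite (_ : (\int[mu]_x f x)%E = (\int[mu]_x f' x)%E).
  apply: le_integral_pointwise => x _; rewrite /f'; case: ifPn => [_|/negP xM].
    exact: leNye.
  by apply: contrapT => h; apply: xM; apply/mem_set/sM.
apply: ae_eq_integral => //; exists M; split => // x /= h; apply: contrapT => xM.
by apply: h => _; rewrite /f' memNset.
Qed.

Lemma ae_eq_integral_nonmeasurable f g :
  {ae mu, forall x, f x = g x} -> measurable_fun setT g ->
  (\int[mu]_x f x = \int[mu]_x g x)%E.
Proof.
move=> fg mg; apply/eqP; rewrite eq_le; apply/andP; split.
  by apply: ae_le_integral_r => //; apply: filterS fg => x ->.
by apply: ae_le_integral_l => //; apply: filterS fg => x ->.
Qed.

Lemma le_integral_2D2 D f f1 f2 : measurable D ->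
  measurable_fun D f1 -> measurable_fun D f2 ->
  (forall x, 0 <= f1 x)%E -> (forall x, 0 <= f2 x)%E ->
  (forall x, D x -> f x <= 2%:E * f1 x + 2%:E * f2 x)%E ->
  (\int[mu]_(x in D) f x <=
   2%:E * \int[mu]_(x in D) f1 x + 2%:E * \int[mu]_(x in D) f2 x)%E.
Proof.
move=> mD m1 m2 p1 p2 h; rewrite -!ge0_integralZl//.
rewrite -ge0_integralD//; last 4 first.
- by move=> x _; rewrite mule_ge0.
- exact: measurable_funeM.
- by move=> x _; rewrite mule_ge0.
- exact: measurable_funeM.
exact: le_integral_pointwise.
Qed.

End Monotonicity.

Lemma sum_sqr_ge0 (R : realType) (I : finType) (F : I -> R) :
  0 <= \sum_i F i ^+ 2.
Proof. by apply: sumr_ge0 => i _; rewrite sqr_ge0. Qed.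

Section Frob.
Context (R : realType) (p q : nat).
Implicit Type M : 'M[R]_(p, q).

Lemma frob_ge0 M : 0 <= frob M. Proof. exact: sqrtr_ge0. Qed.

Lemma frob2E M : frob M ^+ 2 = \sum_i \sum_j M i j ^+ 2.
Proof.
by rewrite sqr_sqrtr//; apply: sumr_ge0 => i _; exact: sum_sqr_ge0.
Qed.

Lemma frob_entry M i j : `|M i j| <= frob M.
Proof.
rewrite -(ler_pXn2r (n := 2)) ?nnegrE ?frob_ge0 ?normr_ge0// real_normK ?num_real//.
rewrite frob2E (bigD1 i)//= (bigD1 j)//= -!addrA lerDl.
by rewrite addr_ge0// ?sumr_ge0// => k _; rewrite ?sqr_ge0 ?sum_sqr_ge0.
Qed.

Lemma frob2D M N : frob (M + N) ^+ 2 <= 2 * frob M ^+ 2 + 2 * frob N ^+ 2.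
Proof.
rewrite !frob2E !mulr_sumr -big_split ler_sum// => i _.
rewrite !mulr_sumr -big_split ler_sum//= => j _; rewrite !mxE.
rewrite -subr_ge0 (_ : _ - _ = (M i j - N i j) ^+ 2) ?sqr_ge0//; ring.
Qed.

Lemma frobN M : frob (- M) = frob M.
Proof.
by rewrite /frob; congr Num.sqrt; apply: eq_bigr => i _; apply: eq_bigr => j _;
   rewrite mxE sqrrN.
Qed.

Lemma frob2_triangle M N K :
  frob (M - K) ^+ 2 <= 2 * frob (M - N) ^+ 2 + 2 * frob (N - K) ^+ 2.
Proof. by rewrite -(subrKA N) frob2D. Qed.

Lemma frob_le_entries M (K : R) : 0 <= K -> (forall i j, `|M i j| <= K) ->
  frob M ^+ 2 <= (p * q)%:R * K ^+ 2.
Proof.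
move=> K0 MK; rewrite frob2E.
apply: (@le_trans _ _ (\sum_(i < p) \sum_(j < q) K ^+ 2)).
  apply: ler_sum => i _; apply: ler_sum => j _.
  by rewrite -(real_normK (num_real _)) ler_pXn2r ?nnegrE.
by rewrite !sumr_const !card_ord -mulrnA mulr_natl mulnC.
Qed.

End Frob.

Section SecondMoments.
Context d (X : measurableType d) (R : realType) (P : probability X R).
Implicit Types (f g : X -> R).

Definition moment2 f : \bar R := (\int[P]_w (f w ^+ 2)%:E)%E.

Definition isL2 f : Prop := measurable_fun setT f /\ (moment2 f < +oo)%E.

Lemma measurable_sqr f : measurable_fun setT f ->
  measurable_fun setT (fun w => (f w ^+ 2)%:E).
Proof. by move=> mf; apply/measurable_EFinP; exact: measurable_funX. Qed.

Lemma isL2_sqr_integrable f : isL2 f -> P.-integrable setT (fun w => (f w ^+ 2)%:E).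
Proof.
move=> [mf f2]; apply/integrableP; split; first exact: measurable_sqr.
by under eq_integral do rewrite gee0_abs ?lee_fin ?sqr_ge0//.
Qed.

Lemma isL2M_integrable f g : isL2 f -> isL2 g ->
  P.-integrable setT (fun w => (f w * g w)%:E).
Proof.
move=> Lf Lg; have [mf _] := Lf; have [mg _] := Lg.
have := integrableD measurableT (isL2_sqr_integrable Lf) (isL2_sqr_integrable Lg).
apply: le_integrable => //; first by apply/measurable_EFinP; exact: measurable_funM.
move=> x _; rewrite -EFinD !abse_EFin lee_fin [leRHS]ger0_norm; last first.
  by rewrite addr_ge0 ?sqr_ge0.
rewrite ler_norml; apply/andP; split; rewrite -subr_ge0.
  have -> : f x * g x - - (f x ^+ 2 + g x ^+ 2) =
    2^-1 * ((f x + g x) ^+ 2 + f x ^+ 2 + g x ^+ 2) by field.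
  by rewrite mulr_ge0 ?addr_ge0 ?sqr_ge0.
have -> : f x ^+ 2 + g x ^+ 2 - f x * g x =
    2^-1 * ((f x - g x) ^+ 2 + f x ^+ 2 + g x ^+ 2) by field.
by rewrite mulr_ge0 ?addr_ge0 ?sqr_ge0.
Qed.

Lemma moment2D f g : measurable_fun setT f -> measurable_fun setT g ->
  (moment2 (fun w => (f w + g w)%R) <= 2%:E * moment2 f + 2%:E * moment2 g)%E.
Proof.
move=> mf mg; apply: le_integral_2D2 => //; try exact: measurable_sqr.
- by move=> x; rewrite lee_fin sqr_ge0.
- by move=> x; rewrite lee_fin sqr_ge0.
move=> x _; rewrite -!EFinM -EFinD lee_fin -subr_ge0.
rewrite (_ : _ - _ = (f x - g x) ^+ 2) ?sqr_ge0//; ring.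
Qed.

Lemma isL2D f g : isL2 f -> isL2 g -> isL2 (fun w => f w + g w).
Proof.
move=> [mf Lf] [mg Lg]; split; first exact: measurable_funD.
apply: le_lt_trans (moment2D mf mg) _.
by rewrite lte_add_pinfty// lte_mul_pinfty.
Qed.

Lemma moment2Z (k : R) f : measurable_fun setT f ->
  moment2 (fun w => k * f w) = ((k ^+ 2)%:E * moment2 f)%E.
Proof.
move=> mf; rewrite /moment2 -ge0_integralZl//=; last 3 first.
- exact: measurable_sqr.
- by move=> x _; rewrite lee_fin sqr_ge0.
- by rewrite lee_fin sqr_ge0.
by apply: eq_integral => x _; rewrite exprMn EFinM.
Qed.

Lemma isL2Z (k : R) f : isL2 f -> isL2 (fun w => k * f w).
Proof.
move=> [mf Lf]; split; first by apply: measurable_funM.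
by rewrite moment2Z// lte_mul_pinfty// ?lee_fin ?sqr_ge0.
Qed.

Lemma isL2N f : isL2 f -> isL2 (fun w => - f w).
Proof. by move=> /(isL2Z (-1)); under eq_fun do rewrite mulN1r. Qed.

Lemma isL2B f g : isL2 f -> isL2 g -> isL2 (fun w => f w - g w).
Proof. by move=> Lf Lg; apply: isL2D => //; exact: isL2N. Qed.

Lemma le_isL2 f g : measurable_fun setT f -> isL2 g ->
  (forall w, `|f w| <= `|g w|) -> isL2 f.
Proof.
move=> mf [mg Lg] fg; split=> //; apply: le_lt_trans Lg.
apply: le_integral_pointwise => x _; rewrite lee_fin.
by rewrite -(real_normK (num_real (f x))) -(real_normK (num_real (g x))) ler_pXn2r ?nnegrE.
Qed.

Lemma isL2_bounded f (K : R) : measurable_fun setT f -> (forall w, `|f w| <= K) ->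
  isL2 f.
Proof.
move=> mf fK; split=> //; apply: (@le_lt_trans _ _ (\int[P]_w (K ^+ 2)%:E)%E).
  apply: le_integral_pointwise => x _; rewrite lee_fin.
  rewrite -(real_normK (num_real (f x))) ler_pXn2r ?nnegrE//.
  exact: le_trans (fK x).
by rewrite integral_cst//= probability_setT mule1 ltey.
Qed.

Lemma isL2_cst (k : R) : isL2 (fun=> k).
Proof. by apply: (@isL2_bounded _ `|k|). Qed.

Lemma isL2_bounded_mul f g (K : R) : measurable_fun setT f ->
  (forall w, `|f w| <= K) -> isL2 g -> isL2 (fun w => f w * g w).
Proof.
move=> mf fK Lg; have [mg _] := Lg.
apply: (@le_isL2 _ (fun w => K * g w)); [exact: measurable_funM|exact: isL2Z|].
move=> w; rewrite !normrM ler_wpM2r// (le_trans (fK w))//.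
exact: ler_norm.
Qed.

Lemma isL2_sum (I : Type) (s : seq I) (Q : pred I) (F : I -> X -> R) :
  (forall i, Q i -> isL2 (F i)) -> isL2 (fun w => \sum_(i <- s | Q i) F i w).
Proof.
move=> LF; elim: s => [|i s IH].
  by under eq_fun do rewrite big_nil; exact: isL2_cst.
under eq_fun do rewrite big_cons.
by have := LF i; case: (Q i) => // LFi; apply: isL2D => //; exact: LFi.
Qed.

Lemma isL2_integrable f : isL2 f -> P.-integrable setT (EFin \o f).
Proof.
by move=> Lf; have := isL2M_integrable Lf (isL2_cst 1); under eq_fun do rewrite mulr1.
Qed.

Lemma isL2_max f g : isL2 f -> isL2 g -> isL2 (fun w => Num.max (f w) (g w)).
Proof.
move=> Lf Lg; have [mf _] := Lf; have [mg _] := Lg.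
have L2 : isL2 (fun w => `|f w| + `|g w|).
  by apply: isL2D; [apply: (le_isL2 _ Lf)|apply: (le_isL2 _ Lg)];
    rewrite ?normr_id//; [exact: measurableT_comp|move=> w; rewrite normr_id|
    exact: measurableT_comp|move=> w; rewrite normr_id].
apply: (le_isL2 _ L2); first exact: measurable_maxr.
move=> w; rewrite [leRHS]ger0_norm ?addr_ge0//.
by rewrite /Num.max; case: ifP => _; rewrite ?lerDl ?lerDr.
Qed.

Lemma moment2_Rintegral f : isL2 f -> (\int[P]_w (f w ^+ 2))%:E = moment2 f.
Proof.
move=> Lf; rewrite /Rintegral fineK//.
exact: (integrable_fin_num measurableT (isL2_sqr_integrable Lf)).
Qed.

(* AM-GM: [|f| <= c / 2 + f ^ 2 / (2 c)]. *)
Lemma integral_norm_le_moment2 f (c : R) : 0 < c -> measurable_fun setT f ->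
  (\int[P]_w `|f w|%:E <= (c / 2)%:E + ((2 * c)^-1)%:E * moment2 f)%E.
Proof.
move=> c0 mf; rewrite /moment2 -ge0_integralZl//=; last 3 first.
- exact: measurable_sqr.
- by move=> x _; rewrite lee_fin sqr_ge0.
- by rewrite lee_fin invr_ge0 mulr_ge0// ltW.
rewrite -[X in (X + _)%E]mule1 -(probability_setT P) -integral_cst//.
rewrite -ge0_integralD//=; last 3 first.
- by move=> x _; rewrite lee_fin divr_ge0// ltW.
- by move=> x _; rewrite lee_fin mulr_ge0 ?sqr_ge0// invr_ge0 mulr_ge0// ltW.
- by apply: measurable_funeM; exact: measurable_sqr.
apply: le_integral_pointwise => x _; rewrite -!EFinM -EFinD lee_fin -subr_ge0.
rewrite -[f x ^+ 2](real_normK (num_real _)).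
rewrite (_ : _ - _ = (2 * c)^-1 * (`|f x| - c) ^+ 2).
  by rewrite mulr_ge0 ?sqr_ge0// invr_ge0 mulr_ge0// ltW.
by field; rewrite gt_eqF.
Qed.

End SecondMoments.

Section AlmostEverywhere.
Context d (X : measurableType d) (R : realType) (mu : {measure set X -> \bar R}).
Implicit Types A B C : X -> Prop.

Lemma ae_mono A B : (forall x, A x -> B x) -> {ae mu, forall x, A x} -> {ae mu, forall x, B x}.
Proof.
by move=> AB [N [mN N0 h]]; exists N; split=> // x nBx; apply: h => Ax; apply: nBx; exact: AB.
Qed.

Lemma ae_mono2 A B C : (forall x, A x -> B x -> C x) ->
  {ae mu, forall x, A x} -> {ae mu, forall x, B x} -> {ae mu, forall x, C x}.
Proof.
move=> ABC [N [mN N0 hN]] [M [mM M0 hM]]; exists (N `|` M); split.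
- exact: measurableU.
- exact: null_set_setU.
- move=> x nCx; apply: contrapT => nNM; apply: nCx.
  by apply: ABC; apply: contrapT => h; apply: nNM; [left; exact: hN|right; exact: hM].
Qed.

Lemma ae_forall_count (I : countType) (Q : I -> X -> Prop) :
  (forall i, {ae mu, forall x, Q i x}) -> {ae mu, forall x, forall i, Q i x}.
Proof.
move=> h; have : {ae mu, forall x, forall n, forall i, unpickle n = Some i -> Q i x}.
  apply: ae_foralln => n; case: (unpickle n) => [i|]; last by apply/aeW.
  by apply: ae_mono (h i) => x Qx j [<-].
by apply: ae_mono => x hx i; apply: (hx (pickle i)); rewrite pickleK.
Qed.

End AlmostEverywhere.

(** * Independence and Gaussian moments *)

Section Freezing.
Context d1 d2 d (T1 : measurableType d1) (T2 : measurableType d2)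
  (X : measurableType d) (R : realType) (P : probability X R).
Variables (X1 : X -> T1) (X2 : X -> T2).
Hypotheses (mX1 : measurable_fun setT X1) (mX2 : measurable_fun setT X2).
Hypothesis indep : forall A C, measurable A -> measurable C ->
  P ((X1 @^-1` A) `&` (X2 @^-1` C)) = (P (X1 @^-1` A) * P (X2 @^-1` C))%E.

Let X12 w := (X1 w, X2 w).
Let mX12 : measurable_fun setT X12.
Proof. exact/measurable_fun_pair. Qed.

HB.instance Definition _ := isMeasurableFun.Build _ _ _ _ X1 mX1.
HB.instance Definition _ := isMeasurableFun.Build _ _ _ _ X2 mX2.
HB.instance Definition _ := isMeasurableFun.Build _ _ _ _ X12 mX12.

Let law1 : probability T1 R := distribution P X1.
Let law2 : probability T2 R := distribution P X2.
Let law12 : probability (T1 * T2)%type R := distribution P X12.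

Let law12E A : measurable A -> (law1 \x law2)%E A = law12 A.
Proof.
apply: product_measure_unique => B C mB mC.
by rewrite /law12 /distribution /pushforward -indep.
Qed.

(** By independence the joint law is the product of the two marginal laws, and Tonelli integrates
    [X2] out while [X1] stays frozen. *)
Lemma ge0_freezing (f : T1 * T2 -> \bar R) :
  measurable_fun setT f -> (forall z, 0 <= f z)%E ->
  (\int[P]_w f (X1 w, X2 w) = \int[P]_w \int[P]_w' f (X1 w, X2 w'))%E.
Proof.
move=> mf f0.
transitivity (\int[law12]_z f z)%E.
  by rewrite ge0_integral_distribution.
rewrite (@eq_measure_integral _ _ _ _ (law1 \x law2)%E law12); last first.
  by move=> A mA _; apply/esym/law12E.
rewrite fubini_tonelli1// ge0_integral_distribution; last 2 first.
- exact: measurable_fun_fubini_tonelli_F.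
- by move=> x; apply: integral_ge0.
apply: eq_integral => w _ /=; rewrite /fubini_F ge0_integral_distribution//.
exact: measurableT_comp.
Qed.

(** Integrability is asked at every frozen value so that the real-valued inner integral coincides
    with the extended Fubini integral everywhere. *)
Lemma freezing (f : T1 * T2 -> R) : measurable_fun setT f ->
  (forall x, P.-integrable setT (fun w => (f (x, X2 w))%:E)) ->
  P.-integrable setT (fun w => (f (X1 w, X2 w))%:E) ->
  (\int[P]_w f (X1 w, X2 w) = \int[P]_w \int[P]_w' f (X1 w, X2 w'))%R /\
  P.-integrable setT (fun w => (\int[P]_w' f (X1 w, X2 w'))%:E).
Proof.
move=> mf intx intf; have mfE : measurable_fun setT (EFin \o f).
  exact/measurable_EFinP.
have intl12 : law12.-integrable setT (EFin \o f) by exact: integrable_pushforward.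
have intl : (law1 \x law2)%E.-integrable setT (EFin \o f).
  move/integrableP : intl12 => [_ h]; apply/integrableP; split => //.
  by rewrite (@eq_measure_integral _ _ _ _ law12)// => A mA _; exact: law12E.
have FE x : (fubini_F law2 (EFin \o f) x = (\int[P]_w' f (x, X2 w'))%:E)%E.
  rewrite /fubini_F /law2 integral_distribution//; last exact: intx.
    by rewrite fineK//; exact: (integrable_fin_num measurableT (intx x)).
  exact: measurableT_comp.
have mF := measurable_fubini_F intl.
have iF := integrable_fubini_F intl.
have iF1 : P.-integrable setT (fubini_F law2 (EFin \o f) \o X1).
  apply/integrableP; split; first exact: measurableT_comp.
  move/integrableP : iF => [_]; rewrite ge0_integral_distribution//.
  exact: measurableT_comp.
split; last by apply: eq_integrable iF1 => // w _ /=; rewrite FE.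
rewrite /Rintegral; congr fine.
transitivity (\int[law12]_z (f z)%:E)%E.
  by rewrite integral_distribution//.
rewrite (@eq_measure_integral _ _ _ _ (law1 \x law2)%E law12); last first.
  by move=> A mA _; apply/esym/law12E.
rewrite -[LHS](integral12_prod_meas1 intl) integral_distribution//.
by apply: eq_integral => w _ /=; rewrite FE.
Qed.

End Freezing.

(** * Moments of the centred normal law *)

Section NormalMoments.
Context (R : realType).
Notation mu := (@lebesgue_measure R).

Import HBNNSimple.

(** On sets the law is the integral of its density; monotone approximation by simple functions
    extends this to integrals. *)
Lemma ge0_integral_normal_prob (s : R) (f : R -> \bar R) :
  measurable_fun setT f -> (forall x, 0 <= f x)%E ->
  (\int[normal_prob 0 s]_x f x = \int[mu]_x (f x * (normal_pdf 0 s x)%:E))%E.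
Proof.
move=> mf f0.
have mp : measurable_fun [set: measurableTypeR R] (fun x => (normal_pdf 0 s x)%:E).
  by apply/measurable_EFinP; exact: measurable_normal_pdf.
have p0 x : (0 <= (normal_pdf 0 s x)%:E)%E by rewrite lee_fin normal_pdf_ge0.
pose f_ := nnsfun_approx (measurableT : measurable [set: measurableTypeR R]) mf.
have cf x : EFin \o f_ ^~ x @ \oo --> f x.
  by apply: cvg_nnsfun_approx => // *; exact: f0.
transitivity (limn (fun n => \int[normal_prob 0 s]_x (f_ n x)%:E))%E.
  rewrite -monotone_convergence//.
  - by apply: eq_integral => y _; apply/esym/cvg_lim => //; exact: cf.
  - by move=> n; exact/measurable_EFinP/measurable_funP.
  - by move=> n y _; rewrite lee_fin.
  - by move=> y _ m n mn; rewrite lee_fin; exact/lefP/nd_nnsfun_approx.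
rewrite [X in limn X](_ : _ =
    (fun n => \int[mu]_x ((f_ n x)%:E * (normal_pdf 0 s x)%:E))%E).
  rewrite -monotone_convergence//; last 3 first.
    - move=> n; apply: emeasurable_funM => //.
      exact/measurable_EFinP/measurable_funP.
    - by move=> n x _; apply: mule_ge0; rewrite ?lee_fin ?normal_pdf_ge0// fun_ge0.
    - move=> x _ m n mn; rewrite lee_wpmul2r// lee_fin.
      exact/lefP/nd_nnsfun_approx.
  apply: eq_integral => x _ /=; apply/cvg_lim => //.
  by apply: cvgeZr => //; exact: cf.
apply/funext => n; rewrite integralT_nnsfun sintegralE.
under [RHS]eq_integral.
  move=> x _; rewrite fimfunE -fsumEFin// ge0_mule_fsuml; last first.
    by move=> y; rewrite nnfun_muleindic_ge0.
  over.
rewrite ge0_integral_fsum//; last 2 first.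
- move=> y; apply: emeasurable_funM => //.
  apply/measurable_EFinP; apply: measurable_funM; first exact: measurable_cst.
  have mA : measurable (f_ n @^-1` [set y] : set (measurableTypeR R)).
    exact: measurable_sfunP.
  exact: (@measurable_indic _ (measurableTypeR R) R setT _ mA).
- by move=> y x _; rewrite mule_ge0// nnfun_muleindic_ge0.
apply: eq_fsbigr => r /set_mem[x _ <-].
rewrite /normal_prob -ge0_integralZl//; last 2 first.
- apply: measurable_funTS; exact: mp.
- by rewrite lee_fin fun_ge0.
rewrite [LHS]integral_mkcond.
apply: eq_integral => y _; rewrite patchE indicE EFinM -muleA.
by case: ifPn => _; rewrite ?mul1e ?mul0e ?mule0.
Qed.

Lemma ge0_integral_lebesgue_opp (f : R -> \bar R) :
  measurable_fun setT f -> (forall x, 0 <= f x)%E ->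
  (\int[mu]_x f (- x)%R = \int[mu]_x f x)%E.
Proof.
move=> mf f0; have mN : measurable_fun setT (-%R : measurableTypeR R -> measurableTypeR R).
  exact: measurable_funN.
have := @ge0_integral_pushforward _ _ (measurableTypeR R) (measurableTypeR R)
  R -%R mN mu setT f measurableT mf (fun x _ => f0 x).
rewrite preimage_setT => <-.
by apply: eq_measure_integral => A mA _; rewrite -[RHS]lebesgue_measureN.
Qed.

Lemma normal_pdf_opp (s x : R) : s != 0 ->
  normal_pdf 0 s (- x) = normal_pdf 0 s x.
Proof. by move=> s0; rewrite !normal_pdfE// /normal_fun !subr0 sqrrN. Qed.

Lemma ge0_integral_normal_prob_opp (s : R) (f : R -> \bar R) : s != 0 ->
  measurable_fun setT f -> (forall x, 0 <= f x)%E ->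
  (\int[normal_prob 0 s]_x f (- x)%R = \int[normal_prob 0 s]_x f x)%E.
Proof.
move=> s0 mf f0; rewrite !ge0_integral_normal_prob//; last exact: measurableT_comp.
rewrite -[RHS]ge0_integral_lebesgue_opp.
- by apply: eq_integral => x _; rewrite normal_pdf_opp.
- apply: emeasurable_funM => //.
  by apply/measurable_EFinP; exact: measurable_normal_pdf.
- by move=> x; rewrite mule_ge0// lee_fin normal_pdf_ge0.
Qed.

Lemma normal_pdf_scale (s x : R) : 0 < s ->
  normal_pdf 0 s (s * x) * s = normal_pdf 0 1 x.
Proof.
move=> s0; rewrite !normal_pdfE ?gt_eqF// /normal_fun /normal_peak !subr0.
rewrite expr1n mul1r exprMn -[in X in expR X]mulr_natr.
rewrite (_ : - _ / _ = - x ^+ 2 / 2); last by field; rewrite gt_eqF.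
rewrite -mulrnAr sqrtrM ?sqr_ge0// sqrtr_sqr gtr0_norm// invfM.
have : Num.sqrt (pi *+ 2 : R) != 0 by rewrite gt_eqF// sqrtr_gt0 mulrn_wgt0// pi_gt0.
by move=> h; field; rewrite h gt_eqF.
Qed.

(** An even moment of the standard normal law, handled as an abstract constant: the estimates rest
    on its finiteness and its scaling. *)
Definition normal_moment (k : nat) : \bar R := (\int[normal_prob 0 1]_x (x ^+ (2 * k))%:E)%E.

Lemma normal_moment_scale (s : R) (k : nat) : 0 < s ->
  (\int[normal_prob 0 s]_x (x ^+ (2 * k))%:E =
   (s ^+ (2 * k))%:E * normal_moment k)%E.
Proof.
move=> s0; have ev0 (x : R) : 0 <= x ^+ (2 * k) by rewrite exprM exprn_ge0// sqr_ge0.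
have mX : measurable_fun setT (fun x : R => (x ^+ (2 * k))%:E).
  by apply/measurable_EFinP; exact: measurable_funX.
rewrite /normal_moment !ge0_integral_normal_prob//.
rewrite -ge0_integralZl//; last 3 first.
- apply: emeasurable_funM => //.
  by apply/measurable_EFinP; exact: measurable_normal_pdf.
- by move=> x _; rewrite mule_ge0// lee_fin ?normal_pdf_ge0.
- by rewrite lee_fin.
have F'E : derive1 (fun x : R => s * x) = cst s.
  apply/funext => x; rewrite derive1E.
  by rewrite (_ : (fun x => s * x) = s *: id)// deriveZ// derive_id /= scaler1.
under [LHS]eq_integral do rewrite -EFinM.
rewrite (@increasing_ge0_integration_by_substitutionT _ (fun x : R => s * x)).
- apply: eq_integral => x _; rewrite F'E /= -!EFinM; congr EFin.
  rewrite -(@normal_pdf_scale s)//=.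
  change ((s * x) ^+ (2 * k) * normal_pdf 0 s (s * x) * s =
    s ^+ (2 * k) * (x ^+ (2 * k) * (normal_pdf 0 s (s * x) * s))).
  by rewrite exprMn !mulrA.
- by move=> x y xy; rewrite ltr_pM2l.
- by rewrite F'E; exact: cst_continuous.
- by rewrite F'E; exact: is_cvg_cst.
- by rewrite F'E; exact: is_cvg_cst.
- by move=> x; exact: derivableM.
- by apply: gt0_cvgMrNy => //; exact: cvg_id.
- by apply: gt0_cvgMry => //; exact: cvg_id.
- move=> x; apply: cvgM; first exact: exprn_continuous.
  by apply: continuous_normal_pdf; rewrite gt_eqF.
- by move=> x; rewrite mulr_ge0// normal_pdf_ge0.
Qed.

Lemma normal_moment2_lty : (normal_moment 2 < +oo)%E.
Proof.
have m4 : measurable_fun setT (fun x : R => (x ^+ 4)%:E).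
  by apply/measurable_EFinP; exact: measurable_funX.
have s2 : 2 != 0 :> R by rewrite pnatr_eq0.
rewrite /normal_moment ge0_integral_normal_prob//; last first.
  by move=> x; rewrite lee_fin (exprM _ 2 2) sqr_ge0.
(* With y = x^2 / 8 the integrand is 64 y^2 exp(-4y) up to the peak. Bounding y exp(-y) by 1 twice
   leaves a multiple of exp(-y), the shape of the normal density with deviation 2. *)
pose C : R := 256%:R * normal_peak 1 / normal_peak 2.
have C0 : 0 <= C by rewrite !mulr_ge0 ?invr_ge0 ?normal_peak_ge0.
apply: (@le_lt_trans _ _ (\int[mu]_x (C%:E * (normal_pdf 0 2 x)%:E))%E); last first.
  rewrite ge0_integralZl//; last 2 first.
  - by apply/measurable_EFinP; exact: measurable_normal_pdf.
  - by move=> x _; rewrite lee_fin normal_pdf_ge0.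
  by rewrite integral_normal_pdf mule1 ltry.
apply: le_integral_pointwise => x _; rewrite -!EFinM lee_fin.
rewrite !normal_pdfE// /C; have p2 := normal_peak_gt0 s2.
rewrite (_ : 256%:R * normal_peak 1 / normal_peak 2 * (normal_peak 2 * normal_fun 0 2 x) =
  normal_peak 1 * (256%:R * normal_fun 0 2 x)); last by field; rewrite gt_eqF.
rewrite mulrCA ler_wpM2l ?normal_peak_ge0//.
rewrite /normal_fun !subr0.
have -> : - x ^+ 2 / (1 ^+ 2 *+ 2) = - (2 * (x ^+ 2 / 8) + x ^+ 2 / 4)  by field.
have -> : - x ^+ 2 / (2 ^+ 2 *+ 2) = - (x ^+ 2 / 8) by field.
set y := x ^+ 2 / 8.
have -> : x ^+ 4 = 64%:R * y ^+ 2 by rewrite /y; field.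
have y0 : 0 <= y by rewrite divr_ge0// sqr_ge0.
have ey : y <= expR y by rewrite (le_trans _ (expR_ge1Dx y))// lerDr.
have -> : - (2 * y + x ^+ 2 / 4) = - y + (- y + - y + - y) by rewrite /y; field.
rewrite expRD mulrCA [leRHS]mulrC ler_wpM2l ?expR_ge0// !expRD.
have -> : 64%:R * y ^+ 2 * (expR (- y) * expR (- y) * expR (- y)) =
  64%:R * ((y * expR (- y)) * (y * expR (- y)) * expR (- y)) by ring.
have e1 : y * expR (- y) <= 1 by rewrite expRN ler_pdivrMr ?expR_gt0// mul1r.
have e0 : 0 <= y * expR (- y) by rewrite mulr_ge0// expR_ge0.
have e2 : expR (- y) <= 1 by rewrite -expR0 ler_expR oppr_le0.
have e3 := expR_ge0 (- y).
have : (y * expR (- y)) * (y * expR (- y)) <= 1 * 1 by apply: ler_pM.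
have : (y * expR (- y)) * (y * expR (- y)) * expR (- y) <= 1 * 1 * 1.
  by rewrite !mul1r mulr_ile1//; [exact: mulr_ge0|exact: mulr_ile1].
lra.
Qed.

End NormalMoments.

(** * Brownian increments *)

Section Filtration.
Context (R : realType) (T : R) (m : nat).
Implicit Types (s t : R) (w : Omega T m).

(** The same space carrying the sigma-algebra [filt s]: measurability with respect to the past
    becomes ordinary measurability, with all its closure lemmas. *)
Definition FOmega s := g_sigma_algebraType (@cylinders R T m s).

HB.instance Definition _ s := Measurable.on (FOmega s).

Lemma filtE s : @filt R T m s = @measurable _ (FOmega s).
Proof. by []. Qed.

Lemma cylinders_sub s t : s <= t -> @cylinders R T m s `<=` @cylinders R T m t.
Proof.
move=> st C [u [i [B [/andP[u0 us] mB ->]]]]; exists u, i, B; split => //.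
by rewrite u0 (le_trans us).
Qed.

Lemma filt_sub s t : s <= t -> @filt R T m s `<=` @filt R T m t.
Proof. by move=> st; apply: sub_sigma_algebra2; exact: cylinders_sub. Qed.

Lemma filt_measurable_set s (A : set (Omega T m)) : s <= T -> filt s A -> measurable A.
Proof. by move=> sT; exact: (filt_sub sT). Qed.

Definition Fmeas s (f : Omega T m -> R) : Prop :=
  measurable_fun [set: FOmega s] (f : FOmega s -> R).

Lemma FmeasP s f : Fmeas s f <-> forall B : set R, measurable B -> filt s (f @^-1` B).
Proof.
split=> [mf B mB|h _ B mB].
  by have := mf measurableT B mB; rewrite setTI.
by rewrite setTI; exact: h.
Qed.

Lemma Fmeas_sub s t f : s <= t -> Fmeas s f -> Fmeas t f.
Proof.
move=> st /FmeasP h; apply/FmeasP => B mB; apply: (filt_sub st); exact: h.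
Qed.

Lemma Fmeas_measurable s f : s <= T -> Fmeas s f -> measurable_fun setT f.
Proof.
move=> sT /FmeasP h _ B mB; rewrite setTI; apply: (filt_measurable_set sT); exact: h.
Qed.

Lemma Fmeas_ev s t i : 0 <= s <= t -> Fmeas t (fun w => ev w s i 0).
Proof.
move=> st; apply/FmeasP => B mB; apply: sub_sigma_algebra.
by exists s, i, B.
Qed.

Lemma ev_clamp w s : ev w s = ev w (clamp T s).
Proof. exact: (path_clamp w). Qed.

Lemma clamp_id s : 0 <= s <= T -> clamp T s = s.
Proof. by case/andP=> s0 sT; rewrite /clamp (min_idPl sT) (max_idPr s0). Qed.

Lemma clamp_itv s : 0 <= T -> 0 <= clamp T s <= T.
Proof. by move=> T0; rewrite /clamp le_max lexx /= ge_max T0 ge_min lexx orbT. Qed.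

Lemma measurable_ev s i : 0 <= T -> measurable_fun setT (fun w => ev w s i 0).
Proof.
move=> T0; apply: (@Fmeas_measurable T) => //.
under eq_fun do rewrite ev_clamp.
by apply: Fmeas_ev; exact: clamp_itv.
Qed.

Lemma ev0 w : ev w 0 = 0. Proof. exact: (path_start w). Qed.

Lemma filtI s A B : @filt R T m s A -> filt s B -> filt s (A `&` B).
Proof. by rewrite filtE => mA mB; exact: measurableI. Qed.

Lemma filtT s : @filt R T m s setT.
Proof. by rewrite filtE. Qed.

Lemma filt_measurable_Fmeas s p q (f : Omega T m -> 'M[R]_(p, q)) :
  filt_measurable s f <-> forall i k, Fmeas s (fun w => f w i k).
Proof.
split=> h i k; [apply/FmeasP => B mB; exact: h|move=> B mB].
by have /FmeasP := h i k; apply.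
Qed.

End Filtration.

Section Wiener.
Context (R : realType) (T : R) (m : nat) (P : probability (Omega T m) R).
Hypothesis hP : wiener_measure P.
Implicit Types (s t : R) (w : Omega T m).

Definition incr s t w (i : 'I_m) : R := ev w t i 0 - ev w s i 0.

Definition incr_cyl s t : set (set (path_fun T m)) :=
  [set C | exists2 B : 'I_m -> set R, (forall i, measurable (B i)) &
     C = [set w | forall i, B i (incr s t w i)]].

(** The sigma-algebra of the increment over [s, t], the independent counterpart of [FOmega s]. *)
Definition IOmega s t := g_sigma_algebraType (incr_cyl s t).

HB.instance Definition _ s t := Measurable.on (IOmega s t).

Lemma incr_meas s t i : 0 <= T -> measurable_fun setT (fun w => incr s t w i).
Proof. by move=> T0; apply: measurable_funB; exact: measurable_ev. Qed.

Lemma incr_cyl_measurable s t : 0 <= T ->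
  incr_cyl s t `<=` @measurable _ (Omega T m).
Proof.
move=> T0 C [B mB ->].
rewrite (_ : [set w | _] = \bigcap_(i in [set: 'I_m]) ((fun w => incr s t w i) @^-1` B i)).
  apply: fin_bigcap_measurable => // i _.
  by rewrite -[X in measurable X]setTI; exact: incr_meas.
by apply/seteqP; split=> w /= h; [move=> i _; exact: h|move=> i; exact: h].
Qed.

Lemma measurable_IOmega_sub s t (C : set (Omega T m)) : 0 <= T ->
  (@measurable _ (IOmega s t)) C -> measurable C.
Proof.
move=> T0; apply: (@smallest_sub _ (sigma_algebra setT)) => //.
  exact: sigma_algebra_measurable.
exact: incr_cyl_measurable.
Qed.

Lemma incr_Imeas s t i :
  measurable_fun [set: IOmega s t] (fun w : IOmega s t => incr s t w i).
Proof.
move=> _ B mB; rewrite setTI; apply: sub_sigma_algebra.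
exists (fun j => if j == i then B else setT).
  by move=> j; case: ifP.
apply/seteqP; split=> w /= h.
  by move=> j; case: ifPn => // /eqP ->.
by have := h i; rewrite eqxx.
Qed.

(** [wiener_measure] gives the product formula for boxes. With [F] fixed, both sides are finite
    measures in [C], and the boxes form a generating class stable under intersection. *)
Lemma incr_independent s t (F C : set (Omega T m)) :
  0 <= s -> s < t -> t <= T -> filt s F -> (@measurable _ (IOmega s t)) C ->
  P (F `&` C) = (P F * P C)%E.
Proof.
move=> s0 st tT fF mC; have T0 : 0 <= T by rewrite (le_trans s0)// (le_trans (ltW st)).
have mF : measurable F by apply: (@filt_measurable_set _ _ _ s) => //; rewrite (le_trans (ltW st)).
have PF0 : (0 <= fine (P F)) by exact: fine_ge0.
pose m1 : {measure set (Omega T m) -> \bar R} := mrestr P mF.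
pose m2 : {measure set (Omega T m) -> \bar R} := mscale (NngNum PF0) P.
have -> : P (F `&` C) = m1 C by rewrite setIC.
have -> : (P F * P C)%E = m2 C.
  by rewrite /m2 /= /mscale /= fineK// fin_num_measure.
apply: (@g_sigma_algebra_measure_unique _ R (Omega T m) (incr_cyl s t) _ (fun=> setT) _ _ m1 m2).
- exact: incr_cyl_measurable.
- by move=> _; exists (fun=> setT) => //; apply/seteqP; split.
- by rewrite -subTset => x _; exists 0%N.
- move=> _ _ [B mB ->] [B' mB' ->]; exists (fun i => B i `&` B' i).
    by move=> i; exact: measurableI.
  by apply/seteqP; split=> w /=; [move=> [h h'] i|move=> h; split=> i; have [] := h i].
- move=> _ [B mB ->]; rewrite /m1 /m2 /= /mrestr /mscale /= setIC.
  rewrite fineK ?fin_num_measure//.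
  have := hP s0 st tT fF mB; rewrite /incr => ->.
  have := hP s0 st tT (@filtT _ _ _ s) mB; rewrite setTI => ->.
  by rewrite probability_setT mul1e.
- move=> k; apply: le_lt_trans (ltey 1); rewrite -(probability_setT P).
  by rewrite /m1 /= /mrestr; apply: le_measure; rewrite ?inE//; exact: measurableI.
- exact: mC.
Qed.

Lemma incr_law s t i (C : set R) : 0 <= s -> s < t -> t <= T -> measurable C ->
  P [set w | C (incr s t w i)] = normal_prob 0 (Num.sqrt (t - s)) C.
Proof.
move=> s0 st tT mC.
have := @hP s t setT (fun j => if j == i then C else setT) s0 st tT (@filtT _ _ _ s).
rewrite setTI => h.
rewrite (_ : [set w | _] = [set w | forall j, (if j == i then C else setT) (ev w t j 0 - ev w s j 0)]).
  rewrite h; last by move=> j; case: ifP.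
  rewrite probability_setT mul1e (bigD1 i)//= eqxx big1 ?mule1// => j /negbTE ->.
  by rewrite probability_setT.
apply/seteqP; split=> w /= hh; first by move=> j; case: ifPn => // /eqP ->.
by have := hh i; rewrite eqxx.
Qed.

Lemma incr_law2 s t i j (C D : set R) : 0 <= s -> s < t -> t <= T -> i != j ->
  measurable C -> measurable D ->
  P ([set w | C (incr s t w i)] `&` [set w | D (incr s t w j)]) =
  (P [set w | C (incr s t w i)] * P [set w | D (incr s t w j)])%E.
Proof.
move=> s0 st tT ij mC mD; rewrite !incr_law//.
have := @hP s t setT (fun k => if k == i then C else if k == j then D else setT)
  s0 st tT (@filtT _ _ _ s).
rewrite setTI => h.
rewrite (_ : _ `&` _ = [set w | forall k, (if k == i then C else if k == j then D else setT) (ev w t k 0 - ev w s k 0)]).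
  rewrite h; last by move=> k; case: ifP => // _; case: ifP.
  rewrite probability_setT mul1e (bigD1 i)//= eqxx (bigD1 j) 1?eq_sym//=.
  rewrite (negbTE ij) eqxx big1 ?mule1// => k /andP[/negbTE -> /negbTE ->].
  by rewrite probability_setT.
apply/seteqP; split=> w /=.
  by move=> [hC hD] k; case: ifPn => [/eqP ->//|_]; case: ifPn => [/eqP ->|].
move=> hh; split; first by have := hh i; rewrite eqxx.
by have := hh j; rewrite eq_sym (negbTE ij) eqxx.
Qed.

Lemma ge0_integral_incr s t i (f : R -> \bar R) : 0 <= s -> s < t -> t <= T ->
  measurable_fun setT f -> (forall x, 0 <= f x)%E ->
  (\int[P]_w f (incr s t w i) = \int[normal_prob 0 (Num.sqrt (t - s))]_x f x)%E.
Proof.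
move=> s0 st tT mf f0; have T0 : 0 <= T by rewrite (le_trans s0)// (le_trans (ltW st)).
pose X : Omega T m -> measurableTypeR R := fun w => incr s t w i.
have mX : measurable_fun setT X by exact: incr_meas.
have := @ge0_integral_pushforward _ _ _ _ R X mX P setT f measurableT mf (fun x _ => f0 x).
rewrite preimage_setT => <-.
by apply: eq_measure_integral => A mA _; exact: (incr_law i s0 st tT mA).
Qed.

(** The identity, read as a random variable with values in a coarser measurable space: independence
    of two sigma-algebras becomes independence of two random variables. *)
Let X1 s : Omega T m -> FOmega T m s := id.
Let X2 s t : Omega T m -> IOmega s t := id.

Let mX1 s : s <= T -> measurable_fun setT (X1 s).
Proof. by move=> sT _ B mB; rewrite setTI; exact: (filt_measurable_set sT). Qed.

Let mX2 s t : 0 <= T -> measurable_fun setT (X2 s t).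
Proof. by move=> T0 _ B mB; rewrite setTI; exact: measurable_IOmega_sub mB. Qed.

Lemma filt_freezing s t (f : FOmega T m s * IOmega s t -> R) :
  0 <= s -> s < t -> t <= T -> measurable_fun setT f ->
  (forall x, P.-integrable setT (fun w : Omega T m => (f (x, w))%:E)) ->
  P.-integrable setT (fun w : Omega T m => (f (w, w))%:E) ->
  (\int[P]_w f (w, w) = \int[P]_w \int[P]_w' f (w, w'))%R /\
  P.-integrable setT (fun w : Omega T m => (\int[P]_w' f (w, w'))%:E).
Proof.
move=> s0 st tT; have sT : s <= T by rewrite (le_trans (ltW st)).
have T0 : 0 <= T by rewrite (le_trans s0).
apply: (@freezing _ _ _ _ _ _ _ P (X1 s) (X2 s t)).
- exact: mX1.
- exact: mX2.
- by move=> A C mA mC; exact: (incr_independent s0 st tT).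
Qed.

Lemma ge0_filt_freezing s t (f : FOmega T m s * IOmega s t -> \bar R) :
  0 <= s -> s < t -> t <= T -> measurable_fun setT f -> (forall z, 0 <= f z)%E ->
  (\int[P]_w f (w, w) = \int[P]_w \int[P]_w' f (w, w'))%E.
Proof.
move=> s0 st tT; have sT : s <= T by rewrite (le_trans (ltW st)).
have T0 : 0 <= T by rewrite (le_trans s0).
apply: (@ge0_freezing _ _ _ _ _ _ _ P (X1 s) (X2 s t)).
- exact: mX1.
- exact: mX2.
- by move=> A C mA mC; exact: (incr_independent s0 st tT).
Qed.

Lemma Rintegral_indep_mul s t (Y V : Omega T m -> R) :
  0 <= s -> s < t -> t <= T ->
  Fmeas s Y -> measurable_fun [set: IOmega s t] V ->
  P.-integrable setT (EFin \o Y) -> P.-integrable setT (EFin \o V) ->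
  P.-integrable setT (fun w => (Y w * V w)%:E) /\
  (\int[P]_w (Y w * V w) = (\int[P]_w Y w) * (\int[P]_w V w))%R.
Proof.
move=> s0 st tT mY mV iY iV; have sT : s <= T by rewrite (le_trans (ltW st)).
have T0 : 0 <= T by rewrite (le_trans s0).
pose f (z : FOmega T m s * IOmega s t) : R := Y z.1 * V z.2.
have mf : measurable_fun setT f.
  apply: measurable_funM.
    exact: (measurableT_comp (mY : measurable_fun [set: FOmega T m s] Y) measurable_fst).
  exact: (measurableT_comp mV measurable_snd).
have mY' : measurable_fun [set: Omega T m] Y by move/integrableP: iY => [/measurable_EFinP].
have mV' : measurable_fun [set: Omega T m] V by move/integrableP: iV => [/measurable_EFinP].
have iYV : P.-integrable setT (fun w => (Y w * V w)%:E).
  apply/integrableP; split; first by apply/measurable_EFinP; exact: measurable_funM.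
  have h := @ge0_filt_freezing s t (fun z => `|f z|%:E) s0 st tT _ _.
  rewrite /f /= in h; under eq_integral do rewrite abse_EFin.
  rewrite h; last 2 first.
  - by apply/measurable_EFinP; exact: measurableT_comp.
  - by move=> z; rewrite lee_fin.
  under eq_integral => w _.
    under eq_integral do rewrite normrM EFinM.
    rewrite ge0_integralZl//; last by apply/measurable_EFinP; exact: measurableT_comp.
    over.
  rewrite ge0_integralZr//; last 2 first.
  - by apply/measurable_EFinP; exact: measurableT_comp.
  - exact: integral_ge0.
  move/integrableP: iY => [_ hY]; move/integrableP: iV => [_ hV].
  by apply: lte_mul_pinfty => //; rewrite ?integral_ge0// ge0_fin_numE// integral_ge0.
split=> //; have [|-> _] := @filt_freezing s t f s0 st tT mf _ iYV.
  by move=> x; rewrite /f /=; under eq_fun do rewrite EFinM; exact: integrableZl.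
rewrite /f /=; under eq_Rintegral => w _ do rewrite RintegralZl//.
by rewrite RintegralZr.
Qed.

(** The variance of the standard normal law, carried as a symbol through every isometry. *)
Definition c2 : R := fine (normal_moment R 1).
Definition c4 : R := fine (normal_moment R 2).

Lemma normal_moment_ge0 k : (0 <= normal_moment R k)%E.
Proof.
by apply: integral_ge0 => x _; rewrite lee_fin exprM exprn_ge0// sqr_ge0.
Qed.

Lemma normal_moment1_lty : (normal_moment R 1 < +oo)%E.
Proof.
apply: (@le_lt_trans _ _ (1 + normal_moment R 2)%E).
  rewrite /normal_moment -[X in (X + _)%E](@integral_normal_pdf R 0 1).
  rewrite -[X in (X + _)%E](_ : (\int[normal_prob 0 1]_x 1)%E = _); last first.
    by rewrite ge0_integral_normal_prob//; apply: eq_integral => x _; rewrite mul1e.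
  rewrite -ge0_integralD//; last 2 first.
  - by move=> x _; rewrite lee_fin exprM sqr_ge0.
  - by apply/measurable_EFinP; exact: measurable_funX.
  apply: le_integral_pointwise => x _; rewrite -EFinD lee_fin muln1 exprM.
  have : 0 <= (x ^+ 2 - 1) ^+ 2 by rewrite sqr_ge0.
  have : 0 <= x ^+ 2 by rewrite sqr_ge0.
  rewrite sqrrB1; lra.
by rewrite lte_add_pinfty// ?ltry// normal_moment2_lty.
Qed.

Lemma c2E : c2%:E = normal_moment R 1.
Proof. by rewrite fineK// ge0_fin_numE ?normal_moment_ge0// normal_moment1_lty. Qed.

Lemma c4E : c4%:E = normal_moment R 2.
Proof. by rewrite fineK// ge0_fin_numE ?normal_moment_ge0// normal_moment2_lty. Qed.

Lemma c2_ge0 : 0 <= c2. Proof. by rewrite -lee_fin c2E normal_moment_ge0. Qed.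
Lemma c4_ge0 : 0 <= c4. Proof. by rewrite -lee_fin c4E normal_moment_ge0. Qed.

Lemma incr_refl s w i : incr s s w i = 0. Proof. exact: subrr. Qed.

Lemma moment2_incr s t i : 0 <= s -> s <= t -> t <= T ->
  moment2 P (fun w => incr s t w i) = ((t - s) * c2)%:E.
Proof.
rewrite /moment2 => s0; rewrite le_eqVlt => /predU1P[->|st] tT.
  by rewrite subrr mul0r; apply: integral0_eq => w _; rewrite incr_refl expr0n.
rewrite (@ge0_integral_incr s t i (fun x => (x ^+ 2)%:E))//; last 2 first.
- by apply/measurable_EFinP; exact: measurable_funX.
- by move=> x; rewrite lee_fin sqr_ge0.
by rewrite (normal_moment_scale 1) ?sqrtr_gt0 ?subr_gt0// muln1 sqr_sqrtr ?subr_ge0 1?ltW// -c2E.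
Qed.

Lemma moment4_incr s t i : 0 <= s -> s <= t -> t <= T ->
  (\int[P]_w (incr s t w i ^+ 4)%:E = ((t - s) ^+ 2 * c4)%:E)%E.
Proof.
move=> s0; rewrite le_eqVlt => /predU1P[->|st] tT.
  by rewrite subrr expr0n mul0r; apply: integral0_eq => w _; rewrite incr_refl expr0n.
rewrite (@ge0_integral_incr s t i (fun x => (x ^+ 4)%:E))//; last 2 first.
- by apply/measurable_EFinP; exact: measurable_funX.
- by move=> x; rewrite lee_fin (exprM _ 2 2) sqr_ge0.
rewrite (normal_moment_scale 2) ?sqrtr_gt0 ?subr_gt0// exprM sqr_sqrtr ?subr_ge0 1?ltW//.
by rewrite -c4E.
Qed.

Lemma isL2_incr s t i : 0 <= s -> s <= t -> t <= T -> isL2 P (fun w => incr s t w i).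
Proof.
move=> s0 st tT; split; first by apply: incr_meas; rewrite (le_trans s0)// (le_trans st).
by rewrite moment2_incr// ltry.
Qed.

(** By symmetry of the normal law the positive and the negative part have the same finite
    integral. *)
Lemma Rintegral_incr s t i : 0 <= s -> s <= t -> t <= T -> (\int[P]_w incr s t w i = 0)%R.
Proof.
move=> s0; rewrite le_eqVlt => /predU1P[->|st] tT.
  by rewrite /Rintegral (integral0_eq _)// => w _; rewrite incr_refl.
rewrite /Rintegral integralE.
have s1 : Num.sqrt (t - s) != 0 by rewrite gt_eqF// sqrtr_gt0 subr_gt0.
have mp : measurable_fun setT (fun x : R => (Num.max x 0)%:E).
  by apply/measurable_EFinP; exact: measurable_maxr.
have p0 (x : R) : (0 <= (Num.max x 0)%:E)%E by rewrite lee_fin le_max lexx orbT.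
rewrite (_ : (\int[P]_x (fun w => (incr s t w i)%:E)^\- x)%E =
  (\int[P]_x (fun w => (incr s t w i)%:E)^\+ x)%E).
  rewrite subee//.
  have := integrable_funepos measurableT (isL2_integrable (isL2_incr i s0 (ltW st) tT)).
  by move=> /(integrable_fin_num measurableT).
rewrite (_ : (\int[P]_x (fun w => (incr s t w i)%:E)^\+ x)%E =
  (\int[P]_w (Num.max (incr s t w i) 0)%:E)%E); last first.
  by apply: eq_integral => w _; rewrite funeposE EFin_max.
rewrite (_ : (\int[P]_x (fun w => (incr s t w i)%:E)^\- x)%E =
  (\int[P]_w (Num.max (- incr s t w i) 0)%:E)%E); last first.
  by apply: eq_integral => w _; rewrite funenegE EFin_max.
rewrite (@ge0_integral_incr s t i (fun x => (Num.max x 0)%:E))//.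
rewrite (@ge0_integral_incr s t i (fun x => (Num.max (- x) 0)%:E))//.
  exact: (ge0_integral_normal_prob_opp s1 mp p0).
by apply/measurable_EFinP; apply: measurable_maxr => //; exact: measurable_funN.
Qed.

Lemma Rintegral_incr_mul s t i j : 0 <= s -> s <= t -> t <= T ->
  (\int[P]_w (incr s t w i * incr s t w j) = (i == j)%:R * ((t - s) * c2))%R.
Proof.
move=> s0 st tT; case: eqP => [<-|/eqP ij].
  rewrite mul1r; apply: EFin_inj; rewrite -(moment2_incr i s0 st tT).
  by rewrite -moment2_Rintegral//; exact: isL2_incr.
rewrite mul0r; move: st; rewrite le_eqVlt => /predU1P[->|st].
  by rewrite /Rintegral (integral0_eq _)// => w _; rewrite incr_refl mul0r.
have T0 : 0 <= T by rewrite (le_trans s0)// (le_trans (ltW st)).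
have Li k := isL2_incr k s0 (ltW st) tT.
pose f (z : R * R) := z.1 * z.2.
have mf : measurable_fun setT f by exact: measurable_funM.
have [|||||/= -> _] := @freezing _ _ _ _ _ _ R P (fun w => incr s t w i)
   (fun w => incr s t w j) _ _ _ f mf.
- exact: incr_meas.
- exact: incr_meas.
- by move=> A C mA mC; exact: (incr_law2 s0 st tT ij).
- move=> x; rewrite /f /=; under eq_fun do rewrite EFinM.
  by apply: integrableZl => //; exact: isL2_integrable.
- exact: (isL2M_integrable (Li i) (Li j)).
rewrite /f /=; under eq_Rintegral => w _.
  rewrite RintegralZl//; last exact: isL2_integrable.
  rewrite Rintegral_incr ?(ltW st)// mulr0; over.
by rewrite Rintegral_cst// mul0r.
Qed.

Lemma incr_martingale s t i (Y : Omega T m -> R) : 0 <= s -> s <= t -> t <= T ->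
  Fmeas s Y -> isL2 P Y ->
  isL2 P (fun w => Y w * incr s t w i) /\ (\int[P]_w (Y w * incr s t w i) = 0)%R.
Proof.
move=> s0; rewrite le_eqVlt => /predU1P[->|st] tT mY LY.
  under eq_fun do rewrite incr_refl mulr0.
  split; first exact: isL2_cst.
  by rewrite /Rintegral (integral0_eq _)// => w _; rewrite incr_refl mulr0.
have Li := isL2_incr i s0 (ltW st) tT.
have mI := @incr_Imeas s t i.
have [_ ->] := Rintegral_indep_mul s0 st tT mY mI (isL2_integrable LY) (isL2_integrable Li).
split; last by rewrite Rintegral_incr ?mulr0// ltW.
have [mY' _] := LY; have [mI' _] := Li.
split; first exact: measurable_funM.
have [||||] := @Rintegral_indep_mul s t (fun w => Y w ^+ 2) (fun w => incr s t w i ^+ 2) s0 st tT.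
- exact: measurable_funX.
- exact: measurable_funX.
- exact: isL2_sqr_integrable.
- exact: isL2_sqr_integrable.
move/integrableP => [_ h] _; apply: le_lt_trans h; apply: le_integral_pointwise => w _.
by rewrite exprMn abse_EFin lee_fin ler_norm.
Qed.

Lemma Rintegral_incr_bracket s t i j (Z : Omega T m -> R) :
  0 <= s -> s <= t -> t <= T -> Fmeas s Z -> P.-integrable setT (EFin \o Z) ->
  (\int[P]_w (Z w * (incr s t w i * incr s t w j)) =
   (\int[P]_w Z w) * ((i == j)%:R * ((t - s) * c2)))%R.
Proof.
move=> s0; rewrite le_eqVlt => /predU1P[->|st] tT mZ iZ.
  rewrite subrr mul0r !mulr0 /Rintegral (integral0_eq _)// => w _.
  by rewrite !incr_refl !mulr0.
have mV : measurable_fun [set: IOmega s t]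
    (fun w : IOmega s t => incr s t w i * incr s t w j).
  by apply: measurable_funM; exact: incr_Imeas.
have iV : P.-integrable setT (fun w => (incr s t w i * incr s t w j)%:E).
  by apply: isL2M_integrable; apply: isL2_incr => //; exact: ltW.
have [_ ->] := Rintegral_indep_mul s0 st tT mZ mV iZ iV.
by rewrite Rintegral_incr_mul// ltW.
Qed.

End Wiener.

Section RintegralSum.
Context d (X : measurableType d) (R : realType) (P : probability X R).

Lemma integrable_bigsum (I : Type) (s : seq I) (Q : pred I) (F : I -> X -> R) :
  (forall i, P.-integrable setT (EFin \o F i)) ->
  P.-integrable setT (fun w => (\sum_(i <- s | Q i) F i w)%:E).
Proof.
move=> iF; under eq_fun do rewrite -sumEFin.
by apply: integrable_sum => // i _; exact: iF.
Qed.

Lemma Rintegral_bigsum (I : Type) (s : seq I) (Q : pred I) (F : I -> X -> R) :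
  (forall i, P.-integrable setT (EFin \o F i)) ->
  (\int[P]_w (\sum_(i <- s | Q i) F i w) = \sum_(i <- s | Q i) \int[P]_w F i w)%R.
Proof.
move=> iF; elim: s => [|i s IH].
  by rewrite big_nil; under eq_Rintegral do rewrite big_nil; rewrite Rintegral_cst// mul0r.
rewrite big_cons; under eq_Rintegral do rewrite big_cons.
by case: ifP => _ //; rewrite RintegralD// ?IH//; exact: integrable_bigsum.
Qed.

End RintegralSum.

(** * Doob's maximal inequality *)

Section RunningMax.
Context (R : realType).
Implicit Type s : nat -> R.

(** The recursion starts from 0, which makes the maximum nonnegative and is the right value for
    sequences that start at 0. *)
Fixpoint rmax s n : R := if n is k.+1 then Num.max (rmax s k) (s n) else 0.

Lemma rmax_ge0 s n : 0 <= rmax s n.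
Proof. by elim: n => //= n IH; rewrite le_max IH. Qed.

Lemma rmax_ub s n k : s 0%N = 0 -> (k <= n)%N -> s k <= rmax s n.
Proof.
move=> s0; elim: n => [|n IH]; first by rewrite leqn0 => /eqP ->; rewrite s0.
rewrite leq_eqVlt => /predU1P[->|]; first by rewrite /= le_max lexx orbT.
by rewrite ltnS => /IH h; rewrite /= le_max h.
Qed.

(* Pathwise form of Doob's L2 inequality: the sum is a martingale transform. *)
Lemma rmax_pathwise s n : s 0%N = 0 ->
  rmax s n ^+ 2 + 4 * (\sum_(i < n) rmax s i * (s i.+1 - s i)) <= 4 * s n ^+ 2.
Proof.
move=> s0.
(* Summation by parts: the maximum grows only where it equals the sequence. The square of
   [rmax s n - 2 * s n] then produces the constant 4. *)
have h : rmax s n ^+ 2 <= 2 * (s n * rmax s n - \sum_(i < n) rmax s i * (s i.+1 - s i)).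
  elim: n => [|n IH]; first by rewrite big_ord0 /= expr0n mulr0 subr0 mulr0.
  rewrite big_ord_recr /=; move: (\sum_(i < n) _) IH => S IH.
  rewrite /Num.max; case: ltP => h; nra.
have := sqr_ge0 (rmax s n - 2 * s n); move: (\sum_(i < n) _) h => S h; nra.
Qed.

End RunningMax.

Section Martingale.
Context (R : realType) (T : R) (m : nat) (P : probability (Omega T m) R).
Implicit Types (r : nat -> R) (M : nat -> Omega T m -> R).

(** The martingale property is expressed as orthogonality of the increments to square-integrable
    variables of the past, in place of conditional expectations. *)
Record martingale r M n : Prop := Martingale {
  mart_time : forall k, (k < n)%N -> r k <= r k.+1 ;
  mart_le : forall k, (k <= n)%N -> r k <= T ;
  mart_meas : forall k, (k <= n)%N -> Fmeas (r k) (M k) ;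
  mart_L2 : forall k, (k <= n)%N -> isL2 P (M k) ;
  mart_start : forall w, M 0%N w = 0 ;
  mart_orth : forall k (Y : Omega T m -> R), (k < n)%N -> Fmeas (r k) Y -> isL2 P Y ->
    (\int[P]_w (Y w * (M k.+1 w - M k w)) = 0)%R }.

Lemma martingaleN r M n : martingale r M n -> martingale r (fun k w => - M k w) n.
Proof.
move=> [h1 h2 h3 h4 h5 h6]; split=> //.
- by move=> k kn; apply: measurable_funN; exact: h3.
- by move=> k kn; apply: isL2N; exact: h4.
- by move=> w; rewrite h5 oppr0.
move=> k Y kn mY LY; rewrite -[RHS](h6 k (fun w => - Y w) kn).
- by apply: eq_Rintegral => w _; ring.
- exact: measurable_funN.
- exact: isL2N.
Qed.

Definition pmax M n w := rmax (fun k => M k w) n.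

Lemma pmax_props r M n k : martingale r M n -> (k <= n)%N ->
  Fmeas (r k) (pmax M k) /\ isL2 P (pmax M k).
Proof.
move=> hM; elim: k => [|k IH] kn.
  by split; [exact: measurable_cst|exact: isL2_cst].
have [h1 h2] := IH (ltnW kn); split.
  apply: measurable_maxr; last exact: (mart_meas hM).
  by apply: (Fmeas_sub (mart_time hM kn)).
by apply: isL2_max => //; exact: (mart_L2 hM).
Qed.

(** Integrate the pathwise inequality: the maximum up to step [i] is known at that time, so the
    martingale transform has mean zero. *)
Lemma doob_pmax r M n : martingale r M n ->
  (moment2 P (pmax M n) <= 4%:E * moment2 P (M n))%E.
Proof.
move=> hM; have [_ Ln] := pmax_props hM (leqnn n).
rewrite -(moment2_Rintegral Ln) -(moment2_Rintegral (mart_L2 hM (leqnn n))).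
rewrite -EFinM lee_fin.
have iD (i : 'I_n) : P.-integrable setT (EFin \o (fun w => pmax M i w * (M i.+1 w - M i w))).
  apply: isL2M_integrable; first by have [] := pmax_props hM (ltnW (ltn_ord i)).
  by apply: isL2B; apply: (mart_L2 hM); [exact: ltn_ord|exact: ltnW].
have iS : P.-integrable setT (EFin \o (fun w => 4 * \sum_(i < n) pmax M i w * (M i.+1 w - M i w))).
  have := @integrableZl _ _ _ P setT measurableT 4 _
    (integrable_bigsum (index_enum 'I_n) xpredT iD).
  by apply: eq_integrable => // w _ /=; rewrite EFinM.
have h0 : (\int[P]_w (4 * \sum_(i < n) pmax M i w * (M i.+1 w - M i w)) = 0)%R.
  rewrite RintegralZl//; last exact: integrable_bigsum.
  rewrite Rintegral_bigsum// big1 ?mulr0// => i _.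
  have [mi Li] := pmax_props hM (ltnW (ltn_ord i)).
  exact: (mart_orth hM).
rewrite -[X in X <= _]addr0 -h0 -RintegralD//; last exact: isL2_sqr_integrable.
rewrite -RintegralZl//; last by apply: isL2_sqr_integrable; exact: (mart_L2 hM).
apply: le_Rintegral => //.
- have := integrableD measurableT (isL2_sqr_integrable Ln) iS.
  by apply: eq_integrable => // w _ /=; rewrite EFinD.
- have := @integrableZl _ _ _ P setT measurableT 4 _ (isL2_sqr_integrable (mart_L2 hM (leqnn n))).
  by apply: eq_integrable => // w _ /=; rewrite EFinM.
by move=> w _; apply: rmax_pathwise; exact: (mart_start hM).
Qed.

Definition amax M n w := Num.max (pmax M n w) (pmax (fun k w => - M k w) n w).

Lemma amax_ub r M n k w : martingale r M n -> (k <= n)%N -> `|M k w| <= amax M n w.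
Proof.
move=> hM kn; have hN := martingaleN hM.
rewrite ler_norml -lerNl !le_max.
have /= -> := @rmax_ub _ (fun k => - M k w) n k (mart_start hN w) kn.
by have /= -> := @rmax_ub _ (fun k => M k w) n k (mart_start hM w) kn; rewrite orbT.
Qed.

Lemma amax_ge0 M n w : 0 <= amax M n w.
Proof. by rewrite le_max rmax_ge0. Qed.

Lemma amax_isL2 r M n : martingale r M n -> isL2 P (amax M n).
Proof.
move=> hM; have hN := martingaleN hM.
by apply: isL2_max; [have [] := pmax_props hM (leqnn n)|have [] := pmax_props hN (leqnn n)].
Qed.

(** The running maxima of [M] and of [- M] contribute 4 each. *)
Lemma doob r M n : martingale r M n ->
  (moment2 P (amax M n) <= 8%:E * moment2 P (M n))%E.
Proof.
move=> hM; have hN := martingaleN hM.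
have [_ [mp _]] := pmax_props hM (leqnn n).
have [_ [mq _]] := pmax_props hN (leqnn n).
apply: (@le_trans _ _ (moment2 P (pmax M n) + moment2 P (pmax (fun k w => (- M k w)%R) n))%E).
  rewrite /moment2 -ge0_integralD//; last 4 first.
  - by move=> w _; rewrite lee_fin sqr_ge0.
  - exact: measurable_sqr.
  - by move=> w _; rewrite lee_fin sqr_ge0.
  - exact: measurable_sqr.
  apply: le_integral_pointwise => w _; rewrite -EFinD lee_fin /amax.
  by rewrite /Num.max; case: ltP => _; rewrite ?lerDl ?lerDr sqr_ge0.
have h1 := doob_pmax hM; have h2 := doob_pmax hN.
have hE : moment2 P (fun w => - M n w) = moment2 P (M n).
  by rewrite /moment2; apply: eq_integral => w _; rewrite sqrrN.
rewrite hE in h2; apply: (le_trans (leeD h1 h2)).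
have [mM LM] := mart_L2 hM (leqnn n).
rewrite -(moment2_Rintegral (mart_L2 hM (leqnn n))) -!EFinM -EFinD lee_fin; lra.
Qed.

End Martingale.

(** * Elementary stochastic integrals *)

Section Blocks.
Context (R : realType) (T : R) (m : nat) (P : probability (Omega T m) R).
Hypothesis hP : wiener_measure P.

(** One scalar term of an elementary stochastic integral: time interval, driving coordinate,
    coefficient. The intervals of a family may overlap in any way, so simple processes on unrelated
    grids can be subtracted without a common refinement. *)
Record block := Block { lo : R ; hi : R ; ch : 'I_m ; co : Omega T m -> R }.

Record valid (b : block) : Prop := Valid {
  valid_lo : 0 <= lo b ;
  valid_lohi : lo b <= hi b ;
  valid_hi : hi b <= T ;
  valid_meas : Fmeas (lo b) (co b) ;
  valid_bnd : exists K : R, forall w, `|co b w| <= K }.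

Definition bint b t w := co b w * incr (Num.min (lo b) t) (Num.min (hi b) t) w (ch b).

Definition bproc b t w : R := co b w * ((lo b < t) && (t <= hi b))%:R.

Lemma incrD (s u t : R) (w : Omega T m) i : incr s t w i = incr s u w i + incr u t w i.
Proof. by rewrite /incr; ring. Qed.

Implicit Types (r t : R).

(** The increment after time [r] is again a coefficient times one Brownian increment, and that
    increment starts late enough for both the coefficient and any variable known at [r] to be
    known. *)
Lemma bint_incr b r t w : valid b -> r <= t ->
  bint b t w - bint b r w =
  co b w * incr (Num.max (lo b) r) (Num.max (Num.max (lo b) r) (Num.min (hi b) t)) w (ch b).
Proof.
move=> vb rt; have lh := valid_lohi vb.
rewrite /bint -mulrBr /incr; congr (_ * _).
have [h1|h1] := leP (lo b) r.
  rewrite (min_idPl (le_trans h1 rt)).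
  have [h2|h2] := leP (hi b) r.
    rewrite (min_idPl (le_trans h2 rt)) (max_idPl _); last exact: h2.
    by rewrite !subrr.
  rewrite (max_idPr (_ : r <= Num.min (hi b) t)) ?le_min ?rt ?(ltW h2)//; ring.
have -> : Num.min (hi b) r = r by apply: min_idPr; apply: le_trans lh; exact: ltW.
rewrite subrr subr0; have [h2|h2] := leP (lo b) t.
  by rewrite (max_idPr (_ : lo b <= Num.min (hi b) t)) ?le_min ?lh.
rewrite (min_idPr (le_trans (ltW h2) lh)) (max_idPl (ltW h2)); ring.
Qed.

Lemma bint0 b w t : valid b -> t <= lo b -> bint b t w = 0.
Proof.
move=> vb tl; rewrite /bint (min_idPr tl) (min_idPr (le_trans tl (valid_lohi vb))).
by rewrite incr_refl mulr0.
Qed.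

Lemma bintE b t w : valid b ->
  bint b t w = co b w * incr (lo b) (Num.max (lo b) (Num.min (hi b) t)) w (ch b).
Proof.
move=> vb; rewrite /bint; congr (_ * _); have lh := valid_lohi vb.
have [h2|h2] := leP (lo b) t.
  by rewrite (max_idPr (_ : lo b <= Num.min (hi b) t)) ?le_min ?lh.
by rewrite (min_idPr (le_trans (ltW h2) lh)) (max_idPl (ltW h2)) !incr_refl.
Qed.

Lemma bint_meas b t : valid b -> 0 <= t -> Fmeas t (bint b t).
Proof.
move=> vb t0; have [h|h] := leP (lo b) t.
  apply: measurable_funM; first exact: (Fmeas_sub h (valid_meas vb)).
  by apply: measurable_funB; apply: Fmeas_ev; rewrite le_min ge_min lexx orbT t0 ?andbT
     ?(valid_lo vb)// (le_trans (valid_lo vb) (valid_lohi vb)).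
rewrite (_ : bint b t = fun=> 0); first exact: measurable_cst.
by apply/funext => w; exact: (bint0 w vb (ltW h)).
Qed.

Lemma bint_L2 b t : valid b -> 0 <= t <= T -> isL2 P (bint b t).
Proof.
move=> vb /andP[t0 tT]; have [K hK] := valid_bnd vb.
have h : isL2 P (fun w => incr (lo b) (Num.max (lo b) (Num.min (hi b) t)) w (ch b)).
  apply: (isL2_incr hP); first exact: (valid_lo vb).
    by rewrite le_max lexx.
  rewrite ge_max ge_min tT orbT andbT.
  exact: le_trans (valid_lohi vb) (valid_hi vb).
rewrite (_ : bint b t = fun w => co b w * incr (lo b) (Num.max (lo b) (Num.min (hi b) t)) w (ch b)); last first.
  by apply/funext => w; exact: bintE.
apply: (isL2_bounded_mul _ hK h).
by apply: (Fmeas_measurable _ (valid_meas vb)); apply: le_trans (valid_lohi vb) (valid_hi vb).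
Qed.

Lemma bint_orth b r t (Y : Omega T m -> R) : valid b -> 0 <= r -> r <= t -> t <= T ->
  Fmeas r Y -> isL2 P Y -> (\int[P]_w (Y w * (bint b t w - bint b r w)) = 0)%R.
Proof.
move=> vb r0 rt tT mY LY; have [K hK] := valid_bnd vb.
under eq_Rintegral do rewrite bint_incr// mulrA.
set a := Num.max (lo b) r.
have lT := le_trans (valid_lohi vb) (valid_hi vb).
have [|||||//] := @incr_martingale _ _ _ _ hP a (Num.max a (Num.min (hi b) t)) (ch b)
  (fun w => Y w * co b w).
- by rewrite /a le_max r0 orbT.
- by rewrite le_max lexx.
- rewrite !ge_max lT (le_trans rt tT) /= ge_min tT orbT//.
- apply: measurable_funM; first by apply: (Fmeas_sub _ mY); rewrite le_max lexx orbT.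
  by apply: (Fmeas_sub _ (valid_meas vb)); rewrite le_max lexx.
under eq_fun do rewrite mulrC.
by apply: (isL2_bounded_mul _ hK LY); apply: (Fmeas_measurable lT); exact: valid_meas.
Qed.

(** The length of the intersection of both intervals with the times up to [t]. *)
Definition overlap b c t := Num.max 0 (Num.min (Num.min (hi b) (hi c)) t - Num.max (lo b) (lo c)).

Definition bval b w := co b w * incr (lo b) (hi b) w (ch b).

Lemma bval_bint b w : valid b -> bval b w = bint b T w.
Proof.
move=> vb; rewrite /bint /bval (min_idPl (valid_hi vb)) (min_idPl _)//.
exact: le_trans (valid_lohi vb) (valid_hi vb).
Qed.

Lemma bval_L2 b : valid b -> isL2 P (bval b).
Proof.
move=> vb; rewrite (_ : bval b = bint b T).
  apply: bint_L2 => //; rewrite lexx andbT.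
  by rewrite (le_trans (valid_lo vb))// (le_trans (valid_lohi vb) (valid_hi vb)).
by apply/funext => w; exact: bval_bint.
Qed.

Lemma bval_meas b t : valid b -> hi b <= t -> Fmeas t (bval b).
Proof.
move=> vb ht; have h0 := le_trans (valid_lo vb) (valid_lohi vb).
apply: measurable_funM.
  by apply: (Fmeas_sub _ (valid_meas vb)); rewrite (le_trans (valid_lohi vb)).
by apply: measurable_funB; apply: Fmeas_ev; rewrite ?h0 ?(valid_lo vb)// (le_trans (valid_lohi vb)).
Qed.

Lemma bval_disjoint b c : valid b -> valid c -> hi b <= lo c ->
  (\int[P]_w (bval b w * bval c w) = 0)%R.
Proof.
move=> vb vc bc.
have [|||||] := @incr_martingale _ _ _ _ hP (lo c) (hi c) (ch c)
  (fun w => co c w * bval b w); last by move=> _ <-; apply: eq_Rintegral => w _; rewrite /bval; ring.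
- exact: valid_lo.
- exact: valid_lohi.
- exact: valid_hi.
- by apply: measurable_funM; [exact: valid_meas|exact: bval_meas].
- have [K hK] := valid_bnd vc; apply: (isL2_bounded_mul _ hK); last exact: bval_L2.
  by apply: (Fmeas_measurable _ (valid_meas vc)); apply: le_trans (valid_lohi vc) (valid_hi vc).
Qed.

Lemma co_L2 b : valid b -> isL2 P (co b).
Proof.
move=> vb; have [K hK] := valid_bnd vb; apply: isL2_bounded hK.
by apply: (Fmeas_measurable _ (valid_meas vb)); apply: le_trans (valid_lohi vb) (valid_hi vb).
Qed.

Lemma bval_split b u : valid b -> lo b <= u <= hi b ->
  [/\ valid (Block (lo b) u (ch b) (co b)), valid (Block u (hi b) (ch b) (co b)) &
    forall w, bval b w = bval (Block (lo b) u (ch b) (co b)) w +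
                         bval (Block u (hi b) (ch b) (co b)) w].
Proof.
move=> [h1 h2 h3 h4 h5] /andP[lu uh]; split.
- by split=> //=; apply: le_trans h3.
- by split=> //=; [exact: le_trans lu|exact: Fmeas_sub h4].
- by move=> w; rewrite /bval /= -mulrDr -incrD.
Qed.

Lemma bval_same l h i j (Z Z' : Omega T m -> R) :
  valid (Block l h i Z) -> valid (Block l h j Z') ->
  (\int[P]_w (bval (Block l h i Z) w * bval (Block l h j Z') w) =
   (\int[P]_w (Z w * Z' w)) * ((i == j)%:R * ((h - l) * c2 R)))%R.
Proof.
move=> v v'; have [/= l0 lh hT mZ _] := v; have [/= _ _ _ mZ' _] := v'.
rewrite -(Rintegral_incr_bracket hP i j l0 lh hT (Z := fun w => Z w * Z' w)).
- by apply: eq_Rintegral => w _; rewrite /bval /=; ring.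
- exact: measurable_funM.
- exact: (isL2M_integrable (co_L2 v) (co_L2 v')).
Qed.

Lemma RintegralD_L2 (f1 g1 f2 g2 : Omega T m -> R) :
  isL2 P f1 -> isL2 P g1 -> isL2 P f2 -> isL2 P g2 ->
  (\int[P]_w (f1 w * g1 w + f2 w * g2 w) =
   (\int[P]_w (f1 w * g1 w)) + (\int[P]_w (f2 w * g2 w)))%R.
Proof. by move=> *; rewrite RintegralD//; exact: isL2M_integrable. Qed.

Lemma bval_polar_same_lo l h h' i j (Z Z' : Omega T m -> R) :
  valid (Block l h i Z) -> valid (Block l h' j Z') -> h <= h' ->
  (\int[P]_w (bval (Block l h i Z) w * bval (Block l h' j Z') w) =
   (\int[P]_w (Z w * Z' w)) * ((i == j)%:R * ((h - l) * c2 R)))%R.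
Proof.
move=> v v' hh'; have lh : l <= h := valid_lohi v.
have [|v1 v2 E] := @bval_split _ h v'; first by rewrite /= lh.
rewrite -(bval_same v v1); under eq_Rintegral do rewrite E mulrDr.
rewrite RintegralD_L2 ?(@bval_disjoint _ (Block h h' j Z')) ?addr0//; exact: bval_L2.
Qed.

(* Cut the interval that starts first at the start of the other one, and the
   interval that ends last at the end of the other one: only the product of the
   pieces over the intersection has a nonzero mean. *)
Lemma bval_polar b c : valid b -> valid c ->
  (\int[P]_w (bval b w * bval c w) =
   c2 R * (ch b == ch c)%:R * (\int[P]_w (co b w * co c w)) * overlap b c T)%R.
Proof.
move=> vb vc.
have -> : overlap b c T = Num.max 0 (Num.min (hi b) (hi c) - Num.max (lo b) (lo c)).
  by rewrite /overlap (min_idPl _)// ge_min (valid_hi vb).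
wlog bc : b c vb vc / lo b <= lo c.
  move=> H; have [bc|bc] : lo b <= lo c \/ lo c <= lo b by apply/orP; exact: le_total.
    exact: H.
  have := H c b vc vb bc; rewrite eq_sym [Num.min (hi c) _]minC [Num.max (lo c) _]maxC.
  under eq_Rintegral do rewrite mulrC.
  by under [X in _ * X * _]eq_Rintegral do rewrite mulrC.
rewrite (max_idPr bc); have [d|d] := leP (hi b) (lo c).
  rewrite bval_disjoint// (max_idPl _) ?mulr0// subr_le0.
  by rewrite ge_min d.
have [|v1 v2 E] := @bval_split _ (lo c) vb; first by rewrite bc ltW.
under eq_Rintegral do rewrite E mulrDl.
rewrite RintegralD_L2; [|exact: bval_L2..].
rewrite (bval_disjoint v1 vc)// add0r.
have cc : c = Block (lo c) (hi c) (ch c) (co c) by case: (c).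
rewrite (max_idPr _); last by rewrite subr_ge0 le_min (ltW d) (valid_lohi vc).
rewrite [in LHS]cc; have [hh|/ltW hh] := leP (hi b) (hi c).
  by rewrite bval_polar_same_lo -?cc//; ring.
under eq_Rintegral do rewrite mulrC.
rewrite bval_polar_same_lo -?cc// [ch c == _]eq_sym.
rewrite (_ : (\int[P]_w (co c w * co b w) = \int[P]_w (co b w * co c w))%R); first by ring.
by apply: eq_Rintegral => w _; rewrite mulrC.
Qed.

Definition btrunc t b := Block (lo b) (Num.max (lo b) (Num.min (hi b) t)) (ch b) (co b).

Lemma btrunc_valid t b : valid b -> valid (btrunc t b).
Proof.
move=> [h1 h2 h3 h4 h5]; split=> //=; first by rewrite le_max lexx.
by rewrite ge_max ge_min h3 /= andbT (le_trans h2).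
Qed.

Lemma overlap_btrunc t b c : valid b -> valid c -> t <= T ->
  overlap (btrunc t b) (btrunc t c) T = overlap b c t.
Proof.
move=> [_ hb hbT _ _] [_ hc hcT _ _] tT; rewrite /overlap /btrunc /=.
move: (lo b) (hi b) (lo c) (hi c) hb hbT hc hcT => l h l' h' lh hT lh' hT'.
have [lt|tl] := leP l t; last first.
  have -> : Num.max l (Num.min h t) = l by apply/max_idPl; rewrite ge_min (ltW tl) orbT.
  rewrite (max_idPl _); last by rewrite subr_le0 !ge_min le_max lexx.
  rewrite (max_idPl _)// subr_le0 le_max; apply/orP; left.
  by rewrite ge_min (ltW tl) orbT.
have [lt'|tl'] := leP l' t; last first.
  have -> : Num.max l' (Num.min h' t) = l' by apply/max_idPl; rewrite ge_min (ltW tl') orbT.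
  rewrite (max_idPl _); last by rewrite subr_le0 !ge_min !le_max lexx !orbT.
  rewrite (max_idPl _)// subr_le0 le_max; apply/orP; right.
  by rewrite ge_min (ltW tl') orbT.
rewrite (max_idPr (_ : l <= Num.min h t)) ?le_min ?lh//.
rewrite (max_idPr (_ : l' <= Num.min h' t)) ?le_min ?lh'//.
by rewrite minACA minxx [X in X - _](min_idPl _)// ge_min tT orbT.
Qed.

Lemma bint_polar b c t : valid b -> valid c -> t <= T ->
  (\int[P]_w (bint b t w * bint c t w) =
   c2 R * (ch b == ch c)%:R * (\int[P]_w (co b w * co c w)) * overlap b c t)%R.
Proof.
move=> vb vc tT.
rewrite -(overlap_btrunc vb vc tT) -(bval_polar (btrunc_valid t vb) (btrunc_valid t vc)).
by apply: eq_Rintegral => w _; rewrite !bintE.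
Qed.

Section Family.
Context (I : finType) (b : I -> block).
Hypothesis vb : forall i, valid (b i).

Definition fint t w := \sum_i bint (b i) t w.

Definition fproc j t w := \sum_(i | ch (b i) == j) bproc (b i) t w.

Lemma fint_L2 t : 0 <= t <= T -> isL2 P (fint t).
Proof. by move=> tT; apply: isL2_sum => i _; exact: bint_L2. Qed.

Lemma fint_meas t : 0 <= t -> Fmeas t (fint t).
Proof.
move=> t0; have h (i : I) : measurable_fun [set: FOmega T m t] (bint (b i) t).
  exact: bint_meas.
rewrite /Fmeas /fint; exact: measurable_sum.
Qed.

Lemma fint_orth r t (Y : Omega T m -> R) : 0 <= r -> r <= t -> t <= T ->
  Fmeas r Y -> isL2 P Y -> (\int[P]_w (Y w * (fint t w - fint r w)) = 0)%R.
Proof.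
move=> r0 rt tT mY LY; have t0 := le_trans r0 rt; have rT := le_trans rt tT.
under eq_Rintegral do rewrite -sumrB mulr_sumr.
rewrite Rintegral_bigsum; first by rewrite big1// => i _; exact: bint_orth.
move=> i; apply: isL2M_integrable => //.
by apply: isL2B; apply: bint_L2; rewrite ?t0 ?r0.
Qed.

Lemma fint0 w : fint 0 w = 0.
Proof. by rewrite /fint big1// => i _; apply: bint0 => //; exact: valid_lo. Qed.

(** The time integral up to [t] of the squared coefficient process, expanded into pairs of
    blocks. *)
Definition energy t w := \sum_i \sum_k (ch (b i) == ch (b k))%:R *
  (co (b i) w * co (b k) w) * overlap (b i) (b k) t.

Lemma fint_isometry_energy t : 0 <= t <= T ->
  (\int[P]_w (fint t w ^+ 2) = c2 R * \int[P]_w energy t w)%R /\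
  P.-integrable setT (EFin \o energy t).
Proof.
move=> /andP[t0 tT]; have Li i : isL2 P (bint (b i) t) by apply: bint_L2; rewrite ?t0.
have iE i k : P.-integrable setT (EFin \o (fun w => (ch (b i) == ch (b k))%:R *
  (co (b i) w * co (b k) w) * overlap (b i) (b k) t)).
  have h := isL2M_integrable (co_L2 (vb i)) (co_L2 (vb k)).
  have := @integrableZl _ _ _ P setT measurableT
    ((ch (b i) == ch (b k))%:R * overlap (b i) (b k) t) _ h.
  by apply: eq_integrable => // w _ /=; rewrite -EFinM mulrAC.
split; last by apply: integrable_bigsum => i; exact: integrable_bigsum.
under eq_Rintegral do rewrite expr2 /fint big_distrlr /=.
rewrite /energy !Rintegral_bigsum; last 2 first.
- by move=> i; exact: integrable_bigsum.
- by move=> i; apply: integrable_bigsum => k; exact: isL2M_integrable.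
rewrite mulr_sumr; apply: eq_bigr => i _.
rewrite !Rintegral_bigsum//; last by move=> k; exact: isL2M_integrable.
rewrite mulr_sumr; apply: eq_bigr => k _.
rewrite bint_polar//.
rewrite (_ : (\int[P]_w ((ch (b i) == ch (b k))%:R * (co (b i) w * co (b k) w) *
   overlap (b i) (b k) t) = \int[P]_w (((ch (b i) == ch (b k))%:R * overlap (b i) (b k) t) * (co (b i) w * co (b k) w)))%R).
  rewrite RintegralZl//; [by ring|exact: (isL2M_integrable (co_L2 (vb i)) (co_L2 (vb k)))].
by apply: eq_Rintegral => w _; ring.
Qed.

Lemma integral_overlap i k t : 0 <= t ->
  (\int[lebesgue_measure]_(r in `[0%R, t])
     (((lo (b i) < r) && (r <= hi (b i)))%:R * ((lo (b k) < r) && (r <= hi (b k)))%:R)%:E =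
   (overlap (b i) (b k) t)%:E)%E.
Proof.
move=> t0.
pose a := Num.max (lo (b i)) (lo (b k)).
pose e := Num.min (Num.min (hi (b i)) (hi (b k))) t.
have a0 : 0 <= a by rewrite le_max (valid_lo (vb i)).
rewrite integral_mkcond.
rewrite (_ : (fun _ => _) \_ _ = EFin \o \1_(`]a, e] : set R)).
  rewrite integral_indic//= setIT lebesgue_measure_itv/= /overlap -/a -/e lte_fin.
  by rewrite -EFinD /Num.max; case: ltP => h; case: ltP => h' //; congr EFin; lra.
apply/funext => r; rewrite patchE /= indicE !mem_setE !in_itv /= -natrM mulnb.
have [/andP[ar re]|h] := boolP (a < r <= e).
  have r0 : 0 <= r by rewrite (le_trans a0)// ltW.
  by move: ar re; rewrite r0 gt_max !le_min => /andP[-> ->] /andP[/andP[-> ->] ->].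
case: ifP => // /andP[r0 rt]; congr (_%:E).
rewrite (_ : [&& _, _ & _] = false)//; apply/negP => /and3P[/andP[h1 h2] h3 h4].
by move/negP: h; rewrite gt_max !le_min h1 h2 h3 h4 rt.
Qed.

Lemma integral_fproc t w : 0 <= t ->
  (\int[lebesgue_measure]_(r in `[0%R, t]) (\sum_j fproc j r w ^+ 2)%:E =
   (energy t w)%:E)%E.
Proof.
move=> t0.
pose f i k r : R := ((ch (b i) == ch (b k))%:R * (co (b i) w * co (b k) w)) *
 (((lo (b i) < r) && (r <= hi (b i)))%:R * ((lo (b k) < r) && (r <= hi (b k)))%:R).
have fE r : \sum_j fproc j r w ^+ 2 = \sum_i \sum_k f i k r.
  transitivity (\sum_j \sum_(i | ch (b i) == j) \sum_(k | ch (b k) == j) bproc (b i) r w * bproc (b k) r w).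
    by apply: eq_bigr => j _; rewrite expr2 /fproc big_distrlr.
  rewrite (partition_big (fun i => ch (b i)) xpredT)//=; apply: eq_bigr => j _.
  apply: eq_bigr => i /eqP ij; rewrite [RHS](bigID (fun k => ch (b k) == j)) /=.
  rewrite [X in _ + X]big1 ?addr0; last first.
    by move=> k kj; rewrite /f ij eq_sym (negbTE kj) !mul0r.
  by apply: eq_bigr => k /eqP kj; rewrite /f ij kj eqxx mul1r /bproc; ring.
have mI (l h : R) : measurable_fun setT (fun r : R => ((l < r) && (r <= h))%:R : R).
  rewrite (_ : (fun r => _) = \1_(`]l, h] : set R))//.
    by apply/funext => r; rewrite indicE mem_setE in_itv.
have if_ i k : lebesgue_measure.-integrable `[0%R, t] (EFin \o f i k).
  apply: measurable_bounded_integrable => //.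
  - by rewrite /= lebesgue_measure_itv/=; case: ifP; rewrite ?ltry.
  - apply: measurable_funTS; apply: measurable_funM => //.
    by apply: measurable_funM; exact: mI.
  exists (`|(ch (b i) == ch (b k))%:R * (co (b i) w * co (b k) w)|); split; first exact: num_real.
  move=> M ltM r _ /=; rewrite /f normrM -natrM mulnb.
  apply: (le_trans _ (ltW ltM)); rewrite ler_piMr// normr_nat lern1.
  by case: (_ && _).
under eq_integral do rewrite fE -sumEFin.
rewrite integral_sum//; last first.
  move=> i; have := @integrable_sum _ _ _ lebesgue_measure `[0%R, t]%classic _ _ (index_enum I) xpredT _ (fun k _ => if_ i k).
  move=> /(_ (measurable_itv _)); apply: eq_integrable => // r _.
  by rewrite sumEFin.
rewrite /energy -sumEFin; apply: eq_bigr => i _.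
under eq_integral do rewrite -sumEFin.
rewrite integral_sum//; last by move=> k; exact: if_.
rewrite -sumEFin; apply: eq_bigr => k _.
rewrite /f EFinM -integral_overlap//.
under eq_integral do rewrite EFinM.
rewrite integralZl//.
apply: measurable_bounded_integrable => //.
- by rewrite /= lebesgue_measure_itv/=; case: ifP; rewrite ?ltry.
- by apply: measurable_funTS; apply: measurable_funM; exact: mI.
exists 1; split; first exact: num_real.
move=> M ltM r _ /=; apply: (le_trans _ (ltW ltM)).
by rewrite -natrM mulnb normr_nat lern1; case: (_ && _).
Qed.

(** Ito's isometry. Both sides expand into pairs of blocks and meet in [energy], where pairs with
    different driving coordinates vanish. *)
Lemma fint_isometry t : 0 <= t <= T ->
  (moment2 P (fint t) = (c2 R)%:E * \int[P]_w \int[lebesgue_measure]_(r in `[0%R, t])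
    (\sum_j fproc j r w ^+ 2)%:E)%E.
Proof.
move=> tT; have [t0 _] := andP tT; have [h iE] := fint_isometry_energy tT.
rewrite -moment2_Rintegral ?h; last exact: fint_L2.
under eq_integral do rewrite integral_fproc//.
rewrite EFinM; congr (_ * _)%E; rewrite /Rintegral fineK//.
exact: (integrable_fin_num measurableT iE).
Qed.

Lemma fint_martingale (r : nat -> R) n :
  r 0%N = 0 -> (forall k, (k < n)%N -> r k <= r k.+1) -> (forall k, (k <= n)%N -> r k <= T) ->
  martingale P r (fun k => fint (r k)) n.
Proof.
move=> r0 rr rT.
have r_ge0 k : (k <= n)%N -> 0 <= r k.
  by elim: k => [|k IH] kn; [rewrite r0|rewrite (le_trans (IH (ltnW kn)))// rr].
split=> //.
- by move=> k kn; apply: fint_meas; exact: r_ge0.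
- by move=> k kn; apply: fint_L2; rewrite r_ge0// rT.
- by move=> w; rewrite r0 fint0.
- by move=> k Y kn mY LY; apply: fint_orth; rewrite ?rr ?rT ?r_ge0// ltnW.
Qed.

End Family.

End Blocks.

(** * Ito integrals *)

Section TimeIntegral.
Context (R : realType) (T : R) (m : nat).
Notation mu := (@lebesgue_measure R).

Lemma measurable_time_section (f : R * Omega T m -> \bar R) w (t : R) :
  measurable_fun (`[0, T] `*` [set: Omega T m]) f -> t <= T ->
  measurable_fun `[0, t] (fun r => f (r, w)).
Proof.
move=> mf tT.
have : measurable_fun (`[0, T] : set R) (fun r => f (r, w)).
  apply: (@measurable_comp _ _ _ _ _ _ (`[0, T] `*` [set: Omega T m])) => //.
  - by apply: measurableX => //; exact: measurable_itv.
  - by move=> _ [r r0 <-].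
  - by apply/measurable_funTS/measurable_fun_pair => //; exact: measurable_cst.
apply: measurable_funS => // r /=; rewrite !in_itv /= => /andP[-> rt].
exact: le_trans tT.
Qed.

Lemma measurable_time_integral (f : R * Omega T m -> \bar R) (t : R) :
  measurable_fun (`[0, T] `*` [set: Omega T m]) f -> (forall z, 0 <= f z)%E ->
  t <= T ->
  measurable_fun setT (fun w => \int[mu]_(r in `[0%R, t]) f (r, w))%E.
Proof.
move=> mf f0 tT.
pose D : set (R * Omega T m) := `[0, t] `*` setT.
have mD : measurable D by apply: measurableX => //; exact: measurable_itv.
have mfD : measurable_fun D f.
  apply: measurable_funS mf; first by apply: measurableX => //; exact: measurable_itv.
  move=> [r w] [/= h _]; split => //=; move: h; rewrite !in_itv /= => /andP[-> rt].
  exact: le_trans tT.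
have mf' : measurable_fun setT (f \_ D) by apply/(measurable_restrictT f mD).
have f'0 z : (0 <= (f \_ D) z)%E by rewrite patchE; case: ifP.
have := @measurable_fun_fubini_tonelli_G _ _ (measurableTypeR R) (Omega T m) R mu _ mf' f'0.
apply: eq_measurable_fun => w _; rewrite /fubini_G [RHS]integral_mkcond.
apply: eq_integral => r _; rewrite !patchE.
by congr (if _ then _ else _); apply/idP/idP => [/set_mem[h _]|/set_mem h]; apply/mem_set.
Qed.

End TimeIntegral.

Lemma four_c_bound (R : realType) (c : R) (a b d x : \bar R) : 0 <= c ->
  (0 <= b)%E -> (0 <= x)%E -> (a <= b)%E -> (d <= 2%:E * a + 2%:E * x)%E ->
  (2%:E * (c%:E * d) <= (4 * c)%:E * b + (4 * c)%:E * x)%E.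
Proof.
move=> c0 b0 x0 ab h.
have h' : (d <= 2%:E * b + 2%:E * x)%E.
  by apply: (le_trans h); apply: leeD2r; rewrite lee_wpmul2l// lee_fin.
apply: (@le_trans _ _ (2%:E * (c%:E * (2%:E * b + 2%:E * x)))%E).
  by rewrite lee_wpmul2l ?lee_fin// lee_wpmul2l// lee_fin.
rewrite !ge0_muleDr ?mule_ge0 ?lee_fin//.
by rewrite !muleA -!EFinM (_ : 2 * c * 2 = 4 * c)//; ring.
Qed.

Section ProcessDistance.
Context (R : realType) (T : R) (m p q : nat) (P : probability (Omega T m) R).
Notation mu := (@lebesgue_measure R).
Implicit Types (H K L : R -> Omega T m -> 'M[R]_(p, q)) (t : R).

Lemma jointly_measurableB H K : jointly_measurable H -> jointly_measurable K ->
  jointly_measurable (fun t w => H t w - K t w).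
Proof.
move=> mH mK i j.
rewrite (_ : (fun x => _) = (fun x : R * Omega T m => H x.1 x.2 i j - K x.1 x.2 i j)).
  by apply: measurable_funB; [exact: mH|exact: mK].
by apply/funext => x; rewrite !mxE.
Qed.

Lemma jointly_measurable_frob2 H : jointly_measurable H ->
  measurable_fun (`[0, T] `*` [set: Omega T m])
    (fun z : R * Omega T m => (frob (H z.1 z.2) ^+ 2)%:E).
Proof.
move=> mH; apply/measurable_EFinP.
rewrite (_ : (fun z => _) = (fun z : R * Omega T m => \sum_i \sum_j H z.1 z.2 i j ^+ 2)); last first.
  by apply/funext => z; rewrite frob2E.
apply: measurable_sum => i; apply: measurable_sum => j.
by apply: measurable_funX; exact: mH.
Qed.

(** Left-open, right-closed cells, the convention of simple processes, so that a coefficient known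
    at the left end gives an adapted process; the value at time 0 is zero. *)
Definition cells n (ts : nat -> R) (c : nat -> Omega T m -> 'M[R]_(p, q)) (r : R) w : 'M[R]_(p, q) :=
  \sum_(l < n | ts l < r <= ts l.+1) c l w.

Lemma jointly_measurable_cells n (ts : nat -> R) (c : nat -> Omega T m -> 'M[R]_(p, q)) :
  (forall l i j, (l < n)%N -> measurable_fun setT (fun w => c l w i j)) ->
  jointly_measurable (cells n ts c).
Proof.
move=> mc i j; apply: measurable_funTS.
rewrite (_ : (fun x => _) = (fun x : R * Omega T m => \sum_(l < n)
   ((ts l < x.1) && (x.1 <= ts l.+1))%:R * c l x.2 i j)); last first.
  apply/funext => x; rewrite /cells summxE big_mkcond; apply: eq_bigr => l _.
  by case: ifP => _; rewrite ?mul1r ?mul0r.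
apply: measurable_sum => l; apply: measurable_funM; last first.
  exact: (measurableT_comp (mc l i j (ltn_ord l)) measurable_snd).
have mI : measurable_fun setT (fun r : R => ((ts l < r) && (r <= ts l.+1))%:R : R).
  rewrite (_ : (fun r => _) = \1_(`]ts l, ts l.+1] : set R))//.
  by apply/funext => r; rewrite indicE mem_setE in_itv.
exact: (measurableT_comp mI measurable_fst).
Qed.

(** The squared distance in L2(dt x P) on [0, t], the left side of the isometry. *)
Definition dist2 t H K : \bar R :=
  (\int[P]_w \int[mu]_(r in `[0%R, t]) (frob (H r w - K r w) ^+ 2)%:E)%E.

Lemma dist2_ge0 t H K : (0 <= dist2 t H K)%E.
Proof.
by apply: integral_ge0 => w _; apply: integral_ge0 => r _; rewrite lee_fin sqr_ge0.
Qed.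

Lemma dist2C t H K : dist2 t H K = dist2 t K H.
Proof.
apply: eq_integral => w _; apply: eq_integral => r _.
by rewrite -frobN opprB.
Qed.

Lemma dist2_mono s t H K : jointly_measurable H -> jointly_measurable K ->
  s <= t -> t <= T -> (dist2 s H K <= dist2 t H K)%E.
Proof.
move=> mH mK st tT; apply: le_integral_pointwise => w _.
have mf := jointly_measurable_frob2 (jointly_measurableB mH mK).
apply: ge0_subset_integral => //.
- exact: (measurable_time_section w mf tT).
- by move=> r _; rewrite lee_fin sqr_ge0.
- by move=> r /=; rewrite !in_itv /= => /andP[-> rs]; rewrite (le_trans rs st).
Qed.

Lemma dist2_triangle t H K L : jointly_measurable H -> jointly_measurable K ->
  jointly_measurable L -> t <= T ->
  (dist2 t H L <= 2%:E * dist2 t H K + 2%:E * dist2 t K L)%E.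
Proof.
move=> mH mK mL tT.
have m1 := jointly_measurable_frob2 (jointly_measurableB mH mK).
have m2 := jointly_measurable_frob2 (jointly_measurableB mK mL).
have p0 (A B : R -> Omega T m -> 'M[R]_(p, q)) : forall z, (0 <= (frob (A z.1 z.2 - B z.1 z.2) ^+ 2)%:E)%E.
  by move=> z; rewrite lee_fin sqr_ge0.
have i1 := measurable_time_integral m1 (p0 H K) tT.
have i2 := measurable_time_integral m2 (p0 K L) tT.
apply: le_integral_2D2.
- exact: measurableT.
- exact: i1.
- exact: i2.
- by move=> w; apply: integral_ge0 => r _; exact: (p0 H K (r, w)).
- by move=> w; apply: integral_ge0 => r _; exact: (p0 K L (r, w)).
move=> w _; apply: le_integral_2D2.
- exact: measurable_itv.
- exact: (measurable_time_section w m1 tT).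
- exact: (measurable_time_section w m2 tT).
- by move=> r; exact: (p0 H K (r, w)).
- by move=> r; exact: (p0 K L (r, w)).
by move=> r _; rewrite -!EFinM -EFinD lee_fin frob2_triangle.
Qed.

End ProcessDistance.

Section SimpleProcess.
Context (R : realType) (T : R) (m k : nat) (P : probability (Omega T m) R).
Hypothesis hP : wiener_measure P.
Hypothesis T0 : 0 <= T.
Notation mu := (@lebesgue_measure R).
Implicit Types (S : simple_process T m k) (H : R -> Omega T m -> 'M[R]_(k, m)).

Lemma sp_time_mono S i j : (i <= j)%N -> (j <= sp_size S)%N ->
  sp_time S i <= sp_time S j.
Proof.
move=> ij; elim: j ij => [|j IH]; first by rewrite leqn0 => /eqP ->.
rewrite leq_eqVlt => /predU1P[->//|]; rewrite ltnS => ij js.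
by rewrite (le_trans (IH ij (ltnW js)))// sp_time_le.
Qed.

Lemma sp_time_itv S i : (i <= sp_size S)%N -> 0 <= sp_time S i <= T.
Proof.
move=> iS; rewrite (le_trans (sp_time_ge0 S)) ?sp_time_mono//=.
by rewrite (le_trans _ (sp_time_leT S))// sp_time_mono.
Qed.

Definition sblock (e : R) S (i : 'I_k) (x : 'I_(sp_size S) * 'I_m) : block T m :=
  Block (sp_time S x.1) (sp_time S x.1.+1) x.2 (fun w => e * sp_coef S x.1 w i x.2).

Lemma sblock_valid (e : R) S i x : valid (@sblock e S i x).
Proof.
case: x => l j; have lS := ltn_ord l; split=> /=.
- by have /andP[] := sp_time_itv (ltnW lS).
- exact: sp_time_le.
- by have /andP[] := sp_time_itv lS.
- have /filt_measurable_Fmeas/(_ i j) h := sp_coef_meas lS.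
  by apply: measurable_funM; [exact: measurable_cst|exact: h].
- have [K hK] := sp_coef_bnd lS; exists (`|e| * K) => w.
  by rewrite normrM ler_wpM2l// (le_trans (frob_entry _ _ _) (hK w)).
Qed.

(** Row [i] of the difference of two simple processes as one family: the sum type juxtaposes the
    blocks, the second ones with sign -1. *)
Definition dblock S1 S2 i (x : ('I_(sp_size S1) * 'I_m) + ('I_(sp_size S2) * 'I_m)) :=
  match x with inl y => @sblock 1 S1 i y | inr y => @sblock (-1) S2 i y end.

Lemma dblock_valid S1 S2 i x : valid (@dblock S1 S2 i x).
Proof. by case: x => x; exact: sblock_valid. Qed.

Lemma big_sblock_int (e : R) S i t w :
  \sum_x bint (@sblock e S i x) t w = e * sp_integral S t w i 0.
Proof.
rewrite -(pair_big xpredT xpredT (fun l j => bint (@sblock e S i (l, j)) t w)) /=.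
rewrite /sp_integral summxE mulr_sumr; apply: eq_bigr => l _.
rewrite mxE mulr_sumr; apply: eq_bigr => j _.
by rewrite /bint /= /incr !mxE; ring.
Qed.

Lemma big_sblock_proc (e : R) S i j t w :
  \sum_(x | ch (@sblock e S i x) == j) bproc (@sblock e S i x) t w =
  e * sp_process S t w i j.
Proof.
rewrite big_mkcond /= -(pair_big xpredT xpredT (fun l (j' : 'I_m) =>
   if ch (@sblock e S i (l, j')) == j then bproc (@sblock e S i (l, j')) t w else 0)) /=.
rewrite /sp_process summxE [in RHS]big_mkcond mulr_sumr; apply: eq_bigr => l _.
rewrite -big_mkcond big_pred1_eq /bproc /=.
by case: ifP => _; rewrite ?mulr1 ?mulr0.
Qed.

Lemma dblock_int S1 S2 i t w :
  fint (@dblock S1 S2 i) t w = (sp_integral S1 t w - sp_integral S2 t w) i 0.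
Proof.
by rewrite /fint big_sumType /= !big_sblock_int !mxE mul1r mulN1r.
Qed.

Lemma dblock_proc S1 S2 i j t w :
  fproc (@dblock S1 S2 i) j t w = (sp_process S1 t w - sp_process S2 t w) i j.
Proof.
by rewrite /fproc big_sumType /= !big_sblock_proc !mxE mul1r mulN1r.
Qed.

Lemma sp_integral_meas S t : 0 <= t -> filt_measurable t (sp_integral S t).
Proof.
move=> t0; apply/filt_measurable_Fmeas => i j; rewrite ord1.
have := @fint_meas _ _ _ _ (@sblock 1 S i) (sblock_valid 1 i) t t0.
by rewrite /fint; under eq_fun do rewrite big_sblock_int mul1r.
Qed.

Lemma sp_integral_measurable S t i : 0 <= t <= T ->
  measurable_fun setT (fun w => sp_integral S t w i 0).
Proof.
move=> /andP[t0 tT]; have /filt_measurable_Fmeas/(_ i 0) := @sp_integral_meas S t t0.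
exact: Fmeas_measurable.
Qed.

Lemma jointly_measurable_sp S : jointly_measurable (sp_process S).
Proof.
apply: (@jointly_measurable_cells _ _ _ _ _ (sp_size S) (sp_time S) (sp_coef S)) => l i j ls.
have /filt_measurable_Fmeas/(_ i j)/(Fmeas_measurable _) := sp_coef_meas ls.
by apply; have /andP[] := sp_time_itv (ltnW ls).
Qed.

Definition vmoment2 q (X : Omega T m -> 'cV[R]_q) : \bar R :=
  (\int[P]_w (frob (X w) ^+ 2)%:E)%E.

Lemma vmoment2_ge0 q (X : Omega T m -> 'cV[R]_q) : (0 <= vmoment2 X)%E.
Proof. by apply: integral_ge0 => w _; rewrite lee_fin sqr_ge0. Qed.

Lemma frob2_cV q (x : 'cV[R]_q) : frob x ^+ 2 = \sum_i x i 0 ^+ 2.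
Proof. by rewrite frob2E; apply: eq_bigr => i _; rewrite big_ord1. Qed.

Lemma measurable_frob2_cV q (X : Omega T m -> 'cV[R]_q) :
  (forall i, measurable_fun setT (fun w => X w i 0)) ->
  measurable_fun setT (fun w => (frob (X w) ^+ 2)%:E).
Proof.
move=> mX; apply/measurable_EFinP; under eq_fun do rewrite frob2_cV.
by apply: measurable_sum => i; exact: measurable_funX.
Qed.

Lemma vmoment2_sum q (X : Omega T m -> 'cV[R]_q) :
  (forall i, measurable_fun setT (fun w => X w i 0)) ->
  vmoment2 X = (\sum_i moment2 P (fun w => X w i 0%R))%E.
Proof.
move=> mX; rewrite /vmoment2; under eq_integral do rewrite frob2_cV -sumEFin.
rewrite ge0_integral_sum//; first by move=> i; exact: measurable_sqr.
by move=> i w _; rewrite lee_fin sqr_ge0.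
Qed.

Lemma vmoment2_triangle q (X Y Z : Omega T m -> 'cV[R]_q) :
  (forall i, measurable_fun setT (fun w => X w i 0)) ->
  (forall i, measurable_fun setT (fun w => Y w i 0)) ->
  (forall i, measurable_fun setT (fun w => Z w i 0)) ->
  (vmoment2 (fun w => X w - Z w)%R <=
   2%:E * vmoment2 (fun w => X w - Y w)%R + 2%:E * vmoment2 (fun w => Y w - Z w)%R)%E.
Proof.
move=> mX mY mZ.
have mB (U V : Omega T m -> 'cV[R]_q) : (forall i, measurable_fun setT (fun w => U w i 0)) ->
  (forall i, measurable_fun setT (fun w => V w i 0)) ->
  measurable_fun setT (fun w => (frob (U w - V w) ^+ 2)%:E).
  move=> mU mV; apply: (@measurable_frob2_cV _ (fun w => U w - V w)) => i.
  by under eq_fun do rewrite !mxE; exact: measurable_funB.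
apply: le_integral_2D2 => //; try exact: mB.
- by move=> w; rewrite lee_fin sqr_ge0.
- by move=> w; rewrite lee_fin sqr_ge0.
by move=> w _; rewrite -!EFinM -EFinD lee_fin frob2_triangle.
Qed.

Lemma sp_isometry S1 S2 (t : R) : 0 <= t <= T ->
  vmoment2 (fun w => sp_integral S1 t w - sp_integral S2 t w) =
  ((c2 R)%:E * dist2 P t (sp_process S1) (sp_process S2))%E.
Proof.
move=> tT; have [t0 tT'] : 0 <= t /\ t <= T by case/andP: tT.
rewrite vmoment2_sum; last first.
  move=> i; under eq_fun do rewrite !mxE.
  by apply: measurable_funB; exact: sp_integral_measurable.
pose D i w : \bar R := (\int[mu]_(r in `[0%R, t])
   (\sum_j fproc (@dblock S1 S2 i) j r w ^+ 2)%:E)%E.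
have DE i w : D i w = (energy (@dblock S1 S2 i) t w)%:E.
  by apply: integral_fproc => //; exact: dblock_valid.
transitivity (\sum_i (c2 R)%:E * \int[P]_w D i w)%E.
  apply: eq_bigr => i _; rewrite -fint_isometry//; last exact: dblock_valid.
  by apply: eq_integral => w _; rewrite dblock_int.
rewrite -ge0_sume_distrr; last first.
  move=> i _; apply: integral_ge0 => w _; apply: integral_ge0 => r _.
  by rewrite lee_fin sum_sqr_ge0.
congr (_ * _)%E; rewrite -ge0_integral_sum//; last 2 first.
- move=> i; have [_ /integrableP[h _]] := fint_isometry_energy hP (@dblock_valid S1 S2 i) tT.
  by apply: eq_measurable_fun h => w _; rewrite DE.
- by move=> i w _; apply: integral_ge0 => r _; rewrite lee_fin sum_sqr_ge0.
have mS := jointly_measurableB (jointly_measurable_sp S1) (jointly_measurable_sp S2).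
apply: eq_integral => w _; rewrite /D -ge0_integral_sum//; last 2 first.
- move=> i; have : measurable_fun (`[0, T] `*` [set: Omega T m])
    (fun z : R * Omega T m => (\sum_j fproc (@dblock S1 S2 i) j z.1 z.2 ^+ 2)%:E).
    apply/measurable_EFinP; apply: measurable_sum => j; apply: measurable_funX.
    apply: eq_measurable_fun (mS i j) => z _; by rewrite dblock_proc.
  by move=> h; exact: (measurable_time_section w h tT').
- by move=> i r _; rewrite lee_fin sum_sqr_ge0.
apply: eq_integral => r _; rewrite frob2E -sumEFin; apply: eq_bigr => i _.
by congr EFin; apply: eq_bigr => j _; rewrite dblock_proc.
Qed.

Lemma ev_measurable q (X : Omega T m -> Omega T q) t i :
  measurable_fun setT X -> measurable_fun setT (fun w => ev (X w) t i 0).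
Proof.
move=> mX; apply: (measurableT_comp (f := fun x : Omega T q => ev x t i 0)) => //.
exact: measurable_ev.
Qed.

(** [is_ito] only provides some approximating sequence; this compares the integral with an arbitrary
    simple process. Two quadratic triangle inequalities, one in L2(P) and one in L2(dt x P), give
    the factor 4, and the error of the sequence vanishes in the limit. *)
Lemma is_ito_sp H I S (t : R) : jointly_measurable H -> is_ito P H I -> 0 <= t <= T ->
  (vmoment2 (fun w => ev (I w) t - sp_integral S t w)%R <=
   (4 * c2 R)%:E * dist2 P t H (sp_process S))%E.
Proof.
move=> mH [mI [Sn [hn1 hn2]]] tT; have [t0 tT'] := andP tT.
have e0 := hn2 t tT; rewrite unlock in e0.
set X := dist2 P t H (sp_process S).
pose u n : \bar R := (2%:E * vmoment2 (fun w => ev (I w) t - sp_integral (Sn n) t w)%R +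
  ((4 * c2 R)%:E * dist2 P T H (sp_process (Sn n)) + (4 * c2 R)%:E * X))%E.
have cu : u n @[n --> \oo] --> ((4 * c2 R)%:E * X)%E.
  rewrite -[Y in _ --> Y]add0e -[Y in _ --> (Y + _)%E](mule0 2%:E).
  apply: cvgeD; first by rewrite mule0.
    exact: cvgeZl.
  rewrite -[Y in _ --> Y]add0e -[Y in _ --> (Y + _)%E](mule0 (4 * c2 R)%:E).
  apply: cvgeD; first by rewrite mule0.
    exact: cvgeZl.
  exact: cvg_cst.
rewrite -(cvg_lim _ cu)//; apply: lime_ge; first by apply/cvg_ex; eexists; exact: cu.
apply: nearW => n; rewrite /u.
have mS (S' : simple_process T m k) i : measurable_fun setT (fun w => sp_integral S' t w i 0).
  exact: sp_integral_measurable.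
have mIt i : measurable_fun setT (fun w => ev (I w) t i 0) by exact: ev_measurable.
apply: (le_trans (vmoment2_triangle mIt (mS (Sn n)) (mS S))).
rewrite leeD2l// sp_isometry//.
have jS := jointly_measurable_sp.
have := dist2_triangle P (jS (Sn n)) mH (jS S) tT'.
have := dist2_mono P mH (jS (Sn n)) tT' (lexx _); rewrite -(dist2C P t (sp_process (Sn n))).
move=> h1 h2; exact: (four_c_bound (c2_ge0 R) (dist2_ge0 _ _ _ _) (dist2_ge0 _ _ _ _) h1 h2).
Qed.

End SimpleProcess.

(** * Backward averages of adapted processes *)

Section StoppedPath.
Context (R : realType) (T : R) (m : nat).
Hypothesis T0 : 0 <= T.
Implicit Types (s r t : R) (w : Omega T m).

Lemma continuous_clamp : continuous (clamp T : R -> R).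
Proof.
apply: (@max_fun_continuous _ _ R (cst 0) (fun t => Num.min t T)).
  exact: cst_continuous.
apply: (@min_fun_continuous _ _ R id (cst T)); last exact: cst_continuous.
by move=> x; exact: cvg_id.
Qed.

Lemma clampK t : clamp T (clamp T t) = clamp T t.
Proof. by rewrite clamp_id// clamp_itv. Qed.

Lemma clamp0 : clamp T 0 = 0. Proof. by rewrite clamp_id// lexx. Qed.

Lemma continuous_ev w : continuous (ev w).
Proof. exact: path_cont. Qed.

Section Stop.
Variables (r : R) (w : Omega T m).

Let f t := ev w (Num.min (clamp T t) (clamp T r)).

Let f_cont : continuous f.
Proof.
move=> x; apply: (@continuous_comp _ _ _ (fun t => Num.min (clamp T t) (clamp T r)) (ev w)).
  by apply: continuous_min; [exact: continuous_clamp|exact: cvg_cst].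
exact: continuous_ev.
Qed.

Let f_start : f 0 = 0.
Proof.
rewrite /f clamp0 (min_idPl _) ?ev0//.
by have /andP[] := clamp_itv r T0.
Qed.

Let f_clamp t : f t = f (clamp T t).
Proof. by rewrite /f clampK. Qed.

Definition stop : Omega T m := PathFun f_cont f_start f_clamp.

Lemma ev_stop t : 0 <= r <= T -> 0 <= t <= T -> ev stop t = ev w (Num.min t r).
Proof. by move=> rT tT; rewrite {1}/ev /= /f !clamp_id. Qed.

End Stop.

Lemma stop_measurable r : 0 <= r <= T ->
  measurable_fun [set: FOmega T m r] (stop r : FOmega T m r -> Omega T m).
Proof.
move=> rT; apply: (@measurability _ _ (FOmega T m r) (Omega T m) setT _ (@cylinders R T m T)) => //.
move=> _ [C [s [i [B [sT mB ->]]]] <-]; rewrite setTI.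
apply: sub_sigma_algebra; exists (Num.min s r), i, B; split=> //.
  case/andP: sT => s0 _; case/andP: rT => r0 _.
  by rewrite le_min s0 r0 ge_min lexx orbT.
have E w : path_val (stop r w) s = path_val w (Num.min s r) := ev_stop w rT sT.
by apply/seteqP; split => w; rewrite /preimage /mkset E.
Qed.

(** The sets that do not separate [w] from [w'] form a sigma-algebra, and it contains every cylinder
    up to time [s]. *)
Lemma filt_local s (A : set (Omega T m)) w w' : filt s A ->
  (forall u, 0 <= u <= s -> ev w u = ev w' u) -> A w -> A w'.
Proof.
move=> fA ww'; suff : A w <-> A w' by move=> [].
have : filt s `<=` [set A | A w <-> A w'].
  apply: smallest_sub; first split => /=.
  - by [].
  - by move=> B hB; split => -[_ nB]; split => // /hB.
  - by move=> F hF; split => -[n _ Fn]; exists n => //; apply/(hF n).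
  by move=> _ [u [i [B [us mB ->]]]] /=; have := ww' u us; rewrite /ev => ->.
exact.
Qed.

Lemma Fmeas_local s (f : Omega T m -> R) w w' : Fmeas s f ->
  (forall u, 0 <= u <= s -> ev w u = ev w' u) -> f w = f w'.
Proof.
move=> /FmeasP mf ww'; have /= := @filt_local s (f @^-1` [set f w]) w w'.
by move=> /(_ (mf _ (measurable_set1 _)) ww' erefl) /= ->.
Qed.

Lemma Fmeas_stop s r (f : Omega T m -> R) w : Fmeas s f -> 0 <= r <= T -> s <= r ->
  f (stop r w) = f w.
Proof.
move=> mf rT sr; apply: (Fmeas_local mf) => u /andP[u0 us].
have ur := le_trans us sr; have /andP[_ rT'] := rT.
by rewrite ev_stop// ?u0 ?(le_trans ur)// (min_idPl ur).
Qed.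

(** Galmarino's test: stopping at [r] is measurable from the past up to [r], and [f] factors through
    it. *)
Lemma Fmeas_of_stop r (f : Omega T m -> R) : 0 <= r <= T -> measurable_fun setT f ->
  (forall w, f (stop r w) = f w) -> Fmeas r f.
Proof.
move=> rT mf h; rewrite /Fmeas (_ : f = f \o stop r); last by apply/funext => w /=.
exact: measurableT_comp mf (stop_measurable rT).
Qed.

End StoppedPath.

Section BackwardAverage.
Context (R : realType) (T : R) (m : nat).
Hypothesis T0 : 0 <= T.
Notation mu := (@lebesgue_measure R).
Implicit Types (s r t : R) (w : Omega T m).

Record good_process (K : R) (H : R -> Omega T m -> R) : Prop := GoodProcess {
  good_bnd : forall t w, 0 <= t <= T -> `|H t w| <= K ;
  good_jm : measurable_fun (`[0, T] `*` [set: Omega T m]) (fun z : R * Omega T m => H z.1 z.2) ;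
  good_adapted : forall t, 0 <= t <= T -> Fmeas t (H t) }.

Variables (K : R) (H : R -> Omega T m -> R).
Hypothesis gH : good_process K H.

Definition primitive r w : R := (\int[mu]_(u in `[0, r]) H u w)%R.

Lemma good_K0 w : 0 <= K.
Proof. by rewrite (le_trans (normr_ge0 _) (good_bnd gH (t := 0) w _))// lexx T0. Qed.

Lemma good_section_measurable r w : r <= T -> measurable_fun `[0, r] (fun u => H u w).
Proof.
move=> rT; apply/measurable_EFinP.
have mE : measurable_fun (`[0, T] `*` [set: Omega T m]) (fun z : R * Omega T m => (H z.1 z.2)%:E).
  by apply/measurable_EFinP; exact: (good_jm gH).
exact: (@measurable_time_section _ _ _ (fun z : R * Omega T m => (H z.1 z.2)%:E) w r mE rT).
Qed.

Lemma good_section_integrable r w : r <= T ->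
  mu.-integrable `[0, r] (EFin \o (fun u => H u w)).
Proof.
move=> rT; apply: measurable_bounded_integrable => //.
- by rewrite /= lebesgue_measure_itv/=; case: ifP; rewrite ?ltry.
- exact: good_section_measurable.
exists K; split; first exact: num_real.
move=> M KM u /=; rewrite in_itv /= => /andP[u0 ur].
by rewrite (le_trans (good_bnd gH w _) (ltW KM))// u0 (le_trans ur).
Qed.

(** Joint measurability refers to the full sigma-algebra, so Tonelli alone gives measurability at
    time [T]. Stopping the path at [r] changes no value of the integrand before [r], and Galmarino's
    test does the rest. *)
Lemma primitive_meas r : 0 <= r <= T -> Fmeas r (primitive r).
Proof.
move=> /andP[r0 rT]; apply: (@Fmeas_of_stop _ _ _ T0); rewrite ?r0//; last first.
  move=> w; apply: eq_Rintegral => u /set_mem /=; rewrite in_itv /= => /andP[u0 ur].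
  have uT : 0 <= u <= T by apply/andP; split; [exact: u0|exact: le_trans ur rT].
  by apply: (@Fmeas_stop _ _ _ T0 u) => //; [exact: (good_adapted gH)|rewrite r0].
(* Adding the bound [K] makes the integrand nonnegative, as Tonelli requires; its integral [K * r]
   is subtracted afterwards. *)
pose G w := (\int[mu]_(u in `[0%R, r]) (`|H u w + K|)%:E)%E.
have mHK : measurable_fun (`[0, T] `*` [set: Omega T m])
    (fun z : R * Omega T m => `|H z.1 z.2 + K|%:E).
  apply/measurable_EFinP; apply: measurableT_comp => //.
  by apply: measurable_funD; [exact: (good_jm gH)|exact: measurable_cst].
have mG : measurable_fun setT G.
  exact: (measurable_time_integral mHK _ rT).
have iK : mu.-integrable `[0, r] (EFin \o (fun=> K)).
  apply: measurable_bounded_integrable => //.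
    by rewrite /= lebesgue_measure_itv/=; case: ifP; rewrite ?ltry.
  by exists `|K|; split; [exact: num_real|move=> M KM u _ /=; exact: ltW].
rewrite (_ : primitive r = fun w => fine (G w) - K * r).
  apply: measurable_funB; last exact: measurable_cst.
  by apply: measurableT_comp => //; exact: measurable_fine.
apply/funext => w.
have -> : fine (G w) = (\int[mu]_(u in `[0, r]) (H u w + K))%R.
  rewrite /Rintegral; congr fine; apply: eq_integral => u /set_mem /=.
  rewrite in_itv /= => /andP[u0 ur]; rewrite ger0_norm// -lerBlDr sub0r.
  have := good_bnd gH w (t := u); rewrite u0 (le_trans ur rT) => /(_ isT).
  by rewrite ler_norml => /andP[].
rewrite RintegralD//; last exact: good_section_integrable.
rewrite Rintegral_cst//; rewrite /= lebesgue_measure_itv/= lte_fin.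
case: ltP => h; first by rewrite oppr0 addr0 /= addrK.
by rewrite mulr0 addr0 (_ : r = 0) ?mulr0 ?subr0//; apply/eqP; rewrite eq_le h.
Qed.

Lemma primitive_lipschitz s r w : s <= r -> r <= T ->
  `|primitive r w - primitive s w| <= K * (r - s).
Proof.
move=> sr rT; have K0 := good_K0 w.
(* Backward averages reach times before 0, where the primitive is an integral over an empty
   interval. *)
have [s0|s0] := leP 0 s; last first.
  have -> : primitive s w = 0.
    by rewrite /primitive set_itv_ge ?Rintegral_set0// bnd_simp -ltNge.
  rewrite subr0; have [r0|r0] := leP 0 r; last first.
    have -> : primitive r w = 0.
      by rewrite /primitive set_itv_ge ?Rintegral_set0// bnd_simp -ltNge.
    by rewrite normr0 mulr_ge0// subr_ge0.
  apply: (@le_trans _ _ (K * r)); last by rewrite ler_wpM2l// lerDl oppr_ge0 ltW.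
  apply: (le_trans (le_normr_Rintegral _ _)) => //; first exact: good_section_integrable.
  have -> : K * r = (\int[mu]_(u in `[0%R, r]) K)%R.
    rewrite Rintegral_cst//= lebesgue_measure_itv/= lte_fin.
    by case: ltP => h; rewrite ?oppr0 ?addr0 //= (_ : r = 0) ?mulr0//; apply/eqP; rewrite eq_le h.
  apply: le_Rintegral => //.
  - exact: integrable_norm (good_section_integrable w rT).
  - apply: measurable_bounded_integrable => //.
      by rewrite /= lebesgue_measure_itv/=; case: ifP; rewrite ?ltry.
    by exists `|K|; split; [exact: num_real|move=> M KM u _ /=; exact: ltW].
  by move=> u /=; rewrite in_itv /= => /andP[u0 ur]; apply: (good_bnd gH); rewrite u0 (le_trans ur).
rewrite /primitive (Rintegral_itvB (good_section_integrable w rT)); last 2 first.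
- by rewrite bnd_simp.
- by rewrite bnd_simp.
have iS : mu.-integrable `]s, r] (EFin \o (fun u => H u w)).
  apply: integrableS (good_section_integrable w rT) => //.
  by move=> u /=; rewrite !in_itv /= => /andP[su ->]; rewrite (le_trans s0 (ltW su)).
apply: (le_trans (le_normr_Rintegral _ _)) => //.
have -> : K * (r - s) = (\int[mu]_(u in `]s, r]) K)%R.
  rewrite Rintegral_cst//= lebesgue_measure_itv/= lte_fin.
  case: ltP => h //=; rewrite (_ : r = s) ?subrr ?mulr0//.
  by apply/eqP; rewrite eq_le h sr.
apply: le_Rintegral => //.
- exact: integrable_norm iS.
- apply: measurable_bounded_integrable => //.
    by rewrite /= lebesgue_measure_itv/=; case: ifP; rewrite ?ltry.
  by exists `|K|; split; [exact: num_real|move=> M KM u _ /=; exact: ltW].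
move=> u /=; rewrite in_itv /= => /andP[su ur]; apply: (good_bnd gH).
by rewrite (le_trans s0 (ltW su)) (le_trans ur).
Qed.

Implicit Type e : R.

(** The mean over the past window of length [e], with [H] extended by zero before time 0: looking
    backwards keeps it adapted. *)
Definition avg (e : R) r w : R := e^-1 * (primitive r w - primitive (r - e) w).

Lemma avg_meas (e r : R) : 0 < e -> 0 <= r <= T -> Fmeas r (avg e r).
Proof.
move=> e0 rT; have /andP[r0 rT'] := rT.
apply: measurable_funM; first exact: measurable_cst.
apply: measurable_funB; first exact: primitive_meas.
have [re|re] := leP 0 (r - e).
  apply: (@Fmeas_sub _ _ _ (r - e)); first by rewrite gerBl ltW.
  by apply: primitive_meas; rewrite re (le_trans _ rT')// gerBl ltW.
rewrite (_ : primitive (r - e) = fun=> 0); first exact: measurable_cst.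
by apply/funext => w; rewrite /primitive set_itv_ge ?Rintegral_set0// bnd_simp -ltNge.
Qed.

Lemma avg_bnd (e r : R) w : 0 < e -> r <= T -> `|avg e r w| <= K.
Proof.
move=> e0 rT; rewrite /avg normrM ger0_norm ?invr_ge0 ?(ltW e0)// ler_pdivrMl//.
apply: (le_trans (primitive_lipschitz _ _ rT)); first by rewrite gerBl ltW.
by rewrite opprB addrC subrK mulrC.
Qed.

(** Lebesgue's differentiation theorem along each path. The exceptional set of times serves all
    sequences at once. *)
Lemma avg_ae_cvg w : {ae mu, forall r, 0 < r <= T -> forall e : R ^nat,
  (forall n, 0 < e n) -> e n @[n --> \oo] --> 0 ->
  avg (e n) r w @[n --> \oo] --> H r w}.
Proof.
pose h := (fun u => H u w) \_ `[0, T].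
have ih : mu.-integrable setT (EFin \o h).
  rewrite /h -restrict_EFin; apply/(integrable_mkcond _ _).1 => //.
  exact: good_section_integrable.
have lh : locally_integrable setT h.
  by apply: open_integrable_locally => //; exact: openT.
have := @FTC1 R h (BLeft 0) _ lh.
have ihy y : mu.-integrable [set` Interval (BLeft 0) (BRight y)] (EFin \o h).
  by apply: integrableS ih.
move=> /(_ ihy); apply: filterS; first exact: (ae_filter_ringOfSetsType mu).
move=> r hr /andP[r0' rT] e e0 ce; have r0 := ltW r0'.
have [dF] : derivable _ r 1 /\ _ := hr r0'.
set F := (fun y : R => (\int[mu]_(t in `[0, y]) h t)%R) in dF *.
have hE y : y <= T -> F y = primitive y w.
  move=> yT; apply: eq_Rintegral => u /set_mem /=; rewrite in_itv /= => /andP[u0 uy].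
  by rewrite /h patchE ifT// mem_setE in_itv /= u0 (le_trans uy).
rewrite derive1E [h r]patchE ifT ?mem_setE ?in_itv /= ?r0 ?rT// => FE.
have cG : (h0^-1 *: (F (h0 *: 1%R + r) - F r)) @[h0 --> 0^'] --> H r w.
  by rewrite -FE; exact: dF.
(* A backward average is the difference quotient of the primitive with a negative increment. *)
move/cvgr_dnbhsP: cG => /(_ (fun n => - e n)) cG.
have : ((- e n)^-1 *: (F (- e n *: 1%R + r) - F r)) @[n --> \oo] --> H r w.
  apply: cG; split; first by move=> n; rewrite oppr_eq0 gt_eqF.
  by rewrite -oppr0; exact: cvgN.
apply: cvg_trans; apply: near_eq_cvg; apply: nearW => n.
have -> : - e n *: 1%R + r = r - e n by rewrite /GRing.scale /= mulr1 addrC.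
rewrite /avg !hE//; last by rewrite (le_trans _ rT)// gerBl ltW.
by rewrite /GRing.scale /= invrN; ring.
Qed.

(** On a cell the average is taken at the left end [x n], not at [r]. Moving by at most [h] changes
    the numerator by at most [2 * K * h]; the much longer window [sqrt h] turns this into the
    vanishing error [2 * K * sqrt h]. *)
Lemma avg_ae_cvg_shift w : {ae mu, forall r, 0 < r <= T ->
  forall (h : R ^nat) (x : R ^nat), (forall n, 0 < h n) -> h n @[n --> \oo] --> 0 ->
  (forall n, x n <= r <= x n + h n) ->
  avg (Num.sqrt (h n)) (x n) w @[n --> \oo] --> H r w}.
Proof.
have := avg_ae_cvg w; apply: filterS; first exact: (ae_filter_ringOfSetsType mu).
move=> r hr rT h x h0 ch xr; have /andP[_ rT'] := rT.
have s0 n : 0 < Num.sqrt (h n) by rewrite sqrtr_gt0.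
have cs : Num.sqrt (h n) @[n --> \oo] --> 0.
  rewrite -[X in _ --> X](sqrtr0 R); apply: continuous_cvg => //.
  exact: sqrt_continuous.
have := hr rT _ s0 cs.
have c0 : avg (Num.sqrt (h n)) (x n) w - avg (Num.sqrt (h n)) r w @[n --> \oo] --> 0.
  apply/norm_cvg0P; apply: (@squeeze_cvgr _ _ _ _ (fun=> 0) (fun n => 2 * K * Num.sqrt (h n))).
  - apply: nearW => n; rewrite normr_ge0 /=.
    have /andP[xr1 xr2] := xr n.
    have l1 := primitive_lipschitz w xr1 rT'.
    have l2 : `|primitive (r - Num.sqrt (h n)) w - primitive (x n - Num.sqrt (h n)) w| <=
       K * (r - x n).
      have := @primitive_lipschitz (x n - Num.sqrt (h n)) (r - Num.sqrt (h n)) w.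
      rewrite lerD2r => /(_ xr1); rewrite (_ : r - Num.sqrt (h n) - _ = r - x n); last by ring.
      by apply; rewrite (le_trans _ rT')// gerBl ltW.
    rewrite /avg -mulrBr normrM ger0_norm ?invr_ge0 ?(ltW (s0 n))// ler_pdivrMl//.
    have l3 : K * (r - x n) <= K * h n.
      by rewrite ler_wpM2l ?(good_K0 w)// lerBlDl.
    have -> : Num.sqrt (h n) * (2 * K * Num.sqrt (h n)) = 2 * K * (Num.sqrt (h n) ^+ 2) by ring.
    rewrite sqr_sqrtr ?(ltW (h0 n))//.
    rewrite (_ : _ - _ = - (primitive r w - primitive (x n) w) +
      (primitive (r - Num.sqrt (h n)) w - primitive (x n - Num.sqrt (h n)) w)); last by ring.
    by rewrite (le_trans (ler_normD _ _))// normrN; lra.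
  - exact: cvg_cst.
  - by rewrite -[X in _ --> X](mulr0 (2 * K)); apply: cvgM => //; exact: cvg_cst.
move=> h1; rewrite -[X in _ --> X]add0r.
rewrite (_ : (fun n => _) = (fun n => (avg (Num.sqrt (h n)) (x n) w -
  avg (Num.sqrt (h n)) r w) + avg (Num.sqrt (h n)) r w)); first exact: cvgD.
by apply/funext => n; rewrite subrK.
Qed.

End BackwardAverage.

(** * Existence and uniqueness of the Ito integral *)

Section Partition.
Context (R : realType) (T : R).
Implicit Types (ts : nat -> R) (h r : R).

Lemma partition_mono n ts h i j : is_partition T n ts h -> (i <= j)%N -> (j <= n)%N ->
  ts i <= ts j.
Proof.
move=> [_ _ H _] ij; elim: j ij => [|j IH]; first by rewrite leqn0 => /eqP ->.
rewrite leq_eqVlt => /predU1P[->//|]; rewrite ltnS => ij js.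
by rewrite (le_trans (IH ij (ltnW js)))// ltW// H.
Qed.

Lemma partition_itv n ts h i : is_partition T n ts h -> (i <= n)%N -> 0 <= ts i <= T.
Proof.
move=> hp iN; have [h0 hn _ _] := hp.
by rewrite -h0 -hn (partition_mono hp (leq0n i) iN) (partition_mono hp iN (leqnn n)).
Qed.

Lemma partition_locate n ts h r : is_partition T n ts h -> 0 < r <= T ->
  exists2 i, (i < n)%N & ts i < r <= ts i.+1.
Proof.
move=> [h0 hn _ _] /andP[r0 rT].
have ex : exists j, r <= ts j by exists n; rewrite hn.
case: (ex_minnP ex) => [[|i]] ri imin; first by move: ri; rewrite h0 leNgt r0.
exists i; last by rewrite ri andbT ltNge; apply/negP => /imin; rewrite ltnn.
by apply: imin; rewrite hn.
Qed.

Lemma partition_unique n ts h r i j : is_partition T n ts h -> (i < n)%N -> (j < n)%N ->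
  ts i < r <= ts i.+1 -> ts j < r <= ts j.+1 -> i = j.
Proof.
move=> hp.
have aux a b : (b < n)%N -> ts a < r <= ts a.+1 -> ts b < r <= ts b.+1 -> (b <= a)%N.
  move=> bn /andP[a1 a2] /andP[b1 b2]; rewrite leqNgt; apply/negP => ab.
  by have := partition_mono hp ab (ltnW bn); rewrite leNgt (lt_le_trans b1 a2).
by move=> iN jN hi hj; apply/eqP; rewrite eqn_leq (aux j i)// (aux i j).
Qed.

End Partition.

Section PathConstruction.
Context (R : realType) (T : R) (k : nat).
Hypothesis T0 : 0 <= T.

Lemma continuous_col q (f : R -> 'cV[R]_q) :
  (forall i, continuous (fun t => f t i 0)) -> continuous f.
Proof.
move=> cf t; apply/cvgrPdist_lt => e e0.
have h i : \forall s \near t, `|f t i 0 - f s i 0| < e.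
  by have /cvgrPdist_lt := cf i t; apply.
near=> s; rewrite [ltLHS]/Num.Def.normr /= mx_normrE; apply: bigmax_lt => // -[i j] _ /=.
rewrite !mxE ord1; move: i; near: s.
by apply: filter_forall => i; exact: h.
Unshelve. all: by end_near. Qed.

Lemma continuous_coord q (f : R -> 'cV[R]_q) i : continuous f -> continuous (fun t => f t i 0).
Proof.
move=> cf t; apply: (@continuous_comp _ _ _ f (fun M : 'cV[R]_q => M i 0)); first exact: cf.
exact: coord_continuous.
Qed.

Lemma path_exists (f : R -> 'cV[R]_k) : f 0 = 0 -> continuous f ->
  exists w : Omega T k, forall t, 0 <= t <= T -> ev w t = f t.
Proof.
move=> f0 cf; pose g t := f (clamp T t).
have cg : continuous g.
  move=> x; apply: (@continuous_comp _ _ _ (clamp T) f); last exact: cf.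
  exact: continuous_clamp.
have g0 : g 0 = 0 by rewrite /g clamp0.
have gK t : g t = g (clamp T t) by rewrite /g clampK.
by exists (PathFun cg g0 gK) => t tT; rewrite /ev /= /g clamp_id.
Qed.

Lemma path_ofE (f : R -> 'cV[R]_k) :
  (exists w : Omega T k, forall t, 0 <= t <= T -> ev w t = f t) ->
  forall t, 0 <= t <= T -> ev (path_of T f) t = f t.
Proof.
move=> [w hw]; rewrite /path_of; case: xgetP => [x _ hx|/(_ w)]; first exact: hx.
by move=> /(_ hw).
Qed.

Lemma path_ext (w w' : Omega T k) : (forall t, 0 <= t <= T -> ev w t = ev w' t) -> w = w'.
Proof.
move=> h; have E : path_val w = path_val w'.
  apply/funext => t; rewrite (path_clamp w) (path_clamp w').
  by apply: h; exact: clamp_itv.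
case: w w' h E => [f fc fs fk] [g gc gs gk] /= _ E; subst g.
by congr PathFun; exact: Prop_irrelevance.
Qed.

Lemma measurable_path d (X : measurableType d) (F : X -> Omega T k) :
  (forall t i, 0 <= t <= T -> measurable_fun setT (fun x => ev (F x) t i 0)) ->
  measurable_fun setT F.
Proof.
move=> hF; apply: (@measurability _ _ X (Omega T k) setT _ (@cylinders R T k T)) => //.
move=> _ [C [s [i [B [sT mB ->]]]] <-].
by have := hF s i sT measurableT B mB.
Qed.

End PathConstruction.

Lemma cvg_rsum (R : realType) (I : finType) (f : I -> R ^nat) (l : I -> R) :
  (forall i, f i n @[n --> \oo] --> l i) ->
  \sum_i f i n @[n --> \oo] --> \sum_i l i.
Proof.
move=> cf; elim: (index_enum I) => [|i s IH].
  by rewrite big_nil; under eq_cvg do rewrite big_nil; exact: cvg_cst.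
by rewrite big_cons; under eq_cvg do rewrite big_cons; apply: cvgD => //; exact: cf.
Qed.

Section DistCvg.
Context (R : realType) (T : R) (m p q : nat) (P : probability (Omega T m) R).
Hypothesis T0 : 0 <= T.
Notation mu := (@lebesgue_measure R).

Lemma integral_cst_itv (c t : R) : 0 <= t ->
  (\int[mu]_(r in `[0%R, t]) c%:E = (c * t)%:E)%E.
Proof.
move=> t0; rewrite integral_cst// /= lebesgue_measure_itv/= lte_fin.
case: ltP => h; first by rewrite oppr0 addr0 EFinM.
by rewrite (_ : t = 0) ?mulr0 ?mule0//; apply/eqP; rewrite eq_le h.
Qed.

(** Dominated convergence twice: in time along each path, where time 0 is negligible, and then over
    the paths. *)
Lemma dist2_cvg0 (H : R -> Omega T m -> 'M[R]_(p, q)) (G : nat -> R -> Omega T m -> 'M[R]_(p, q)) (C : R) :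
  jointly_measurable H -> (forall n, jointly_measurable (G n)) ->
  (forall n (r : R) w, 0 <= r <= T -> frob (H r w - G n r w) ^+ 2 <= C) ->
  (forall w, {ae mu, forall r, 0 < r <= T ->
     frob (H r w - G n r w) ^+ 2 @[n --> \oo] --> 0}) ->
  dist2 P T H (G n) @[n --> \oo] --> 0%E.
Proof.
move=> mH mG bC cG.
have mf n := jointly_measurable_frob2 (jointly_measurableB mH (mG n)).
have inner w : (\int[mu]_(r in `[0%R, T]) (frob (H r w - G n r w) ^+ 2)%:E)%E @[n --> \oo] --> 0%E.
  have [] := @dominated_convergence _ (measurableTypeR R) R mu `[0, T] (measurable_itv _)
    (fun n r => (frob (H r w - G n r w) ^+ 2)%:E) (cst 0%E) (fun=> C%:E) _ _ _ _ _.
  - by move=> n; exact: (measurable_time_section w (mf n) (lexx T)).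
  - exact: measurable_cst.
  - have : {ae mu, forall r : R, r != 0}.
      exists [set 0]; split=> //; first exact: lebesgue_measure_set1.
      by move=> r /=; rewrite /= => /negP; rewrite negbK => /eqP.
    have := cG w; apply: filterS2; first exact: (ae_filter_ringOfSetsType mu).
    move=> r cr r0 /=; rewrite in_itv /= => /andP[r1 rT].
    by apply/fine_cvgP; split; [exact: nearW|apply: cr; rewrite rT lt_def r0 r1].
  - apply: measurable_bounded_integrable => //.
      by rewrite /= lebesgue_measure_itv/=; case: ifP; rewrite ?ltry.
    by exists `|C|; split; [exact: num_real|move=> M KM u _ /=; exact: ltW].
  - apply/aeW => r n /=; rewrite in_itv /= => rT.
    by rewrite lee_fin ger0_norm ?sqr_ge0// bC.
  by move=> _ _; rewrite integral0.
have C0 : 0 <= C by apply: le_trans (bC 0%N 0 point _); rewrite ?sqr_ge0// lexx.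
have [] := @dominated_convergence _ (Omega T m) R P setT measurableT
    (fun n w => \int[mu]_(r in `[0%R, T]) (frob (H r w - G n r w) ^+ 2)%:E)%E (cst 0%E) (fun=> (C * T)%:E) _ _ _ _ _.
- move=> n; apply: (measurable_time_integral (mf n) _ (lexx T)) => z.
  by rewrite lee_fin sqr_ge0.
- exact: measurable_cst.
- by apply/aeW => w _; exact: inner.
- exact: finite_measure_integrable_cst.
- apply/aeW => w n _; rewrite gee0_abs; last by apply: integral_ge0 => r _; rewrite lee_fin sqr_ge0.
  rewrite -integral_cst_itv//; apply: le_integral_pointwise => r /=.
  by rewrite in_itv /= lee_fin => rT; exact: bC.
by move=> _ _; rewrite integral0.
Qed.

End DistCvg.

Section MatrixAverage.
Context (R : realType) (T : R) (m p q : nat).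
Hypothesis T0 : 0 <= T.
Notation mu := (@lebesgue_measure R).

Record good_matrix (K : R) (H : R -> Omega T m -> 'M[R]_(p, q)) : Prop := GoodMatrix {
  gm_bnd : forall t w i j, 0 <= t <= T -> `|H t w i j| <= K ;
  gm_jm : jointly_measurable H ;
  gm_adapted : adapted H }.

Lemma good_matrix_entry K H i j : good_matrix K H -> good_process K (fun t w => H t w i j).
Proof.
move=> [h1 h2 h3]; split.
- by move=> t w tT; exact: h1.
- exact: h2.
- by move=> t tT; have /filt_measurable_Fmeas := h3 t tT; apply.
Qed.

Definition avgmx (H : R -> Omega T m -> 'M[R]_(p, q)) e r w : 'M[R]_(p, q) :=
  \matrix_(i, j) avg (fun t w => H t w i j) e r w.

Lemma avgmx_bnd K H e r w i j : good_matrix K H -> 0 < e -> r <= T -> `|avgmx H e r w i j| <= K.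
Proof.
by move=> gH e0 rT; rewrite mxE; apply: avg_bnd => //; exact: good_matrix_entry.
Qed.

Lemma avgmx_meas K H e r : good_matrix K H -> 0 < e -> 0 <= r <= T -> filt_measurable r (avgmx H e r).
Proof.
move=> gH e0 rT; apply/filt_measurable_Fmeas => i j.
have := avg_meas T0 (good_matrix_entry i j gH) e0 rT.
by rewrite /Fmeas; apply: eq_measurable_fun => w _; rewrite mxE.
Qed.

Lemma frob_bounded (M : 'M[R]_(p, q)) (K : R) : 0 <= K -> (forall i j, `|M i j| <= K) ->
  frob M <= (p * q)%:R * K ^+ 2 + 1.
Proof.
move=> K0 hM; have h2 := frob_le_entries K0 hM.
have [h|h] := leP (frob M) 1.
  by apply: (le_trans h); rewrite lerDr mulr_ge0// sqr_ge0.
apply: (@le_trans _ _ (frob M ^+ 2)); last by rewrite (le_trans h2)// lerDl.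
by rewrite expr2 ler_peMr ?frob_ge0// ltW.
Qed.

Lemma avgmx_ae_cvg K H w : good_matrix K H -> {ae mu, forall r, 0 < r <= T ->
  forall (h : R ^nat) (x : R ^nat), (forall n, 0 < h n) -> h n @[n --> \oo] --> 0 ->
  (forall n, x n <= r <= x n + h n) ->
  frob (H r w - avgmx H (Num.sqrt (h n)) (x n) w) ^+ 2 @[n --> \oo] --> 0}.
Proof.
move=> gH.
have hij i j := avg_ae_cvg_shift T0 (good_matrix_entry i j gH) w.
have := ae_forall_count (fun i => ae_forall_count (hij i)); apply: ae_mono.
move=> r hr rT h x h0 ch xr.
have cij i j : (H r w i j - avgmx H (Num.sqrt (h n)) (x n) w i j) ^+ 2 @[n --> \oo] --> (0 : R).
  have cd : H r w i j - avgmx H (Num.sqrt (h n)) (x n) w i j @[n --> \oo] --> (0 : R).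
    rewrite -[X in _ --> X](subrr (H r w i j)); apply: cvgB; first exact: cvg_cst.
    rewrite (_ : (fun n => _) = fun n => avg (fun t w => H t w i j) (Num.sqrt (h n)) (x n) w).
      exact: (hr i j rT h x h0 ch xr).
    by apply/funext => n; rewrite mxE.
  by rewrite -[X in _ --> X](mulr0 (0 : R)); apply: cvgM.
rewrite (_ : (fun n : nat => _) = fun n => \sum_(i < p) \sum_(j < q)
    (H r w i j - avgmx H (Num.sqrt (h n)) (x n) w i j) ^+ 2); last first.
  by apply/funext => n; rewrite frob2E; apply: eq_bigr => i _; apply: eq_bigr => j _; rewrite !mxE.
have := cvg_rsum (fun i => cvg_rsum (cij i)).
by rewrite [X in _ --> X -> _]big1// => i _; rewrite big1.
Qed.

End MatrixAverage.

Section PartitionCells.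
Context (R : realType) (T : R) (m p q : nat).
Variables (n : nat) (ts : nat -> R) (h : R).
Hypothesis hp : is_partition T n ts h.
Variable c : nat -> Omega T m -> 'M[R]_(p, q).

Lemma cellsE r w i : (i < n)%N -> ts i < r <= ts i.+1 -> cells n ts c r w = c i w.
Proof.
move=> iN ri; rewrite /cells (big_pred1 (Ordinal iN))// => j /=.
apply/idP/eqP => [rj|-> //]; apply/val_inj => /=.
exact: (partition_unique hp (ltn_ord j) iN rj ri).
Qed.

Lemma cells0 r w : r <= 0 -> cells n ts c r w = 0.
Proof.
move=> r0; rewrite /cells big1// => j /andP[/= h1 _].
have /andP[h2 _] := partition_itv hp (ltnW (ltn_ord j)).
by have := le_lt_trans h2 h1; rewrite ltNge r0.
Qed.

End PartitionCells.

Section Approximation.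
Context (R : realType) (T : R) (m k : nat) (P : probability (Omega T m) R).
Hypothesis T0 : 0 <= T.
Notation mu := (@lebesgue_measure R).

Section PartitionProcess.
Variables (n : nat) (ts : nat -> R) (h : R).
Hypothesis hp : is_partition T n ts h.
Variable c : nat -> Omega T m -> 'M[R]_(k, m).
Hypothesis mc : forall i, (i < n)%N -> filt_measurable (ts i) (c i).
Hypothesis bc : forall i, (i < n)%N -> exists K : R, forall w, frob (c i w) <= K.

Let p1 : 0 <= ts 0%N. Proof. by have [-> _ _ _] := hp. Qed.
Let p2 : ts n <= T. Proof. by have [_ -> _ _] := hp. Qed.
Let p3 i : (i < n)%N -> ts i <= ts i.+1. Proof. by have [_ _ H _] := hp; move=> /H /ltW. Qed.

Definition partition_process : simple_process T m k :=
  SimpleProcess p1 p2 p3 mc bc.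

Lemma partition_processE r w i : (i < n)%N -> ts i < r <= ts i.+1 ->
  sp_process partition_process r w = c i w.
Proof. exact: (cellsE hp). Qed.

Lemma partition_process0 r w : r <= 0 -> sp_process partition_process r w = 0.
Proof. exact: (cells0 hp). Qed.

End PartitionProcess.

(** Freezing on each cell the average over the past of its left end gives a simple process; the
    window is the square root of the mesh. *)
Lemma avg_process_cvg K H (h : nat -> R) (n : nat -> nat) (ts : nat -> nat -> R)
    (hp : forall l, is_partition T (n l) (ts l) (h l))
    (mc : forall l i, (i < n l)%N -> filt_measurable (ts l i) (avgmx H (Num.sqrt (h l)) (ts l i)))
    (bc : forall l i, (i < n l)%N -> exists K : R, forall w, frob (avgmx H (Num.sqrt (h l)) (ts l i) w) <= K) :
  good_matrix K H -> (forall l, 0 < h l) -> h l @[l --> \oo] --> 0 ->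
  dist2 P T H (sp_process (partition_process (hp l) (mc l) (bc l))) @[l --> \oo] --> 0%E.
Proof.
move=> gH h0 ch.
have [K0|K0] := leP 0 K; last first.
  (* A negative bound leaves only matrices without entries. *)
  have mk0 (i : 'I_k) (j : 'I_m) : False.
    have := gm_bnd gH (t := 0) point i j; rewrite lexx T0 => /(_ isT).
    by rewrite leNgt (lt_le_trans K0).
  rewrite (_ : (fun l => _) = fun=> 0%E); first exact: cvg_cst.
  apply/funext => l; apply: integral0_eq => w _; apply: integral0_eq => r _.
  by rewrite frob2E big1// => i _; rewrite big1// => j _; have := mk0 i j.
apply: (@dist2_cvg0 _ _ _ _ _ _ T0 _ _ ((k * m)%:R * (2 * K) ^+ 2)).
- exact: gm_jm gH.
- by move=> l; exact: jointly_measurable_sp.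
- move=> l r w rT; apply: frob_le_entries => [|i j]; first by rewrite mulr_ge0.
  rewrite !mxE (le_trans (ler_normB _ _))// mulr_natl mulr2n lerD//; first exact: (gm_bnd gH).
  have [r0|r0] := leP r 0; first by rewrite partition_process0// mxE normr0.
  have rT' : 0 < r <= T by rewrite r0; case/andP: rT.
  have [i' iN ri] := partition_locate (hp l) rT'.
  rewrite (partition_processE (hp l) (mc l) (bc l) w iN ri); apply: (avgmx_bnd T0) => //; first by rewrite sqrtr_gt0.
  by have /andP[] := partition_itv (hp l) (ltnW iN).
move=> w.
apply: ae_mono (avgmx_ae_cvg T0 w gH) => r hr rT.
pose il l : nat := projT1 (cid2 (partition_locate (hp l) rT)).
have ilP l : (il l < n l)%N /\ ts l (il l) < r <= ts l (il l).+1.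
  by rewrite /il; case: cid2.
rewrite (_ : (fun l : nat => _) = fun l => frob (H r w - avgmx H (Num.sqrt (h l)) (ts l (il l)) w) ^+ 2).
  apply: (hr rT h (fun l => ts l (il l)) h0 ch) => l.
  have [iN /andP[r1 r2]] := ilP l; rewrite (ltW r1) (le_trans r2)//.
  by have [_ _ _ /(_ _ iN)] := hp l; rewrite lerBlDl.
by apply/funext => l; rewrite (partition_processE (hp _) (mc _) (bc _) w (ilP _).1 (ilP _).2).
Qed.

End Approximation.

Section DyadicSup.
Context (R : realType).

Lemma rmax_le (s : nat -> R) n x : 0 <= x -> (forall k, (k <= n)%N -> s k <= x) ->
  rmax s n <= x.
Proof.
move=> x0; elim: n => [|n IH] h //=.
by rewrite ge_max h// IH// => k kn; apply: h; exact: leqW.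
Qed.

(** The Weierstrass test: the tail of the series bounds the distance to the limit uniformly in
    [t]. *)
Lemma continuous_limit (f : nat -> R -> R) (a : nat -> R) :
  (forall n, continuous (f n)) -> (forall n, 0 <= a n) -> cvgn (series a) ->
  (forall n t, `|f n.+1 t - f n t| <= a n) ->
  continuous (fun t => limn (f^~ t)) /\ (forall t, f n t @[n --> \oo] --> limn (f^~ t)).
Proof.
move=> cf a0 ca fa.
have fE t n : f n t = f 0%N t + series (fun j => f j.+1 t - f j t) n.
  by rewrite /series /= telescope_sumr// addrC subrK.
have cfn t : cvgn (f^~ t).
  rewrite (_ : f^~ t = fun n => f 0%N t + series (fun j => f j.+1 t - f j t) n); last first.
    by apply/funext => n; exact: fE.
  apply: is_cvgD; first exact: is_cvg_cst.
  apply: normed_cvg; apply: (series_le_cvg _ _ _ ca) => n; [exact: normr_ge0|exact: a0|exact: fa].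
have tail n t : `|limn (f^~ t) - f n t| <= limn (series a) - series a n.
  have h p : (n <= p)%N -> `|f p t - f n t| <= limn (series a) - series a n.
    move=> np; apply: (@le_trans _ _ (series a p - series a n)); last first.
      rewrite lerD2r; apply: nondecreasing_cvgn_le => //.
      by apply: nondecreasing_series.
    elim: p np => [|p IH]; first by rewrite leqn0 => /eqP ->; rewrite !subrr normr0.
    rewrite leq_eqVlt => /predU1P[->|]; first by rewrite !subrr normr0.
    rewrite ltnS => /IH h; rewrite seriesSr.
    rewrite (_ : f p.+1 t - f n t = (f p.+1 t - f p t) + (f p t - f n t)); last by ring.
    apply: (le_trans (ler_normD _ _)).
    by have := fa p t; lra.
  have cd : `|f p t - f n t| @[p --> \oo] --> `|limn (f^~ t) - f n t|.
    by apply: cvg_norm; apply: cvgB; [exact: cfn|exact: cvg_cst].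
  rewrite -(cvg_lim _ cd)//; apply: limr_le; first by apply/cvg_ex; eexists; exact: cd.
  by exists n => // p /=; exact: h.
split; last by move=> t; exact: cfn.
move=> t; apply/cvgrPdist_lt => e e0.
have e3 : 0 < e / 3 by rewrite divr_gt0.
have : series a n @[n --> \oo] --> limn (series a) by exact: ca.
move=> /cvgrPdist_lt/(_ _ e3)[N _ /(_ N (leqnn _))].
move=> /(le_lt_trans (ler_norm _)) aN.
have /cvgrPdist_lt/(_ _ e3) := cf N t; apply: filterS => s cs.
have h1 := tail N t; have h2 := tail N s.
rewrite (_ : _ - _ = (limn (f^~ t) - f N t) + ((f N t - f N s) - (limn (f^~ s) - f N s))); last by ring.
apply: (le_lt_trans (ler_normD _ _)).
have := ler_normB (f N t - f N s) (limn (f^~ s) - f N s); lra.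
Qed.

Lemma cvge0_squeeze (u : nat -> \bar R) (v : R ^nat) :
  (forall n, 0 <= u n <= (v n)%:E)%E -> v n @[n --> \oo] --> 0 -> u n @[n --> \oo] --> 0%E.
Proof.
move=> h cv; apply: (@squeeze_cvge _ _ _ _ (cst 0%E) u (fun n => (v n)%:E)).
- by apply: nearW => n /=; exact: h.
- exact: cvg_cst.
- by apply/fine_cvgP; split; first exact: nearW.
Qed.

Lemma cvg_geometric4 (c : R) : c * (4 * (4 ^+ n)^-1) @[n --> \oo] --> (0 : R).
Proof.
rewrite (_ : (fun n => _) = fun n => (c * 4) * 4^-1 ^+ n); last first.
  by apply/funext => n; rewrite exprVn mulrA.
rewrite -[X in _ --> X](mulr0 (c * 4)); apply: cvgM; first exact: cvg_cst.
by apply: cvg_expr; rewrite ger0_norm ?invr_ge0// invf_lt1// ltr1n.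
Qed.

Lemma dyadic_approx (T t : R) : 0 < T -> 0 <= t <= T ->
  exists2 u : nat -> nat, (forall p, (u p <= 2 ^ p)%N) &
    T * (u p)%:R / (2 ^ p)%:R @[p --> \oo] --> t.
Proof.
move=> T0 /andP[t0 tT].
pose x p := t / T * (2 ^ p)%:R.
have p0 p : 0 < (2 ^ p)%:R :> R by rewrite ltr0n expn_gt0.
have x0 p : 0 <= x p by rewrite /x mulr_ge0 ?(ltW (p0 p))// mulr_ge0// invr_ge0 ltW.
exists (fun p => Num.truncn (x p)).
  move=> p; rewrite -(ler_nat R) (@le_trans _ _ (x p)) ?truncn_le//.
  by rewrite ler_piMl ?(ltW (p0 p))// ler_pdivrMr// mul1r.
apply/cvgrPdist_le => e e0.
have c2p : (2 ^ p)%:R^-1 @[p --> \oo] --> (0 : R).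
  under eq_fun do rewrite natrX -exprVn.
  by apply: cvg_expr; rewrite ger0_norm ?invr_ge0// invf_lt1// ltr1n.
have eT : 0 < e / T by rewrite divr_gt0.
move/cvgrPdist_le: c2p => /(_ _ eT); apply: filterS => p.
rewrite sub0r normrN ger0_norm ?invr_ge0 ?(ltW (p0 p))// => hp.
have /andP[h1 h2] := trunc_itv (x0 p).
have -> : t = T * x p / (2 ^ p)%:R by rewrite /x; field; rewrite !gt_eqF.
rewrite -mulrBl -mulrBr normrM normrM (ger0_norm (ltW T0)) ger0_norm ?subr_ge0//.
rewrite [X in _ * X <= _]ger0_norm ?invr_ge0 ?(ltW (p0 p))//.
have h3 : x p - (Num.truncn (x p))%:R <= 1 by rewrite lerBlDl natr1 ltW.
apply: (@le_trans _ _ (T * 1 / (2 ^ p)%:R)).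
  by rewrite ler_wpM2r ?invr_ge0 ?(ltW (p0 p))// ler_wpM2l// ltW.
by rewrite mulr1 mulrC -ler_pdivlMr.
Qed.

End DyadicSup.

Section FamilySup.
Context (R : realType) (T : R) (m : nat) (P : probability (Omega T m) R).
Hypothesis hP : wiener_measure P.
Hypothesis T0 : 0 < T.
Let T0' : 0 <= T. Proof. exact: ltW. Qed.

Lemma amax_le (M : nat -> Omega T m -> R) n w x : 0 <= x ->
  (forall k, (k <= n)%N -> `|M k w| <= x) -> amax M n w <= x.
Proof.
move=> x0 h; rewrite ge_max; apply/andP; split; apply: rmax_le => // k /h.
  exact: le_trans (ler_norm _).
by apply: le_trans; rewrite -normrN ler_norm.
Qed.

Lemma continuous_ev_min (w : Omega T m) (c : R) j :
  continuous (fun t : R => ev w (Num.min c t) j 0).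
Proof.
apply: continuous_coord => t.
apply: (@continuous_comp _ _ _ (fun t => Num.min c t) (ev w)); last exact: continuous_ev.
apply: (@min_fun_continuous _ _ R (cst c) id); first exact: cst_continuous.
by move=> x; exact: cvg_id.
Qed.

Lemma continuous_bint (b : block T m) w : continuous (fun t => bint b t w).
Proof.
move=> t; rewrite /bint /incr; apply: cvgM; first exact: cvg_cst.
by apply: cvgB; exact: continuous_ev_min.
Qed.

Section Family.
Context (I : finType) (b : I -> block T m).
Hypothesis vb : forall i, valid (b i).

Lemma continuous_fint w : continuous (fun t => fint b t w).
Proof.
rewrite /fint; elim: (index_enum I) => [|i s IH] t.
  by under eq_fun do rewrite big_nil; exact: cvg_cst.
rewrite (_ : (fun t => _) = fun t => bint (b i) t w + \sum_(i <- s) bint (b i) t w); last first.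
  by apply/funext => u; rewrite big_cons.
by apply: cvgD; [exact: continuous_bint|exact: IH].
Qed.

Let r p k : R := T * k%:R / (2 ^ p)%:R.

Let p0 p : 0 < (2 ^ p)%:R :> R. Proof. by rewrite ltr0n expn_gt0. Qed.

Let rT p k : (k <= 2 ^ p)%N -> r p k <= T.
Proof. by move=> kp; rewrite /r ler_pdivrMr// ler_wpM2l// ler_nat. Qed.

Let mart p : martingale P (r p) (fun k => fint b (r p k)) (2 ^ p).
Proof.
apply: fint_martingale => //; first by rewrite /r mulr0 mul0r.
  by move=> k _; rewrite /r ler_wpM2r ?invr_ge0 ?(ltW (p0 p))// ler_wpM2l// ler_nat.
by move=> k; exact: rT.
Qed.

Let a p w := amax (fun k => fint b (r p k)) (2 ^ p) w.

(** The grids are nested: point [k] of level [p] is point [2 * k] of the next level. *)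
Let a_nd w : nondecreasing_seq (fun p => (a p w)%:E).
Proof.
apply/nondecreasing_seqP => p; rewrite lee_fin; apply: amax_le; first exact: amax_ge0.
move=> k kp; have := @amax_ub _ _ _ _ _ _ _ (2 * k)%N w (mart p.+1).
rewrite {1}expnS leq_pmul2l// => /(_ kp); rewrite (_ : r p.+1 (2 * k) = r p k)//.
by rewrite /r expnS !natrM; have := p0 p; move: (2 ^ p)%:R => e e0; field; rewrite gt_eqF.
Qed.

(* Doob's inequality on dyadic grids, then monotone convergence. *)
Lemma fint_sup : exists A : Omega T m -> \bar R,
  [/\ measurable_fun setT A, forall w, (0 <= A w)%E,
      forall w t, 0 <= t <= T -> (`|fint b t w|%:E <= A w)%E &
      forall c : R, 0 < c -> (\int[P]_w A w <=
        (c / 2)%:E + ((2 * c)^-1)%:E * (8%:E * moment2 P (fint b T)))%E].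
Proof.
pose A w := ereal_sup (range (fun p => (a p w)%:E)).
have cA w : (fun p => (a p w)%:E) @ \oo --> A w.
  by apply: ereal_nondecreasing_cvgn; exact: a_nd.
have ma p : measurable_fun setT (fun w => (a p w)%:E).
  by apply/measurable_EFinP; have [] := amax_isL2 (mart p).
have a0 p w : (0 <= (a p w)%:E)%E by rewrite lee_fin amax_ge0.
have aA p w : ((a p w)%:E <= A w)%E.
  by apply: ereal_sup_ubound; exists p.
exists A; split.
- exact: emeasurable_fun_cvg ma _.
- by move=> w; exact: le_trans (aA 0%N w).
(* Continuity in time carries the bound from dyadic times to all times. *)
- move=> w t tT; have [u u2 cu] := dyadic_approx T0 tT.
  case: (A w) (aA ^~ w) => [x||] h; [|by rewrite leey|]; last first.
    by have := h 0%N; rewrite leeNy_eq.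
  rewrite lee_fin.
  have cf : `|fint b (r p (u p)) w| @[p --> \oo] --> `|fint b t w|.
    apply: cvg_norm.
    by apply: (@cvg_comp _ _ _ (fun p => r p (u p)) (fun t => fint b t w) _ _ _ cu); exact: continuous_fint.
  rewrite -(cvg_lim _ cf)//; apply: limr_le; first by apply/cvg_ex; eexists; exact: cf.
  apply: nearW => p; have := h p; rewrite lee_fin; apply: le_trans.
  exact: amax_ub (mart p) (u2 p).
move=> c c0.
have -> : (\int[P]_w A w = limn (fun p => \int[P]_w (a p w)%:E))%E.
  rewrite -(monotone_convergence P measurableT ma) => [|p w _|w _]; [|exact: a0|exact: a_nd].
  by apply: eq_integral => w _; rewrite (cvg_lim _ (cA w)).
apply: lime_le.
  apply: ereal_nondecreasing_is_cvgn => p q pq.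
  by apply: le_integral_pointwise => w _; exact: a_nd.
apply: nearW => p.
have La := amax_isL2 (mart p).
apply: (@le_trans _ _ (\int[P]_w `|a p w|%:E)%E).
  by apply: le_integral_pointwise => w _; rewrite lee_fin ler_norm.
apply: (le_trans (integral_norm_le_moment2 P c0 La.1)).
rewrite leeD2l// lee_wpmul2l//; first by rewrite lee_fin invr_ge0 mulr_ge0// ltW.
apply: (le_trans (doob (mart p))); rewrite lee_wpmul2l ?lee_fin//.
by rewrite /r mulfK// gt_eqF.
Qed.

End Family.

End FamilySup.

Section ItoExists.
Context (R : realType) (T : R) (m k : nat) (P : probability (Omega T m) R).
Hypothesis hP : wiener_measure P.
Hypothesis T0 : 0 < T.
Let T0' : 0 <= T. Proof. exact: ltW. Qed.
Implicit Types (S : simple_process T m k) (H : R -> Omega T m -> 'M[R]_(k, m)).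

Lemma sp_integral_continuous S w i : continuous (fun t => sp_integral S t w i 0).
Proof.
have := @continuous_fint _ _ _ _ (@sblock _ _ _ _ 1 S i) w.
by rewrite /fint (_ : (fun t => _) = fun t => sp_integral S t w i 0)//; apply/funext => t;
  rewrite big_sblock_int mul1r.
Qed.

Lemma sp_integral0 S w : sp_integral S 0 w = 0.
Proof.
apply/matrixP => i j; rewrite ord1 [RHS]mxE.
have := @fint0 _ _ _ _ (@sblock _ _ _ _ 1 S i) (sblock_valid 1 i) w.
by rewrite /fint big_sblock_int mul1r.
Qed.

Lemma moment2_entry (X : Omega T m -> 'cV[R]_k) i :
  (moment2 P (fun w => X w i ord0) <= vmoment2 P X)%E.
Proof.
apply: le_integral_pointwise => w _; rewrite lee_fin frob2_cV.
by rewrite (bigD1 i)//= lerDl sumr_ge0// => j _; rewrite sqr_ge0.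
Qed.

Lemma geometric_bound (d1 d2 d : \bar R) n : (0 <= d)%E ->
  (d1 <= ((4 ^+ n)^-1)%:E)%E -> (d2 <= ((4 ^+ n)^-1)%:E)%E ->
  (d <= 2%:E * d1 + 2%:E * d2)%E -> (d <= (4 * (4 ^+ n)^-1)%:E)%E.
Proof.
move=> d0 h1 h2 h; apply: (le_trans h).
apply: (@le_trans _ _ (2%:E * ((4 ^+ n)^-1)%:E + 2%:E * ((4 ^+ n)^-1)%:E)%E).
  by apply: leeD; rewrite lee_wpmul2l// lee_fin.
by rewrite -!EFinM -EFinD lee_fin; lra.
Qed.

(** A subsequence has squared errors at most 4^-n. The maxima [D n] of the successive differences of
    its integrals have means of order 2^-n, so their sum is almost surely finite; there the
    integrals converge uniformly in time, and the limit is a continuous path. *)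
Lemma ito_exists H (S0 : nat -> simple_process T m k) : jointly_measurable H ->
  dist2 P T H (sp_process (S0 n)) @[n --> \oo] --> 0%E ->
  exists I, is_ito P H I.
Proof.
move=> mH cS0.
have q0 n : 0 < (4 ^+ n)^-1 :> R by rewrite invr_gt0 exprn_gt0.
have ex n : exists l, (dist2 P T H (sp_process (S0 l)) <= ((4 ^+ n)^-1)%:E)%E.
  have /fine_cvgP[hfin /cvgrPdist_le/(_ _ (q0 n)) hd] := cS0.
  have [l [fl dl]] := filter_ex (filterI hfin hd); exists l.
  rewrite sub0r normrN in dl.
  by rewrite -(fineK fl) lee_fin (le_trans (ler_norm _)).
pose S n := S0 (projT1 (cid (ex n))).
have dS n : (dist2 P T H (sp_process (S n)) <= ((4 ^+ n)^-1)%:E)%E.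
  by rewrite /S; case: cid.
have jS n := jointly_measurable_sp (S n).
have dSS n p : (n <= p)%N -> (dist2 P T (sp_process (S p)) (sp_process (S n)) <= (4 * (4 ^+ n)^-1)%:E)%E.
  move=> np; have tri := dist2_triangle P (jS p) mH (jS n) (lexx T).
  apply: (geometric_bound (dist2_ge0 _ _ _ _) _ (dS n) tri).
  rewrite dist2C; apply: (le_trans (dS p)); rewrite lee_fin lef_pV2 ?posrE ?exprn_gt0//.
  by rewrite ler_eXn2l// ltr1n.
pose M n t w := sp_integral (S n) t w.
have mM n (t : R) i : 0 <= t <= T -> measurable_fun setT (fun w => M n t w i 0).
  by move=> tT; exact: sp_integral_measurable.
have vM n p (t : R) : (n <= p)%N -> 0 <= t <= T ->
  (vmoment2 P (fun w => M p t w - M n t w)%R <= (c2 R * (4 * (4 ^+ n)^-1))%:E)%E.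
  move=> np tT; rewrite (sp_isometry hP)// EFinM lee_wpmul2l ?lee_fin ?c2_ge0//.
  have /andP[t0 tT'] := tT.
  exact: le_trans (dist2_mono P (jS p) (jS n) tT' (lexx T)) (dSS n p np).
have vb n i x := @dblock_valid _ _ _ _ (S n.+1) (S n) i x.
pose A n i : Omega T m -> \bar R := projT1 (cid (fint_sup hP T0 (vb n i))).
have hA n i := projT2 (cid (fint_sup hP T0 (vb n i))).
(* Taking c = 2^-n in the maximal bound, a coordinate costs 2^-n / 2 + 16 [c2] 2^-n, because the
   squared distance of consecutive terms is at most 4 times 4^-n. *)
pose C : R := k%:R * (1 + 32%:R * c2 R).
have C0 : 0 <= C by rewrite mulr_ge0// addr_ge0// mulr_ge0// c2_ge0.
pose D n w : \bar R := (\sum_(i < k) A n i w)%E.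
have D0 n w : (0 <= D n w)%E by apply: sume_ge0 => i _; have [_ +  _ _] := hA n i; apply.
have mD n : measurable_fun setT (D n).
  by apply: emeasurable_sum => i; have [+ _  _ _] := hA n i.
have TT : 0 <= T <= T by rewrite T0' lexx.
have iD n : (\int[P]_w D n w <= (C / (2 ^ n.+1)%:R)%:E)%E.
  rewrite /D ge0_integral_sum//; last 2 first.
  - by move=> i; have [+ _  _ _] := hA n i.
  - by move=> i w _; have [_ + _ _] := hA n i; apply.
  pose c : R := (2 ^+ n)^-1; have c0 : 0 < c by rewrite invr_gt0 exprn_gt0.
  have h i : (\int[P]_w A n i w <= ((1 + 32%:R * c2 R) / (2 ^ n.+1)%:R)%:E)%E.
    have [_ _ _ /(_ c c0)] := hA n i => h; apply: (le_trans h).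
    have hm : (moment2 P (fint (@dblock _ _ _ _ (S n.+1) (S n) i) T) <= (c2 R * (4 * (4 ^+ n)^-1))%:E)%E.
      rewrite (_ : fint _ _ = fun w => (M n.+1 T w - M n T w) i 0); last first.
        by apply/funext => w; rewrite dblock_int.
      apply: le_trans (vM n n.+1 T (leqnSn n) TT).
      exact: (@moment2_entry (fun w => M n.+1 T w - M n T w)).
    apply: (@le_trans _ _ ((c / 2)%:E + ((2 * c)^-1)%:E * (8%:E * (c2 R * (4 * (4 ^+ n)^-1))%:E))%E).
      rewrite leeD2l// lee_wpmul2l ?lee_fin ?invr_ge0 ?mulr_ge0 ?(ltW c0)//.
      by rewrite lee_wpmul2l// lee_fin.
    rewrite -!EFinM -EFinD lee_fin natrX exprS /c.
    have -> : 4 ^+ n = 2 ^+ n * 2 ^+ n :> R by rewrite -exprMn -natrM.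
    have e0 : 2 ^+ n != 0 :> R by rewrite expf_neq0// pnatr_eq0.
    by move: (2 ^+ n) e0 (c2 R) => e e0 cc; rewrite le_eqVlt; apply/orP; left; apply/eqP; field.
  apply: (@le_trans _ _ (\sum_(i < k) ((1 + 32%:R * c2 R) / (2 ^ n.+1)%:R)%:E)%E).
    by apply: lee_sum => i _; exact: h.
  by rewrite sumEFin lee_fin sumr_const card_ord -[X in X <= _]mulr_natl /C -(mulrA k%:R).
pose Z w := (\sum_(n <oo) D n w)%E.
have mZ : measurable_fun setT Z by exact: ge0_emeasurable_sum.
have iZ : (\int[P]_w Z w < +oo)%E.
  rewrite integral_nneseries//; apply: (@le_lt_trans _ _ C%:E); last exact: ltry.
  apply: le_trans (epsilon_trick0 xpredT C0); apply: lee_nneseries => // n _ _.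
  exact: integral_ge0.
pose G : set (Omega T m) := [set w | (Z w < +oo)%E].
have mG : measurable G.
  have := emeasurable_fun_infty_o measurableT mZ +oo%E; rewrite setTI.
  exact.
have aeG : {ae P, forall w, G w}.
  have Z0 w : (0 <= Z w)%E by exact: nneseries_ge0.
  have intZ : P.-integrable setT Z.
    by apply/integrableP; split=> //; under eq_integral do rewrite gee0_abs//.
  have := integrable_ae measurableT intZ; apply: filterS => w /(_ I).
  by rewrite ge0_fin_numE.
have Dfin w n : G w -> (D n w < +oo)%E.
  move=> Gw; apply: le_lt_trans Gw; apply: le_trans (nneseries_lim_ge n.+1 _); last by move=> ? _ _.
  by rewrite big_nat_recr//= leeDr// sume_ge0.
have cser w : G w -> cvgn (series (fun n => fine (D n w))).
  move=> Gw; apply: nondecreasing_is_cvgn.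
    by apply: nondecreasing_series => n _; rewrite fine_ge0.
  exists (fine (Z w)) => _ [n _ <-]; rewrite -lee_fin fineK; last first.
    by rewrite ge0_fin_numE//; exact: nneseries_ge0.
  rewrite /series /= -sumEFin.
  apply: le_trans (nneseries_lim_ge n _); last by move=> ? _ _.
  by apply: lee_sum => j _; rewrite fineK// ge0_fin_numE// Dfin.
pose f w i n t : R := M n (clamp T t) w i 0.
have cf w i n : continuous (f w i n).
  move=> t; apply: (@continuous_comp _ _ _ (clamp T) (fun t => M n t w i 0)).
    exact: continuous_clamp.
  exact: sp_integral_continuous.
have hf w i : G w -> forall n t, `|f w i n.+1 t - f w i n t| <= fine (D n w).
  move=> Gw n t; rewrite -lee_fin fineK; last by rewrite (ge0_fin_numE (D0 n w)); exact: Dfin.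
  have [_ A0 hAi _] := hA n i; have := hAi w (clamp T t) (clamp_itv t T0').
  rewrite dblock_int !mxE => h; apply: (le_trans h).
  rewrite /D (bigD1 i) //; apply: leeDl; apply: sume_ge0 => j _.
  by have [_ + _ _] := hA n j; apply.
have lim w i (Gw : G w) := continuous_limit (cf w i) (fun n => fine_ge0 (D0 n w)) (cser w Gw) (hf w i Gw).
(* Off the event of convergence the zero path is taken, so that every [w] has a continuous path and
   measurability holds everywhere. *)
pose L w t : 'cV[R]_k := \col_i (if w \in G then limn (fun n => f w i n t) else 0).
have L0 w : L w 0 = 0.
  apply/matrixP => i j; rewrite !mxE; case: ifP => // _.
  rewrite /f (_ : (fun n => _) = cst 0) ?lim_cst//.
  by apply/funext => n; rewrite clamp0 // /M sp_integral0 mxE.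
have cL w : continuous (L w).
  apply: continuous_col => i; rewrite (_ : (fun t => _) =
    if w \in G then (fun t => limn (fun n => f w i n t)) else (fun=> 0)).
    case: ifPn => [/set_mem Gw|_]; first by have [] := lim w i Gw.
    exact: cst_continuous.
  by apply/funext => t; rewrite mxE; case: ifP.
pose I w : Omega T k := path_of T (L w).
have IE w t : 0 <= t <= T -> ev (I w) t = L w t.
  by apply: path_ofE; exact: (path_exists T0' (L0 w) (cL w)).
have cI w t i : G w -> 0 <= t <= T -> M n t w i 0 @[n --> \oo] --> ev (I w) t i 0.
  move=> Gw tT; rewrite IE// mxE mem_set//.
  have [_ /(_ t)] := lim w i Gw; rewrite /f.
  by under eq_fun do rewrite (clamp_id tT).
have mIt t i : 0 <= t <= T -> measurable_fun setT (fun w => ev (I w) t i 0).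
  move=> tT; apply: (@measurable_fun_cvg _ _ _ setT (fun n w => \1_G w * M n t w i 0)).
    by move=> n; apply: measurable_funM => //; exact: mM.
  move=> w _; rewrite indicE; case: (boolP (w \in G)) => [/set_mem Gw|wG].
    by under eq_fun do rewrite mul1r; exact: cI.
  under eq_fun do rewrite mul0r.
  by rewrite IE// mxE (negbTE wG); exact: cvg_cst.
exists I; split; first by apply: measurable_path => t i; exact: mIt.
exists S; split.
  apply: (cvge0_squeeze _ (cvg_geometric4 1)) => n; rewrite mul1r.
  apply/andP; split; first exact: dist2_ge0.
  by apply: (le_trans (dS n)); rewrite lee_fin ler_peMl ?(ltW (q0 n))// ler1n.
move=> t tT.
have bound n : (vmoment2 P (fun w => ev (I w) t - M n t w)%R <= (c2 R * (4 * (4 ^+ n)^-1))%:E)%E.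
  (* The almost sure limit is also the limit in L2: Fatou in [p], with [n] fixed. *)
  pose F p w : \bar R := (frob (M (p + n)%N t w - M n t w) ^+ 2)%:E.
  have mF p : measurable_fun setT (F p).
    apply: (@measurable_frob2_cV _ _ _ _ (fun w => M (p + n)%N t w - M n t w)) => i.
    by under eq_fun do rewrite !mxE; apply: measurable_funB; exact: mM.
  have F0 p w : (0 <= F p w)%E by rewrite lee_fin sqr_ge0.
  apply: (@le_trans _ _ (\int[P]_w limn_einf (F^~ w))%E).
    apply: ae_le_integral_l; last first.
      apply: (@measurable_frob2_cV _ _ _ _ (fun w => ev (I w) t - M n t w)) => i.
      by under eq_fun do rewrite !mxE; apply: measurable_funB; [exact: mIt|exact: mM].
    move: aeG; apply: filterS => w Gw.
    have cF : F^~ w @ \oo --> (frob (ev (I w) t - M n t w) ^+ 2)%:E.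
      apply/fine_cvgP; split; first exact: nearW.
      rewrite /F /= frob2_cV.
      rewrite (_ : fine \o _ = fun p => \sum_i (M (p + n)%N t w - M n t w) i 0 ^+ 2); last first.
        by apply/funext => p /=; rewrite frob2_cV.
      apply: cvg_rsum => i.
      have cd : (M (p + n)%N t w - M n t w) i 0 @[p --> \oo] --> (ev (I w) t - M n t w) i 0.
        rewrite !mxE (_ : (fun p : nat => _) = fun p => M (p + n)%N t w i 0 - M n t w i 0); last first.
          by apply/funext => p; rewrite !mxE.
        apply: cvgB; last exact: cvg_cst.
        exact: (cvg_comp _ _ (cvg_addnr n) (cI w t i Gw tT)).
      by rewrite expr2; apply: cvgM.
    by rewrite is_cvg_limn_einfE ?(cvg_lim _ cF)//; apply/cvg_ex; eexists; exact: cF.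
  apply: (le_trans (fatou P measurableT mF _)) => //.
  rewrite limn_einf_lim; apply: lime_le; first exact: is_cvg_einfs.
  apply: nearW => p; apply: (@le_trans _ _ (\int[P]_w F p w)%E).
    by apply: ereal_inf_lbound; exists p => //=.
  by apply: (vM n (p + n)%N) => //; exact: leq_addl.
rewrite unlock.
apply: (cvge0_squeeze _ (cvg_geometric4 (c2 R))) => n.
by apply/andP; split; [exact: vmoment2_ge0|exact: bound].
Qed.

End ItoExists.

Lemma cvge0_le (R : realType) (u : nat -> \bar R) (c : R) : 0 < c ->
  u n @[n --> \oo] --> 0%E -> \forall n \near \oo, (u n <= c%:E)%E.
Proof.
move=> c0 /fine_cvgP[uf /cvgrPdist_le/(_ _ c0) uc].
near=> n; have un : u n \is a fin_num by near: n.
rewrite -(fineK un) lee_fin (le_trans (ler_norm _))// -normrN -[X in `|X|]add0r.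
by near: n.
Unshelve. all: by end_near. Qed.

Section ItoProperties.
Context (R : realType) (T : R) (m k : nat) (P : probability (Omega T m) R).
Hypothesis hP : wiener_measure P.
Hypothesis T0 : 0 < T.
Let T0' : 0 <= T. Proof. exact: ltW. Qed.
Notation mu := (@lebesgue_measure R).
Implicit Types (S : simple_process T m k) (H G : R -> Omega T m -> 'M[R]_(k, m)).

Definition process_ae_eq t H H' := {ae P, forall w, {ae mu, forall r : R, 0 <= r <= t -> H r w = H' r w}}.

Lemma dist2_ae t H H' G : jointly_measurable H' -> jointly_measurable G -> t <= T ->
  process_ae_eq t H H' -> dist2 P t H G = dist2 P t H' G.
Proof.
move=> mH' mG tT e.
have mf := jointly_measurable_frob2 (jointly_measurableB mH' mG).
apply: ae_eq_integral_nonmeasurable; last first.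
  by apply: (measurable_time_integral mf _ tT) => z; rewrite lee_fin sqr_ge0.
move: e; apply: ae_mono => w hw; rewrite integral_mkcond [RHS]integral_mkcond.
apply: ae_eq_integral_nonmeasurable; last first.
  apply/(measurable_restrictT _ _).1 => //; exact: (measurable_time_section w mf tT).
move: hw; apply: ae_mono => r hr; rewrite !patchE; case: ifPn => // /set_mem /=; rewrite in_itv /= => /hr ->.
by [].
Qed.

Lemma dist2_xx t H : dist2 P t H H = 0%E.
Proof.
by apply: integral0_eq => w _; apply: integral0_eq => r _; rewrite subrr frob2E big1// => i _;
  rewrite big1// => j _; rewrite mxE expr0n.
Qed.

(** Hedging integrands run along [state], which is known only almost surely; they are replaced here
    by measurable representatives, and nothing is asked of [H]. The sets from which [ito] chooses
    are equal, hence so are the choices, for every path. *)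
Lemma ito_ext H H' : jointly_measurable H' -> process_ae_eq T H H' -> ito P H = ito P H'.
Proof.
move=> mH' e; rewrite /ito.
apply: (congr1 (xget _)); apply/seteqP.
have h S : dist2 P T H (sp_process S) = dist2 P T H' (sp_process S).
  by apply: dist2_ae => //; exact: jointly_measurable_sp.
have hc (S : nat -> simple_process T m k) :
    (fun n => dist2 P T H (sp_process (S n))) = (fun n => dist2 P T H' (sp_process (S n))).
  by apply/funext => n; exact: h.
rewrite /dist2 in hc.
split=> I [mI [S [S1 S2]]]; (split; first exact: mI); exists S; (split; last exact: S2).
  by rewrite -hc; exact: S1.
by rewrite hc; exact: S1.
Qed.

Lemma vmoment2_eq0 q (X : Omega T m -> 'cV[R]_q) : (forall i, measurable_fun setT (fun w => X w i 0)) ->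
  vmoment2 P X = 0%E -> {ae P, forall w, X w = 0}.
Proof.
move=> mX v0; have mf := measurable_frob2_cV mX.
have := (ae_eq_integral_abs P measurableT mf).1; rewrite (_ : (\int[P]_(x in _) _)%E = vmoment2 P X); last first.
  by apply: eq_integral => w _; rewrite gee0_abs// lee_fin sqr_ge0.
move=> /(_ v0); apply: ae_mono => w /(_ I) [] /eqP; rewrite sqrf_eq0 => /eqP f0.
apply/matrixP => i j; rewrite mxE; apply/eqP; rewrite -normr_le0 -f0; exact: frob_entry.
Qed.

(** The integrands are compared up to time [t] only, so this gives locality of the integral as well
    as uniqueness. *)
Lemma is_ito_unique H H' I I' (t : R) : jointly_measurable H -> jointly_measurable H' ->
  is_ito P H I -> is_ito P H' I' -> 0 <= t <= T -> dist2 P t H H' = 0%E ->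
  {ae P, forall w, ev (I w) t = ev (I' w) t}.
Proof.
move=> mH mH' hI hI' tT d0; have /andP[t0 tT'] := tT.
have mI i : measurable_fun setT (fun w => ev (I w) t i 0) by apply: ev_measurable; case: hI.
have mI' i : measurable_fun setT (fun w => ev (I' w) t i 0) by apply: ev_measurable; case: hI'.
suff : {ae P, forall w, (ev (I w) t - ev (I' w) t) = 0}.
  by apply: ae_mono => w /eqP; rewrite subr_eq0 => /eqP.
apply: vmoment2_eq0.
  by move=> i; rewrite (_ : (fun w => _) = (fun w => ev (I w) t i 0 - ev (I' w) t i 0));
    [exact: measurable_funB|apply/funext => w; rewrite !mxE].
have [_ [S [S1 _]]] := hI.
apply/eqP; rewrite eq_le vmoment2_ge0 andbT.
(* Both integrals are compared with the same simple integral: 24 is 2 times 4 for [I] plus 2 times 4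
   times 2 for [I'], whose distance to the simple process passes through [H]. *)
have bound n : (vmoment2 P (fun w => ev (I w) t - ev (I' w) t)%R <=
    (24 * c2 R)%:E * dist2 P T H (sp_process (S n)))%E.
  have mS i : measurable_fun setT (fun w => sp_integral (S n) t w i 0) by exact: sp_integral_measurable.
  have jS := jointly_measurable_sp (S n).
  apply: (le_trans (vmoment2_triangle P mI mS mI')).
  have h1 := is_ito_sp hP T0' (S n) mH hI tT.
  have := is_ito_sp hP T0' (S n) mH' hI' tT.
  have dm := dist2_mono P mH jS tT' (lexx T).
  have dtri := dist2_triangle P mH' mH jS tT'.
  rewrite (dist2C P t H' H) d0 mule0 add0e in dtri.
  rewrite (_ : vmoment2 P (fun w => ev (I' w) t - sp_integral (S n) t w)%R =
               vmoment2 P (fun w => sp_integral (S n) t w - ev (I' w) t)%R); last first.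
    by apply: eq_integral => w _; rewrite -frobN opprB.
  move: dtri dm h1.
  move: (dist2_ge0 P T H (sp_process (S n))) (dist2_ge0 P t H (sp_process (S n))) (c2_ge0 R).
  move: (dist2 P T H (sp_process (S n))) (dist2 P t H (sp_process (S n))) (dist2 P t H' (sp_process (S n))).
  move: (vmoment2 _ _) (vmoment2 _ _) (c2 R) => x y c DT D D' DT0 D0 c0 hD' hD hx hy.
  apply: (@le_trans _ _ (2%:E * ((4 * c)%:E * DT) + 2%:E * ((4 * c)%:E * (2%:E * DT)))%E).
    apply: leeD; rewrite lee_wpmul2l ?lee_fin//.
      by rewrite (le_trans hx)// lee_wpmul2l ?lee_fin ?mulr_ge0.
    rewrite (le_trans hy)// lee_wpmul2l ?lee_fin ?mulr_ge0//.
    by rewrite (le_trans hD')// lee_wpmul2l ?lee_fin.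
  rewrite !muleA -!EFinM -ge0_muleDl ?lee_fin ?mulr_ge0//.
  by rewrite -EFinD (_ : 2 * (4 * c) + 2 * (4 * c) * 2 = 24 * c)//; ring.
have cu : ((24 * c2 R)%:E * dist2 P T H (sp_process (S n)))%E @[n --> \oo] --> 0%E.
  by rewrite -[X in _ --> X](mule0 (24 * c2 R)%:E); exact: cvgeZl.
rewrite -(cvg_lim _ cu)//; apply: lime_ge; first by apply/cvg_ex; eexists; exact: cu.
exact: nearW.
Qed.

(** Countably many rational times are treated at once; continuity excludes a difference at any other
    time. *)
Lemma ae_path_eq q (X Y : Omega T m -> Omega T q) :
  (forall t, 0 <= t <= T -> {ae P, forall w, ev (X w) t = ev (Y w) t}) ->
  {ae P, forall w, X w = Y w}.
Proof.
move=> h; pose r n : R := ratr (odflt (0 : rat) (unpickle n)).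
have : {ae P, forall w, forall n, ev (X w) (r n) = ev (Y w) (r n)}.
  apply: ae_foralln => n; have := h _ (clamp_itv (r n) T0').
  by apply: ae_mono => w; rewrite -!ev_clamp.
apply: ae_mono => w hw; apply: (path_ext T0') => t tT; apply/matrixP => i j; rewrite (ord1 j).
apply/eqP; rewrite -subr_eq0; apply/negPn/negP => d0.
pose f t := ev (X w) t i 0 - ev (Y w) t i 0.
have cf : continuous f.
  by move=> s; apply: cvgB; apply: continuous_coord; exact: continuous_ev.
have oU : open (f @^-1` [set x | x != 0]).
  by apply: open_comp => [s _|]; [exact: cf|exact: open_neq].
have [x [fx [q' _ qE]]] := dense_rat (ex_intro _ t d0) oU; subst x.
have := hw (pickle q'); rewrite /r pickleK /= => e.
by move: fx; rewrite /f /= e subrr eqxx.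
Qed.

Lemma itoP H : (exists I, is_ito P H I) -> is_ito P H (ito P H).
Proof. by move=> h; rewrite /ito; exact: xgetPex. Qed.

Lemma sp_integral_path S w : exists x : Omega T k, forall t, 0 <= t <= T -> ev x t = sp_integral S t w.
Proof.
apply: (path_exists T0'); first exact: sp_integral0.
by apply: continuous_col => i; exact: sp_integral_continuous.
Qed.

Lemma is_ito_simple S : is_ito P (sp_process S) (fun w => path_of T (fun t => sp_integral S t w)).
Proof.
have E w := path_ofE (sp_integral_path S w).
split.
  apply: measurable_path => t i tT; rewrite (_ : (fun w => _) = (fun w => sp_integral S t w i 0)).
    exact: sp_integral_measurable.
  by apply/funext => w; rewrite E.
exists (fun=> S); split.
  rewrite (_ : (fun n => _) = (fun=> 0%E)); first exact: cvg_cst.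
  by apply/funext => n; exact: dist2_xx.
move=> t tT; rewrite unlock (_ : (fun n => _) = (fun=> 0%E)); first exact: cvg_cst.
apply/funext => n; apply: integral0_eq => w _; rewrite E// subrr frob2E big1// => i _.
by rewrite big1// => j _; rewrite mxE expr0n.
Qed.

Lemma ito_simple H S : process_ae_eq T H (sp_process S) ->
  {ae P, forall w, forall t, 0 <= t <= T -> ev (ito P H w) t = sp_integral S t w}.
Proof.
move=> e; have mS := jointly_measurable_sp S.
rewrite (ito_ext mS e).
have hS := is_ito_simple S.
have : {ae P, forall w, ito P (sp_process S) w = path_of T (fun t => sp_integral S t w)}.
  apply: ae_path_eq => t tT.
  apply: (is_ito_unique mS mS _ hS tT); last exact: dist2_xx.
  by apply: itoP; eexists; exact: hS.
by apply: ae_mono => w -> t tT; rewrite (path_ofE (sp_integral_path S w)).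
Qed.

Lemma uniform_partition n : is_partition T n.+1 (fun i => T * i%:R / n.+1%:R) (T / n.+1%:R).
Proof.
have n0 : 0 < n.+1%:R :> R by rewrite ltr0n.
split; first by rewrite mulr0 mul0r.
- by rewrite mulfK// gt_eqF.
- by move=> i _; rewrite ltr_pM2r ?invr_gt0// ltr_pM2l// ltr_nat.
- by move=> i _; rewrite -mulrBl -mulrBr -natrB// subSnn mulr1.
Qed.

Lemma mesh_cvg0 : T / n.+1%:R @[n --> \oo] --> (0 : R).
Proof.
by rewrite -[X in _ --> X](mulr0 T); apply: cvgM; [exact: cvg_cst|exact: cvg_harmonic].
Qed.

Lemma avgmx_frob_bnd K H e r : good_matrix K H -> 0 < e -> r <= T ->
  exists C : R, forall w, frob (avgmx H e r w) <= C.
Proof.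
move=> gH e0 rT; exists ((k * m)%:R * `|K| ^+ 2 + 1) => w.
apply: frob_bounded => // i j; rewrite (le_trans _ (ler_norm K))//.
exact: (avgmx_bnd T0' _ _ _ gH).
Qed.

Lemma ito_good K H : good_matrix K H -> is_ito P H (ito P H).
Proof.
move=> gH; apply: itoP.
have h0 l : 0 < T / l.+1%:R by rewrite divr_gt0.
have s0 l : 0 < Num.sqrt (T / l.+1%:R) by rewrite sqrtr_gt0.
have itv l i : (i < l.+1)%N -> 0 <= T * i%:R / l.+1%:R <= T.
  by move=> il; exact: (partition_itv (uniform_partition l) (ltnW il)).
have mc l i (il : (i < l.+1)%N) := avgmx_meas T0' gH (s0 l) (itv l i il).
have bc l i (il : (i < l.+1)%N) := avgmx_frob_bnd gH (s0 l) (proj2 (andP (itv l i il))).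
exact: (ito_exists hP T0 (gm_jm gH) (avg_process_cvg P T0' uniform_partition mc bc gH h0 mesh_cvg0)).
Qed.

Lemma ito_entry_L2 H I (t : R) i : jointly_measurable H -> is_ito P H I -> 0 <= t <= T ->
  isL2 P (fun w => ev (I w) t i 0).
Proof.
move=> mH hI tT; have [mI [S [_ /(_ t tT)]]] := hI; rewrite unlock => S2.
have mIt j : measurable_fun setT (fun w => ev (I w) t j 0) by exact: ev_measurable.
have mS n j : measurable_fun setT (fun w => sp_integral (S n) t w j 0) by exact: sp_integral_measurable.
have /fine_cvgP[/filter_ex[n fn] _] := S2.
rewrite (_ : (fun w => _) = (fun w => (ev (I w) t - sp_integral (S n) t w) i 0 + sp_integral (S n) t w i 0)); last first.
  by apply/funext => w; rewrite !mxE subrK.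
have mD j : measurable_fun setT (fun w => (ev (I w) t - sp_integral (S n) t w) j 0).
  rewrite (_ : (fun w => _) = (fun w => ev (I w) t j 0 - sp_integral (S n) t w j 0)).
    exact: measurable_funB.
  by apply/funext => w; rewrite !mxE.
apply: isL2D; last first.
  rewrite (_ : (fun w => _) = fint (@sblock _ _ _ _ 1 (S n) i) t).
    by apply: fint_L2 => // x; exact: sblock_valid.
  by apply/funext => w; rewrite /fint big_sblock_int mul1r.
split; first exact: mD.
apply: (@le_lt_trans _ _ (vmoment2 P (fun w => ev (I w) t - sp_integral (S n) t w)%R)).
  exact: (@moment2_entry _ _ _ _ _ (fun w => ev (I w) t - sp_integral (S n) t w)).
by move: fn; rewrite ge0_fin_numE//; exact: vmoment2_ge0.
Qed.

(** The identity is exact for simple integrals. Replacing the integral by a simple one costs at most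
    [c] in L1 at each of the two times, for any positive [c]. *)
Lemma ito_orth H I (s t : R) i (F : set (Omega T m)) : jointly_measurable H -> is_ito P H I ->
  0 <= s -> s <= t -> t <= T -> filt s F ->
  (\int[P]_w (\1_F w * (ev (I w) t i 0 - ev (I w) s i 0)) = 0)%R.
Proof.
move=> mH hI s0 st tT fF.
have sT : 0 <= s <= T by rewrite s0 (le_trans st).
have tT' : 0 <= t <= T by rewrite tT (le_trans s0).
have mF : measurable F by apply: filt_measurable_set fF; case/andP: sT.
have [mI [S [_ S2]]] := hI; have St := S2 t tT'; have Ss := S2 s sT; rewrite unlock in St Ss.
set J := (X in X = 0).
have LI r : 0 <= r <= T -> isL2 P (fun w => ev (I w) r i 0) by move=> rT; exact: (ito_entry_L2 i mH hI).
have m1 : measurable_fun setT (\1_F : Omega T m -> R) by [].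
have b1 w : `|\1_F w : R| <= 1 by rewrite indicE; case: (_ \in _); rewrite ?normr1// normr0.
suff h (c : R) : 0 < c -> `|J| <= 2 * c.
  apply/eqP; rewrite -normr_le0; apply/ler_addgt0Pl => e e0.
  by rewrite addr0 (le_trans (h (e / 2) _)) ?divr_gt0//; lra.
move=> c0; have c20 : 0 < c ^+ 2 by rewrite exprn_gt0.
have [n [nt ns]] : exists n, (vmoment2 P (fun w => ev (I w) t - sp_integral (S n) t w)%R <= (c ^+ 2)%:E)%E /\
   (vmoment2 P (fun w => ev (I w) s - sp_integral (S n) s w)%R <= (c ^+ 2)%:E)%E.
  have [n [h1 h2]] := filter_ex (filterI (cvge0_le c20 St) (cvge0_le c20 Ss)).
  by exists n; split; [exact: h1|exact: h2].
pose X r w := (ev (I w) r - sp_integral (S n) r w) i 0.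
have LS r : 0 <= r <= T -> isL2 P (fun w => sp_integral (S n) r w i 0).
  move=> rT; rewrite (_ : (fun w => _) = fint (@sblock _ _ _ _ 1 (S n) i) r).
    by apply: fint_L2 => // x; exact: sblock_valid.
  by apply/funext => w; rewrite /fint big_sblock_int mul1r.
have LX r : 0 <= r <= T -> isL2 P (X r).
  move=> rT; rewrite (_ : X r = (fun w => ev (I w) r i 0 - sp_integral (S n) r w i 0)).
    by apply: isL2B; [exact: LI|exact: LS].
  by apply/funext => w; rewrite /X !mxE.
have bX r : 0 <= r <= T -> (vmoment2 P (fun w => ev (I w) r - sp_integral (S n) r w)%R <= (c ^+ 2)%:E)%E ->
   (\int[P]_w `|X r w|%:E <= c%:E)%E.
  move=> rT h; have [mX _] := LX r rT.
  apply: (le_trans (integral_norm_le_moment2 P c0 mX)).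
  apply: (@le_trans _ _ ((c / 2)%:E + ((2 * c)^-1)%:E * (c ^+ 2)%:E)%E).
    rewrite leeD2l// lee_wpmul2l ?lee_fin ?invr_ge0 ?mulr_ge0 ?(ltW c0)//.
    apply: (le_trans _ h); exact: (@moment2_entry _ _ _ _ _ (fun w => ev (I w) r - sp_integral (S n) r w)).
  rewrite -EFinM -EFinD lee_fin le_eqVlt; apply/orP; left; apply/eqP; field.
  by rewrite gt_eqF.
have LFX r : 0 <= r <= T -> isL2 P (fun w => \1_F w * X r w) by move=> rT; exact: (isL2_bounded_mul m1 b1 (LX r rT)).
have JE : J = (\int[P]_w (\1_F w * X t w) - \int[P]_w (\1_F w * X s w))%R.
  rewrite -RintegralB//; [|exact: (isL2_integrable (LFX t tT'))|exact: (isL2_integrable (LFX s sT))].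
  have L1 : isL2 P (fun w => \1_F w * X t w - \1_F w * X s w) by apply: isL2B; exact: LFX.
  have L2 : isL2 P (fun w => \1_F w * (sp_integral (S n) t w i 0 - sp_integral (S n) s w i 0)).
    by apply: (isL2_bounded_mul m1 b1); apply: isL2B; exact: LS.
  rewrite -[RHS]addr0.
  have <- : (\int[P]_w (\1_F w * (sp_integral (S n) t w i 0 - sp_integral (S n) s w i 0)) = 0)%R.
    have FF : Fmeas s (\1_F : Omega T m -> R).
      by rewrite filtE in fF; exact: (@measurable_indic _ (FOmega T m s)).
    have orth := @fint_orth _ _ _ _ hP _ _ (sblock_valid 1 (S := S n) i) s t _ s0 st tT FF (isL2_bounded P m1 b1).
    by rewrite -[RHS]orth; apply: eq_Rintegral => w _; rewrite /fint !big_sblock_int !mul1r.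
  rewrite -RintegralD//; [|exact: (isL2_integrable L1)|exact: (isL2_integrable L2)].
  by apply: eq_Rintegral => w _; rewrite /X !mxE; ring.
have bF r : 0 <= r <= T -> (\int[P]_w `|X r w|%:E <= c%:E)%E -> `|\int[P]_w (\1_F w * X r w)|%R <= c.
  move=> rT h; have iF := isL2_integrable (LFX r rT).
  apply: (le_trans (le_normr_Rintegral measurableT iF)); rewrite -lee_fin; apply: le_trans h.
  rewrite /Rintegral fineK; last by have := integrable_fin_num measurableT (integrable_abse iF).
  apply: le_integral_pointwise => w _; rewrite lee_fin normrM ler_piMl//; exact: b1.
rewrite JE (le_trans (ler_normB _ _))// mulr_natl mulr2n.
by apply: lerD; apply: bF => //; exact: bX.
Qed.

End ItoProperties.

(** * Piecewise constant controls *)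

Section PartitionIntegral.
Context (R : realType) (T : R) (n : nat) (ts : nat -> R) (h : R).
Hypothesis hp : is_partition T n ts h.
Notation mu := (@lebesgue_measure R).

(** Controls are constant on right-open cells, simple processes on left-open ones; the two are
    compared in the interiors, which have full measure. *)
Lemma ae_interior : {ae mu, forall r : R, 0 <= r <= T ->
  exists2 i, (i < n)%N & ts i < r < ts i.+1}.
Proof.
have : {ae mu, forall r : R, forall j, r != ts j}.
  apply: ae_foralln => j; exists [set ts j]; split=> //; first exact: lebesgue_measure_set1.
  by move=> r /= /negP; rewrite negbK => /eqP.
apply: ae_mono => r hr /andP[r0 rT].
have [t0 _ _ _] := hp.
have r0' : 0 < r <= T by rewrite rT andbT lt_def r0 -t0 hr.
have [i iN /andP[ri ri']] := partition_locate hp r0'.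
by exists i => //; rewrite ri lt_def ri' eq_sym hr.
Qed.

Lemma integral_cell (x y s : R) : 0 <= x -> x <= y -> 0 <= s ->
  (\int[mu]_(r in `[0%R, s]) (((x < r) && (r <= y))%:R)%:E =
   (Num.min y s - Num.min x s)%:E)%E.
Proof.
move=> x0 xy s0; rewrite integral_mkcond.
rewrite (_ : (fun _ => _) \_ _ = EFin \o \1_(`]x, (Num.min y s)] : set R)).
  rewrite integral_indic//= setIT lebesgue_measure_itv/= lte_fin -EFinD.
  by case: (leP y s) => ys; case: (leP x s) => xs; case: ltP => h' //; congr EFin; lra.
apply/funext => r; rewrite patchE /= indicE !mem_setE !in_itv /= le_min.
have [xr|xr] := ltP x r; last by case: ifP.
have -> : 0 <= r by rewrite (le_trans x0)// ltW.
by rewrite /= andbC; case: (r <= s).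
Qed.

Lemma Rintegral_step (f : R -> R) (c : nat -> R) s :
  (forall i t, (i < n)%N -> ts i < t < ts i.+1 -> f t = c i) -> 0 <= s <= T ->
  (\int[mu]_(t in `[0%R, s]) f t = \sum_(j < n) (Num.min (ts j.+1) s - Num.min (ts j) s) * c j)%R.
Proof.
move=> fc /andP[s0 sT].
pose F j t : \bar R := ((c j)%:E * (((ts j < t) && (t <= ts j.+1))%:R)%:E)%E.
have tj (j : 'I_n) : 0 <= ts j /\ ts j <= ts j.+1.
  have /andP[h0 _] := partition_itv hp (ltnW (ltn_ord j)).
  by split=> //; exact: (partition_mono hp (leqnSn j) (ltn_ord j)).
have mI (j : nat) : measurable_fun `[0, s] (fun r : R => (((ts j < r) && (r <= ts j.+1))%:R)%:E : \bar R).
  apply: measurable_funTS; apply/measurable_EFinP.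
  rewrite (_ : (fun r => _) = \1_(`]ts j, ts j.+1] : set R))//.
  by apply/funext => r; rewrite indicE mem_setE in_itv.
have iI (j : nat) : mu.-integrable `[0, s] (fun r : R => (((ts j < r) && (r <= ts j.+1))%:R)%:E : \bar R).
  apply: measurable_bounded_integrable => //.
  - by rewrite /= lebesgue_measure_itv/=; case: ifP; rewrite ?ltry.
  - by have /measurable_EFinP := mI j.
  - exists 1; split=> // M M1 u _ /=; rewrite ger0_norm//.
    by rewrite (le_trans _ (ltW M1))//; case: (_ && _).
have E : (\int[mu]_(t in `[0%R, s]) (f t)%:E = \int[mu]_(t in `[0%R, s]) (\sum_(j < n) F j t))%E.
  rewrite integral_mkcond [RHS]integral_mkcond; apply: ae_eq_integral_nonmeasurable; last first.
    apply/(measurable_restrictT _ _).1 => //.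
    by apply: emeasurable_sum => j; apply: measurable_funeM; exact: mI.
  apply: ae_mono ae_interior => r hr; rewrite !patchE; case: ifPn => // /set_mem /=.
  rewrite in_itv /= => /andP[r0 rs]; have [|i iN /andP[ri ri']] := hr.
    by rewrite r0 (le_trans rs).
  rewrite (fc i) ?ri//.
  rewrite (bigD1 (Ordinal iN))//= big1 ?adde0; last first.
    move=> j ji; rewrite /F; case: (boolP (_ && _)) => [rj|]; last by rewrite mule0.
    case/eqP: ji; apply/val_inj => /=; apply: (partition_unique hp (ltn_ord j) iN rj).
    by rewrite ri ltW.
  by rewrite /F /= ri (ltW ri') mule1.
rewrite /Rintegral E integral_sum//=; last by move=> j; apply: integrableZl => //; exact: iI.
rewrite (_ : (\sum_(j < n) _)%E = (\sum_(j < n) (Num.min (ts j.+1) s - Num.min (ts j) s) * c j)%:E)//.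
rewrite -sumEFin; apply: eq_bigr => j _; rewrite /F (integralZl _ (iI j))//.
by have [h1 h2] := tj j; rewrite integral_cell// -EFinM mulrC.
Qed.

End PartitionIntegral.

(** * States of step controls and the gains of a hedge along them *)

Section StepState.
Context (R : realType) (T : R) (d m : nat) (P : probability (Omega T m) R).
Hypothesis hP : wiener_measure P.
Hypothesis T0 : 0 < T.
Let T0' : 0 <= T. Proof. exact: ltW. Qed.
Notation mu := (@lebesgue_measure R).
Variables (n : nat) (ts : nat -> R) (h : R).
Hypothesis hp : is_partition T n ts h.
Implicit Types v : nat -> Omega T m -> control R d m.

(** A closed form available for every path, whereas [state] agrees with it only almost surely. *)
Definition step_state v (t : R) (w : Omega T m) : 'cV[R]_d :=
  \sum_(i < n) ((Num.min (ts i.+1) t - Num.min (ts i) t) *: (v i w).1 +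
    (v i w).2 *m (ev w (Num.min (ts i.+1) t) - ev w (Num.min (ts i) t))).

Record step_family v : Prop := StepFamily {
  sf_drift : forall i, (i < n)%N -> filt_measurable (ts i) (fun w => (v i w).1) ;
  sf_vol : forall i, (i < n)%N -> filt_measurable (ts i) (fun w => (v i w).2) ;
  sf_bnd : forall i, (i < n)%N -> exists K : R, forall w, frob (v i w).2 <= K }.

Definition step_vol v (hv : step_family v) : simple_process T m d :=
  partition_process hp (sf_vol hv) (sf_bnd hv).

Lemma step_stateE v (hv : step_family v) t w : step_state v t w =
  \sum_(i < n) (Num.min (ts i.+1) t - Num.min (ts i) t) *: (v i w).1 +
  sp_integral (step_vol hv) t w.
Proof. by rewrite /step_state big_split. Qed.

Lemma step_state0 v w : step_state v 0 w = 0.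
Proof.
rewrite /step_state big1// => i _.
have /andP[h1 _] := partition_itv hp (ltn_ord i).
have /andP[h2 _] := partition_itv hp (ltnW (ltn_ord i)).
by rewrite !min_r// !subrr scale0r mulmx0 addr0.
Qed.

Lemma step_state_continuous v (hv : step_family v) w : continuous (fun t => step_state v t w).
Proof.
apply: continuous_col => j.
rewrite (_ : (fun t => _) = fun t => (\sum_(i < n) (Num.min (ts i.+1) t - Num.min (ts i) t) * (v i w).1 j 0) +
   sp_integral (step_vol hv) t w j 0); last first.
  by apply/funext => t; rewrite (step_stateE hv) mxE summxE; congr +%R; apply: eq_bigr => i _; rewrite !mxE.
have cm (c : R) : continuous (fun t : R => Num.min c t).
  by move=> t; apply: (@min_fun_continuous _ _ R (cst c) id) => // x; [exact: cvg_cst|exact: cvg_id].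
move=> t; apply: cvgD; last exact: sp_integral_continuous.
elim: (index_enum 'I_n) => [|i s IH].
  by under eq_fun do rewrite big_nil; rewrite big_nil; exact: cvg_cst.
rewrite big_cons (_ : (fun u => _) = fun u => (Num.min (ts i.+1) u - Num.min (ts i) u) * (v i w).1 j 0 +
  \sum_(i <- s) (Num.min (ts i.+1) u - Num.min (ts i) u) * (v i w).1 j 0); last first.
  by apply/funext => u; rewrite big_cons.
apply: cvgD IH; apply: cvgM; last exact: cvg_cst.
by apply: cvgB; exact: cm.
Qed.

Definition step_path v w : Omega T d := path_of T (fun t => step_state v t w).

Lemma step_path_exists v (hv : step_family v) w :
  exists x : Omega T d, forall t, 0 <= t <= T -> ev x t = step_state v t w.
Proof.
by apply: (path_exists T0'); [exact: step_state0|exact: (step_state_continuous hv)].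
Qed.

Lemma step_pathE v (hv : step_family v) w t : 0 <= t <= T -> ev (step_path v w) t = step_state v t w.
Proof. exact: (path_ofE (step_path_exists hv w)). Qed.

Lemma step_state_meas v (hv : step_family v) t j : 0 <= t <= T ->
  Fmeas t (fun w => step_state v t w j 0).
Proof.
move=> /andP[t0 tT]; rewrite /Fmeas.
rewrite (_ : (fun w => _) = fun w => (\sum_(i < n) (Num.min (ts i.+1) t - Num.min (ts i) t) * (v i w).1 j 0) +
   sp_integral (step_vol hv) t w j 0); last first.
  by apply/funext => w; rewrite (step_stateE hv) mxE summxE; congr +%R; apply: eq_bigr => i _; rewrite !mxE.
apply: measurable_funD; last first.
  by have /filt_measurable_Fmeas/(_ j 0) := sp_integral_meas (step_vol hv) t0.
apply: measurable_sum => i; have [it|ti] := leP (ts i) t.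
  apply: measurable_funM; first exact: measurable_cst.
  have /filt_measurable_Fmeas/(_ j 0) := sf_drift hv (ltn_ord i).
  exact: Fmeas_sub.
have ti' : t <= ts i.+1 by rewrite (le_trans (ltW ti))// (partition_mono hp (leqnSn i) (ltn_ord i)).
rewrite (_ : (fun w => _) = cst 0); first exact: measurable_cst.
by apply/funext => w; rewrite (min_r ti') subrr mul0r.
Qed.

Lemma step_path_measurable v (hv : step_family v) r : 0 <= r <= T ->
  measurable_fun [set: FOmega T m r] (step_path v : FOmega T m r -> FOmega T d r).
Proof.
move=> /andP[r0 rT].
apply: (@measurability _ _ (FOmega T m r) (FOmega T d r) setT _ (@cylinders R T d r)) => //.
move=> _ [C [s [i [B [/andP[s0 sr] mB ->]]]] <-].
have sT : 0 <= s <= T by rewrite s0 (le_trans sr).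
have := Fmeas_sub sr (step_state_meas hv i sT) measurableT mB; rewrite !setTI.
congr (measurable _); apply/seteqP.
have E w : path_val (step_path v w) s = step_state v s w := step_pathE hv w sT.
by split=> w; rewrite /preimage /mkset E.
Qed.

Lemma step_path_measurableT v (hv : step_family v) : measurable_fun setT (step_path v).
Proof.
apply: measurable_path => t i tT; rewrite (_ : (fun w => _) = fun w => step_state v t w i 0).
  by apply: Fmeas_measurable (step_state_meas hv i tT); case/andP: tT.
by apply/funext => w; rewrite step_pathE.
Qed.

Lemma state_step v (hv : step_family v) (a : R -> Omega T m -> control R d m) :
  (forall i t w, (i < n)%N -> ts i <= t < ts i.+1 -> a t w = v i w) ->
  {ae P, forall w, state P a w = step_path v w}.
Proof.
move=> av.
have e : process_ae_eq P T (fun t w => (a t w).2) (sp_process (step_vol hv)).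
  apply/aeW => w; apply: ae_mono (ae_interior hp) => r hr /hr[i iN /andP[ri ri']].
  rewrite (av i)// ?(ltW ri)// (partition_processE hp _ _ w iN)//.
  by rewrite ri ltW.
apply: ae_mono (ito_simple hP T0 e) => w hw.
have hE t : 0 <= t <= T -> (\col_i (\int[mu]_(t in `[0%R, t]) ((a t w).1 i 0))%R) +
    ev (ito P (fun t w => (a t w).2) w) t = step_state v t w.
  move=> tT; rewrite hw// (step_stateE hv); congr (_ + _).
  apply/matrixP => i j; rewrite mxE summxE (ord1 j).
  rewrite (@Rintegral_step _ _ _ _ _ hp (fun t => (a t w).1 i 0) (fun j => (v j w).1 i 0))//.
    by apply: eq_bigr => l _; rewrite mxE.
  by move=> l r lN /andP[lr rl]; rewrite (av l)// (ltW lr).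
apply: (path_ext T0') => t tT; rewrite step_pathE// -hE// /state.
apply: path_ofE tT; have [x hx] := step_path_exists hv w.
by exists x => s sT; rewrite hx// hE.
Qed.

Section Hedge.
Variable phi : R -> Omega T d -> 'cV[R]_d.
Hypothesis hphi : hedge phi.

Definition cst_family (u : nat -> control R d m) : nat -> Omega T m -> control R d m :=
  fun i _ => u i.

Lemma cst_family_step u : step_family (cst_family u).
Proof.
split=> i iN; last by exists (frob (u i).2).
- by apply/filt_measurable_Fmeas => j k; exact: measurable_cst.
- by apply/filt_measurable_Fmeas => j k; exact: measurable_cst.
Qed.

(** A jointly measurable and adapted representative of the integrand in [dual_payoff]: explicit
    state, left-open version of the control. *)
Definition hedge_process (u : nat -> control R d m) (r : R) (w : Omega T m) : 'M[R]_(1, m) :=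
  (phi r (step_path (cst_family u) w))^T *m sp_process (step_vol (cst_family_step u)) r w.

Lemma hedge_process_good u : exists K, good_matrix K (hedge_process u).
Proof.
have [[K hK] jphi aphi] := hphi.
have [M0 [M0p hM]] : exists M : R, 0 <= M /\ forall r w i j, `|sp_process (step_vol (cst_family_step u)) r w i j| <= M.
  exists (\sum_(l < n) frob (u l).2); split; first by apply: sumr_ge0 => l _; exact: frob_ge0.
  move=> r w i j; rewrite /sp_process summxE (le_trans (ler_norm_sum _ _ _))//.
  rewrite big_mkcond /=; apply: ler_sum => l _; case: ifP => _; last exact: frob_ge0.
  exact: frob_entry.
have K0 : 0 <= K by apply: le_trans (hK 0 point _); rewrite ?frob_ge0// lexx.
exists (\sum_(l < d) K * M0); split.
- move=> t w i j tT; rewrite mxE (le_trans (ler_norm_sum _ _ _))//; apply: ler_sum => l _.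
  rewrite normrM mxE ler_pM//.
  exact: le_trans (frob_entry _ _ _) (hK t _ tT).
- move=> i j; rewrite (_ : (fun x => _) = fun x : R * Omega T m =>
    \sum_l phi x.1 (step_path (cst_family u) x.2) l 0 * sp_process (step_vol (cst_family_step u)) x.1 x.2 l j).
    apply: measurable_sum => l; apply: measurable_funM; last exact: jointly_measurable_sp.
    have mX := step_path_measurableT (cst_family_step u).
    apply: (@measurable_comp _ _ _ _ _ _ (`[0, T] `*` setT) (fun z : R * Omega T d => phi z.1 z.2 l 0)
      _ (fun x : R * Omega T m => (x.1, step_path (cst_family u) x.2))).
    + by apply: measurableX.
    + by move=> _ [[r w] /= [rT _] <-].
    + exact: jphi.
    + apply: measurable_funTS; apply/measurable_fun_pairP; split; first exact: measurable_fst.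
      exact: (measurableT_comp mX measurable_snd).
  by apply/funext => x; rewrite mxE; apply: eq_bigr => l _; rewrite mxE (ord1 i).
move=> t tT; apply/filt_measurable_Fmeas => i j; rewrite /Fmeas.
rewrite (_ : (fun x => _) = fun w =>
    \sum_l phi t (step_path (cst_family u) w) l 0 * sp_process (step_vol (cst_family_step u)) t w l j).
  apply: measurable_sum => l; apply: measurable_funM; last first.
    rewrite (_ : (fun w => _) = cst (sp_process (step_vol (cst_family_step u)) t point l j)).
      exact: measurable_cst.
    by apply/funext => w; rewrite /sp_process !summxE.
  apply: (@measurableT_comp _ _ _ (FOmega T m t) (FOmega T d t) _ (fun x => phi t x l 0)); last first.
    exact: (step_path_measurable (cst_family_step u) tT).
  by have /filt_measurable_Fmeas := aphi t tT; apply.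
by apply/funext => w; rewrite mxE; apply: eq_bigr => l _; rewrite mxE (ord1 i).
Qed.

Definition hedge_gain u : Omega T m -> Omega T 1 := ito P (hedge_process u).

Lemma hedge_gain_ito u : is_ito P (hedge_process u) (hedge_gain u).
Proof. by have [K gH] := hedge_process_good u; exact: (ito_good hP T0 gH). Qed.

Lemma hedge_process_jm u : jointly_measurable (hedge_process u).
Proof. by have [K []] := hedge_process_good u. Qed.

Lemma hedge_gainE u (a : R -> control R d m) :
  (forall i t, (i < n)%N -> ts i <= t < ts i.+1 -> a t = u i) ->
  ito P (fun s w => (phi s (state P (fun s (_ : Omega T m) => a s) w))^T *m (a s).2) = hedge_gain u.
Proof.
move=> au; apply: (ito_ext (hedge_process_jm u)).
have := @state_step _ (cst_family_step u) (fun s _ => a s) (fun i t w => au i t).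
apply: ae_mono => w ->; apply: ae_mono (ae_interior hp) => r hr /hr[i iN /andP[ri ri']].
rewrite /hedge_process (au i)// ?(ltW ri)// (partition_processE hp _ _ w iN)//.
by rewrite ri ltW.
Qed.

(** Up to [ts k.+1] the two states agree; the hedge is adapted to the path of the state, so the
    integrands agree too, and locality of the integral concludes. *)
Lemma hedge_gain_local u u' k : (k < n)%N -> (forall i, (i <= k)%N -> u i = u' i) ->
  forall t, 0 <= t <= ts k.+1 -> {ae P, forall w, ev (hedge_gain u w) t = ev (hedge_gain u' w) t}.
Proof.
move=> kn uu' t /andP[t0 tk].
have kT : ts k.+1 <= T by have /andP[] := partition_itv hp kn.
have tT : 0 <= t <= T by rewrite t0 (le_trans tk).
apply: (is_ito_unique hP T0 (hedge_process_jm u) (hedge_process_jm u') (hedge_gain_ito u) (hedge_gain_ito u') tT).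
rewrite -(dist2_xx P t (hedge_process u')); apply: dist2_ae; try exact: hedge_process_jm.
  by case/andP: tT.
apply/aeW => w; apply: ae_mono (ae_interior hp) => r hr /andP[r0 rt].
have rk := le_trans rt tk; have rT : 0 <= r <= T by rewrite r0 (le_trans rk).
have [i iN /andP[ri ri']] := hr rT.
have ik : (i <= k)%N.
  rewrite leqNgt; apply/negP => ki.
  by have := partition_mono hp ki (ltnW iN); rewrite leNgt (lt_le_trans ri rk).
rewrite /hedge_process !(partition_processE hp _ _ w iN) ?ri ?(ltW ri')//.
rewrite /cst_family (uu' i)//; congr (_^T *m _).
apply/matrixP => j l; rewrite (ord1 l).
have [_ _ /(_ r rT)/filt_measurable_Fmeas/(_ j 0) mphi] := hphi.
apply: (Fmeas_local mphi) => s /andP[s0 sr].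
have sk := le_trans sr rk; have sT : 0 <= s <= T by rewrite s0 (le_trans sk).
rewrite !(step_pathE (cst_family_step _))//; apply: eq_bigr => q _; rewrite /cst_family.
have [qk|kq] := leqP q k; first by rewrite uu'.
have sq : s <= ts q by rewrite (le_trans sk)// (partition_mono hp kq (ltnW (ltn_ord q))).
have sq' : s <= ts q.+1 by rewrite (le_trans sq)// (partition_mono hp (leqnSn q) (ltn_ord q)).
by rewrite !(min_r sq) !(min_r sq') !subrr !scale0r !mulmx0.
Qed.

End Hedge.

End StepState.

(** * Lipschitz functions *)

Section Lipschitz.
Context (R : realType) (d : nat).
Implicit Types (x y z : 'cV[R]_d) (f g : 'cV[R]_d -> R) (L : R).

Definition l1 x : R := \sum_i `|x i 0|.

Lemma l1_ge0 x : 0 <= l1 x.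
Proof. by apply: sumr_ge0. Qed.

Lemma l1D x y : l1 (x + y) <= l1 x + l1 y.
Proof. by rewrite -big_split; apply: ler_sum => i _; rewrite mxE ler_normD. Qed.

Lemma l1N x : l1 (- x) = l1 x.
Proof. by apply: eq_bigr => i _; rewrite mxE normrN. Qed.

Lemma l1_0 : l1 0 = 0.
Proof. by rewrite /l1 big1// => i _; rewrite mxE normr0. Qed.

Lemma l1Z (a : R) x : l1 (a *: x) = `|a| * l1 x.
Proof. by rewrite /l1 mulr_sumr; apply: eq_bigr => i _; rewrite mxE normrM. Qed.

Lemma l1_entry x i : `|x i 0| <= l1 x.
Proof. by rewrite /l1 (bigD1 i)//= lerDl sumr_ge0. Qed.

Definition lip L f := forall x y, `|f x - f y| <= L * l1 (x - y).

Lemma lip_le L f x y : lip L f -> f x <= f y + L * l1 (x - y).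
Proof. by move=> /(_ x y); rewrite ler_norml => /andP[_]; rewrite lerBlDl. Qed.

(** Vectors are measurable coordinate by coordinate, so a superlevel set is written as a countable
    union over rational points [q] of the conditions that the cone of slope [L] below [f q] already
    exceeds the level at [u w]. *)
Lemma lip_measurable d0 (X : measurableType d0) (u : X -> 'cV[R]_d) L f : 0 <= L -> lip L f ->
  (forall i, measurable_fun setT (fun w => u w i 0)) -> measurable_fun setT (fun w => f (u w)).
Proof.
move=> L0 fL mu; apply: (measurability _ (RGenOInfty.measurableE R)) => //.
move=> _ [_ [y ->] <-]; rewrite setTI.
pose q2r (q : 'cV[rat]_d) : 'cV[R]_d := \col_i ratr (q i 0).
rewrite (_ : _ @^-1` _ = \bigcup_(q in [set: 'cV[rat]_d]) [set w | y < f (q2r q) - L * l1 (u w - q2r q)]).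
  apply: countable_bigcupT_measurable; first exact: countableP.
  move=> q; have m1 : measurable_fun setT (fun w => f (q2r q) - L * l1 (u w - q2r q)).
    apply: measurable_funB; first exact: measurable_cst.
    apply: measurable_funM; first exact: measurable_cst.
    apply: measurable_sum => i; apply: measurableT_comp => //.
    rewrite (_ : (fun w => _) = fun w => u w i 0 - q2r q i 0).
      by apply: measurable_funB => //; exact: measurable_cst.
    by apply/funext => w; rewrite !mxE.
  have := m1 measurableT [set` `]y, +oo[] (measurable_itv _); rewrite setTI.
  by congr (measurable _); apply/seteqP; split=> w /=; rewrite in_itv /= andbT.
apply/seteqP; split=> w /=; rewrite in_itv /= andbT; last first.
  move=> [q _ /= /lt_le_trans]; apply; rewrite lerBlDr -l1N opprB; exact: lip_le.
move=> yf; pose D := f (u w) - y.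
have D0 : 0 < D by rewrite subr_gt0.
(* Rational coordinates closer than [e] keep the loss [2 * L * l1 (u w - x)] below the available gap
   [D]; adding 1 avoids a zero denominator. *)
pose e := D / (2 * L * d%:R + 1).
have c0 : 0 < 2 * L * d%:R + 1 by rewrite ltr_wpDl ?mulr_ge0.
have e0 : 0 < e by rewrite divr_gt0.
have ex i : exists q : rat, `|u w i 0 - ratr q| < e.
  have /rat_in_itvoo[q] : u w i 0 - e < u w i 0 + e by rewrite ltrBlDr -addrA ltrDl addr_gt0.
  rewrite in_itv /= => /andP[q1 q2]; exists q.
  by rewrite ltr_norml; apply/andP; split; lra.
exists (\col_i projT1 (cid (ex i))) => //=.
set x := q2r _; have lx : l1 (u w - x) <= d%:R * e.
  rewrite /l1 (le_trans (ler_sum _ (G := fun=> e) _))//.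
    by move=> i _; rewrite !mxE; case: cid => q /= /ltW.
  by rewrite sumr_const card_ord mulr_natl.
have h : 2 * L * l1 (u w - x) < D.
  apply: (@le_lt_trans _ _ (2 * L * (d%:R * e))).
    by apply: ler_wpM2l => //; rewrite mulr_ge0.
  rewrite mulrA /e mulrA ltr_pdivrMr// mulrC ltr_pM2l//.
  by rewrite ltrDl.
have := lip_le (u w) x fL; rewrite /D in h; lra.
Qed.

Lemma unif_continuous_l1 g : unif_continuous g -> forall e : R, 0 < e ->
  exists2 dl : R, 0 < dl & forall x y, l1 (x - y) < dl -> `|g x - g y| < e.
Proof.
move=> /unif_continuousP ug e e0; have [dl dl0 h] := ug e e0; exists dl => // x y xy.
have /= := h (x, y); rewrite /ball /= -/(ball _ _ _); apply; rewrite mx_norm_ball /ball_ /=.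
rewrite [ltLHS]/Num.Def.normr /= mx_normrE; apply: bigmax_lt => // -[i j] _ /=.
rewrite (ord1 j); exact: le_lt_trans (l1_entry _ _) xy.
Qed.

(** The sup-convolution of [g] with cones of slope [L]. *)
Lemma lip_approx g (K : R) : (forall x, `|g x| <= K) -> unif_continuous g ->
  forall e : R, 0 < e -> exists L gL, [/\ 0 <= L, lip L gL, forall x, g x <= gL x,
    forall x, gL x <= g x + e & forall x, `|gL x| <= K].
Proof.
move=> gK ug e e0; have [dl dl0 hdl] := unif_continuous_l1 ug e0.
have K0 : 0 <= K by exact: le_trans (gK 0).
(* At distance [dl] the penalty reaches [2 * K], the largest possible variation of [g]; at shorter
   distances uniform continuity bounds the gain by [e]. *)
pose L := 2 * K / dl; have L0 : 0 <= L by rewrite divr_ge0 ?mulr_ge0// ltW.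
pose E x := [set g y - L * l1 (x - y) | y in [set: 'cV[R]_d]].
have Ll x : 0 <= L * l1 x by rewrite mulr_ge0// l1_ge0.
have ubE x : ubound (E x) K.
  move=> _ [y _ <-]; rewrite (le_trans _ (gK y))// (le_trans _ (ler_norm _))//.
  by rewrite lerBlDr lerDl.
have hE x : has_sup (E x) by split; [exists (g x - L * l1 (x - x)); exists x|exists K; exact: ubE].
have geE x y : g y - L * l1 (x - y) <= sup (E x).
  by apply: ub_le_sup; [exists K; exact: ubE|exists y].
have gle x : g x <= sup (E x).
  by have := geE x x; rewrite subrr l1_0 mulr0 subr0.
have leE x c : (forall y, g y - L * l1 (x - y) <= c) -> sup (E x) <= c.
  by move=> h; apply: ge_sup; [case: (hE x)|move=> _ [y _ <-]].
exists L, (fun x => sup (E x)); split=> //.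
- have one x x' : sup (E x) - sup (E x') <= L * l1 (x - x').
    rewrite lerBlDr; apply: leE => y; have := geE x' y.
    have := l1D (x - y) (x' - x); rewrite (_ : x - y + (x' - x) = x' - y); last first.
      by rewrite addrC addrA subrK.
    rewrite -(l1N (x' - x)) opprB => /(ler_wpM2l L0); rewrite mulrDr; lra.
  move=> x x'; rewrite ler_norml one andbT.
  by have := one x' x; rewrite -(l1N (x' - x)) opprB; lra.
- move=> x; apply: leE => y; have [xy|xy] := ltP (l1 (x - y)) dl.
    by have := hdl x y xy; rewrite ltr_norml => /andP[h _]; have := Ll (x - y); lra.
  have : L * dl <= L * l1 (x - y) by rewrite ler_wpM2l.
  rewrite /L mulfVK ?gt_eqF//.
  have := gK x; have := gK y; rewrite !ler_norml => /andP[? ?] /andP[? ?]; lra.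
- move=> x; rewrite ler_norml; apply/andP; split.
    by rewrite (le_trans _ (gle x))//; have := gK x; rewrite ler_norml => /andP[].
  by apply: ge_sup; [case: (hE x)|exact: ubE].
Qed.

Lemma unif_measurable d0 (X : measurableType d0) (u : X -> 'cV[R]_d) g (K : R) :
  (forall x, `|g x| <= K) -> unif_continuous g ->
  (forall i, measurable_fun setT (fun w => u w i 0)) -> measurable_fun setT (fun w => g (u w)).
Proof.
move=> gK ug mu.
have n0 n : 0 < n.+1%:R^-1 :> R by rewrite invr_gt0.
have ex n : exists G, exists2 L, 0 <= L /\ lip L G & forall x, g x <= G x <= g x + n.+1%:R^-1.
  have [L [G [L0 h1 h2 h3 _]]] := lip_approx gK ug (n0 n).
  by exists G, L => // x; rewrite h2 h3.
have [G GP] := choice ex.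
apply: (@measurable_fun_cvg _ _ _ setT (fun n w => G n (u w))).
  by move=> n; have [L [L0 lG] _] := GP n; exact: lip_measurable L0 lG mu.
move=> w _; have sq : \forall n \near \oo, g (u w) <= G n (u w) <= g (u w) + n.+1%:R^-1.
  by apply: nearW => n; have [L _] := GP n; exact.
apply: (squeeze_cvgr sq); first exact: cvg_cst.
by rewrite -[X in _ --> X]addr0; apply: cvgD; [exact: cvg_cst|exact: cvg_harmonic].
Qed.

End Lipschitz.

(** * Measurable choice of a maximiser among finitely many *)

Section Selection.
Context (R : realType) (q : nat).

Definition argmx (f : 'I_q.+1 -> R) : 'I_q.+1 :=
  odflt ord0 [pick j | [forall j', f j' <= f j]].

Lemma argmxP f j : f j <= f (argmx f).
Proof.
rewrite /argmx; case: pickP => [i /forallP|/(_ [arg max_(i > ord0) f i]%O)] //=.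
by case: arg_maxP => //= i _ h /negP[]; apply/forallP => j'; exact: h.
Qed.

(** The chosen index is a function of the finite table of comparisons between the values, and each
    entry of that table is measurable. *)
Lemma argmx_measurable d (X : measurableType d) (f : 'I_q.+1 -> X -> R) j :
  (forall i, measurable_fun setT (f i)) -> measurable [set w | argmx (fun i => f i w) = j].
Proof.
move=> mf; pose b w : {ffun 'I_q.+1 * 'I_q.+1 -> bool} := [ffun x => f x.1 w <= f x.2 w].
pose F (c : {ffun 'I_q.+1 * 'I_q.+1 -> bool}) := odflt ord0 [pick j | [forall j', c (j', j)]].
have E w : argmx (fun i => f i w) = F (b w).
  by rewrite /argmx /F; congr odflt; apply: eq_pick => i; apply: eq_forallb => i'; rewrite ffunE.
rewrite (_ : [set w | _] = \bigcup_(c in [set c | F c = j]) \bigcap_(x in [set: 'I_q.+1 * 'I_q.+1]) [set w | (f x.1 w <= f x.2 w) = c x]).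
  apply: fin_bigcup_measurable => // c _; apply: fin_bigcap_measurable => // x _.
  have := measurable_fun_ler (mf x.1) (mf x.2) measurableT (Y := [set c x]) I.
  by rewrite setTI.
apply/seteqP; split=> w /=; rewrite E.
  by move=> h; exists (b w) => // x _ /=; rewrite ffunE.
move=> [c /= <- h]; congr F; apply/ffunP => x; rewrite ffunE; exact: h.
Qed.

End Selection.

(** * The dual value dominates *)

Section StepControl.
Context (R : realType) (T : R) (d m : nat).
Variables (n : nat) (ts : nat -> R) (h : R).
Hypothesis hp : is_partition T n ts h.
Hypothesis T0 : 0 < T.

Lemma partition_size_gt0 : (0 < n)%N.
Proof.
have [h0 hn _ _] := hp; rewrite lt0n; apply/negP => /eqP n0.
by move: T0; rewrite -hn n0 h0 ltxx.
Qed.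

Lemma partition_unique_left (r : R) i j : (i < n)%N -> (j < n)%N ->
  ts i <= r < ts i.+1 -> ts j <= r < ts j.+1 -> i = j.
Proof.
have aux a b : (b < n)%N -> ts a <= r < ts a.+1 -> ts b <= r < ts b.+1 -> (b <= a)%N.
  move=> bn /andP[a1 a2] /andP[b1 b2]; rewrite leqNgt; apply/negP => ab.
  by have := partition_mono hp ab (ltnW bn); rewrite leNgt (le_lt_trans b1 a2).
by move=> iN jN hi hj; apply/eqP; rewrite eqn_leq (aux j i)// (aux i j).
Qed.

Lemma step_control_exists (N : set (control R d m)) (u : nat -> control R d m) :
  (forall i, (i < n)%N -> N (u i)) ->
  exists2 a, step_control T n ts N a & forall i t, (i < n)%N -> ts i <= t < ts i.+1 -> a t = u i.
Proof.
move=> Nu; pose idx (t : R) : nat := xget 0%N [set i | (i < n)%N /\ ts i <= t < ts i.+1].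
have idxE i t : (i < n)%N -> ts i <= t < ts i.+1 -> idx t = i.
  move=> iN it; rewrite /idx; case: xgetP => [j _ [jN jt]|/(_ i) []//].
  exact: partition_unique_left jN iN jt it.
have idxN t : (idx t < n)%N.
  by rewrite /idx; case: xgetP => [j _ []//|_]; exact: partition_size_gt0.
have aE i t : (i < n)%N -> ts i <= t < ts i.+1 -> u (idx (clamp T t)) = u i.
  move=> iN it; rewrite clamp_id ?(idxE i)//; have /andP[i1 i2] := it.
  have /andP[j1 j2] := partition_itv hp iN.
  have /andP[k1 k2] := partition_itv hp (ltnW iN).
  by rewrite (le_trans k1 i1) (le_trans (ltW i2)).
exists (fun t => u (idx (clamp T t))); last exact: aE.
split.
- by move=> t _; apply: Nu.
- move=> i t iN it; rewrite (aE i t)// (aE i (ts i))// lexx /=.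
  by have /andP[i1 i2] := it; exact: le_lt_trans i2.
- by move=> t; rewrite clampK// ltW.
Qed.

End StepControl.

Lemma measurable_stopped d (X : measurableType d) (R : realType) n (ka : X -> nat) (f : nat -> X -> R) :
  (forall w, (ka w <= n)%N) -> (forall k, (k <= n)%N -> measurable [set w | (ka w <= k)%N]) ->
  (forall k, (k <= n)%N -> measurable_fun setT (f k)) -> measurable_fun setT (fun w => f (ka w) w).
Proof.
move=> ka_le mle mf.
rewrite (_ : (fun w => _) = fun w => \sum_(k < n.+1) \1_[set w | ka w = k] w * f k w).
  apply: measurable_sum => k; have kn : (k <= n)%N by rewrite -ltnS.
  apply: measurable_funM; last exact: mf.
  apply: measurable_indic; case: (nat_of_ord k) kn => [|j] jn.
    by rewrite (_ : [set w | _] = [set w | (ka w <= 0)%N]); [exact: mle|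
       apply/seteqP; split=> w /= => [->//|]; rewrite leqn0 => /eqP].
  rewrite (_ : [set w | _] = [set w | (ka w <= j.+1)%N] `\` [set w | (ka w <= j)%N]).
    by apply: measurableD; apply: mle => //; exact: ltnW.
  apply/seteqP; split=> w /= => [->|[h1 /negP h2]]; first by split=> //; rewrite ltnn.
  by apply/eqP; rewrite eqn_leq h1 ltnNge.
apply/funext => w; have kw : (ka w < n.+1)%N by rewrite ltnS.
rewrite (bigD1 (Ordinal kw))//= big1 ?addr0.
  by rewrite indicE mem_set// mul1r.
move=> k kk; rewrite indicE memNset ?mul0r//= => e; case/eqP: kk.
by apply/val_inj => /=.
Qed.

(** * A random step control played against a hedge *)

Section SelectedControl.
Context (R : realType) (T : R) (d m : nat) (P : probability (Omega T m) R).
Hypothesis hP : wiener_measure P.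
Hypothesis T0 : 0 < T.
Let T0' : 0 <= T. Proof. exact: ltW. Qed.
Variables (n : nat) (ts : nat -> R) (h : R).
Hypothesis hp : is_partition T n ts h.
Variables (q : nat) (c : 'I_q.+1 -> control R d m).
Variables (al : nat -> Omega T m -> 'I_q.+1) (ka : Omega T m -> nat).
Hypothesis al_meas : forall i j, (i < n)%N -> filt (ts i) [set w | al i w = j].

Definition selected i w := c (al i w).

Lemma selected_family : step_family n ts selected.
Proof.
have h1 i (F : 'I_q.+1 -> R) : (i < n)%N -> Fmeas (ts i) (fun w => F (al i w)).
  move=> iN; rewrite /Fmeas (_ : (fun w => _) = fun w => \sum_j F j * \1_[set w | al i w = j] w).
    apply: measurable_sum => j; apply: measurable_funM; first exact: measurable_cst.
    by have := al_meas j iN; rewrite filtE => H; exact: (@measurable_indic _ (FOmega T m (ts i))).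
  apply/funext => w; rewrite (bigD1 (al i w))//= big1 ?addr0; last first.
    by move=> j jw; rewrite indicE memNset ?mulr0//= => /esym/eqP; rewrite (negbTE jw).
  by rewrite indicE mem_set// mulr1.
split=> i iN.
- by apply/filt_measurable_Fmeas => j k; exact: (h1 i (fun l => (c l).1 j k)).
- by apply/filt_measurable_Fmeas => j k; exact: (h1 i (fun l => (c l).2 j k)).
- exists (\sum_j frob (c j).2) => w; rewrite (bigD1 (al i w))//= lerDl.
  by apply: sumr_ge0 => j _; exact: frob_ge0.
Qed.

Hypothesis ka_le : forall w, (ka w <= n)%N.
Hypothesis ka_meas : forall k, (k <= n)%N -> filt (ts k) [set w | (ka w <= k)%N].

Variable phi : R -> Omega T d -> 'cV[R]_d.
Hypothesis hphi : hedge phi.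

Notation V := {ffun 'I_n -> 'I_q.+1}.
Let uval (u : V) (i : nat) : control R d m := if insub i is Some j then c (u j) else c ord0.
Let alV w : V := [ffun i : 'I_n => al i w].
(** The choices up to cell [k], completed by a dummy choice: all that is known of the control when
    that cell starts. *)
Let pre k (u : V) : V := [ffun i : 'I_n => if (i <= k)%N then u i else ord0].
Let J (u : V) (t : R) w : R := ev (hedge_gain P hp phi (uval u) w) t 0 0.
Let D u k w := J u (ts k.+1) w - J u (ts k) w.
Let F k (u : V) := [set w | alV w = u /\ (k < ka w)%N].
Let E k (u : V) := [set w | pre k (alV w) = u /\ (k < ka w)%N].

Let uvalE w i : (i < n)%N -> uval (alV w) i = selected i w.
Proof. by move=> iN; rewrite /uval insubT /= ffunE. Qed.

Let tsT k : (k <= n)%N -> 0 <= ts k <= T. Proof. exact: (partition_itv hp). Qed.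

Let filt_stop k : (k <= n)%N -> filt (ts k) [set w | (k < ka w)%N].
Proof.
move=> kn; have := ka_meas kn; rewrite filtE => H.
rewrite (_ : [set w | _] = ~` [set w | (ka w <= k)%N]).
  exact: (measurableC (H : measurable (_ : set (FOmega T m (ts k))))).
by apply/seteqP; split => w /=; rewrite ltnNge => /negP.
Qed.

Let filt_prefix k u : (k < n)%N -> filt (ts k) (E k u).
Proof.
move=> kn; rewrite (_ : E k u = (\bigcap_(i in [set: 'I_n]) [set w | (if (i <= k)%N then al i w else ord0) = u i]) `&`
   [set w | (k < ka w)%N]).
  apply: filtI; last exact: (filt_stop (ltnW kn)).
  rewrite filtE; apply: fin_bigcap_measurable => // i _; have [ik|ki] := leqP i k.
    rewrite -filtE; apply: filt_sub (al_meas _ (ltn_ord i)).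
    exact: (partition_mono hp ik (ltnW kn)).
  have [e|e] := eqVneq ord0 (u i).
    by rewrite (_ : [set w | _] = setT); [exact: measurableT|apply/seteqP; split].
  rewrite (_ : [set w | _] = set0); first exact: measurable0.
  by apply/seteqP; split => // w /= /eqP; rewrite (negbTE e).
apply/seteqP; split=> w [/= h1 h2]; split=> //.
  by move=> i _ /=; rewrite -h1 !ffunE.
by apply/ffunP => i; rewrite !ffunE; exact: h1.
Qed.

Let mF k u : (k < n)%N -> measurable (F k u).
Proof.
move=> kn; rewrite (_ : F k u = (\bigcap_(i in [set: 'I_n]) [set w | al i w = u i]) `&` [set w | (k < ka w)%N]).
  apply: measurableI; last first.
    by apply: filt_measurable_set (filt_stop (ltnW kn)); case/andP: (tsT (ltnW kn)).
  apply: fin_bigcap_measurable => // i _; apply: filt_measurable_set (al_meas _ (ltn_ord i)).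
  by case/andP: (tsT (ltnW (ltn_ord i))).
apply/seteqP; split=> w [/= h1 h2]; split=> //.
  by move=> i _ /=; rewrite -h1 !ffunE.
by apply/ffunP => i; rewrite !ffunE; exact: h1.
Qed.

Let J_L2 u (t : R) : 0 <= t <= T -> isL2 P (J u t).
Proof.
move=> tT; exact: (ito_entry_L2 hP T0 0 (hedge_process_jm T0 hp hphi _) (hedge_gain_ito hP T0 hp hphi _) tT).
Qed.

Let D_L2 u k : (k < n)%N -> isL2 P (D u k).
Proof. by move=> kn; apply: isL2B; apply: J_L2; apply: tsT => //; exact: ltnW. Qed.

Let indic_L2 (A : set (Omega T m)) f : measurable A -> isL2 P f -> isL2 P (fun w => \1_A w * f w).
Proof.
move=> mA Lf; apply: (isL2_bounded_mul (K := 1) _ _ Lf); first exact: measurable_indic.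
by move=> w; rewrite indicE; case: (_ \in _); rewrite ?normr1// normr0.
Qed.

Let indic_integrable (A : set (Omega T m)) f : measurable A -> isL2 P f ->
  P.-integrable setT (EFin \o (fun w => \1_A w * f w)).
Proof. by move=> mA Lf; exact: (isL2_integrable (indic_L2 mA Lf)). Qed.

(* Before time ts k.+1 the gains see only the prefix of the control, which is
   known at time ts k. *)
Let gain_step k : (k < n)%N -> \sum_u (\int[P]_w (\1_(F k u) w * D u k w))%R = 0.
Proof.
(* Each gain on cell [k] is replaced by the gain of the completed prefix, equal to it almost surely.
   The event [F k u] still depends on later choices. *)
move=> kn; transitivity (\sum_u (\int[P]_w (\1_(F k u) w * D (pre k u) k w))%R).
  apply: eq_bigr => u _; rewrite /Rintegral; apply: (congr1 fine).
  apply: ae_eq_integral_nonmeasurable; last first.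
    by have [+ _] := indic_L2 (mF u kn) (D_L2 (pre k u) kn); move/measurable_EFinP.
  have pu i : (i <= k)%N -> uval u i = uval (pre k u) i.
    by move=> ik; rewrite /uval; case: insubP => [j jn ji|]; rewrite ?ffunE ?ji ?ik.
  have kT : 0 <= ts k.+1 <= ts k.+1 by rewrite lexx andbT; case/andP: (tsT kn).
  have kT' : 0 <= ts k <= ts k.+1.
    by rewrite (partition_mono hp (leqnSn k) kn) andbT; case/andP: (tsT (ltnW kn)).
  have a1 := hedge_gain_local hP T0 hp hphi kn pu kT.
  have a2 := hedge_gain_local hP T0 hp hphi kn pu kT'.
  have DE : {ae P, forall w, D u k w = D (pre k u) k w}.
    by apply: ae_mono2 a1 a2 => w e1 e2; exact: (f_equal2 (fun x y : 'cV[R]_1 => x 0 0 - y 0 0) e1 e2).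
  by apply: ae_mono DE => w ->.
(* The events of all controls with prefix [z] add up to [E k z], which is known at [ts k]; against
   it the increment of a single integral has mean zero. *)
rewrite (partition_big (pre k) xpredT)//= big1// => z _.
transitivity (\int[P]_w (\1_(E k z) w * D z k w))%R; last first.
  apply: (ito_orth hP T0 0 (hedge_process_jm T0 hp hphi _) (hedge_gain_ito hP T0 hp hphi _)).
  - by case/andP: (tsT (ltnW kn)).
  - exact: (partition_mono hp (leqnSn k) kn).
  - by case/andP: (tsT kn).
  - exact: filt_prefix.
transitivity (\sum_(u | pre k u == z) (\int[P]_w (\1_(F k u) w * D z k w))%R).
  by apply: eq_bigr => u /eqP ->.
rewrite -(Rintegral_bigsum (P := P)); last by move=> u; exact: indic_integrable (mF u kn) (D_L2 z kn).
apply: eq_Rintegral => w _; rewrite -mulr_suml; congr (_ * _).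
have [hk|hk] := boolP (k < ka w)%N; last first.
  rewrite big1; first by rewrite indicE memNset//= => -[_]; exact/negP.
  by move=> u _; rewrite indicE memNset//= => -[_]; exact/negP.
have [e|e] := eqVneq (pre k (alV w)) z.
  rewrite (bigD1 (alV w)) ?e//= big1 ?addr0; last first.
    by move=> u /andP[_ uw]; rewrite indicE memNset//= => -[/esym/eqP]; rewrite (negbTE uw).
  by rewrite !indicE !mem_set.
rewrite big1; first by rewrite indicE memNset//= => -[/eqP]; rewrite (negbTE e).
move=> u /eqP uz; rewrite indicE memNset//= => -[wu]; move: e; rewrite wu uz; by rewrite eqxx.
Qed.

(** The gain of the random control up to the random time, assembled from the gains of finitely many
    deterministic controls. *)
Let G w := \sum_(k < n) \sum_u \1_(F k u) w * D u k w.

Let G_L2 : isL2 P G.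
Proof. by apply: isL2_sum => k _; apply: isL2_sum => u _; apply: indic_L2; [exact: mF|exact: D_L2]. Qed.

Let G0 : (\int[P]_w G w = 0)%R.
Proof.
rewrite Rintegral_bigsum; last first.
  by move=> k; apply: isL2_integrable; apply: isL2_sum => u _; apply: indic_L2; [exact: mF|exact: D_L2].
rewrite big1// => k _; rewrite Rintegral_bigsum; first exact: gain_step.
by move=> u; apply: indic_integrable; [exact: mF|exact: D_L2].
Qed.

Let GE w : G w = J (alV w) (ts (ka w)) w.
Proof.
transitivity (\sum_(0 <= k < n) (k < ka w)%:R * D (alV w) k w).
  rewrite big_mkord; apply: eq_bigr => k _.
  rewrite (bigD1 (alV w))//= big1 ?addr0; last first.
    by move=> u uw; rewrite indicE memNset ?mul0r//= => -[/esym/eqP]; rewrite (negbTE uw).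
  congr (_ * _); rewrite indicE; have [hk|hk] := boolP (k < ka w)%N; first by rewrite mem_set.
  by rewrite memNset//= => -[_]; exact/negP.
rewrite (@big_cat_nat _ _ _ (ka w) 0 n)//= [X in _ + X]big_nat_cond [X in _ + X]big1 ?addr0; last first.
  by move=> k /andP[/andP[kk _] _]; rewrite ltnNge kk mul0r.
rewrite big_nat_cond (eq_bigr (fun k => D (alV w) k w)); last first.
  by move=> k /andP[/andP[_ kk] _]; rewrite kk mul1r.
rewrite -big_nat_cond telescope_sumr// (_ : J _ (ts 0) _ = 0) ?subr0//.
by rewrite /J; have [-> _ _ _] := hp; rewrite ev0 mxE.
Qed.

Variables (g : 'cV[R]_d -> R) (K : R).
Hypothesis gK : forall x, `|g x| <= K.
Hypothesis gc : unif_continuous g.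
Variable N : set (control R d m).
Hypothesis cN : forall j, N (c j).

Lemma stopped_measurable :
  measurable_fun setT (fun w => g (step_state n ts selected (ts (ka w)) w)).
Proof.
apply: (measurable_stopped (f := fun k w => g (step_state n ts selected (ts k) w)) ka_le) => k kn.
  by apply: filt_measurable_set (ka_meas kn); case/andP: (tsT kn).
apply: (unif_measurable gK gc) => i.
by apply: (Fmeas_measurable _ (step_state_meas hp selected_family i (tsT kn))); case/andP: (tsT kn).
Qed.

(** Along a path the random control coincides with one deterministic control, so the supremum
    dominates its payoff at the time [ts (ka w)]. The gain [G] in that payoff has mean zero. *)
Lemma dual_payoff_ge :
  (\int[P]_w (g (step_state n ts selected (ts (ka w)) w))%:E <= \int[P]_w dual_payoff P g n ts N phi w)%E.
Proof.
have mg := stopped_measurable.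
have ig : P.-integrable setT (fun w => (g (step_state n ts selected (ts (ka w)) w))%:E).
  by apply: isL2_integrable; apply: (isL2_bounded _ mg) => w; exact: gK.
have iG := isL2_integrable G_L2.
have -> : (\int[P]_w (g (step_state n ts selected (ts (ka w)) w))%:E =
  \int[P]_w ((g (step_state n ts selected (ts (ka w)) w) - G w)%R)%:E)%E.
  under [RHS]eq_integral do rewrite EFinB.
  rewrite integralB//; have -> : (\int[P]_x (G x)%:E = 0)%E.
    by rewrite -[LHS]fineK ?integrable_fin_num//; congr EFin; exact: G0.
  by rewrite sube0.
apply: ae_le_integral_l; last first.
  by apply/measurable_EFinP; apply: measurable_funB => //; have [] := G_L2.
have Nu (u : V) i : (i < n)%N -> N (uval u i) by move=> iN; rewrite /uval; case: insub.
have [a aP] : exists a : V -> R -> control R d m, forall u, step_control T n ts N (a u) /\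
    forall i t, (i < n)%N -> ts i <= t < ts i.+1 -> a u t = uval u i.
  have : forall u, exists a, step_control T n ts N a /\
      forall i t, (i < n)%N -> ts i <= t < ts i.+1 -> a t = uval u i.
    by move=> u; have [a a1 a2] := step_control_exists hp T0 (Nu u); exists a.
  by move=> /choice[a aP]; exists a.
have aX : {ae P, forall w, forall u : V,
    state P (fun s _ => a u s) w = step_path n ts (cst_family (uval u)) w}.
  apply: ae_forall_count => u.
  apply: (state_step hP T0 hp); first exact: cst_family_step.
  by move=> i t w; exact: (aP u).2.
apply: ae_mono aX => w hX; have [asc aE] := aP (alV w).
apply: ereal_sup_ubound; exists (a (alV w)), (ts (ka w)); split=> //; first exact: tsT.
rewrite /= hX (step_pathE T0 hp); [|exact: cst_family_step|exact: tsT].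
rewrite (hedge_gainE hP T0 hp hphi aE) GE; congr (g _ - _)%:E.
by apply: eq_bigr => i _; rewrite /cst_family uvalE.
Qed.

End SelectedControl.

Lemma young (R : realType) (c x y : R) : 0 < c -> x ^+ 2 <= y -> `|x| <= c / 2 + (2 * c)^-1 * y.
Proof.
move=> c0 xy; rewrite -(ler_pM2l (x := 2 * c)) ?mulr_gt0//.
rewrite (_ : 2 * c * (c / 2 + (2 * c)^-1 * y) = c ^+ 2 + y); last by field; rewrite gt_eqF.
have := sqr_ge0 (`|x| - c); rewrite -(real_normK (num_real x)) in xy; nra.
Qed.

(** * Approximation of an admissible control by step controls with values in a net *)

Section AdmissibleState.
Context (R : realType) (T : R) (d m : nat) (P : probability (Omega T m) R).
Hypothesis hP : wiener_measure P.
Hypothesis T0 : 0 < T.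
Let T0' : 0 <= T. Proof. exact: ltW. Qed.
Notation mu := (@lebesgue_measure R).
Variable A : set (control R d m).

Definition control_bound (K : R) := forall b, A b ->
  (forall i j, `|b.1 i j| <= K) /\ (forall i j, `|b.2 i j| <= K).

Lemma compact_control_bound : compact A -> exists2 K : R, 0 <= K & control_bound K.
Proof.
move=> /(@compact_bounded R ('cV[R]_d * 'M[R]_(d, m))%type)[M [_ hM]].
have M1 : M < `|M| + 1 by rewrite (le_lt_trans (ler_norm M))// ltrDl.
exists (`|M| + 1) => [|b Ab]; first by rewrite addr_ge0.
have hb := hM _ M1 _ Ab; rewrite /= prod_normE ge_max in hb.
have entry p q (B : 'M[R]_(p, q)) i j : `|B i j| <= `|B|.
  rewrite [leRHS]/Num.Def.normr /= mx_normrE.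
  by apply/bigmax_geP; right => /=; exists (i, j).
have /andP[h1 h2] := hb.
by split=> i j; [exact: le_trans (entry _ _ _ _ _) h1|exact: le_trans (entry _ _ _ _ _) h2].
Qed.

Variable K : R.
Hypothesis K0 : 0 <= K.
Hypothesis hK : control_bound K.
Variable a : R -> Omega T m -> control R d m.
Hypothesis ha : admissible A a.

Let a1 t w : 'cV[R]_d := (a t w).1.
Let a2 t w : 'M[R]_(d, m) := (a t w).2.

Lemma admissible_drift : good_matrix K a1.
Proof.
have [Aa j1 _ d1 _] := ha; split=> // t w i j tT.
by have [h _] := hK (Aa t w tT); exact: h.
Qed.

Lemma admissible_vol : good_matrix K a2.
Proof.
have [Aa _ j2 _ d2] := ha; split=> // t w i j tT.
by have [_ h] := hK (Aa t w tT); exact: h.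
Qed.

Let g1 i := good_matrix_entry i 0 admissible_drift.

Lemma admissible_stateE w t : 0 <= t <= T -> ev (state P a w) t =
  (\col_i primitive (fun r w => a1 r w i 0) t w) + ev (ito P a2 w) t.
Proof.
apply: path_ofE; pose f s := (\col_i primitive (fun r w => a1 r w i 0) (clamp T s) w) + ev (ito P a2 w) s.
have [||x hx] := path_exists T0' (f := f).
- apply/matrixP => i j; rewrite /f clamp0// ev0 !mxE addr0 /primitive.
  by rewrite set_itv1 Rintegral_set1.
- apply: continuous_col => i; rewrite (_ : (fun t => _) =
    fun s => primitive (fun r w => a1 r w i 0) (clamp T s) w + ev (ito P a2 w) s i 0); last first.
    by apply/funext => s; rewrite !mxE.
  move=> s; apply: cvgD; last by apply: continuous_coord; exact: continuous_ev.
  have lp x y : `|primitive (fun r w => a1 r w i 0) (clamp T x) w - primitive (fun r w => a1 r w i 0) (clamp T y) w|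
      <= K * `|clamp T x - clamp T y|.
    have /andP[_ xT] := clamp_itv x T0'; have /andP[_ yT] := clamp_itv y T0'.
    have [xy|/ltW xy] := leP (clamp T x) (clamp T y).
      rewrite distrC [X in _ * X]distrC [X in _ * X]ger0_norm ?subr_ge0//.
      exact: (primitive_lipschitz T0' (g1 i) w xy yT).
    by rewrite [X in _ * X]ger0_norm ?subr_ge0//; exact: (primitive_lipschitz T0' (g1 i) w xy xT).
  apply/cvgrPdist_lt => e e0; have K1 : 0 < K + 1 by rewrite ltr_wpDl.
  have eK : 0 < e / (K + 1) by rewrite divr_gt0.
  have /cvgrPdist_lt/(_ _ eK) := @continuous_clamp R T s; apply: filterS => y hy.
  apply: (le_lt_trans (lp s y)); apply: (@le_lt_trans _ _ ((K + 1) * `|clamp T s - clamp T y|)).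
    by rewrite ler_wpM2r// lerDl.
  by rewrite mulrC -ltr_pdivlMr.
by exists x => s sT; rewrite hx// /f clamp_id.
Qed.

Lemma state_coord_measurable t i : 0 <= t <= T ->
  measurable_fun setT (fun w => ev (state P a w) t i 0).
Proof.
move=> tT; rewrite (_ : (fun w => _) =
  fun w => primitive (fun r w => a1 r w i 0) t w + ev (ito P a2 w) t i 0); last first.
  by apply/funext => w; rewrite admissible_stateE// !mxE.
apply: measurable_funD.
  by apply: Fmeas_measurable (primitive_meas T0' (g1 i) tT); case/andP: tT.
by apply: ev_measurable; have [] := ito_good hP T0 admissible_vol.
Qed.

Section Approximation.
Variables (n : nat -> nat) (ts : nat -> nat -> R) (hh : nat -> R).
Hypothesis hp : forall j, is_partition T (n j) (ts j) (hh j).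
Hypothesis h0 : forall j, 0 < hh j.
Hypothesis ch : hh j @[j --> \oo] --> 0.
Variables (q : nat -> nat) (c : forall j, 'I_(q j).+1 -> control R d m).
Hypothesis cA : forall j l, A (c (j := j) l).
Hypothesis cnet : forall j b, A b -> exists l, cdist b (c (j := j) l) <= hh j.

Definition sqdist (b b' : control R d m) : R := frob (b.1 - b'.1) ^+ 2 + frob (b.2 - b'.2) ^+ 2.

Lemma sqdist_triangle b b' b'' : sqdist b b'' <= 2 * sqdist b b' + 2 * sqdist b' b''.
Proof.
rewrite /sqdist; have := frob2_triangle b.1 b'.1 b''.1; have := frob2_triangle b.2 b'.2 b''.2.
lra.
Qed.

Lemma sqdistC b b' : sqdist b b' = sqdist b' b.
Proof. by rewrite /sqdist -frobN opprB -[X in _ + X ^+ 2]frobN opprB. Qed.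

Lemma sqdist_ge0 b b' : 0 <= sqdist b b'.
Proof. by rewrite addr_ge0// sqr_ge0. Qed.

Let avgc j i w : control R d m :=
  (avgmx a1 (Num.sqrt (hh j)) (ts j i) w, avgmx a2 (Num.sqrt (hh j)) (ts j i) w).

(* the net point nearest to the average of the control over the recent past *)
Definition nearest j i w : 'I_(q j).+1 := argmx (fun l => - sqdist (avgc j i w) (c (j := j) l)).

Let s0 j : 0 < Num.sqrt (hh j). Proof. by rewrite sqrtr_gt0. Qed.

Lemma nearest_meas j i l : (i < n j)%N -> filt (ts j i) [set w | nearest j i w = l].
Proof.
move=> iN; rewrite filtE; apply: (@argmx_measurable _ _ _ (FOmega T m (ts j i))) => l'.
have tT := partition_itv (hp j) (ltnW iN).
have m1 := (filt_measurable_Fmeas _ _).1 (avgmx_meas T0' admissible_drift (s0 j) tT).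
have m2 := (filt_measurable_Fmeas _ _).1 (avgmx_meas T0' admissible_vol (s0 j) tT).
apply: measurableT_comp => //; rewrite (_ : (fun w => _) = fun w =>
  \sum_i' \sum_j' ((avgc j i w).1 i' j' - (c (j := j) l').1 i' j') ^+ 2 +
  \sum_i' \sum_j' ((avgc j i w).2 i' j' - (c (j := j) l').2 i' j') ^+ 2); last first.
  apply/funext => w; rewrite /sqdist !frob2E; congr (_ + _);
    by apply: eq_bigr => i' _; apply: eq_bigr => j' _; rewrite /= !mxE.
by apply: measurable_funD; apply: measurable_sum => i'; apply: measurable_sum => j';
  apply: measurable_funX; apply: measurable_funB; try exact: measurable_cst; [exact: m1|exact: m2].
Qed.

Notation sel j := (selected (c (j := j)) (nearest j)).

Let fam j : step_family (n j) (ts j) (sel j).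
Proof. by apply: selected_family => i l; exact: nearest_meas. Qed.

Let G1 j := cells (n j) (ts j) (fun i w => (sel j i w).1 : 'cV[R]_d).
Let G2 j := cells (n j) (ts j) (fun i w => (sel j i w).2 : 'M[R]_(d, m)).

(** [A] need not be convex, so an average may leave it and be far from the net. The selected point
    is therefore compared with the net point nearest to the control itself; this turns the factor 2
    of the triangle inequality into 2 + 4 = 6. *)
Let sel_near j i r w : (i < n j)%N -> 0 <= r <= T ->
  sqdist (a r w) (sel j i w) <= 6 * sqdist (a r w) (avgc j i w) + 4 * hh j ^+ 2.
Proof.
move=> iN rT; have [Aa _ _ _ _] := ha.
have [l hl] := cnet j (Aa r w rT).
have h1 : sqdist (a r w) (c (j := j) l) <= hh j ^+ 2.
  have -> : sqdist (a r w) (c (j := j) l) = cdist (a r w) (c (j := j) l) ^+ 2.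
    by rewrite /cdist sqr_sqrtr//; exact: sqdist_ge0.
  by rewrite ler_sqr ?nnegrE// ?sqrtr_ge0// ltW.
have h2 : sqdist (avgc j i w) (sel j i w) <= sqdist (avgc j i w) (c (j := j) l).
  have := argmxP (fun l => - sqdist (avgc j i w) (c (j := j) l)) l.
  by rewrite lerN2.
have h3 := sqdist_triangle (a r w) (avgc j i w) (sel j i w).
have h4 := sqdist_triangle (avgc j i w) (a r w) (c (j := j) l).
rewrite (sqdistC (avgc j i w) (a r w)) in h4; lra.
Qed.

Let near_cvg w : {ae mu, forall r : R, 0 < r <= T -> forall il : nat -> nat,
  (forall j, (il j < n j)%N /\ ts j (il j) < r <= ts j (il j).+1) ->
  sqdist (a r w) (sel j (il j) w) @[j --> \oo] --> 0}.
Proof.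
apply: ae_mono2 (avgmx_ae_cvg T0' w admissible_drift) (avgmx_ae_cvg T0' w admissible_vol).
move=> r c1 c2 rT il hil; have rT' : 0 <= r <= T by case/andP: rT => r0 ->; rewrite ltW.
have xr j : ts j (il j) <= r <= ts j (il j) + hh j.
  have [iN /andP[r1 r2]] := hil j; rewrite (ltW r1) (le_trans r2)//.
  by have [_ _ _ /(_ _ iN)] := hp j; rewrite lerBlDl.
have {}c1 := c1 rT hh (fun j => ts j (il j)) h0 ch xr.
have {}c2 := c2 rT hh (fun j => ts j (il j)) h0 ch xr.
have sq : \forall j \near \oo, 0 <= sqdist (a r w) (sel j (il j) w) <=
   6 * sqdist (a r w) (avgc j (il j) w) + 4 * hh j ^+ 2.
  by apply: nearW => j; rewrite sqdist_ge0 sel_near//; have [] := hil j.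
apply: (squeeze_cvgr sq); first exact: cvg_cst.
have ch2 : hh j ^+ 2 @[j --> \oo] --> (0 : R).
  by rewrite -[X in _ --> X](mulr0 (0 : R)); apply: cvgM.
rewrite -[X in _ --> X](addr0 (0 : R)); apply: cvgD.
  rewrite -[X in _ --> X](mulr0 (6 : R)); apply: cvgM; first exact: cvg_cst.
  by rewrite -[X in _ --> X](addr0 (0 : R)); apply: cvgD.
by rewrite -[X in _ --> X](mulr0 (4 : R)); apply: cvgM; first exact: cvg_cst.
Qed.

Let cells_bnd p r' (F : nat -> nat -> Omega T m -> 'M[R]_(p, r')) j r w i i' :
  (forall l, `|F j l w i i'| <= K) -> `|cells (n j) (ts j) (F j) r w i i'| <= K.
Proof.
move=> hF; have [r0|r0] := leP r 0; first by rewrite (cells0 (hp j))// mxE normr0.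
have [rT|rT] := leP r T; last first.
  rewrite /cells big1 ?mxE ?normr0// => l /andP[_ rl].
  have /andP[_ h2] := partition_itv (hp j) (ltn_ord l).
  by have := lt_le_trans rT (le_trans rl h2); rewrite ltxx.
have rT' : 0 < r <= T by rewrite r0.
have [l lN rl] := partition_locate (hp j) rT'.
by rewrite (cellsE (hp j) _ _ lN rl).
Qed.

Let G1_jm j : jointly_measurable (G1 j).
Proof.
apply: jointly_measurable_cells => l i i' lN.
have := sf_drift (fam j) lN => /filt_measurable_Fmeas/(_ i i'); apply: Fmeas_measurable.
by have /andP[] := partition_itv (hp j) (ltnW lN).
Qed.

Let G2_jm j : jointly_measurable (G2 j).
Proof.
apply: jointly_measurable_cells => l i i' lN.
have := sf_vol (fam j) lN => /filt_measurable_Fmeas/(_ i i'); apply: Fmeas_measurable.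
by have /andP[] := partition_itv (hp j) (ltnW lN).
Qed.

Let cvg_cells w : {ae mu, forall r, 0 < r <= T ->
  frob (a1 r w - G1 j r w) ^+ 2 @[j --> \oo] --> 0 /\
  frob (a2 r w - G2 j r w) ^+ 2 @[j --> \oo] --> 0}.
Proof.
apply: ae_mono (near_cvg w) => r hr rT.
pose il j : nat := projT1 (cid2 (partition_locate (hp j) rT)).
have ilP j : (il j < n j)%N /\ ts j (il j) < r <= ts j (il j).+1.
  by rewrite /il; case: cid2.
have {}hr := hr rT il ilP.
split; apply: (squeeze_cvgr (f := cst 0) _ _ hr); try exact: cvg_cst; apply: nearW => j;
  rewrite sqr_ge0 /=; have [iN ri] := ilP j.
  by rewrite /G1 (cellsE (hp j) _ _ iN ri) /sqdist lerDl sqr_ge0.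
by rewrite /G2 (cellsE (hp j) _ _ iN ri) /sqdist lerDr sqr_ge0.
Qed.

Let D1_cvg : dist2 P T a1 (G1 j) @[j --> \oo] --> 0%E.
Proof.
apply: (@dist2_cvg0 _ _ _ _ _ _ T0' _ _ ((d * 1)%:R * (2 * K) ^+ 2)).
- exact: gm_jm admissible_drift.
- exact: G1_jm.
- move=> j r w rT; apply: frob_le_entries => [|i i']; first by rewrite mulr_ge0.
  rewrite !mxE (le_trans (ler_normB _ _))// mulr_natl mulr2n lerD//.
    exact: (gm_bnd admissible_drift).
  by apply: (@cells_bnd _ _ (fun j i w => (sel j i w).1)) => l; have [h _] := hK (cA (nearest j l w)).
- by move=> w; apply: ae_mono (cvg_cells w) => r hr /hr[].
Qed.

Let D2_cvg : dist2 P T a2 (G2 j) @[j --> \oo] --> 0%E.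
Proof.
apply: (@dist2_cvg0 _ _ _ _ _ _ T0' _ _ ((d * m)%:R * (2 * K) ^+ 2)).
- exact: gm_jm admissible_vol.
- exact: G2_jm.
- move=> j r w rT; apply: frob_le_entries => [|i i']; first by rewrite mulr_ge0.
  rewrite !mxE (le_trans (ler_normB _ _))// mulr_natl mulr2n lerD//.
    exact: (gm_bnd admissible_vol).
  by apply: (@cells_bnd _ _ (fun j i w => (sel j i w).2)) => l; have [_ h] := hK (cA (nearest j l w)).
- by move=> w; apply: ae_mono (cvg_cells w) => r hr /hr[].
Qed.

(** Young's inequality with a free weight [cc] bounds first moments by squared distances: pointwise
    in time for the drift, in L2(P) for the stochastic integral. *)
Let coord_bound j (t cc : R) i : 0 <= t <= T -> 0 < cc ->
  (\int[P]_w `|(ev (state P a w) t - step_state (n j) (ts j) (sel j) t w) i 0|%:E <=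
   (cc / 2 * (T + 1))%:E + ((2 * cc)^-1)%:E *
     (dist2 P T a1 (G1 j) + (4 * c2 R)%:E * dist2 P T a2 (G2 j)))%E.
Proof.
move=> tT cc0; have /andP[t0 tT'] := tT.
have icc : 0 <= (2 * cc)^-1 by rewrite invr_ge0 mulr_ge0// ltW.
have cc2 : 0 <= cc / 2 by rewrite divr_ge0// ltW.
pose S := step_vol (hp j) (fam j).
pose D w : R := primitive (fun r w => a1 r w i 0) t w -
  \sum_(l < n j) (Num.min (ts j l.+1) t - Num.min (ts j l) t) * (sel j l w).1 i 0.
pose M w : R := (ev (ito P a2 w) t - sp_integral S t w) i 0.
have E w : (ev (state P a w) t - step_state (n j) (ts j) (sel j) t w) i 0 = D w + M w.
  rewrite admissible_stateE// (step_stateE (hp j) (fam j)) /D /M -/S !mxE summxE.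
  rewrite (eq_bigr (fun l : 'I_(n j) => (Num.min (ts j l.+1) t - Num.min (ts j l) t) * (sel j l w).1 i 0)).
    by rewrite !opprD; ring.
  by move=> l _; rewrite !mxE.
have jf := jointly_measurable_frob2 (jointly_measurableB (gm_jm admissible_drift) (G1_jm j)).
pose Q w : \bar R := (\int[mu]_(r in `[0%R, T]) (frob (a1 r w - G1 j r w) ^+ 2)%:E)%E.
have mQ : measurable_fun setT Q.
  by apply: (measurable_time_integral jf _ (lexx T)) => z; rewrite lee_fin sqr_ge0.
have Q0 w : (0 <= Q w)%E by apply: integral_ge0 => r _; rewrite lee_fin sqr_ge0.
have bD w : (`|D w|%:E <= (cc / 2 * T)%:E + ((2 * cc)^-1)%:E * Q w)%E.
  have iA := good_section_integrable (g1 i) w tT'.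
  have mG (s : R) : s <= T -> measurable_fun `[0, s] (fun r => G1 j r w i 0).
    move=> sT; apply/measurable_EFinP.
    apply: (@measurable_time_section _ _ _ (fun z : R * Omega T m => (G1 j z.1 z.2 i 0)%:E) w s _ sT).
    by apply/measurable_EFinP; exact: G1_jm.
  have iG : mu.-integrable `[0, t] (EFin \o (fun r => G1 j r w i 0)).
    apply: measurable_bounded_integrable => //.
    - by rewrite /= lebesgue_measure_itv/=; case: ifP; rewrite ?ltry.
    - exact: mG.
    - exists K; split; first exact: num_real.
      move=> M' KM' r _ /=; apply: le_trans (ltW KM').
      by apply: (@cells_bnd _ _ (fun j i w => (sel j i w).1)) => l; have [h _] := hK (cA (nearest j l w)).
  have -> : D w = (\int[mu]_(r in `[0, t]) (a1 r w i 0 - G1 j r w i 0))%R.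
    rewrite RintegralB//; congr (_ - _).
    rewrite (Rintegral_step (hp j) (c := fun l => (sel j l w).1 i 0))//.
    by move=> l r lN /andP[r1 r2]; rewrite /G1 (cellsE (hp j) _ _ lN)// r1 ltW.
  have iB : mu.-integrable `[0, t] (EFin \o (fun r => a1 r w i 0 - G1 j r w i 0)).
    rewrite (_ : EFin \o _ = (fun r => (a1 r w i 0)%:E - (G1 j r w i 0)%:E)%E).
      by apply: integrableB; [exact: measurable_itv|exact: iA|exact: iG].
    by apply/funext.
  apply: (@le_trans _ _ (\int[mu]_(r in `[0%R, t]) `|a1 r w i 0 - G1 j r w i 0|%:E)%E).
    have h : `|\int[mu]_(r in `[0, t]) (a1 r w i 0 - G1 j r w i 0)|%R <=
        (\int[mu]_(r in `[0, t]) `|a1 r w i 0 - G1 j r w i 0|)%R.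
      by apply: le_normr_Rintegral; [exact: measurable_itv|exact: iB].
    rewrite -lee_fin in h; apply: (le_trans h); rewrite /Rintegral fineK//.
    apply: integrable_fin_num; first exact: measurable_itv.
    exact: (integrable_abse iB).
  apply: (@le_trans _ _ (\int[mu]_(r in `[0%R, T]) ((cc / 2)%:E + ((2 * cc)^-1)%:E * (frob (a1 r w - G1 j r w) ^+ 2)%:E))%E).
    rewrite integral_mkcond [leRHS]integral_mkcond; apply: le_integral_pointwise => r _.
    rewrite !patchE; case: ifPn => [/set_mem /=|_]; last first.
      by case: ifP => // _; rewrite -EFinM -EFinD lee_fin addr_ge0// mulr_ge0// sqr_ge0.
    rewrite in_itv /= => /andP[r0 rt]; rewrite mem_set/=; last by rewrite in_itv /= r0 (le_trans rt).
    rewrite -EFinM -EFinD lee_fin young//.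
    have := frob_entry (a1 r w - G1 j r w) i 0; rewrite !mxE => h.
    by rewrite -ler_sqr ?nnegrE ?frob_ge0// in h; rewrite real_normK ?num_real in h.
  rewrite ge0_integralD//=; last 2 first.
  - by move=> r _; rewrite -EFinM lee_fin mulr_ge0// sqr_ge0.
  - by apply: measurable_funeM; exact: (measurable_time_section w jf (lexx T)).
  rewrite integral_cst_itv// ge0_integralZl//=.
  - exact: (measurable_time_section w jf (lexx T)).
  - by move=> r _; rewrite lee_fin sqr_ge0.
have mM : measurable_fun setT M.
  rewrite /M (_ : (fun w => _) = fun w => ev (ito P a2 w) t i 0 - sp_integral S t w i 0).
    apply: measurable_funB; last exact: sp_integral_measurable.
    by apply: ev_measurable; have [] := ito_good hP T0 admissible_vol.
  by apply/funext => w; rewrite !mxE.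
have bM : (\int[P]_w `|M w|%:E <= (cc / 2)%:E + ((2 * cc)^-1)%:E * ((4 * c2 R)%:E * dist2 P T a2 (G2 j)))%E.
  apply: (le_trans (integral_norm_le_moment2 P cc0 mM)); rewrite leeD2l// lee_wpmul2l ?lee_fin//.
  have := is_ito_sp hP T0' S (gm_jm admissible_vol) (ito_good hP T0 admissible_vol) tT.
  have dm := dist2_mono P (gm_jm admissible_vol) (G2_jm j) tT' (lexx T).
  move=> h; apply: (@le_trans _ _ (vmoment2 P (fun w => ev (ito P a2 w) t - sp_integral S t w)%R)).
    exact: (@moment2_entry _ _ _ _ _ (fun w => ev (ito P a2 w) t - sp_integral S t w)).
  by apply: (le_trans h); rewrite lee_wpmul2l// lee_fin mulr_ge0// c2_ge0.
apply: (@le_trans _ _ (\int[P]_w (((cc / 2 * T)%:E + ((2 * cc)^-1)%:E * Q w) + `|M w|%:E))%E).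
  apply: le_integral_pointwise => w _; rewrite E.
  by apply: (@le_trans _ _ (`|D w|%:E + `|M w|%:E)%E); [rewrite -EFinD lee_fin ler_normD|exact: leeD2r].
have mcQ : measurable_fun setT (fun w => ((2 * cc)^-1)%:E * Q w)%E by exact: measurable_funeM.
have ccT : (0 <= (cc / 2 * T)%:E)%E by rewrite lee_fin mulr_ge0.
have cQ0 w : (0 <= ((2 * cc)^-1)%:E * Q w)%E by rewrite mule_ge0// lee_fin.
rewrite ge0_integralD//=; last 3 first.
- by move=> w _; exact: adde_ge0.
- by apply: emeasurable_funD => //; exact: measurable_cst.
- by apply/measurable_EFinP; exact: measurableT_comp.
have iQ : (\int[P]_w Q w = dist2 P T a1 (G1 j))%E by [].
rewrite ge0_integralD//= ge0_integralZl//= iQ integral_cst//= probability_setT mule1.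
apply: (le_trans (leeD2l _ bM)).
move: (dist2_ge0 P T a1 (G1 j)) (dist2_ge0 P T a2 (G2 j)).
move: (dist2 P T a1 (G1 j)) (dist2 P T a2 (G2 j)) => x y x0 y0.
rewrite ge0_muleDr//; last by rewrite mule_ge0// lee_fin mulr_ge0// c2_ge0.
by rewrite mulrDr mulr1 EFinD addeACA.
Qed.

Lemma nearest_state_cvg (t e : R) : 0 <= t <= T -> 0 < e -> \forall j \near \oo,
  (\int[P]_w (l1 (ev (state P a w) t - step_state (n j) (ts j) (sel j) t w))%:E <= e%:E)%E.
Proof.
move=> tT e0; pose L : R := d%:R * ((T + 1) / 2 + (1 + 4 * c2 R) / 2) + 1.
have c20 := c2_ge0 R.
have L0 : 0 < L by rewrite ltr_wpDl// mulr_ge0// addr_ge0// divr_ge0// addr_ge0// mulr_ge0.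
(* Once both squared distances are below [cc ^+ 2], the bound for a coordinate is linear in [cc],
   and [L] collects the coefficients of all coordinates. *)
pose cc := e / L; have cc0 : 0 < cc by rewrite divr_gt0.
have q0 : 0 < cc ^+ 2 by rewrite exprn_gt0.
have [N1 _ hN1] := cvge0_le q0 D1_cvg; have [N2 _ hN2] := cvge0_le q0 D2_cvg.
exists (maxn N1 N2) => // j; rewrite /mkset geq_max => /andP[jN1 jN2].
have {hN1}b1 := hN1 j jN1; have {hN2}b2 := hN2 j jN2; rewrite /mkset in b1 b2.
have icc : 0 <= (2 * cc)^-1 by rewrite invr_ge0 mulr_ge0// ltW.
have bi i : (\int[P]_w `|(ev (state P a w) t - step_state (n j) (ts j) (sel j) t w) i 0|%:E <=
    (cc * ((T + 1) / 2 + (1 + 4 * c2 R) / 2))%:E)%E.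
  apply: (le_trans (coord_bound j i tT cc0)).
  apply: (@le_trans _ _ ((cc / 2 * (T + 1))%:E + ((2 * cc)^-1)%:E * ((cc ^+ 2)%:E + (4 * c2 R)%:E * (cc ^+ 2)%:E))%E).
    apply: leeD2l; apply: lee_wpmul2l; first by rewrite lee_fin.
    by apply: (leeD b1); apply: (lee_wpmul2l _ b2); rewrite lee_fin mulr_ge0.
  rewrite -(EFinM (4 * c2 R)) -(EFinD (cc ^+ 2)) -EFinM -EFinD lee_fin le_eqVlt.
  apply/orP; left; apply/eqP.
  by field; rewrite gt_eqF.
rewrite (_ : (\int[P]_w _)%E = (\sum_(i < d) \int[P]_w `|(ev (state P a w) t -
    step_state (n j) (ts j) (sel j) t w) i 0|%:E)%E); last first.
  rewrite -ge0_integral_sum//.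
  - by apply: eq_integral => w _; rewrite sumEFin.
  - move=> i; apply/measurable_EFinP; apply: measurableT_comp => //.
    rewrite (_ : (fun w => _) = fun w => ev (state P a w) t i 0 - step_state (n j) (ts j) (sel j) t w i 0).
      apply: measurable_funB; first exact: state_coord_measurable.
      by apply: (Fmeas_measurable _ (step_state_meas (hp j) (fam j) i tT)); case/andP: tT.
    by apply/funext => w; rewrite !mxE.
apply: (le_trans (lee_sum _ (fun i _ => bi i))).
rewrite sumEFin lee_fin sumr_const card_ord -[X in X <= _]mulr_natl mulrCA.
rewrite /cc mulrAC ler_pdivrMr// ler_wpM2l ?(ltW e0)//.
by rewrite /L lerDl; exact: ler01.
Qed.

End Approximation.

End AdmissibleState.

(** * Rounding a stopping time up to a grid *)

Section GridStopping.
Context (R : realType) (T : R) (m : nat).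
Hypothesis T0 : 0 < T.
Variables (n : nat) (ts : nat -> R) (h : R).
Hypothesis hp : is_partition T n ts h.
Variable tau : Omega T m -> R.
Hypothesis st : stopping_time tau.

(** The first grid point not before [tau]; [find] returns [n] when no earlier index qualifies, and
    [ts n] is [T]. Rounding up keeps a stopping time. *)
Definition grid_index w := find (fun k => tau w <= ts k) (iota 0 n).

Lemma grid_index_le w : (grid_index w <= n)%N.
Proof. by rewrite -[X in (_ <= X)%N](size_iota 0) find_size. Qed.

Lemma le_grid_index w : tau w <= ts (grid_index w).
Proof.
have [h1|h1] := ltnP (grid_index w) n; last first.
  have /eqP -> : grid_index w == n by rewrite eqn_leq grid_index_le.
  by have [_ -> _ _] := hp; case: st => /(_ w)/andP[].
have := h1; rewrite -{1}(size_iota 0 n) -has_find => /(nth_find 0%N).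
by rewrite nth_iota.
Qed.

Lemma grid_index_leE k w : (k <= n)%N -> (grid_index w <= k)%N = (tau w <= ts k).
Proof.
move=> kn; apply/idP/idP => [gk|tk].
  exact: le_trans (le_grid_index w) (partition_mono hp gk kn).
rewrite leqNgt; apply/negP => kg; have := before_find 0%N kg.
have kn' := leq_trans kg (grid_index_le w).
by rewrite nth_iota// tk.
Qed.

Lemma grid_index_filt k : (k <= n)%N -> filt (ts k) [set w | (grid_index w <= k)%N].
Proof.
move=> kn; rewrite (_ : [set w | _] = [set w | tau w <= ts k]).
  exact: (proj2 st _ (partition_itv hp kn)).
by apply/seteqP; split=> w /=; rewrite grid_index_leE.
Qed.

Lemma grid_index_measurable k : (k <= n)%N -> measurable [set w | (grid_index w <= k)%N].
Proof.
move=> kn; have /andP[_ kT] := partition_itv hp kn.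
exact: (filt_measurable_set kT (grid_index_filt kn)).
Qed.

Lemma grid_index_ub w : ts (grid_index w) <= tau w + h.
Proof.
have := grid_index_le w; case E : (grid_index w) => [|k] kn.
  have [-> tn _ th] := hp; have [/(_ w)/andP[t0 _] _] := st; rewrite addr_ge0//.
  have n0 := partition_size_gt0 hp T0.
  apply: le_trans (th 0%N n0); rewrite subr_ge0.
  exact: (partition_mono hp (leqnSn 0) n0).
have [_ _ _ /(_ k kn)] := hp.
have : ts k < tau w by rewrite ltNge -grid_index_leE ?(ltnW kn)// E ltnn.
lra.
Qed.

Lemma grid_stopping_time : stopping_time (fun w => ts (grid_index w)).
Proof.
split=> [w|s sT]; first exact: (partition_itv hp (grid_index_le w)).
rewrite (_ : [set w | _] = \bigcup_(k in [set k : 'I_n.+1 | ts k <= s]) [set w | (grid_index w <= k)%N]).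
  rewrite filtE; apply: fin_bigcup_measurable => // k /= ks; rewrite -filtE.
  have kn : (k <= n)%N by rewrite -ltnS.
  exact: filt_sub (grid_index_filt kn).
apply/seteqP; split=> w /=.
  by move=> gs; exists (Ordinal (n := n.+1) (grid_index_le w)) => /=.
move=> [k /= ks gk]; apply: le_trans ks; apply: (partition_mono hp gk).
by rewrite -ltnS.
Qed.

End GridStopping.

Lemma grid_index_refine (R : realType) (T : R) (m : nat) (n : nat) (ts : nat -> R) (h : R)
    (tau : Omega T m -> R) w : is_partition T n ts h -> stopping_time tau ->
  (exists2 j, (j <= n)%N & tau w = ts j) -> ts (grid_index n ts tau w) = tau w.
Proof.
move=> hp st [j jn e]; apply/eqP; rewrite eq_le (le_grid_index hp st) andbT e.
by apply: (partition_mono hp _ jn); rewrite (grid_index_leE hp st)// e.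
Qed.

Lemma finite_enumeration (X : eqType) (A : set X) : finite_set A -> A !=set0 ->
  exists q, exists c : 'I_q.+1 -> X, range c = A.
Proof.
move=> /finite_seqP[s ->] [x0 /= xs]; have s0 : (0 < size s)%N by case: s xs.
exists (size s).-1, (fun i : 'I_(size s).-1.+1 => nth x0 s i); apply/seteqP; split=> [_ [i _ <-]|x xs'] /=.
  by apply: mem_nth; rewrite -[X in (_ < X)%N](prednK s0).
have xi : (index x s < (size s).-1.+1)%N by rewrite prednK// index_mem.
by exists (Ordinal xi) => //=; rewrite nth_index.
Qed.

Lemma cvge_near_le (R : realType) (u : nat -> \bar R) (x : \bar R) (e : R) : x \is a fin_num ->
  u n @[n --> \oo] --> x -> 0 < e -> \forall n \near \oo, (x <= u n + e%:E)%E.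
Proof.
move=> /fineK <- /fine_cvgP[uf /cvgrPdist_le uc] e0; have {}uc := uc _ e0.
near=> n; have un : u n \is a fin_num by near: n.
rewrite -(fineK un) -EFinD lee_fin -lerBlDl (le_trans (ler_norm _))//.
by near: n.
Unshelve. all: by end_near. Qed.

(** * The primal gain of one control and one stopping time is asymptotically below the dual value *)

Section LowerBound.
Context (R : realType) (T : R) (hT : 0 < T) (d m : nat)
  (P0 : probability (Omega T m) R) (hP0 : wiener_measure P0)
  (A : set ('cV[R]_d * 'M[R]_(d, m))) (hA0 : A !=set0) (hA : compact A)
  (n : R -> nat) (t : R -> nat -> R)
  (ht : forall h, 0 < h -> is_partition T (n h) (t h) h)
  (hnested : forall h h', 0 < h' -> h' < h ->
     forall i, (i <= n h)%N -> exists2 j, (j <= n h')%N & t h i = t h' j)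
  (N : R -> set ('cV[R]_d * 'M[R]_(d, m)))
  (hN : forall h, 0 < h -> finite_net A (N h) h)
  (g : 'cV[R]_d -> R) (Kg : R) (gK : forall x, `|g x| <= Kg) (hgc : unif_continuous g).

Variables (a : R -> Omega T m -> control R d m) (tau : Omega T m -> R).
Hypotheses (ha : admissible A a) (st : stopping_time tau).

Let X w := state P0 a w.
Let T0' : 0 <= T. Proof. exact: ltW. Qed.

Let gX_measurable (s : R) : 0 <= s <= T -> measurable_fun setT (fun w => g (ev (X w) s)).
Proof.
move=> sT; apply: (unif_measurable gK hgc) => i.
have [K K0 hK] := compact_control_bound hA.
exact: (state_coord_measurable hP0 hT K0 hK ha).
Qed.

Let bounded_integrable (f : Omega T m -> R) : measurable_fun setT f -> (forall w, `|f w| <= Kg) ->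
  P0.-integrable setT (EFin \o f).
Proof. by move=> mf fK; apply: isL2_integrable; exact: (isL2_bounded P0 mf fK). Qed.

(** The rounded times decrease the error to zero along every continuous path, and [g] is bounded:
    dominated convergence. *)
Let grid_stop e : 0 < e -> exists2 h, 0 < h &
  ('E_P0[fun w => g (ev (X w) (tau w))] <=
   \int[P0]_w (g (ev (X w) (t h (grid_index (n h) (t h) tau w))))%:E + e%:E)%E.
Proof.
move=> e0; pose hl (l : nat) : R := l.+1%:R^-1.
have hl0 l : 0 < hl l by rewrite invr_gt0.
pose F l w := g (ev (X w) (t (hl l) (grid_index (n (hl l)) (t (hl l)) tau w))).
have mF l : measurable_fun setT (F l).
  have hp := ht (hl0 l).
  apply: (measurable_stopped (f := fun k w => g (ev (X w) (t (hl l) k))) (grid_index_le (n (hl l)) (t (hl l)) tau)) => k kn.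
    exact: (grid_index_measurable hp st kn).
  exact: gX_measurable (partition_itv hp kn).
have cF w : F l w @[l --> \oo] --> g (ev (X w) (tau w)).
  have ct : t (hl l) (grid_index (n (hl l)) (t (hl l)) tau w) @[l --> \oo] --> tau w.
    have sq : \forall l \near \oo, tau w <= t (hl l) (grid_index (n (hl l)) (t (hl l)) tau w) <= tau w + hl l.
      apply: nearW => l; have hp := ht (hl0 l).
      by rewrite (le_grid_index hp st) (grid_index_ub hT hp st).
    apply: (squeeze_cvgr sq); first exact: cvg_cst.
    by rewrite -[X in _ --> X]addr0; apply: cvgD; [exact: cvg_cst|exact: cvg_harmonic].
  have cX i : ev (X w) (t (hl l) (grid_index (n (hl l)) (t (hl l)) tau w)) i 0 @[l --> \oo] --> ev (X w) (tau w) i 0.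
    apply: (@cvg_comp _ _ _ _ (fun s => ev (X w) s i 0) _ _ _ ct).
    by apply: continuous_coord; exact: continuous_ev.
  apply/cvgrPdist_lt => e' e'0; have [dl dl0 hdl] := unif_continuous_l1 hgc e'0.
  have cl : l1 (ev (X w) (tau w) - ev (X w) (t (hl l) (grid_index (n (hl l)) (t (hl l)) tau w))) @[l --> \oo] --> (0 : R).
    rewrite (_ : 0 = \sum_(i < d) `|ev (X w) (tau w) i 0 - ev (X w) (tau w) i 0|); last first.
      by rewrite big1// => i _; rewrite subrr normr0.
    rewrite /l1 (_ : (fun l : nat => _) = fun l => \sum_(i < d) `|ev (X w) (tau w) i 0 -
      ev (X w) (t (hl l) (grid_index (n (hl l)) (t (hl l)) tau w)) i 0|); last first.
      by apply/funext => l; apply: eq_bigr => i _; rewrite !mxE.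
    by apply: cvg_rsum => i; apply: cvg_norm; apply: cvgB; [exact: cvg_cst|exact: cX].
  move/cvgrPdist_lt: cl => /(_ _ dl0); apply: filterS => l.
  by rewrite sub0r normrN ger0_norm ?l1_ge0// => /hdl.
have mG : measurable_fun setT (fun w => g (ev (X w) (tau w))).
  by apply: (measurable_fun_cvg mF) => w _; exact: cF.
have [] := @dominated_convergence _ (Omega T m) R P0 setT measurableT
    (fun l w => (F l w)%:E) (fun w => (g (ev (X w) (tau w)))%:E) (fun=> Kg%:E).
- by move=> l; apply/measurable_EFinP.
- exact/measurable_EFinP.
- apply/aeW => w _; apply/fine_cvgP; split; first exact: nearW.
  exact: cF.
- exact: finite_measure_integrable_cst.
- by apply/aeW => w l _; exact: gK.
move=> _ _ cI.
have fI : (\int[P0]_w (g (ev (X w) (tau w)))%:E)%E \is a fin_num.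
  by apply: integrable_fin_num => //; exact: (bounded_integrable mG).
have [l hl'] := filter_ex (cvge_near_le fI cI e0).
by exists (hl l) => //; rewrite unlock; exact: hl'.
Qed.

(** The states converge at each fixed time, not at random ones. The stopping time has values in the
    fixed grid of [h], so the errors at its finitely many points can be added while the control is
    refined. *)
Let coarse_control h tau' e : 0 < h -> stopping_time tau' ->
  (forall w, exists2 k, (k <= n h)%N & tau' w = t h k) -> 0 < e ->
  forall hh : nat -> R, (forall j, 0 < hh j) -> hh j @[j --> \oo] --> 0 ->
  \forall j \near \oo, (\int[P0]_w (g (ev (X w) (tau' w)))%:E <=
    dual_value P0 g (n (hh j)) (t (hh j)) (N (hh j)) + e%:E)%E.
Proof.
move=> h0 st' tau'_grid e0 hh hh0 chh.
have [K K0 hK] := compact_control_bound hA.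
have /choice[Fc hFc] : forall j, exists F : {q : nat & 'I_q.+1 -> control R d m}, range (projT2 F) = N (hh j).
  move=> j; have [fN NA Nn] := hN (hh0 j).
  have [b Ab] := hA0; have [b' Nb' _] := Nn b Ab.
  have [q [c hc]] := finite_enumeration fN (ex_intro _ b' Nb').
  by exists (existT _ q c).
pose q j := projT1 (Fc j); pose c j : 'I_(q j).+1 -> control R d m := projT2 (Fc j).
have cN j l : N (hh j) (c j l) by rewrite -hFc; exists l.
have cA j l : A (c j l) by have [_ NA _] := hN (hh0 j); exact/NA/cN.
have cnet j b : A b -> exists l, cdist b (c j l) <= hh j.
  move=> Ab; have [_ _ /(_ b Ab)[b' Nb' bb']] := hN (hh0 j).
  by move: Nb'; rewrite -hFc => -[l _ lb]; exists l; rewrite /c lb.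
have hp j := ht (hh0 j).
pose al j := nearest a (fun j => t (hh j)) hh c j.
pose Y j s w := step_state (n (hh j)) (t (hh j)) (selected (c j) (al j)) s w.
have near_l1 (k : 'I_(n h).+1) e' : 0 < e' -> \forall j \near \oo,
    (\int[P0]_w (l1 (ev (X w) (t h k) - Y j (t h k) w))%:E <= e'%:E)%E.
  move=> e'0; have kT : 0 <= t h k <= T by apply: (partition_itv (ht h0)); rewrite -ltnS.
  exact: (nearest_state_cvg hP0 hT K0 hK ha hp hh0 chh cA cnet kT e'0).
have al_meas j i l : (i < n (hh j))%N -> filt (t (hh j) i) [set w | al j i w = l].
  by move=> iN; exact: (nearest_meas hT hK ha hp hh0 c l iN).
have e2 : 0 < e / 2 by rewrite divr_gt0.
have [dl dl0 hdl] := unif_continuous_l1 hgc e2.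
have Kg0 : 0 <= Kg by exact: le_trans (gK 0).
(* A bounded uniformly continuous function has an affine modulus: error [e / 2] within distance
   [dl], slope [C] beyond it. *)
pose C := 2 * Kg / dl; have C0 : 0 <= C by rewrite divr_ge0 ?mulr_ge0// ltW.
have gC x y : g x <= g y + e / 2 + C * l1 (x - y).
  have [xy|xy] := ltP (l1 (x - y)) dl.
    have := hdl x y xy; rewrite ltr_norml => /andP[_].
    have : 0 <= C * l1 (x - y) by rewrite mulr_ge0// l1_ge0.
    lra.
  have : C * dl <= C * l1 (x - y) by rewrite ler_wpM2l.
  rewrite /C mulfVK ?gt_eqF//.
  have := gK x; have := gK y; rewrite !ler_norml => /andP[? ?] /andP[? ?]; lra.
(* The errors at the [(n h).+1] grid times, multiplied by [C], then sum to at most [e / 2]. *)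
pose e3 := e / 2 / (C * (n h).+1%:R + 1).
have c1 : 0 < C * (n h).+1%:R + 1 by rewrite ltr_wpDl// mulr_ge0.
have e30 : 0 < e3 by rewrite divr_gt0.
have hh_lt : \forall j \near \oo, hh j < h.
  move/cvgrPdist_lt: chh => /(_ _ h0); apply: filterS => j.
  by rewrite sub0r normrN ger0_norm// ltW.
have l1_all : \forall j \near \oo, forall k : 'I_(n h).+1,
    (\int[P0]_w (l1 (ev (X w) (t h k) - Y j (t h k) w))%:E <= e3%:E)%E.
  by apply: filter_forall => k; exact: near_l1.
have [J1 _ hJ1] := hh_lt; have [J2 _ hJ2] := l1_all.
exists (maxn J1 J2) => // j; rewrite /mkset geq_max => /andP[j1 j2].
have {hJ1}hj := hJ1 j j1; have {hJ2}lj := hJ2 j j2; rewrite /mkset in hj lj.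
(* By nesting the values of [tau'] lie on the finer grid, so this rounding does not move it. *)
pose ka := grid_index (n (hh j)) (t (hh j)) tau'.
have kaE w : t (hh j) (ka w) = tau' w.
  apply: (grid_index_refine (hp j) st'); have [k kn ->] := tau'_grid w.
  exact: (hnested (hh0 j) hj kn).
have fam : step_family (n (hh j)) (t (hh j)) (selected (c j) (al j)).
  by apply: selected_family => i l; exact: al_meas.
have mY s i : 0 <= s <= T -> measurable_fun setT (fun w => Y j s w i 0).
  by move=> sT; apply: (Fmeas_measurable _ (step_state_meas (hp j) fam i sT)); case/andP: sT.
have mgY : measurable_fun setT (fun w => g (Y j (tau' w) w)).
  rewrite (_ : (fun w => _) = fun w => g (Y j (t (hh j) (ka w)) w)); last first.
    by apply/funext => w; rewrite kaE.
  apply: (measurable_stopped (f := fun k w => g (Y j (t (hh j) k) w)) (grid_index_le (n (hh j)) (t (hh j)) tau')) => k kn.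
    exact: (grid_index_measurable (hp j) st' kn).
  by apply: (unif_measurable gK hgc) => i; exact: mY (partition_itv (hp j) kn).
have ml (k : 'I_(n h).+1) : measurable_fun setT (fun w => (l1 (ev (X w) (t h k) - Y j (t h k) w))%:E).
  apply/measurable_EFinP; apply: measurable_sum => i; apply: measurableT_comp => //.
  have kT : 0 <= t h k <= T by apply: (partition_itv (ht h0)); rewrite -ltnS.
  rewrite (_ : (fun w => _) = fun w => ev (X w) (t h k) i 0 - Y j (t h k) w i 0).
    by apply: measurable_funB; [exact: (state_coord_measurable hP0 hT K0 hK ha)|exact: mY].
  by apply/funext => w; rewrite !mxE.
pose B w : \bar R := (C%:E * \sum_(k < (n h).+1) (l1 (ev (X w) (t h k) - Y j (t h k) w))%:E)%E.
have S0 w : (0 <= \sum_(k < (n h).+1) (l1 (ev (X w) (t h k) - Y j (t h k) w))%:E)%E.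
  by apply: sume_ge0 => k _; rewrite lee_fin l1_ge0.
have mS : measurable_fun setT (fun w => \sum_(k < (n h).+1) (l1 (ev (X w) (t h k) - Y j (t h k) w))%:E)%E.
  by apply: emeasurable_sum => k; exact: ml.
have mB : measurable_fun setT B by exact: measurable_funeM.
have B0 w : (0 <= B w)%E by rewrite mule_ge0// lee_fin.
have iB : (\int[P0]_w B w <= (e / 2)%:E)%E.
  rewrite /B ge0_integralZl//= ge0_integral_sum//=; last first.
    by move=> k w _; rewrite lee_fin l1_ge0.
  apply: (@le_trans _ _ (C%:E * \sum_(k < (n h).+1) e3%:E)%E).
    by apply: lee_wpmul2l; [rewrite lee_fin|apply: lee_sum => k _; exact: lj].
  rewrite sumEFin -EFinM lee_fin sumr_const card_ord -[e3 *+ _]mulr_natl mulrA /e3.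
  by rewrite mulrCA ler_piMr ?(ltW e2)// ler_pdivrMr// mul1r lerDl ler01.
have igY : P0.-integrable setT (EFin \o (fun w => g (Y j (tau' w) w))).
  by apply: bounded_integrable => // w; exact: gK.
have mgY2 : measurable_fun setT (fun w => g (Y j (tau' w) w) + e / 2).
  by apply: measurable_funD.
have igY2 : P0.-integrable setT (EFin \o (fun w => g (Y j (tau' w) w) + e / 2)).
  apply: isL2_integrable; apply: (isL2_bounded (K := Kg + e / 2) P0 mgY2) => w.
  by rewrite (le_trans (ler_normD _ _))// lerD// ger0_norm// ltW.
have iB' : P0.-integrable setT B.
  apply/integrableP; split=> //; under eq_integral do rewrite gee0_abs//.
  exact: le_lt_trans iB (ltry _).
apply: (@le_trans _ _ (\int[P0]_w ((g (Y j (tau' w) w) + e / 2)%:E + B w))%E).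
  apply: le_integral_pointwise => w _; have [k kn tk] := tau'_grid w.
  have kn' : (k < (n h).+1)%N by rewrite ltnS.
  apply: (@le_trans _ _ (g (Y j (tau' w) w) + e / 2 + C * l1 (ev (X w) (tau' w) - Y j (tau' w) w))%:E).
    by rewrite lee_fin; exact: gC.
  rewrite EFinD leeD2l// EFinM /B lee_wpmul2l ?lee_fin//.
  rewrite (bigD1 (Ordinal kn'))//= -tk leeDl//.
  by apply: sume_ge0 => l _; rewrite lee_fin l1_ge0.
rewrite integralD//.
have -> : (\int[P0]_w (g (Y j (tau' w) w) + e / 2)%:E = \int[P0]_w (g (Y j (tau' w) w))%:E + (e / 2)%:E)%E.
  rewrite -[X in (_ + X)%E]mule1 -(@probability_setT _ _ _ P0) -integral_cst// -integralD//.
  exact: finite_measure_integrable_cst.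
rewrite -addeA; apply: (@le_trans _ _ (\int[P0]_w (g (Y j (tau' w) w))%:E + e%:E)%E).
  apply: leeD2l; rewrite [X in (_ <= X)%E](_ : e%:E = ((e / 2)%:E + (e / 2)%:E)%E).
    exact: leeD2l.
  by rewrite -EFinD -splitr.
apply: leeD2r; apply: le_ereal_inf_tmp => _ [phi hphi ->].
under eq_integral do rewrite -kaE.
exact: (dual_payoff_ge hP0 hT (hp j) (fun i l => al_meas j i l) (grid_index_le _ _ _)
  (fun k kn => grid_index_filt (hp j) st' kn) hphi gK hgc (cN j)).
Qed.

Lemma lower_bound_seq e : 0 < e -> forall hh : nat -> R, (forall j, 0 < hh j) -> hh j @[j --> \oo] --> 0 ->
  \forall j \near \oo, ('E_P0[fun w => g (ev (X w) (tau w))] <=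
    dual_value P0 g (n (hh j)) (t (hh j)) (N (hh j)) + e%:E)%E.
Proof.
move=> e0 hh hh0 chh; have e2 : 0 < e / 2 by rewrite divr_gt0.
have [h h0 hE] := grid_stop e2.
have := coarse_control h0 (grid_stopping_time (ht h0) st) _ e2 hh0 chh.
have hg w : exists2 k, (k <= n h)%N & t h (grid_index (n h) (t h) tau w) = t h k.
  by exists (grid_index (n h) (t h) tau w) => //; exact: grid_index_le.
move=> /(_ hg)[J _ hJ]; exists J => // j /hJ; rewrite /mkset => hj.
apply: (le_trans hE); apply: (le_trans (leeD2r _ hj)).
by rewrite -addeA -EFinD -splitr.
Qed.

End LowerBound.

(** * One step of the controlled walk *)

Section FiniteSums.
Context (R : realType).

Lemma sqr_sum_le (I : finType) (x : I -> R) : (\sum_i x i) ^+ 2 <= #|I|%:R * \sum_i x i ^+ 2.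
Proof.
rewrite expr2 big_distrlr /=.
apply: (@le_trans _ _ (\sum_i \sum_j (x i ^+ 2 / 2 + x j ^+ 2 / 2))).
  apply: ler_sum => i _; apply: ler_sum => j _.
  have : 0 <= (x i - x j) ^+ 2 by rewrite sqr_ge0.
  rewrite sqrrB; lra.
rewrite (eq_bigr (fun i => #|I|%:R * (x i ^+ 2 / 2) + \sum_j x j ^+ 2 / 2)); last first.
  by move=> i _; rewrite big_split /= sumr_const mulr_natl.
rewrite big_split /= sumr_const -mulr_sumr -!mulr_suml -(mulr_natl _ #|I|).
move: (\sum_i x i ^+ 2) => S; lra.
Qed.

Lemma pow4_sum_le (I : finType) (x : I -> R) : (\sum_i x i) ^+ 4 <= #|I|%:R ^+ 3 * \sum_i x i ^+ 4.
Proof.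
rewrite (exprM _ 2 2); apply: (@le_trans _ _ ((#|I|%:R * \sum_i x i ^+ 2) ^+ 2)).
  by rewrite lerXn2r ?nnegrE ?sqr_ge0 ?sqr_sum_le// mulr_ge0// sumr_ge0// => i _; rewrite sqr_ge0.
rewrite exprMn (exprSr _ 2) -mulrA ler_wpM2l ?sqr_ge0//.
apply: le_trans (sqr_sum_le _) _; rewrite ler_wpM2l//.
by apply: ler_sum => i _; rewrite -exprM.
Qed.

Lemma isL2_norm d (X : measurableType d) (P : probability X R) (f : X -> R) :
  isL2 P f -> isL2 P (fun w => `|f w|).
Proof.
move=> Lf; have [mf _] := Lf; apply: le_isL2 Lf _ => [|w]; last by rewrite normr_id.
exact: measurableT_comp.
Qed.

Lemma l1_mulmx p q (M : 'M[R]_(p, q)) (v : 'cV[R]_q) (K : R) :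
  (forall i j, `|M i j| <= K) -> l1 (M *m v) <= p%:R * K * l1 v.
Proof.
move=> MK; rewrite -mulrA mulr_natl -[X in _ *+ X](card_ord p) -sumr_const.
apply: ler_sum => i _; rewrite mxE (le_trans (ler_norm_sum _ _ _))// /l1 mulr_sumr.
by apply: ler_sum => j _; rewrite normrM ler_wpM2r.
Qed.

End FiniteSums.

Section OneStep.
Context (R : realType) (T : R) (d m : nat) (P : probability (Omega T m) R).
Hypothesis hP : wiener_measure P.
Implicit Types (b : control R d m) (f : 'cV[R]_d -> R) (x : 'cV[R]_d) (w : Omega T m).

Definition inc (s t : R) b w : 'cV[R]_d := (t - s) *: b.1 + b.2 *m (ev w t - ev w s).

Lemma inc_entry s t b w i :
  inc s t b w i 0 = (t - s) * b.1 i 0 + \sum_j b.2 i j * incr s t w j.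
Proof. by rewrite !mxE; congr +%R; apply: eq_bigr => j _; rewrite !mxE. Qed.

Lemma inc_Imeas s t b i :
  measurable_fun [set: IOmega T m s t] (fun w : IOmega T m s t => inc s t b w i 0).
Proof.
rewrite (_ : (fun w => _) = fun w => (t - s) * b.1 i 0 + \sum_j b.2 i j * incr s t w j); last first.
  by apply/funext => w; exact: inc_entry.
apply: measurable_funD; first exact: measurable_cst.
by apply: measurable_sum => j; apply: measurable_funM; [exact: measurable_cst|exact: incr_Imeas].
Qed.

Lemma inc_Fmeas s t b i : 0 <= s -> s <= t -> Fmeas t (fun w => inc s t b w i 0).
Proof.
move=> s0 st; rewrite /Fmeas (_ : (fun w => _) = fun w => (t - s) * b.1 i 0 + \sum_j b.2 i j * incr s t w j); last first.
  by apply/funext => w; exact: inc_entry.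
apply: measurable_funD; first exact: measurable_cst.
apply: measurable_sum => j; apply: measurable_funM; first exact: measurable_cst.
by apply: measurable_funB; apply: Fmeas_ev; rewrite ?lexx ?st ?s0 ?(le_trans s0).
Qed.

Lemma inc_meas s t b i : 0 <= s -> s <= t -> t <= T -> measurable_fun setT (fun w => inc s t b w i 0).
Proof. by move=> s0 st tT; exact: Fmeas_measurable tT (inc_Fmeas b i s0 st). Qed.

(** The transition operator of one step under a frozen control. *)
Definition condE (s t : R) b f x : R := (\int[P]_w f (x + inc s t b w))%R.

(** A class that transitions, finite maxima and averages of translates preserve with the same
    constants, so the bounds do not deteriorate with the number of steps. *)
Definition blip (L K : R) f := [/\ 0 <= L, lip L f & forall x, `|f x| <= K].

Section Blip.
Variables (L K : R) (f : 'cV[R]_d -> R).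
Hypothesis fLK : blip L K f.

Lemma blip_measurable d0 (X : measurableType d0) (u : X -> 'cV[R]_d) :
  (forall i, measurable_fun setT (fun z => u z i 0)) -> measurable_fun setT (fun z => f (u z)).
Proof. by move=> mu; have [L0 fL _] := fLK; exact: lip_measurable L0 fL mu. Qed.

Variables (s t : R).
Hypotheses (s0 : 0 <= s) (st : s < t) (tT : t <= T).

Lemma shift_inc_meas b x i : measurable_fun setT (fun w => (x + inc s t b w) i 0).
Proof.
rewrite (_ : (fun w => _) = fun w => x i 0 + inc s t b w i 0); last by apply/funext => w; rewrite mxE.
by apply: measurable_funD; [exact: measurable_cst|exact: inc_meas (ltW st) tT].
Qed.

Lemma condE_L2 b x : isL2 P (fun w => f (x + inc s t b w)).
Proof.
have [_ _ fK] := fLK.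
apply: isL2_bounded => [|w]; last exact: fK.
by apply: blip_measurable => i; exact: shift_inc_meas.
Qed.

Lemma condE_integrable b x : P.-integrable setT (EFin \o (fun w => f (x + inc s t b w))).
Proof. exact: isL2_integrable (condE_L2 b x). Qed.

Lemma blip_condE b : blip L K (condE s t b f).
Proof.
have [L0 fL fK] := fLK; split=> // [x y|x].
  rewrite /condE -RintegralB//; [|exact: condE_integrable..].
  apply: (@le_trans _ _ (\int[P]_w (L * l1 (x - y)))%R); last first.
    by rewrite Rintegral_cst//= probability_setT mulr1.
  apply: le_trans (le_normr_Rintegral _ _) _ => //.
    by apply: isL2_integrable; apply: isL2B; exact: condE_L2.
  apply: le_Rintegral => //.
  - apply: isL2_integrable; have := isL2B (condE_L2 b x) (condE_L2 b y); exact: isL2_norm.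
  - exact: isL2_integrable (isL2_cst _ _).
  by move=> w _; rewrite (le_trans (fL _ _))// opprD addrACA subrr addr0.
apply: le_trans (le_normr_Rintegral _ _) _ => //; first exact: condE_integrable.
rewrite -[leRHS]mulr1 -[X in _ <= _ * X](_ : fine (P setT) = 1); last by rewrite probability_setT.
rewrite -Rintegral_cst//; apply: le_Rintegral => //.
- by apply: isL2_integrable; apply: isL2_norm; exact: condE_L2.
- exact: isL2_integrable (isL2_cst _ _).
Qed.

(** The Markov property in weak form, tested against variables of the past: the state is frozen and
    the independent increment integrated out. *)
Lemma condE_freeze b (Y : Omega T m -> R) (X : Omega T m -> 'cV[R]_d) :
  Fmeas s Y -> isL2 P Y -> (forall i, Fmeas s (fun w => X w i 0)) ->
  (\int[P]_w (Y w * f (X w + inc s t b w)) = \int[P]_w (Y w * condE s t b f (X w)))%R.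
Proof.
move=> mY LY mX; have [L0 fL fK] := fLK.
pose F (z : FOmega T m s * IOmega T m s t) : R := Y z.1 * f (X z.1 + inc s t b z.2).
have mF : measurable_fun setT F.
  apply: measurable_funM.
    exact: (measurableT_comp (mY : measurable_fun [set: FOmega T m s] Y) measurable_fst).
  apply: blip_measurable => i.
  rewrite [X in measurable_fun _ X](_ : _ = fun z : FOmega T m s * IOmega T m s t => X z.1 i 0 + inc s t b z.2 i 0).
    apply: measurable_funD.
      exact: (measurableT_comp (mX i : measurable_fun [set: FOmega T m s] _) measurable_fst).
    exact: (measurableT_comp (@inc_Imeas s t b i) measurable_snd).
  by apply/funext => z; rewrite mxE.
have mXi i : measurable_fun [set: Omega T m] (fun w => X w i 0).
  by apply: Fmeas_measurable (mX i); rewrite (le_trans (ltW st)).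
have LF : isL2 P (fun w => Y w * f (X w + inc s t b w)).
  rewrite (_ : (fun w => _) = fun w => f (X w + inc s t b w) * Y w); last by apply/funext => w; rewrite mulrC.
  apply: isL2_bounded_mul LY => [|w]; [|exact: fK].
  apply: blip_measurable => i.
  rewrite (_ : (fun w => _) = fun w => X w i 0 + inc s t b w i 0); last by apply/funext => w; rewrite mxE.
  by apply: measurable_funD => //; exact: inc_meas (ltW st) tT.
have [|] := @filt_freezing _ _ _ _ hP s t F s0 st tT mF _ (isL2_integrable LF).
  by move=> w; apply: isL2_integrable; exact: (isL2Z (Y w) (condE_L2 b (X w))).
rewrite /F /= => -> _; apply: eq_Rintegral => w _.
by rewrite RintegralZl//; exact: condE_integrable.
Qed.

End Blip.

Lemma gain_orth (s t : R) b (L : R) (G : Omega T m -> 'cV[R]_d) (Y : Omega T m -> R) :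
  0 <= s -> s <= t -> t <= T ->
  (forall i, Fmeas s (fun w => G w i 0)) -> (forall w i, `|G w i 0| <= L) ->
  Fmeas s Y -> isL2 P Y ->
  let gain w := \sum_i G w i 0 * (b.2 *m (ev w t - ev w s)) i 0 in
  isL2 P (fun w => Y w * gain w) /\ (\int[P]_w (Y w * gain w) = 0)%R.
Proof.
move=> s0 st tT mG GL mY LY gain.
have sT := le_trans st tT.
have E w : Y w * gain w = \sum_i \sum_j b.2 i j * ((Y w * G w i 0) * incr s t w j).
  rewrite /gain mulr_sumr; apply: eq_bigr => i _.
  rewrite mxE !mulr_sumr; apply: eq_bigr => j _; rewrite !mxE /incr; ring.
have h i j : isL2 P (fun w => (Y w * G w i 0) * incr s t w j) /\
    (\int[P]_w ((Y w * G w i 0) * incr s t w j) = 0)%R.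
  apply: (incr_martingale hP _ s0 st tT); first exact: (measurable_funM mY (mG i)).
  rewrite (_ : (fun w => _) = fun w => G w i 0 * Y w); last by apply/funext => w; rewrite mulrC.
  apply: isL2_bounded_mul LY => [|w]; [|exact: GL].
  exact: Fmeas_measurable (mG i).
have h' i j : isL2 P (fun w => b.2 i j * ((Y w * G w i 0) * incr s t w j)).
  by apply: isL2Z; case: (h i j).
split.
  rewrite (_ : (fun w => _) = fun w => \sum_i \sum_j b.2 i j * ((Y w * G w i 0) * incr s t w j)); last exact/funext.
  by apply: isL2_sum => i _; apply: isL2_sum.
under eq_Rintegral do rewrite E.
rewrite Rintegral_bigsum; last by move=> i; apply: isL2_integrable; apply: isL2_sum.
rewrite big1// => i _; rewrite Rintegral_bigsum; last by move=> j; exact: isL2_integrable.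
rewrite big1// => j _; rewrite RintegralZl//; last by apply: isL2_integrable; case: (h i j).
by have [_ ->] := h i j; rewrite mulr0.
Qed.

(* [C] absorbs [T] *)
Lemma moment4_inc (K : R) : 0 <= T -> exists2 C, 0 <= C &
  forall (s t : R) b, 0 <= s -> s <= t -> t <= T ->
    (forall i, `|b.1 i 0| <= K) -> (forall i j, `|b.2 i j| <= K) ->
    (\int[P]_w (l1 (inc s t b w) ^+ 4)%:E <= (C * (t - s) ^+ 2)%:E)%E.
Proof.
move=> T0; pose a := d%:R * K; pose M : R := m%:R ^+ 3.
exists (8 * (a ^+ 4 * T ^+ 2 + a ^+ 4 * (M * (m%:R * c4 R)))).
  have h : 0 <= a ^+ 4 by rewrite (exprM _ 2 2) sqr_ge0.
  have h' : 0 <= M * (m%:R * c4 R) by rewrite mulr_ge0 ?exprn_ge0// mulr_ge0// c4_ge0.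
  by rewrite mulr_ge0// addr_ge0// mulr_ge0// sqr_ge0.
move=> s t b s0 st tT b1 b2.
have p4 w i : 0 <= incr s t w i ^+ 4 :> R by rewrite (exprM _ 2 2) sqr_ge0.
have a4 : 0 <= a ^+ 4 by rewrite (exprM _ 2 2) sqr_ge0.
have ts0 : 0 <= t - s by rewrite subr_ge0.
have bnd w : l1 (inc s t b w) ^+ 4 <= 8 * (a ^+ 4 * T ^+ 2 * (t - s) ^+ 2) +
    8 * a ^+ 4 * M * \sum_(j < m) incr s t w j ^+ 4.
  have h1 : l1 (inc s t b w) <= a * (t - s) + a * l1 (ev w t - ev w s).
    apply: le_trans (l1D _ _) _; apply: lerD; last exact: l1_mulmx.
    rewrite l1Z ger0_norm// mulrC ler_wpM2r// /l1 /a mulr_natl -[X in _ *+ X](card_ord d) -sumr_const.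
    by apply: ler_sum.
  have h2 : l1 (ev w t - ev w s) ^+ 4 <= M * \sum_(j < m) incr s t w j ^+ 4.
    rewrite /M -[X in X%:R](card_ord m); apply: le_trans (pow4_sum_le _) _.
    rewrite ler_wpM2l ?exprn_ge0//; apply: ler_sum => j _.
    by rewrite !mxE -/(incr s t w j) (exprM _ 2 2) real_normK ?num_real// -exprM.
  have h3 (x y : R) : (x + y) ^+ 4 <= 8 * (x ^+ 4 + y ^+ 4).
    have := @pow4_sum_le R bool (fun c => if c then x else y).
    by rewrite !big_bool card_bool; rewrite (_ : 2%:R ^+ 3 = 8 :> R)//; ring.
  apply: le_trans (_ : (a * (t - s) + a * l1 (ev w t - ev w s)) ^+ 4 <= _).
    by apply: lerXn2r; rewrite ?nnegrE ?l1_ge0// (le_trans _ h1)// l1_ge0.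
  apply: le_trans (h3 _ _) _; rewrite mulrDr [(a * (t - s)) ^+ 4]exprMn [(a * l1 _) ^+ 4]exprMn; apply: lerD.
    rewrite ler_wpM2l// -mulrA ler_wpM2l// (exprD _ 2 2) ler_wpM2r ?sqr_ge0//.
    by rewrite lerXn2r ?nnegrE// lerBlDr (le_trans tT)// lerDl.
  rewrite -[leRHS]mulrA -[leRHS]mulrA ler_wpM2l//; exact: (ler_wpM2l a4 h2).
apply: (@le_trans _ _ (\int[P]_w ((8 * (a ^+ 4 * T ^+ 2 * (t - s) ^+ 2))%:E +
    (8 * a ^+ 4 * M)%:E * \sum_(j < m) (incr s t w j ^+ 4)%:E))%E).
  by apply: le_integral_pointwise => w _; rewrite sumEFin -EFinM -EFinD lee_fin.
have mi j : measurable_fun setT (fun w : Omega T m => (incr s t w j ^+ 4)%:E).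
  by apply/measurable_EFinP; apply: measurable_funX; exact: incr_meas.
have M0 : 0 <= M by rewrite exprn_ge0.
have aM : 0 <= 8 * a ^+ 4 * M by rewrite mulr_ge0// mulr_ge0.
rewrite ge0_integralD//=; last 3 first.
- by move=> w _; rewrite lee_fin mulr_ge0// mulr_ge0 ?sqr_ge0// mulr_ge0 ?sqr_ge0.
- by move=> w _; apply: mule_ge0; [rewrite lee_fin|apply: sume_ge0 => j _; rewrite lee_fin].
- by apply: emeasurable_funM => //; apply: emeasurable_sum.
rewrite integral_cst//= probability_setT mule1 ge0_integralZl//=; last 2 first.
- by apply: emeasurable_sum.
- by move=> w _; apply: sume_ge0 => j _; rewrite lee_fin.
rewrite ge0_integral_sum//=; last by move=> j w _; rewrite lee_fin.
under eq_bigr do rewrite moment4_incr//.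
rewrite sumEFin -EFinM -EFinD lee_fin sumr_const card_ord -(mulr_natl ((t - s) ^+ 2 * c4 R) m).
by rewrite le_eqVlt; apply/orP; left; apply/eqP; ring.
Qed.

End OneStep.

(** * Cells of a partition *)

Section Cells.
Context (R : realType) (T : R) (d m : nat) (P : probability (Omega T m) R).
Hypothesis hP : wiener_measure P.
Hypothesis T0 : 0 < T.
Let T0' : 0 <= T. Proof. exact: ltW. Qed.
Variables (M : nat) (r : nat -> R) (del : R).
Hypothesis hp : is_partition T M r del.

(** At a time in cell [k], earlier cells are complete and later ones empty. States and hedging gains
    share this decomposition. *)
Lemma cell_sum (V : zmodType) (G : nat -> R -> R -> V) k t : (forall j x, G j x x = 0) ->
  (k < M)%N -> r k <= t <= r k.+1 ->
  \sum_(j < M) G j (Num.min (r j) t) (Num.min (r j.+1) t) =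
  \sum_(j < M) G j (Num.min (r j) (r k)) (Num.min (r j.+1) (r k)) + G k (r k) t.
Proof.
move=> G0 kM /andP[kt tk].
rewrite (bigD1 (Ordinal kM))//= [in RHS](bigD1 (Ordinal kM))//=.
have kk : r k <= r k.+1 := le_trans kt tk.
rewrite minxx (min_r kk) (min_r tk) (min_l kt) G0 add0r addrC; congr (_ + _).
apply: eq_bigr => j jk; case: (ltngtP (j : nat) k) => [jk'|kj|e].
- have h2 : r j.+1 <= r k by apply: (partition_mono hp jk'); exact: ltnW.
  have h1 : r j <= r j.+1 by apply: (partition_mono hp).
  have h3 := le_trans h2 kt.
  by rewrite !min_l// ?(le_trans h1).
- have h2 : r k.+1 <= r j by apply: (partition_mono hp kj); exact: ltnW.
  have h1 : r j <= r j.+1 by apply: (partition_mono hp).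
  have h3 := le_trans tk h2.
  have h4 := le_trans kk h2.
  by rewrite !min_r ?G0// (le_trans _ h1).
- by move: jk; rewrite -val_eqE /= e eqxx.
Qed.

Lemma step_state_cell (v : nat -> Omega T m -> control R d m) k t w :
  (k < M)%N -> r k <= t <= r k.+1 ->
  step_state M r v t w = step_state M r v (r k) w + inc (r k) t (v k w) w.
Proof.
move=> kM kt; pose G j x y : 'cV[R]_d := (y - x) *: (v j w).1 + (v j w).2 *m (ev w y - ev w x).
apply: (cell_sum (G := G)) kM kt => j x.
by rewrite /G !subrr scale0r mulmx0 addr0.
Qed.

Lemma partition_integral_cell p (c : nat -> Omega T m -> 'M[R]_(p, m))
  (mc : forall i, (i < M)%N -> filt_measurable (r i) (c i))
  (bc : forall i, (i < M)%N -> exists K : R, forall w, frob (c i w) <= K) k t w :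
  (k < M)%N -> r k <= t <= r k.+1 ->
  sp_integral (partition_process hp mc bc) t w =
  sp_integral (partition_process hp mc bc) (r k) w + c k w *m (ev w t - ev w (r k)).
Proof.
move=> kM kt; pose G j x y : 'cV[R]_p := c j w *m (ev w y - ev w x).
apply: (cell_sum (G := G)) kM kt => j x.
by rewrite /G !subrr mulmx0.
Qed.

Lemma partition_locate_left t : 0 <= t <= T -> exists2 k, (k < M)%N & r k <= t <= r k.+1.
Proof.
move=> /andP[t0 tT]; have M0 := partition_size_gt0 hp T0.
have [->|tn] := eqVneq t 0.
  have [r0 _ _ _] := hp; exists 0%N => //; rewrite -r0 lexx.
  exact: (partition_mono hp (leqnSn 0) M0).
have [|k kM /andP[h1 h2]] := @partition_locate _ _ _ _ _ t hp.
  by rewrite tT andbT lt_def tn.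
by exists k => //; rewrite h2 ltW.
Qed.

Lemma partition_locate_co t : 0 <= t < T -> exists2 k, (k < M)%N & r k <= t < r k.+1.
Proof.
move=> /andP[t0 tT]; have [r0 rM _ _] := hp.
have ex : exists i, (i <= M)%N && (r i <= t) by exists 0%N; rewrite r0.
have ub i : (i <= M)%N && (r i <= t) -> (i <= M)%N by case/andP.
case: (ex_maxnP ex ub) => i /andP[iM it] imax.
have iM' : (i < M)%N.
  by rewrite ltn_neqAle iM andbT; apply/eqP => e; move: it; rewrite e rM leNgt tT.
exists i => //; rewrite it /= ltNge; apply/negP => hi.
by have := imax i.+1; rewrite iM' hi => /(_ isT); rewrite ltnn.
Qed.

(** Such controls may still differ at time [T]. The states agree for every path nevertheless,
    because the drift integrals are equal and [ito] chooses from equal sets. *)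
Lemma state_ext (a a' : R -> control R d m) (u : nat -> control R d m) :
  (forall i t, (i < M)%N -> r i <= t < r i.+1 -> a t = u i) ->
  (forall i t, (i < M)%N -> r i <= t < r i.+1 -> a' t = u i) ->
  state P (fun t (_ : Omega T m) => a t) = state P (fun t (_ : Omega T m) => a' t).
Proof.
move=> au au'.
have e (b : R -> control R d m) : (forall i t, (i < M)%N -> r i <= t < r i.+1 -> b t = u i) ->
    process_ae_eq P T (fun t (_ : Omega T m) => (b t).2) (sp_process (step_vol hp (cst_family_step T M r u))).
  move=> bu; apply/aeW => w; apply: ae_mono (ae_interior hp) => s hr /hr[i iN /andP[ri ri']].
  rewrite (bu i)// ?(ltW ri)// (partition_processE hp _ _ w iN)//.
  by rewrite ri ltW.
have ie : ito P (fun t (_ : Omega T m) => (a t).2) = ito P (fun t (_ : Omega T m) => (a' t).2).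
  have js := jointly_measurable_sp (step_vol hp (cst_family_step T M r u)).
  by rewrite (ito_ext js (e _ au)) (ito_ext js (e _ au')).
apply/funext => w; rewrite /state /path_of ie; congr xget; apply/funext => x; apply/propext.
have E s : 0 <= s <= T -> (\col_i (\int[lebesgue_measure]_(t in `[0, s]) ((a t).1 i 0))%R) =
    (\col_i (\int[lebesgue_measure]_(t in `[0, s]) ((a' t).1 i 0))%R) :> 'cV[R]_d.
  move=> sT; apply/matrixP => i j; rewrite !mxE.
  have h (b : R -> control R d m) : (forall i t, (i < M)%N -> r i <= t < r i.+1 -> b t = u i) ->
      forall i0 t, (i0 < M)%N -> r i0 < t < r i0.+1 -> (b t).1 i 0 = (u i0).1 i 0.
    move=> bu l t lN /andP[l1 l2]; have lt : r l <= t < r l.+1 by rewrite (ltW l1) l2.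
    by rewrite (bu l t lN lt).
  exact: etrans (Rintegral_step hp (h a au) sT) (esym (Rintegral_step hp (h a' au') sT)).
split=> xh s sT.
  exact: etrans (xh s sT) (congr1 (fun z => z + _) (E s sT)).
exact: etrans (xh s sT) (congr1 (fun z => z + _) (esym (E s sT))).
Qed.

End Cells.

Lemma step_control_refine (R : realType) (T : R) (d m : nat) M (r : nat -> R) (del : R)
    n (ts : nat -> R) h (N : set (control R d m)) a : 0 < T -> is_partition T M r del ->
  is_partition T n ts h -> (forall i, (i <= n)%N -> exists2 j, (j <= M)%N & ts i = r j) ->
  step_control T n ts N a -> step_control T M r N a.
Proof.
move=> T0 hp hp' rf [a1 a2 a3]; split=> // k t kM /andP[kt tk].
have kT : 0 <= r k <= T by exact: (partition_itv hp (ltnW kM)).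
have M0 := partition_size_gt0 hp T0.
have n0 := partition_size_gt0 hp' T0.
have lt_r : r k < r k.+1 := le_lt_trans kt tk.
have [i iN /andP[i1 i2]] : exists2 i, (i < n)%N & ts i <= r k < ts i.+1.
  apply: (partition_locate_co hp'); case/andP: kT => -> _ /=.
  by apply: (lt_le_trans lt_r); case/andP: (partition_itv hp kM).
have tki : r k.+1 <= ts i.+1.
  have [j jM e] := rf i.+1 iN; rewrite e in i2 *.
  have kj : (k < j)%N.
    rewrite ltnNge; apply/negP => jk.
    by have := partition_mono hp jk (ltnW kM); rewrite leNgt i2.
  exact: (partition_mono hp kj jM).
rewrite (a2 i)//; last by rewrite (le_trans i1 kt) (lt_le_trans tk).
by rewrite (a2 i (r k))// i1 (lt_le_trans lt_r).
Qed.

(** * Dynamic programming *)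

Lemma argmx_dist (R : realType) q (F G : 'I_q.+1 -> R) (C : R) :
  (forall i, `|F i - G i| <= C) -> `|F (argmx F) - G (argmx G)| <= C.
Proof.
move=> FG; rewrite ler_norml; have hG := argmxP G (argmx F); have hF := argmxP F (argmx G).
have := FG (argmx F); have := FG (argmx G); rewrite !ler_norml => /andP[? ?] /andP[? ?].
by apply/andP; split; lra.
Qed.

Lemma max_dist (R : realType) (a b x y C : R) : `|a - b| <= C -> `|x - y| <= C ->
  `|Num.max a x - Num.max b y| <= C.
Proof.
rewrite !ler_norml => /andP[? ?] /andP[? ?].
by rewrite /Num.max; case: ltP => ?; case: ltP => ?; apply/andP; split; lra.
Qed.

Lemma max_norm (R : realType) (a b C : R) : `|a| <= C -> `|b| <= C -> `|Num.max a b| <= C.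
Proof. by move=> ? ?; rewrite /Num.max; case: ifP. Qed.

Section DynamicProgramming.
Context (R : realType) (T : R) (d m : nat) (P : probability (Omega T m) R).
Hypothesis hP : wiener_measure P.
Hypothesis T0 : 0 < T.
Let T0' : 0 <= T. Proof. exact: ltW. Qed.
Variables (M : nat) (r : nat -> R) (del : R).
Hypothesis hp : is_partition T M r del.
Variables (q : nat) (c : 'I_q.+1 -> control R d m).
Variables (gL : 'cV[R]_d -> R) (L Kg : R).
Hypothesis hgL : blip L Kg gL.

(** The Snell envelope of the controlled walk: stop now, or continue with the best control of the
    net. The recursion counts the steps that remain. *)
Fixpoint backward j : 'cV[R]_d -> R :=
  if j is j'.+1 then fun x => Num.max (gL x)
    (let F i := condE P (r (M - j)%N) (r (M - j)%N.+1) (c i) (backward j') x in F (argmx F))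
  else gL.

Definition value k := backward (M - k).

Definition cont k x i := condE P (r k) (r k.+1) (c i) (value k.+1) x.

Lemma value_end : value M = gL.
Proof. by rewrite /value subnn. Qed.

Lemma valueE k x : (k < M)%N -> value k x = Num.max (gL x) (cont k x (argmx (cont k x))).
Proof.
move=> kM; have e : (M - k = (M - k.+1).+1)%N by rewrite subnSK.
have ek : (M - (M - k.+1).+1 = k)%N by rewrite -e subKn// ltnW.
rewrite {1}/value e; cbn [backward]; rewrite ek; reflexivity.
Qed.

Lemma rk k : (k < M)%N -> [/\ 0 <= r k, r k < r k.+1 & r k.+1 <= T].
Proof.
move=> kM; have [_ _ h _] := hp; split; last by case/andP: (partition_itv hp kM).
- by case/andP: (partition_itv hp (ltnW kM)).
- exact: h.
Qed.

Lemma blip_value k : (k <= M)%N -> blip L Kg (value k).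
Proof.
rewrite /value => kM; have : (M - k <= M)%N by exact: leq_subr.
elim: (M - k)%N => [//|j IH] jM.
have [L0 gl gk] := hgL.
have kM' : (M - j.+1 < M)%N by rewrite ltn_subrL (leq_ltn_trans (leq0n j) jM).
have [h1 h2 h3] := rk kM'.
have B i := blip_condE P (IH (ltnW jM)) h1 h2 h3 (c i).
split=> // [x y|x] /=.
  apply: max_dist; first exact: gl.
  pose F z i := condE P (r (M - j.+1)) (r (M - j.+1).+1) (c i) (backward j) z.
  by apply: (@argmx_dist _ _ (F x) (F y)) => i; have [_ h _] := B i; exact: h.
by apply: max_norm; [exact: gk|have [_ _ h] := B (argmx (fun i => condE P (r (M - j.+1)) (r (M - j.+1).+1) (c i) (backward j) x)); exact: h].
Qed.

Lemma value_ge k x : (k <= M)%N -> gL x <= value k x.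
Proof.
rewrite leq_eqVlt => /predU1P[->|kM]; first by rewrite value_end.
by rewrite valueE// le_max lexx.
Qed.

Lemma value_ge_cont k x i : (k < M)%N -> cont k x i <= value k x.
Proof. by move=> kM; rewrite valueE// le_max (argmxP (cont k x) i) orbT. Qed.

Lemma blip_cont k i : (k < M)%N -> blip L Kg (fun x => cont k x i).
Proof.
move=> kM; have [h1 h2 h3] := rk kM.
exact: (blip_condE P (blip_value kM) h1 h2 h3 (c i)).
Qed.

(** The walk under optimal feedback, in which the choice on a cell is a function of the state at its
    start. *)
Fixpoint feedback k (w : Omega T m) : 'cV[R]_d :=
  if k is k'.+1 then
    feedback k' w + inc (r k') (r k) (c (argmx (cont k' (feedback k' w)))) w
  else 0.

Definition policy k w := argmx (cont k (feedback k w)).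

Lemma policy_filt k j : (k < M)%N -> (forall i, Fmeas (r k) (fun w => feedback k w i 0)) ->
  filt (r k) [set w | policy k w = j].
Proof.
move=> kM mX; rewrite filtE.
have := @argmx_measurable R q _ (FOmega T m (r k)) (fun i w => cont k (feedback k w) i) j.
apply=> i; exact: (blip_measurable (blip_cont i kM) mX).
Qed.

Lemma feedback_meas k i : (k <= M)%N -> Fmeas (r k) (fun w => feedback k w i 0).
Proof.
elim: k i => [|k IH] i kM /=.
  rewrite /Fmeas (_ : (fun w => _) = cst 0); first exact: measurable_cst.
  by apply/funext => w; rewrite mxE.
have [h1 h2 h3] := rk kM.
have mX i' : Fmeas (r k) (fun w => feedback k w i' 0) by apply: IH; exact: ltnW.
rewrite /Fmeas (_ : (fun w => _) = fun w => feedback k w i 0 +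
  \sum_j \1_[set w | policy k w = j] w * inc (r k) (r k.+1) (c j) w i 0).
  apply: measurable_funD; first exact: (Fmeas_sub (ltW h2) (mX i)).
  apply: measurable_sum => j; apply: measurable_funM; last exact: (inc_Fmeas (c j) i h1 (ltW h2)).
  have := filt_sub (ltW h2) (policy_filt j kM mX); rewrite filtE => H.
  exact: (@measurable_indic _ (FOmega T m (r k.+1))).
apply/funext => w; rewrite mxE (bigD1 (policy k w))//= big1 ?addr0; last first.
  by move=> j jw; rewrite indicE memNset ?mul0r//= => /esym/eqP; rewrite (negbTE jw).
by rewrite indicE mem_set// mul1r.
Qed.

Lemma filt_policy k j : (k < M)%N -> filt (r k) [set w | policy k w = j].
Proof. by move=> kM; apply: policy_filt => // i; apply: feedback_meas; exact: ltnW. Qed.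

Let hstop k w := value k (feedback k w) == gL (feedback k w).

(** The first step at which stopping is optimal; the default [M] of [find] is consistent with this,
    as the last value function is [gL]. *)
Definition exit w := find (fun k => hstop k w) (iota 0 M).

Lemma exit_le w : (exit w <= M)%N.
Proof. by rewrite -[X in (_ <= X)%N](size_iota 0) find_size. Qed.

Lemma exitE k w : (k < M)%N -> (exit w <= k)%N = has (fun j => hstop j w) (iota 0 k.+1).
Proof.
move=> kM; rewrite /exit -ltnS -has_take_leq ?size_iota//.
by rewrite take_iota (minn_idPl kM).
Qed.

Lemma before_exit k w : (k < exit w)%N -> hstop k w = false.
Proof.
move=> kw; have := before_find 0%N kw.
by rewrite nth_iota// (leq_trans kw (exit_le w)).
Qed.

Lemma at_exit w : value (exit w) (feedback (exit w) w) = gL (feedback (exit w) w).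
Proof.
have [h|h] := ltnP (exit w) M; last first.
  have /eqP -> : exit w == M by rewrite eqn_leq exit_le.
  by rewrite value_end.
have := h; rewrite -{1}(size_iota 0 M) -has_find => /(nth_find 0%N).
by rewrite nth_iota// => /eqP.
Qed.

Lemma exit_filt k : (k <= M)%N -> filt (r k) [set w | (exit w <= k)%N].
Proof.
rewrite leq_eqVlt => /predU1P[->|kM].
  rewrite (_ : [set w | _] = setT); first exact: filtT.
  by apply/seteqP; split => // w _; exact: exit_le.
rewrite (_ : [set w | _] = \bigcup_(j in `I_k.+1) [set w | hstop j w]).
  rewrite filtE; apply: fin_bigcup_measurable; first exact: finite_II.
  move=> j /= jk; have jM : (j <= M)%N := ltnW (leq_trans jk kM).
  have mX i := feedback_meas i jM.
  have mv := blip_measurable (blip_value jM) mX.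
  have mg := blip_measurable hgL mX.
  have H : filt (r j) [set w | hstop j w].
    by have := measurable_fun_eqr mv mg measurableT (Y := [set true]) I; rewrite setTI.
  exact: (filt_sub (partition_mono hp (jk : (j <= k)%N) (ltnW kM)) H).
apply/seteqP; split=> w /=; rewrite exitE//.
  by move=> /hasP[j]; rewrite mem_iota => /= jk jw; exists j.
by move=> [j jk jw]; apply/hasP; exists j => //; rewrite mem_iota.
Qed.

Let E k l := [set w | policy k w = l /\ (k < exit w)%N].

Let filtE_E k l : (k < M)%N -> filt (r k) (E k l).
Proof.
move=> kM; apply: filtI; first exact: filt_policy.
have := exit_filt (ltnW kM); rewrite filtE => H.
rewrite (_ : (fun w => _) = ~` [set w | (exit w <= k)%N]); first exact: (@measurableC _ (FOmega T m (r k))).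
by apply/seteqP; split=> w /=; rewrite ltnNge => /negP.
Qed.

(** The value process stopped at [exit]. Before that step the maximum is attained by continuing, so
    the process has a constant mean; at that step it equals the payoff. *)
Let Z k w := value (minn k (exit w)) (feedback (minn k (exit w)) w).

Let D k l w := \1_(E k l) w * (value k.+1 (feedback k w + inc (r k) (r k.+1) (c l) w) - cont k (feedback k w) l).

Let ZS k w : (k < M)%N -> Z k.+1 w = Z k w + \sum_l D k l w.
Proof.
move=> kM; rewrite /Z; have [h|h] := ltnP k (exit w); last first.
  rewrite (minn_idPr (leqW h)) big1 ?addr0// => l _.
  by rewrite /D indicE memNset ?mul0r//= => -[_]; rewrite ltnNge h.
rewrite (minn_idPl h) (bigD1 (policy k w))//= big1 ?addr0; last first.
  by move=> l lw; rewrite /D indicE memNset ?mul0r//= => -[/esym/eqP]; rewrite (negbTE lw).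
rewrite /D indicE mem_set// mul1r.
have := before_exit h; rewrite /hstop valueE// -/(policy k w).
by rewrite /Num.max; case: ltP => [_ _|_]; [rewrite [RHS]addrC subrK|rewrite eqxx].
Qed.

Let D_props k l : (k < M)%N -> isL2 P (D k l) /\ (\int[P]_w D k l w = 0)%R.
Proof.
move=> kM; have [h1 h2 h3] := rk kM; have rT : r k <= T := le_trans (ltW h2) h3.
have mX i := feedback_meas i (ltnW kM).
have BV := blip_value kM; have BC := blip_cont l kM.
have mY : Fmeas (r k) (\1_(E k l) : Omega T m -> R).
  by have := filtE_E l kM; rewrite filtE => H; exact: (@measurable_indic _ (FOmega T m (r k))).
have LY : isL2 P (\1_(E k l) : Omega T m -> R).
  apply: (@isL2_bounded _ _ _ P _ 1); first exact: Fmeas_measurable rT mY.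
  by move=> w; rewrite indicE; case: (_ \in _); rewrite ?normr1// normr0.
have mXT i := Fmeas_measurable rT (mX i).
have mXi i : measurable_fun setT (fun w => (feedback k w + inc (r k) (r k.+1) (c l) w) i 0).
  rewrite (_ : (fun w => _) = fun w => feedback k w i 0 + inc (r k) (r k.+1) (c l) w i 0); last by apply/funext => w; rewrite mxE.
  by apply: measurable_funD => //; exact: inc_meas (ltW h2) h3.
have mul (f : Omega T m -> R) : measurable_fun setT f -> (forall w, `|f w| <= Kg) ->
    isL2 P (fun w => \1_(E k l) w * f w).
  move=> mf fK; rewrite (_ : (fun w => _) = fun w => f w * \1_(E k l) w); last by apply/funext => w; rewrite mulrC.
  exact: (isL2_bounded_mul mf fK LY).
have [_ _ KV] := BV; have [_ _ KC] := BC.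
have L1 := mul _ (blip_measurable BV mXi) (fun w => KV _).
have L2 := mul _ (blip_measurable BC mXT) (fun w => KC _).
have DE : D k l = fun w => \1_(E k l) w * value k.+1 (feedback k w + inc (r k) (r k.+1) (c l) w) -
    \1_(E k l) w * cont k (feedback k w) l.
  by apply/funext => w; rewrite /D mulrBr.
rewrite DE; split; first exact: isL2B.
rewrite RintegralB//; [|exact: isL2_integrable..].
by rewrite (condE_freeze hP BV h1 h2 h3 (c l) mY LY mX) subrr.
Qed.

Let Z_props k : (k <= M)%N -> isL2 P (Z k) /\ (\int[P]_w Z k w = value 0 0)%R.
Proof.
elim: k => [|k IH] kM.
  have -> : Z 0 = cst (value 0 0) by apply/funext => w; rewrite /Z min0n.
  split; first exact: isL2_cst.
  by rewrite Rintegral_cst//= probability_setT mulr1.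
have [LZ IZ] := IH (ltnW kM).
have -> : Z k.+1 = fun w => Z k w + \sum_l D k l w by apply/funext => w; exact: ZS.
have LD l : isL2 P (D k l) by have [] := D_props l kM.
have LS : isL2 P (fun w => \sum_l D k l w) by apply: isL2_sum.
split; first exact: isL2D.
rewrite RintegralD//; [|exact: isL2_integrable..].
rewrite IZ Rintegral_bigsum; last by move=> l; exact: isL2_integrable.
by rewrite big1 ?addr0// => l _; have [] := D_props l kM.
Qed.

Lemma feedback_state k w : (k <= M)%N ->
  feedback k w = step_state M r (selected c policy) (r k) w.
Proof.
elim: k => [|k IH] kM.
  by have [-> _ _ _] := hp; rewrite (step_state0 hp).
have [h1 h2 h3] := rk kM.
by rewrite (step_state_cell hp _ _ kM) ?lexx ?(ltW h2)// -IH// ltnW.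
Qed.

Lemma value_exit : (\int[P]_w gL (step_state M r (selected c policy) (r (exit w)) w) = value 0 0)%R /\
  isL2 P (fun w => gL (step_state M r (selected c policy) (r (exit w)) w)).
Proof.
have -> : (fun w => gL (step_state M r (selected c policy) (r (exit w)) w)) = Z M.
  apply/funext => w; rewrite /Z (minn_idPr (exit_le w)) at_exit feedback_state//.
  exact: exit_le.
by have [] := Z_props (leqnn M).
Qed.

Lemma exit_stopping_time : stopping_time (fun w => r (exit w)).
Proof.
split=> [w|t /andP[t0 tT]]; first exact: (partition_itv hp (exit_le w)).
rewrite (_ : [set w | _] = \bigcup_(k in [set k | (k <= M)%N /\ r k <= t]) [set w | (exit w <= k)%N]).
  rewrite filtE; apply: fin_bigcup_measurable.
    by apply: (@sub_finite_set _ _ `I_M.+1) => [k /= [kM _]|]; [exact: kM|exact: finite_II].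
  by move=> k [kM rt]; exact: (filt_sub rt (exit_filt kM)).
apply/seteqP; split=> w /=; first by move=> h; exists (exit w) => //=; split=> //; exact: exit_le.
move=> [k [kM rt] /= h]; apply: le_trans rt; exact: (partition_mono hp h kM).
Qed.

(* right-continuous in time, so that the value on a cell is known at its start *)
Lemma selected_admissible (A : set (control R d m)) (al : nat -> Omega T m -> 'I_q.+1) :
  (forall j, A (c j)) -> (forall i j, (i < M)%N -> filt (r i) [set w | al i w = j]) ->
  exists2 a, admissible A a & forall i t w, (i < M)%N -> r i <= t < r i.+1 -> a t w = selected c al i w.
Proof.
(* The default [M] marks the times outside every cell, in particular [T], where the control is set
   to the constant [c ord0]. *)
move=> cA mal; pose idx (t : R) : nat := xget M [set i | (i < M)%N /\ r i <= t < r i.+1].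
have idxE i t : (i < M)%N -> r i <= t < r i.+1 -> idx t = i.
  move=> iN it; rewrite /idx; case: xgetP => [j _ [jN jt]|/(_ i) []//].
  exact: (partition_unique_left hp jN iN jt it).
have idx_lt t : (idx t < M)%N -> r (idx t) <= t < r (idx t).+1.
  by rewrite /idx; case: xgetP => [j _ []//|_]; rewrite ltnn.
pose a t w := if (idx t < M)%N then c (al (idx t) w) else c ord0.
have aE i t w : (i < M)%N -> r i <= t < r i.+1 -> a t w = selected c al i w.
  by move=> iN it; rewrite /a (idxE i)// iN.
have mF (F : control R d m -> R) i : (i < M)%N -> Fmeas (r i) (fun w => F (c (al i w))).
  move=> iN; rewrite /Fmeas (_ : (fun w => _) = fun w => \sum_j F (c j) * \1_[set w | al i w = j] w).
    apply: measurable_sum => j; apply: measurable_funM; first exact: measurable_cst.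
    by have := mal i j iN; rewrite filtE => H; exact: (@measurable_indic _ (FOmega T m (r i))).
  apply/funext => w; rewrite (bigD1 (al i w))//= big1 ?addr0; last first.
    by move=> j jw; rewrite indicE memNset ?mulr0//= => /esym/eqP; rewrite (negbTE jw).
  by rewrite indicE mem_set// mulr1.
have jm (F : control R d m -> R) : measurable_fun (`[0, T] `*` [set: Omega T m])
    (fun x : R * Omega T m => F (a x.1 x.2)).
  apply: measurable_funTS.
  rewrite (_ : (fun x => _) = fun x : R * Omega T m =>
    (F (c ord0) + \sum_(k < M) \1_(`[r k, r k.+1[ : set R) x.1 * (F (c (al k x.2)) - F (c ord0)))).
    apply: measurable_funD; first exact: measurable_cst.
    apply: measurable_sum => k; apply: measurable_funM.
      have mI : measurable_fun setT (\1_(`[r k, r k.+1[ : set R) : R -> R) by [].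
      exact: (measurableT_comp mI measurable_fst).
    apply: measurable_funB; last exact: measurable_cst.
    apply: (measurableT_comp (f := fun w => F (c (al k w)))) => //.
    by apply: Fmeas_measurable (mF F k (ltn_ord k)); case/andP: (partition_itv hp (ltnW (ltn_ord k))).
  apply/funext => -[t w] /=; have [h|h] := ltnP (idx t) M.
    rewrite /a h (bigD1 (Ordinal h))//= big1 ?addr0.
      by rewrite indicE mem_setE in_itv /= idx_lt// mul1r addrC subrK.
    move=> k kt; rewrite indicE mem_setE in_itv /=; case: (boolP (_ <= _ < _)) => [kk|]; last by rewrite mul0r.
    by move: kt; rewrite -val_eqE /= (idxE _ _ (ltn_ord k) kk) eqxx.
  rewrite /a ltnNge h /= big1 ?addr0// => k _; rewrite indicE mem_setE in_itv /=.
  case: (boolP (_ <= _ < _)) => [kk|]; last by rewrite mul0r.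
  by move: h; rewrite (idxE _ _ (ltn_ord k) kk) leqNgt ltn_ord.
have ad (F : control R d m -> R) t : Fmeas t (fun w => F (a t w)).
  have [h|h] := boolP (idx t < M)%N.
    rewrite (_ : (fun w => _) = fun w => F (c (al (idx t) w))).
      by case/andP: (idx_lt t h) => h1 _; exact: (Fmeas_sub h1 (mF F _ h)).
    by apply/funext => w; rewrite /a h.
  rewrite (_ : (fun w => _) = cst (F (c ord0))); first exact: measurable_cst.
  by apply/funext => w; rewrite /a (negbTE h).
exists a => //; split.
- by move=> t w _; rewrite /a; case: ifP.
- by move=> i k; exact: (jm (fun b => b.1 i k)).
- by move=> i k; exact: (jm (fun b => b.2 i k)).
- by move=> t _; apply/filt_measurable_Fmeas => i k; exact: (ad (fun b => b.1 i k)).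
- by move=> t _; apply/filt_measurable_Fmeas => i k; exact: (ad (fun b => b.2 i k)).
Qed.

Lemma value_le_primal (A : set (control R d m)) g (e : R) : (forall j, A (c j)) ->
  (forall x, gL x <= g x + e) -> ((value 0 0 - e)%:E <= primal_value P A g)%E.
Proof.
move=> cA ge; have [a aA aE] := selected_admissible cA filt_policy.
have sf := selected_family c filt_policy.
have [IE LE] := value_exit.
have h := state_step hP T0 hp sf aE.
apply: (@le_trans _ _ ('E_P[fun w => g (ev (state P a w) (r (exit w)))])%E); last first.
  by apply: ereal_sup_ubound; exists a, (fun w => r (exit w)); split=> //; exact: exit_stopping_time.
rewrite unlock.
have iLE := isL2_integrable LE.
have -> : (value 0 0 - e)%:E = (\int[P]_w (gL (step_state M r (selected c policy) (r (exit w)) w) - e)%:E)%E.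
  rewrite -IE; under [RHS]eq_integral do rewrite EFinB.
  rewrite integralB//; last exact: (isL2_integrable (isL2_cst P e)).
  rewrite integral_cst//= probability_setT mule1 EFinB /Rintegral fineK//.
  exact: (integrable_fin_num measurableT iLE).
apply: ae_le_integral_l; last first.
  apply/measurable_EFinP; apply: measurable_funB; [by case: LE|exact: measurable_cst].
apply: ae_mono h => w ->; rewrite (step_pathE T0 hp sf) ?(partition_itv hp (exit_le w))//.
by rewrite lee_fin lerBlDr.
Qed.

End DynamicProgramming.

(** * Smoothing by finite averages *)

Section DifferenceQuotient.
Context (R : realType) (F p : R -> R) (L c eps : R).
Hypotheses (eps0 : 0 < eps) (L0 : 0 <= L) (c0 : 0 <= c).
Hypothesis FL : forall a b, `|F a - F b| <= L * `|a - b|.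
Hypothesis Fp : forall a, F (a + eps) - F a = eps * p a.
Hypothesis pc : forall a b, `|p a - p b| <= c * `|a - b|.
Hypothesis pL : forall a, `|p a| <= L.

(** At multiples of [eps] the increments of [F] are exactly [eps] times values of [p], which drift
    from [p b] at most linearly. *)
Let taylor_nat b n : `|F (b + eps * n%:R) - F b - eps * n%:R * p b| <= c * (eps * n%:R) ^+ 2.
Proof.
elim: n => [|n IH]; first by rewrite mulr0 addr0 subrr mul0r subrr normr0 expr0n mulr0.
have e : F (b + eps * n.+1%:R) = F (b + eps * n%:R) + eps * p (b + eps * n%:R).
  by rewrite -Fp [RHS]addrC subrK -natr1 mulrDr mulr1 addrA.
rewrite e.
have h1 := pc (b + eps * n%:R) b; rewrite addrAC subrr add0r in h1.
have n0 : 0 <= eps * n%:R :> R by rewrite mulr_ge0// ltW.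
rewrite (ger0_norm n0) in h1.
move: IH h1; rewrite -natr1 !ler_norml => /andP[a1 a2] /andP[b1 b2].
have e1 : eps * p (b + eps * n%:R) - eps * p b <= eps * (c * (eps * n%:R)).
  by rewrite -mulrBr ler_wpM2l// ltW.
have e2 : - (eps * (c * (eps * n%:R))) <= eps * p (b + eps * n%:R) - eps * p b.
  by rewrite -mulrBr -mulrN ler_wpM2l// ltW.
have s1 : 0 <= c * eps ^+ 2 by rewrite mulr_ge0// sqr_ge0.
have s2 : 0 <= c * eps ^+ 2 * n%:R by rewrite mulr_ge0.
by apply/andP; split; nra.
Qed.

(** Round [a] down to a multiple of [eps]; the rest costs [L * eps] in [F] and as much in the linear
    term. *)
Let taylor_ge0 b a : 0 <= a -> `|F (b + a) - F b - a * p b| <= c * a ^+ 2 + 2 * L * eps.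
Proof.
move=> a0; pose n := Num.truncn (a / eps).
have ae : 0 <= a / eps by rewrite divr_ge0// ltW.
have /andP[n1 n2] := truncn_itv ae.
have n1' : eps * n%:R <= a by rewrite mulrC -ler_pdivlMr.
have n2' : a < eps * n%:R + eps.
  by move: n2; rewrite ltr_pdivrMr// -natr1 mulrDl mul1r mulrC.
have n0 : 0 <= eps * n%:R by rewrite mulr_ge0// ltW.
have h := taylor_nat b n; set t := eps * n%:R in h n1' n2' n0.
have h1 : `|F (b + a) - F (b + t)| <= L * eps.
  apply: le_trans (FL _ _) _; rewrite ler_wpM2l// opprD addrACA subrr add0r ger0_norm ?subr_ge0//.
  by rewrite lerBlDl ltW.
have h2 : `|(a - t) * p b| <= eps * L.
  rewrite normrM ler_pM// ger0_norm ?subr_ge0//.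
  by rewrite lerBlDl ltW.
have h3 : c * t ^+ 2 <= c * a ^+ 2 by rewrite ler_wpM2l// lerXn2r ?nnegrE.
move: h h1 h2; rewrite !ler_norml => /andP[? ?] /andP[? ?] /andP[? ?].
by apply/andP; split; lra.
Qed.

(** For negative [a] the expansion runs forward from [a]; replacing [p a] by [p 0] costs a second
    [c * a ^+ 2]. *)
Lemma taylor_1d a : `|F a - F 0 - a * p 0| <= 2 * c * a ^+ 2 + 2 * L * eps.
Proof.
have s0 : 0 <= c * a ^+ 2 by rewrite mulr_ge0// sqr_ge0.
have [a0|a0] := leP 0 a.
  by have := taylor_ge0 0 a0; rewrite add0r => /le_trans; apply; lra.
have na : 0 <= - a by rewrite oppr_ge0 ltW.
have := taylor_ge0 a na; rewrite subrr sqrrN => h.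
have h2 : `|a * (p a - p 0)| <= c * a ^+ 2.
  rewrite normrM; have := pc a 0; rewrite subr0 => /(ler_wpM2l (normr_ge0 a)).
  by rewrite mulrCA -expr2 real_normK// num_real.
move: h h2; rewrite !ler_norml => /andP[? ?] /andP[? ?].
by apply/andP; split; lra.
Qed.

End DifferenceQuotient.

Section Smoothing.
Context (R : realType) (d : nat).
Variables (eps : R) (Q : nat).
Hypothesis eps0 : 0 < eps.
Implicit Types (f : 'cV[R]_d -> R) (x : 'cV[R]_d).

Let rho := eps * Q.+1%:R.
Let rho0 : 0 < rho. Proof. by rewrite mulr_gt0. Qed.

Definition unitv (i : 'I_d) : 'cV[R]_d := delta_mx i 0.

Lemma l1_unitv i : l1 (unitv i) = 1.
Proof.
rewrite /l1 (bigD1 i)//= mxE !eqxx normr1 big1 ?addr0// => j ji.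
by rewrite mxE (negbTE ji) normr0.
Qed.

(** A discrete convolution in direction [i], with [Q.+1] nodes at spacing [eps], over a width of
    about [rho]. *)
Definition savg i f x := Q.+1%:R^-1 * \sum_(k < Q.+1) f (x + (eps * k%:R) *: unitv i).

Lemma savg_bound (a : nat -> R) (C : R) : (forall k, (k < Q.+1)%N -> `|a k| <= C) ->
  `|Q.+1%:R^-1 * \sum_(k < Q.+1) a k| <= C.
Proof.
move=> aC; rewrite normrM ger0_norm// mulrC ler_pdivrMr//.
apply: le_trans (ler_norm_sum _ _ _) _; rewrite mulr_natr -[X in _ *+ X](card_ord Q.+1) -sumr_const.
by apply: ler_sum => k _; exact: aC.
Qed.

Lemma savg_comm i j f : savg i (savg j f) = savg j (savg i f).
Proof.
apply/funext => x; rewrite /savg; congr (_ * _); rewrite -!mulr_sumr; congr (_ * _).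
rewrite exchange_big; apply: eq_bigr => k _; apply: eq_bigr => l _.
by rewrite addrAC.
Qed.

Lemma savgB i f x y : savg i f x - savg i f y =
  Q.+1%:R^-1 * \sum_(k < Q.+1) (f (x + (eps * k%:R) *: unitv i) - f (y + (eps * k%:R) *: unitv i)).
Proof. by rewrite /savg -mulrBr -sumrB. Qed.

Lemma blip_savg L K i f : blip L K f -> blip L K (savg i f).
Proof.
move=> [L0 fL fK]; split=> // [x y|x]; last first.
  by apply: (savg_bound (a := fun k => f (x + (eps * k%:R) *: unitv i))) => k _; exact: fK.
rewrite savgB; apply: (savg_bound (a := fun k => f (x + (eps * k%:R) *: unitv i) - f (y + (eps * k%:R) *: unitv i))) => k _.
by apply: le_trans (fL _ _) _; rewrite opprD addrACA subrr addr0.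
Qed.

Lemma savg_close L i f x : 0 <= L -> lip L f -> `|savg i f x - f x| <= L * rho.
Proof.
move=> L0 fL.
have -> : savg i f x - f x = Q.+1%:R^-1 * \sum_(k < Q.+1) (f (x + (eps * k%:R) *: unitv i) - f x).
  by rewrite sumrB mulrBr sumr_const card_ord -(mulr_natl (f x)) mulrA mulVf ?mul1r ?pnatr_eq0.
apply: (savg_bound (a := fun k => f (x + (eps * k%:R) *: unitv i) - f x)) => k kQ.
apply: le_trans (fL _ _) _; rewrite ler_wpM2l// addrAC subrr add0r l1Z l1_unitv mulr1 ger0_norm.
  by rewrite /rho ler_pM2l// ler_nat ltnW.
by rewrite mulr_ge0// ltW.
Qed.

Lemma savg_mono i f f' x : (forall y, f y <= f' y) -> savg i f x <= savg i f' x.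
Proof. by move=> ff'; rewrite /savg ler_wpM2l ?invr_ge0//; apply: ler_sum. Qed.

Definition smooth (s : seq 'I_d) f := foldr savg f s.

(** Averages in different directions commute, so any one of them can be taken last. *)
Lemma smooth_mem i s f : i \in s -> exists s', smooth s f = savg i (smooth s' f).
Proof.
elim: s => //= j s IH; rewrite inE => /predU1P[<-|/IH[s' e]]; first by exists s.
by exists (j :: s'); rewrite e /= savg_comm.
Qed.

Lemma blip_smooth L K s f : blip L K f -> blip L K (smooth s f).
Proof. by move=> Bf; elim: s => //= i s IH; exact: blip_savg. Qed.

Lemma smooth_close L K s f x : blip L K f -> `|smooth s f x - f x| <= (size s)%:R * (L * rho).
Proof.
move=> Bf; elim: s => [|i s IH] /=; first by rewrite subrr normr0 mul0r.
have [L0 sL _] := blip_smooth s Bf; have h := savg_close i x L0 sL.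
rewrite -nat1r mulrDl mul1r -[X in `|X|](subrKA (smooth s f x)).
by apply: le_trans (ler_normD _ _) _; exact: lerD.
Qed.

Lemma smooth_mono s f f' x : (forall y, f y <= f' y) -> smooth s f x <= smooth s f' x.
Proof. by move=> ff'; elim: s x => [|i s IH] x //=; exact: savg_mono. Qed.

(** The transition operator is linear and translation invariant. *)
Lemma condE_smooth (T : R) m (P : probability (Omega T m) R) s t b L K l f x :
  0 <= s -> s < t -> t <= T -> blip L K f ->
  condE P s t b (smooth l f) x = smooth l (condE P s t b f) x.
Proof.
move=> s0 st tT Bf; elim: l x => [//|i l IH] x /=.
have Bl := blip_smooth l Bf.
have ii k : P.-integrable setT (EFin \o (fun w => smooth l f (x + inc s t b w + (eps * k%:R) *: unitv i))).
  have := condE_integrable P Bl s0 st tT b (x + (eps * k%:R) *: unitv i).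
  by apply: eq_integrable => // w _ /=; rewrite addrAC.
rewrite /condE /savg RintegralZl//; last by apply: integrable_bigsum => k; exact: ii.
rewrite Rintegral_bigsum; last by move=> k; exact: ii.
congr (_ * _); apply: eq_bigr => k _; rewrite -/(condE P s t b f) -IH.
by apply: eq_Rintegral => w _; rewrite addrAC.
Qed.

Definition pd i f x := (f (x + eps *: unitv i) - f x) / eps.

Section Gradient.
Variables (L K : R) (f : 'cV[R]_d -> R).
Hypothesis Bf : blip L K f.
Let V := smooth (enum 'I_d) f.
Let BV : blip L K V. Proof. exact: blip_smooth. Qed.
Let L0 : 0 <= L. Proof. by case: Bf. Qed.

(** The step of the quotient equals the spacing of the average, so the sum telescopes into a
    quotient over the long step [rho]. This is why [pd i V] has a Lipschitz constant [2 * L / rho]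
    free of [eps]. *)
Let pdE i : exists2 W, blip L K W & forall x, pd i V x = (W (x + rho *: unitv i) - W x) / rho.
Proof.
have [s e] := @smooth_mem i (enum 'I_d) f (mem_enum _ _).
exists (smooth s f); first exact: blip_smooth.
move=> x; rewrite /V e; set W := smooth s f.
pose G k := W (x + (eps * k%:R) *: unitv i).
rewrite /pd savgB -(big_mkord xpredT (fun k => W (x + eps *: unitv i + (eps * k%:R) *: unitv i) - G k)).
rewrite (eq_bigr (fun k => G k.+1 - G k)); last first.
  by move=> k _; rewrite /G -addrA -scalerDl -nat1r mulrDr mulr1.
rewrite telescope_sumr// /G mulr0 scale0r addr0 /rho invfM.
by rewrite [LHS]mulrC mulrA [RHS]mulrC.
Qed.

Lemma pd_bound i x : `|pd i V x| <= L.
Proof.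
have ri : 0 <= rho^-1 by rewrite invr_ge0 ltW.
have [W [_ WL _] ->] := pdE i; rewrite normrM (ger0_norm ri) ler_pdivrMr//.
apply: le_trans (WL _ _) _; rewrite addrAC subrr add0r l1Z l1_unitv mulr1 ger0_norm// ltW//.
Qed.

Lemma pd_lip i : lip (2 * L / rho) (pd i V).
Proof.
have ri : 0 <= rho^-1 by rewrite invr_ge0 ltW.
move=> x y; have [W [_ WL _] e] := pdE i; rewrite !e -mulrBl normrM (ger0_norm ri).
rewrite mulrAC ler_wpM2r//.
have h1 := WL (x + rho *: unitv i) (y + rho *: unitv i); rewrite opprD addrACA subrr addr0 in h1.
have h2 := WL x y.
by move: h1 h2; rewrite !ler_norml => /andP[? ?] /andP[? ?]; apply/andP; split; lra.
Qed.

Let c := 2 * L / rho.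
Let c0 : 0 <= c. Proof. by rewrite divr_ge0 ?mulr_ge0// ltW. Qed.

Let taylor_coord i x a : `|V (x + a *: unitv i) - V x - a * pd i V x| <= 2 * c * a ^+ 2 + 2 * L * eps.
Proof.
have [_ VL _] := BV.
have := @taylor_1d R (fun a => V (x + a *: unitv i)) (fun a => pd i V (x + a *: unitv i)) L c eps eps0 L0 c0.
rewrite scale0r addr0; apply.
- move=> a1 a2; apply: le_trans (VL _ _) _.
  by rewrite opprD addrACA subrr add0r -scalerBl l1Z l1_unitv mulr1.
- by move=> a1; rewrite scalerDl addrA /pd mulrC mulfVK// gt_eqF.
- move=> a1 a2; apply: le_trans (pd_lip _ _ _) _.
  by rewrite opprD addrACA subrr add0r -scalerBl l1Z l1_unitv mulr1.
- by move=> a1; exact: pd_bound.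
Qed.

Let taylor_list x (z : 'cV[R]_d) s :
  `|V (x + \sum_(i <- s) z i 0 *: unitv i) - V x - \sum_(i <- s) pd i V x * z i 0| <=
  2 * c * (\sum_(i <- s) `|z i 0|) ^+ 2 + (size s)%:R * (2 * L * eps).
Proof.
elim: s => [|i s IH]; first by rewrite !big_nil addr0 subrr subr0 normr0 expr0n mulr0 mul0r addr0.
rewrite !big_cons /=.
have -> : (size s).+1%:R * (2 * L * eps) = (size s)%:R * (2 * L * eps) + 2 * L * eps.
  by rewrite -natr1 mulrDl mul1r.
set S := \sum_(j <- s) z j 0 *: unitv j in IH *; set B := \sum_(j <- s) `|z j 0| in IH *.
have SB : l1 S <= B.
  rewrite /S /B; elim: (s) => [|j r Hr]; first by rewrite !big_nil l1_0.
  rewrite !big_cons; apply: le_trans (l1D _ _) _; apply: lerD => //.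
  by rewrite l1Z l1_unitv mulr1.
have B0 : 0 <= B by apply: le_trans SB; exact: l1_ge0.
have h1 := taylor_coord i (x + S) (z i 0).
have h2 : `|(pd i V (x + S) - pd i V x) * z i 0| <= c * B * `|z i 0|.
  rewrite normrM ler_wpM2r//; apply: le_trans (pd_lip _ _ _) _.
  by rewrite addrAC subrr add0r ler_wpM2l.
rewrite (_ : x + (z i 0 *: unitv i + S) = x + S + z i 0 *: unitv i); last by rewrite -addrA [S + _]addrC.
have z2 : z i 0 ^+ 2 = `|z i 0| ^+ 2 by rewrite real_normK// num_real.
rewrite z2 in h1.
have s1 : 0 <= c * B * `|z i 0| by exact: (mulr_ge0 (mulr_ge0 c0 B0)).
move: IH h1 h2; rewrite sqrrD; move: (\sum_(j <- s) _) => D.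
rewrite !ler_norml => /andP[? ?] /andP[? ?] /andP[? ?].
by apply/andP; split; lra.
Qed.

(** Add the coordinates one at a time. The term that is not quadratic is proportional to [eps],
    which stays free once [rho] is fixed. *)
Lemma smooth_taylor x z : `|V (x + z) - V x - \sum_i pd i V x * z i 0| <=
  4 * L / rho * l1 z ^+ 2 + d%:R * (2 * L * eps).
Proof.
have := taylor_list x z (enum 'I_d); rewrite size_enum_ord !big_enum /=.
rewrite (_ : \sum_i z i 0 *: unitv i = z); last first.
  apply/matrixP => i j; rewrite (ord1 j) summxE (bigD1 i)//= big1 ?addr0.
    by rewrite !mxE !eqxx mulr1.
  by move=> k ki; rewrite !mxE eq_sym (negbTE ki) mulr0.
rewrite -/(l1 z) (_ : 2 * c = 4 * L / rho)// /c mulrA; congr (_ / _); ring.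
Qed.

End Gradient.

End Smoothing.

(** * The discrete hedge *)

Section DiscreteHedge.
Context (R : realType) (T : R) (d m : nat) (P : probability (Omega T m) R).
Hypothesis hP : wiener_measure P.
Hypothesis T0 : 0 < T.
Let T0' : 0 <= T. Proof. exact: ltW. Qed.
Variables (M : nat) (r : nat -> R) (del : R).
Hypothesis hp : is_partition T M r del.
Variables (V : nat -> 'cV[R]_d -> R) (p : nat -> 'cV[R]_d -> 'cV[R]_d).
Variables (L K Lp C1 eta Kc C : R).
Hypothesis BV : forall k, (k <= M)%N -> blip L K (V k).
Hypothesis Bp : forall k i, (k < M)%N -> blip Lp L (fun x => p k x i 0).
Hypotheses (C10 : 0 <= C1) (eta0 : 0 <= eta) (Kc0 : 0 <= Kc) (C0 : 0 <= C).
Hypothesis taylor : forall k x z, (k < M)%N ->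
  `|V k.+1 (x + z) - V k.+1 x - \sum_i p k x i 0 * z i 0| <= C1 * l1 z ^+ 2 + eta.
Hypothesis moment4 : forall (s t : R) (b : control R d m), 0 <= s -> s <= t -> t <= T ->
  (forall i, `|b.1 i 0| <= Kc) -> (forall i j, `|b.2 i j| <= Kc) ->
  (\int[P]_w (l1 (inc s t b w) ^+ 4)%:E <= (C * (t - s) ^+ 2)%:E)%E.

(** The position on a cell depends on the state at its start, read off the path of the state, so the
    same function hedges against every control. *)
Definition discrete_hedge : R -> Omega T d -> 'cV[R]_d :=
  cells M r (fun k x => p k (ev x (r k))).

Let hedge_coord k i : (k < M)%N -> Fmeas (r k) (fun x : Omega T d => p k (ev x (r k)) i 0).
Proof.
move=> kM; have [h1 _ _] := rk hp kM.
have mX i' : Fmeas (r k) (fun x : Omega T d => ev x (r k) i' 0) by apply: Fmeas_ev; rewrite h1 lexx.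
exact: (blip_measurable (Bp i kM) mX).
Qed.

Lemma discrete_hedge_hedge : hedge discrete_hedge.
Proof.
have M0 := partition_size_gt0 hp T0.
have pb k x i : (k < M)%N -> `|p k x i 0| <= L by move=> kM; have [_ _] := Bp i kM; apply.
split.
- exists ((d * 1)%:R * L ^+ 2 + 1) => t x /andP[t0 tT].
  have L0 : 0 <= L by have [] := BV (leqnn M).
  apply: frob_bounded => // i j; rewrite (ord1 j); have [t0'|t0'] := leP t 0.
    by rewrite /discrete_hedge (cells0 hp)// mxE normr0.
  have [|k kM kt] := @partition_locate _ _ _ _ _ t hp; first by rewrite t0' tT.
  by rewrite /discrete_hedge (cellsE hp _ _ kM kt); exact: pb.
- apply: jointly_measurable_cells => l i j lM; rewrite (ord1 j).
  by have [h1 h2 h3] := rk hp lM; apply: Fmeas_measurable (hedge_coord i lM); exact: le_trans (ltW h2) h3.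
- move=> t /andP[t0 tT]; apply/filt_measurable_Fmeas => i j; rewrite (ord1 j).
  have [t0'|t0'] := leP t 0.
    rewrite /Fmeas (_ : (fun w => _) = cst 0); first exact: measurable_cst.
    by apply/funext => w; rewrite /discrete_hedge (cells0 hp)// mxE.
  have [|k kM kt] := @partition_locate _ _ _ _ _ t hp; first by rewrite t0' tT.
  rewrite (_ : (fun w => _) = fun x : Omega T d => p k (ev x (r k)) i 0).
    by case/andP: kt => kt _; exact: (Fmeas_sub (ltW kt) (hedge_coord i kM)).
  by apply/funext => w; rewrite /discrete_hedge (cellsE hp _ _ kM kt).
Qed.

Variable u : nat -> control R d m.
Hypothesis u1 : forall k i, (k < M)%N -> `|(u k).1 i 0| <= Kc.
Hypothesis u2 : forall k i j, (k < M)%N -> `|(u k).2 i j| <= Kc.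
Hypothesis super : forall k x, (k < M)%N -> condE P (r k) (r k.+1) (u k) (V k.+1) x <= V k x.

Let X k w : 'cV[R]_d := step_state M r (cst_family u) (r k) (w : Omega T m).

Let X_meas k i : (k <= M)%N -> Fmeas (r k) (fun w => X k w i 0).
Proof. by move=> kM; exact: (step_state_meas hp (cst_family_step T M r u) i (partition_itv hp kM)). Qed.

Let XS k w : (k < M)%N -> X k.+1 w = X k w + inc (r k) (r k.+1) (u k) w.
Proof. by move=> kM; have [h1 h2 h3] := rk hp kM; rewrite /X (step_state_cell hp _ _ kM)// lexx (ltW h2). Qed.

Let coef k w : 'M[R]_(1, m) := (p k (X k w))^T *m (u k).2.

Let coef_meas k : (k < M)%N -> filt_measurable (r k) (coef k).
Proof.
move=> kM; apply/filt_measurable_Fmeas => i j; rewrite /Fmeas.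
rewrite (_ : (fun w => _) = fun w => \sum_l p k (X k w) l 0 * (u k).2 l j).
  apply: measurable_sum => l; apply: measurable_funM; last exact: measurable_cst.
  exact: (blip_measurable (Bp l kM) (fun i => X_meas i (ltnW kM))).
by apply/funext => w; rewrite mxE; apply: eq_bigr => l _; rewrite mxE (ord1 i).
Qed.

Let coef_bnd k : (k < M)%N -> exists K : R, forall w, frob (coef k w) <= K.
Proof.
move=> kM; have pb x i : `|p k x i 0| <= L by have [_ _] := Bp i kM; apply.
have L0 : 0 <= L by have [] := BV (leqnn M).
exists ((1 * m)%:R * (\sum_(l < d) L * Kc) ^+ 2 + 1) => w.
apply: frob_bounded => [|i j]; first by apply: sumr_ge0 => l _; exact: mulr_ge0.
rewrite mxE (le_trans (ler_norm_sum _ _ _))//; apply: ler_sum => l _.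
by rewrite normrM mxE (ord1 i) ler_pM// u2.
Qed.

Let S := partition_process hp coef_meas coef_bnd.

Let gain_ae : {ae P, forall w, forall t, 0 <= t <= T ->
  ev (hedge_gain P hp discrete_hedge u w) t = sp_integral S t w}.
Proof.
apply: (ito_simple hP T0); apply/aeW => w; apply: ae_mono (ae_interior hp) => s hs /hs[i iN /andP[ri ri']].
have si : r i < s <= r i.+1 by rewrite ri ltW.
rewrite /hedge_process !(partition_processE hp _ _ w iN)// /discrete_hedge (cellsE hp _ _ iN si).
rewrite (step_pathE T0 hp (cst_family_step T M r u))//.
exact: (partition_itv hp (ltnW iN)).
Qed.

Let J t w : R := sp_integral S t w 0 0.
Let gain k t w : R := \sum_i p k (X k w) i 0 * ((u k).2 *m (ev w t - ev w (r k))) i 0.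

Let J_cell k t w : (k < M)%N -> r k <= t <= r k.+1 -> J t w = J (r k) w + gain k t w.
Proof.
move=> kM kt; rewrite /J /S (partition_integral_cell hp coef_meas coef_bnd w kM kt) mxE; congr (_ + _).
by rewrite /coef -mulmxA mxE; apply: eq_bigr => i _; rewrite mxE.
Qed.

Let J_meas k : (k <= M)%N -> Fmeas (r k) (J (r k)).
Proof.
move=> kM; have /andP[h0 _] := partition_itv hp kM.
by have /filt_measurable_Fmeas/(_ 0 0) := sp_integral_meas S h0.
Qed.

Let next k x := condE P (r k) (r k.+1) (u k) (V k.+1) x.

Let B_next k : (k < M)%N -> blip L K (next k).
Proof. by move=> kM; have [h1 h2 h3] := rk hp kM; exact: (blip_condE P (BV kM) h1 h2 h3 (u k)). Qed.

(** The part of the change of value on cell [k] that the hedge misses: the Taylor remainder minus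
    its conditional mean. *)
Let D k w := V k.+1 (X k.+1 w) - next k (X k w) - gain k (r k.+1) w.

Let rT k : (k <= M)%N -> r k <= T. Proof. by move=> kM; case/andP: (partition_itv hp kM). Qed.

Let VX_meas k : (k <= M)%N -> Fmeas (r k) (fun w => V k (X k w)).
Proof. by move=> kM; exact: (blip_measurable (BV kM) (fun i => X_meas i kM)). Qed.

Let nextX_meas k : (k < M)%N -> Fmeas (r k) (fun w => next k (X k w)).
Proof. by move=> kM; exact: (blip_measurable (B_next kM) (fun i => X_meas i (ltnW kM))). Qed.

Let gain_orth' k Y : (k < M)%N -> Fmeas (r k) Y -> isL2 P Y ->
  isL2 P (fun w => Y w * gain k (r k.+1) w) /\ (\int[P]_w (Y w * gain k (r k.+1) w) = 0)%R.
Proof.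
move=> kM mY LY; have [h1 h2 h3] := rk hp kM.
apply: (gain_orth hP (L := L) (u k) (G := fun w => p k (X k w)) h1 (ltW h2) h3 _ _ mY LY).
  by move=> i; exact: (blip_measurable (Bp i kM) (fun i => X_meas i (ltnW kM))).
by move=> w i; have [_ _] := Bp i kM; apply.
Qed.

Let cst_meas s (a : R) : Fmeas s (cst a : Omega T m -> R).
Proof. exact: measurable_cst. Qed.

Let gain_L2 k : (k < M)%N -> isL2 P (gain k (r k.+1)).
Proof.
move=> kM; have [+ _] := @gain_orth' k (cst 1) kM (@cst_meas (r k) 1) (isL2_cst P 1).
by rewrite (_ : (fun w => _) = gain k (r k.+1))//; apply/funext => w; rewrite mul1r.
Qed.

Let bounded_L2 k (f : Omega T m -> R) (B : R) : (k <= M)%N -> Fmeas (r k) f ->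
  (forall w, `|f w| <= B) -> isL2 P f.
Proof. by move=> kM mf fB; apply: isL2_bounded fB; exact: Fmeas_measurable (rT kM) mf. Qed.

Let VX_L2 k : (k <= M)%N -> isL2 P (fun w => V k (X k w)).
Proof. by move=> kM; have [_ _ VK] := BV kM; apply: (bounded_L2 kM (VX_meas kM)) => w; exact: VK. Qed.

Let nextX_L2 k : (k < M)%N -> isL2 P (fun w => next k (X k w)).
Proof.
by move=> kM; have [_ _ VK] := B_next kM; apply: (bounded_L2 (ltnW kM) (nextX_meas kM)) => w; exact: VK.
Qed.

Let D_L2 k : (k < M)%N -> isL2 P (D k).
Proof.
move=> kM; apply: isL2B (gain_L2 kM); apply: isL2B (nextX_L2 kM); exact: VX_L2.
Qed.

Let D_orth k Y : (k < M)%N -> Fmeas (r k) Y -> isL2 P Y -> (\int[P]_w (Y w * D k w) = 0)%R.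
Proof.
move=> kM mY LY; have [h1 h2 h3] := rk hp kM.
have [Lg g0] := gain_orth' kM mY LY.
have mul (f : Omega T m -> R) : isL2 P f -> (forall w, `|f w| <= K) -> isL2 P (fun w => Y w * f w).
  move=> [mf _] fK; rewrite (_ : (fun w => _) = fun w => f w * Y w); last by apply/funext => w; rewrite mulrC.
  exact: (isL2_bounded_mul mf fK LY).
have [_ _ VK] := BV kM; have [_ _ NK] := B_next kM.
have L1 := mul _ (VX_L2 kM) (fun w => VK _).
have L2 := mul _ (nextX_L2 kM) (fun w => NK _).
have -> : (fun w => Y w * D k w) = fun w => Y w * V k.+1 (X k.+1 w) - Y w * next k (X k w) - Y w * gain k (r k.+1) w.
  by apply/funext => w; rewrite /D !mulrBr.
rewrite RintegralB//; [|by apply: isL2_integrable; exact: isL2B|exact: isL2_integrable].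
rewrite RintegralB//; [|exact: isL2_integrable..].
rewrite g0 subr0; under eq_Rintegral do rewrite XS//.
by rewrite (condE_freeze hP (BV kM) h1 h2 h3 (u k) mY LY (fun i => X_meas i (ltnW kM))) subrr.
Qed.

Let Mart k w := \sum_(j < k) D j w.

Let MartS k w : Mart k.+1 w = Mart k w + D k w.
Proof. exact: big_ord_recr. Qed.

Let D_meas k : (k < M)%N -> Fmeas (r k.+1) (D k).
Proof.
move=> kM; have [h1 h2 h3] := rk hp kM.
rewrite /Fmeas (_ : D k = fun w => V k.+1 (X k.+1 w) - next k (X k w) - (J (r k.+1) w - J (r k) w)).
  apply: measurable_funB; last first.
    by apply: measurable_funB; [exact: J_meas|exact: (Fmeas_sub (ltW h2) (J_meas (ltnW kM)))].
  by apply: measurable_funB; [exact: VX_meas|exact: (Fmeas_sub (ltW h2) (nextX_meas kM))].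
apply/funext => w; rewrite /D (J_cell w kM) ?lexx ?(ltW h2)//.
by rewrite [J _ _ + _]addrC addrK.
Qed.

Let Mart_meas k : (k <= M)%N -> Fmeas (r k) (Mart k).
Proof.
move=> kM; rewrite /Fmeas /Mart; apply: measurable_sum => j.
have jM : (j < M)%N := leq_trans (ltn_ord j) kM.
exact: (Fmeas_sub (partition_mono hp (ltn_ord j) kM) (D_meas jM)).
Qed.

Let Mart_L2 k : (k <= M)%N -> isL2 P (Mart k).
Proof. by move=> kM; apply: isL2_sum => j _; apply: D_L2; exact: leq_trans (ltn_ord j) kM. Qed.

Lemma hedge_martingale : martingale P r Mart M.
Proof.
split.
- by move=> k kM; have [_ h2 _] := rk hp kM; exact: ltW.
- exact: rT.
- exact: Mart_meas.
- exact: Mart_L2.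
- by move=> w; rewrite /Mart big_ord0.
- move=> k Y kM mY LY; rewrite -[RHS](D_orth kM mY LY); apply: eq_Rintegral => w _.
  by rewrite MartS addrAC subrr add0r.
Qed.

Let Rem k w := V k.+1 (X k.+1 w) - V k.+1 (X k w) -
  \sum_i p k (X k w) i 0 * inc (r k) (r k.+1) (u k) w i 0.

(** The conditional mean of the Taylor remainder [Rem], known at the start of the cell and hence
    orthogonal to [D]. *)
Let h k w := next k (X k w) - V k.+1 (X k w) - (r k.+1 - r k) * \sum_i p k (X k w) i 0 * (u k).1 i 0.

Let RemE k w : Rem k w = D k w + h k w.
Proof.
rewrite /Rem /D /h /gain.
have -> : \sum_i p k (X k w) i 0 * inc (r k) (r k.+1) (u k) w i 0 =
    (r k.+1 - r k) * (\sum_i p k (X k w) i 0 * (u k).1 i 0) +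
    \sum_i p k (X k w) i 0 * ((u k).2 *m (ev w (r k.+1) - ev w (r k))) i 0.
  rewrite mulr_sumr -big_split; apply: eq_bigr => i _ /=.
  by rewrite /inc [in LHS]mxE [X in _ * (X + _)]mxE mulrDr mulrCA.
ring.
Qed.

Let h_meas k : (k < M)%N -> Fmeas (r k) (h k).
Proof.
move=> kM; apply: measurable_funB.
  apply: measurable_funB; first exact: nextX_meas.
  exact: (blip_measurable (BV kM) (fun i => X_meas i (ltnW kM))).
apply: measurable_funM; first exact: measurable_cst.
apply: measurable_sum => i; apply: measurable_funM; last exact: measurable_cst.
exact: (blip_measurable (Bp i kM) (fun i => X_meas i (ltnW kM))).
Qed.

Let h_L2 k : (k < M)%N -> isL2 P (h k).
Proof.
move=> kM; have [_ _ VK] := BV kM; have [_ _ NK] := B_next kM; have [h1 h2 h3] := rk hp kM.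
apply: (bounded_L2 (B := K + K + (r k.+1 - r k) * \sum_(i < d) L * Kc) (ltnW kM) (h_meas kM)) => w.
apply: le_trans (ler_normB _ _) _; apply: lerD.
  by apply: le_trans (ler_normB _ _) _; exact: lerD.
have dr0 : 0 <= r k.+1 - r k by rewrite subr_ge0 ltW.
rewrite normrM (ger0_norm dr0) ler_wpM2l//.
apply: le_trans (ler_norm_sum _ _ _) _; apply: ler_sum => i _.
by rewrite normrM ler_pM ?u1//; have [_ _] := Bp i kM; apply.
Qed.

(* [D] is the centred remainder, and centring decreases the second moment *)
Let D_moment k : (k < M)%N ->
  (\int[P]_w D k w ^+ 2 <= 2 * C1 ^+ 2 * (C * (r k.+1 - r k) ^+ 2) + 2 * eta ^+ 2)%R.
Proof.
move=> kM; have [h1 h2 h3] := rk hp kM.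
have LD := D_L2 kM; have Lh := h_L2 kM.
have LR : isL2 P (Rem k).
  by rewrite (_ : Rem k = fun w => D k w + h k w); [exact: isL2D|apply/funext => w; exact: RemE].
have iD2 := isL2M_integrable LD LD; have ihD := isL2M_integrable Lh LD.
have iR2 := isL2M_integrable LR LR.
have l : (\int[P]_w D k w ^+ 2 <= \int[P]_w Rem k w ^+ 2)%R.
  have -> : (\int[P]_w D k w ^+ 2 = \int[P]_w (D k w * D k w + 2 * (h k w * D k w)))%R.
    rewrite RintegralD//; last first.
      by have := integrableZl measurableT 2 ihD; apply: eq_integrable => // w _ /=; rewrite EFinM.
    rewrite RintegralZl// (D_orth kM (h_meas kM) Lh) mulr0 addr0.
    by apply: eq_Rintegral => w _; rewrite expr2.
  under [leRHS]eq_Rintegral do rewrite expr2.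
  apply: le_Rintegral => //.
    have := integrableD measurableT iD2 (integrableZl measurableT 2 ihD).
    by apply: eq_integrable => // w _ /=; rewrite EFinD EFinM.
  move=> w _; rewrite RemE.
  have : 0 <= h k w ^+ 2 by rewrite sqr_ge0.
  by move: (h k w) (D k w) => x y; nra.
apply: le_trans l _; rewrite -lee_fin moment2_Rintegral//.
have b w : Rem k w ^+ 2 <= 2 * C1 ^+ 2 * l1 (inc (r k) (r k.+1) (u k) w) ^+ 4 + 2 * eta ^+ 2.
  have t := taylor (X k w) (inc (r k) (r k.+1) (u k) w) kM; rewrite -XS// -/(Rem k w) in t.
  set y := l1 _ in t *.
  have y0 : 0 <= y by exact: l1_ge0.
  apply: (@le_trans _ _ ((C1 * y ^+ 2 + eta) ^+ 2)).
    rewrite -[leLHS]real_normK ?num_real// lerXn2r ?nnegrE//.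
    by rewrite addr_ge0// mulr_ge0// sqr_ge0.
  have : 0 <= (C1 * y ^+ 2 - eta) ^+ 2 by rewrite sqr_ge0.
  rewrite (_ : 4%N = (2 * 2)%N)// exprM !sqrrD exprMn; lra.
have ml : measurable_fun setT (fun w : Omega T m => l1 (inc (r k) (r k.+1) (u k) w)).
  apply: measurable_sum => i; apply: measurableT_comp => //; exact: inc_meas (ltW h2) h3.
apply: (@le_trans _ _ (\int[P]_w ((2 * C1 ^+ 2)%:E * (l1 (inc (r k) (r k.+1) (u k) w) ^+ 4)%:E + (2 * eta ^+ 2)%:E))%E).
  by apply: le_integral_pointwise => w _; rewrite -EFinM -EFinD lee_fin.
have c0 : 0 <= 2 * C1 ^+ 2 by rewrite mulr_ge0// sqr_ge0.
have y4 (w : Omega T m) : 0 <= l1 (inc (r k) (r k.+1) (u k) w) ^+ 4 by rewrite exprn_ge0// l1_ge0.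
have m4 : measurable_fun setT (fun w : Omega T m => (l1 (inc (r k) (r k.+1) (u k) w) ^+ 4)%:E).
  by apply/measurable_EFinP; exact: measurable_funX.
rewrite ge0_integralD//; last 3 first.
- by move=> w _; apply: mule_ge0; rewrite lee_fin.
- by apply: emeasurable_funM.
- by move=> w _; rewrite lee_fin mulr_ge0// sqr_ge0.
rewrite integral_cst//= probability_setT mule1 ge0_integralZl//=; last by move=> w _; rewrite lee_fin.
rewrite EFinD (EFinM (2 * C1 ^+ 2)); apply: leeD2r; apply: lee_wpmul2l; first by rewrite lee_fin.
by apply: moment4 => //; [exact: ltW|move=> i; exact: u1|move=> i j; exact: u2].
Qed.

(** Orthogonal increments add their second moments: the squared cell lengths sum to at most
    [del * T], while the error [eta] is paid once per cell. *)
Lemma hedge_martingale_moment :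
  (moment2 P (Mart M) <= (2 * C1 ^+ 2 * C * del * T + 2 * eta ^+ 2 * M%:R)%:E)%E.
Proof.
have [r0 rM _ rd] := hp.
have pyth k : (k <= M)%N -> (\int[P]_w Mart k w ^+ 2 <= 2 * C1 ^+ 2 * C * del * r k + 2 * eta ^+ 2 * k%:R)%R.
  elim: k => [|k IH] kM.
    rewrite r0 !mulr0 addr0 (_ : (fun w => _) = cst 0); last by apply/funext => w; rewrite /Mart big_ord0 expr0n.
    by rewrite Rintegral_cst//= mul0r.
  have LD := D_L2 kM; have LM := Mart_L2 (ltnW kM).
  have iD2 := isL2M_integrable LD LD; have iMD := isL2M_integrable LM LD.
  have iM2 := isL2M_integrable LM LM.
  have i2 : P.-integrable setT (EFin \o (fun w => 2 * (Mart k w * D k w))).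
    by have := integrableZl measurableT 2 iMD; apply: eq_integrable => // w _ /=; rewrite EFinM.
  have -> : (\int[P]_w Mart k.+1 w ^+ 2 = \int[P]_w Mart k w ^+ 2 + \int[P]_w D k w ^+ 2)%R.
    transitivity (\int[P]_w (Mart k w * Mart k w + 2 * (Mart k w * D k w) + D k w * D k w))%R.
      by apply: eq_Rintegral => w _; rewrite MartS; ring.
    rewrite RintegralD//; last first.
      by have := integrableD measurableT iM2 i2; apply: eq_integrable.
    rewrite RintegralD// RintegralZl// (D_orth kM (Mart_meas (ltnW kM)) LM) mulr0 addr0.
    by congr (_ + _); apply: eq_Rintegral => w _; rewrite expr2.
  have [h1 h2 h3] := rk hp kM.
  have IHk := IH (ltnW kM); have Dk := D_moment kM.
  have c0 : 0 <= 2 * C1 ^+ 2 * C by rewrite mulr_ge0// mulr_ge0// sqr_ge0.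
  have sq : (r k.+1 - r k) ^+ 2 <= del * (r k.+1 - r k).
    by rewrite expr2 ler_wpM2r ?rd// subr_ge0 ltW.
  have := ler_wpM2l c0 sq; rewrite -natr1; lra.
rewrite -moment2_Rintegral; last exact: Mart_L2.
by rewrite lee_fin -[X in _ * del * X]rM; exact: pyth.
Qed.

(** The supersolution inequality bounds [next] by the current value, so beyond the gain only the
    martingale can raise the value. *)
Let value_gain k w : (k <= M)%N -> V k (X k w) - J (r k) w <= V 0 0 + Mart k w.
Proof.
elim: k => [|k IH] kM.
  have [r0 _ _ _] := hp.
  rewrite /Mart big_ord0 addr0 /X /J r0 (step_state0 hp) (sp_integral0 S).
  by rewrite mxE subr0.
have [h1 h2 h3] := rk hp kM.
rewrite MartS (J_cell w kM) ?lexx ?(ltW h2)//.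
have := IH (ltnW kM); have := super (X k w) kM; rewrite -/(next k (X k w)) /D; lra.
Qed.

Variables (gL : 'cV[R]_d -> R) (a : R).
Hypothesis gl : lip L gL.
Hypothesis gV : forall k x, (k <= M)%N -> gL x <= V k x + a.

(** The comparison is made at the start of the cell that contains [t]. Inside the cell the Brownian
    increment enters twice, through the state and through the hedging gain, hence the factor 2; the
    drift enters through the state alone. *)
Lemma hedge_payoff : {ae P, forall w, forall t, 0 <= t <= T ->
  exists2 k, (k < M)%N /\ r k <= t <= r k.+1 &
  gL (ev (step_path M r (cst_family u) w) t) - ev (hedge_gain P hp discrete_hedge u w) t 0 0 <=
  V 0 0 + a + amax Mart M w + L * (d%:R * Kc) * del + 2 * (L * (d%:R * Kc)) * l1 (ev w t - ev w (r k))}.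
Proof.
apply: ae_mono gain_ae => w hw t tT; have [k kM kt] := partition_locate_left T0 hp tT.
exists k => //; have /andP[k1 k2] := kt; have [h1 h2 h3] := rk hp kM.
rewrite (hw _ tT) -/(J t w) (J_cell w kM kt) (step_pathE T0 hp (cst_family_step T M r u))//.
rewrite (step_state_cell hp _ w kM kt) -/(X k w) /cst_family.
have [L0 _ _] := BV (ltnW kM).
have l := lip_le (X k w + inc (r k) t (u k) w) (X k w) gl.
rewrite addrAC subrr add0r in l.
set y := l1 (ev w t - ev w (r k)).
have u2k : l1 ((u k).2 *m (ev w t - ev w (r k))) <= d%:R * Kc * y.
  by apply: l1_mulmx => i j; exact: u2.
have u1k : l1 (u k).1 <= d%:R * Kc.
  rewrite /l1 mulr_natl -[X in _ *+ X](card_ord d) -sumr_const.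
  by apply: ler_sum => i _; exact: u1.
have dK0 : 0 <= d%:R * Kc by rewrite mulr_ge0.
have li : l1 (inc (r k) t (u k) w) <= d%:R * Kc * del + d%:R * Kc * y.
  apply: le_trans (l1D _ _) _; apply: lerD => //.
  rewrite l1Z ger0_norm ?subr_ge0// mulrC; apply: ler_pM => //; [exact: l1_ge0|by rewrite subr_ge0|].
  by have [_ _ _ rd] := hp; apply: le_trans (rd k kM); rewrite lerD2r.
have gk : - gain k t w <= L * (d%:R * Kc * y).
  rewrite /gain; apply: (@le_trans _ _ (L * l1 ((u k).2 *m (ev w t - ev w (r k))))); last by rewrite ler_wpM2l.
  rewrite -sumrN /l1 mulr_sumr; apply: ler_sum => i _.
  apply: le_trans (ler_norm _) _; rewrite normrN normrM ler_wpM2r//.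
  by have [_ _] := Bp i kM; apply.
have v := value_gain w (ltnW kM).
have am := amax_ub w hedge_martingale (ltnW kM).
have am' := le_trans (ler_norm _) am.
have g1 := gV (X k w) (ltnW kM).
have := ler_wpM2l L0 li; lra.
Qed.

Lemma hedge_error : exists2 E : Omega T m -> R, isL2 P E /\ (forall w, 0 <= E w) /\
  (moment2 P E <= (8 * (2 * C1 ^+ 2 * C * del * T + 2 * eta ^+ 2 * M%:R))%:E)%E &
  {ae P, forall w, forall t, 0 <= t <= T ->
  exists2 k, (k < M)%N /\ r k <= t <= r k.+1 &
  gL (ev (step_path M r (cst_family u) w) t) - ev (hedge_gain P hp discrete_hedge u w) t 0 0 <=
  V 0 0 + a + E w + L * (d%:R * Kc) * del + 2 * (L * (d%:R * Kc)) * l1 (ev w t - ev w (r k))}.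
Proof.
have hm := hedge_martingale; exists (amax Mart M); last exact: hedge_payoff.
split; first exact: amax_isL2 hm.
split; first by move=> w; exact: amax_ge0.
apply: le_trans (doob hm) _; rewrite (EFinM 8); apply: lee_wpmul2l; first by rewrite lee_fin.
exact: hedge_martingale_moment.
Qed.

End DiscreteHedge.

(** * Oscillation of the canonical process *)

Section Oscillation.
Context (R : realType) (T : R) (m : nat) (P : probability (Omega T m) R).
Hypothesis hP : wiener_measure P.
Hypothesis T0 : 0 < T.
Let T0' : 0 <= T. Proof. exact: ltW. Qed.
Implicit Types (w : Omega T m) (s t dl : R).

(* rational times make the supremum countable *)
Definition osc dl w : \bar R := ereal_sup [set z | exists2 q : rat * rat,
  `|ratr q.1 - ratr q.2 : R| <= dl & z = (l1 (ev w (ratr q.1) - ev w (ratr q.2)))%:E].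

Lemma osc_ge0 dl w : 0 <= dl -> (0 <= osc dl w)%E.
Proof.
move=> dl0; apply: (@ereal_sup_ubound _ _ 0%E); exists (0, 0) => /=; first by rewrite subrr normr0.
by rewrite subrr l1_0.
Qed.

Lemma osc_measurable dl : measurable_fun setT (osc dl).
Proof.
apply: (measurability _ (ErealGenOInfty.measurableE R)) => //.
move=> _ [_ [y ->] <-]; rewrite setTI.
rewrite (_ : _ @^-1` _ = \bigcup_(q in [set q : rat * rat | `|ratr q.1 - ratr q.2 : R| <= dl])
    [set w | y < l1 (ev w (ratr q.1) - ev w (ratr q.2))]).
  rewrite bigcup_mkcond; apply: countable_bigcupT_measurable; first exact: countableP.
  move=> q; case: ifP => // _.
  have mf : measurable_fun setT (fun w => l1 (ev w (ratr q.1) - ev w (ratr q.2))).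
    apply: measurable_sum => i; apply: measurableT_comp => //.
    rewrite (_ : (fun w => _) = fun w => ev w (ratr q.1) i 0 - ev w (ratr q.2) i 0).
      by apply: measurable_funB; exact: measurable_ev.
    by apply/funext => w; rewrite !mxE.
  have := mf measurableT [set` `]y, +oo[] (measurable_itv _); rewrite setTI.
  by congr (measurable _); apply/seteqP; split=> w /=; rewrite in_itv /= andbT.
apply/seteqP; split=> w /=; rewrite in_itv /= andbT.
  by move=> /ereal_sup_gt[_ [q hq ->]]; rewrite lte_fin => h; exists q.
move=> [q hq /= h]; apply: (@lt_le_trans _ _ (l1 (ev w (ratr q.1) - ev w (ratr q.2)))%:E).
  by rewrite lte_fin.
by apply: ereal_sup_ubound; exists q.
Qed.

Lemma ev_l1_continuous w s (e : R) : 0 < e ->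
  exists2 r : R, 0 < r & forall a, `|a - s| < r -> l1 (ev w a - ev w s) < e.
Proof.
move=> e0; have cf : continuous (fun a => l1 (ev w a - ev w s)).
  have cs (l : seq 'I_m) : continuous (fun a => \sum_(j <- l) `|(ev w a - ev w s) j 0|).
    elim: l => [|i l IH] a.
      rewrite (_ : (fun _ => _) = cst 0); first exact: cvg_cst.
      by apply/funext => b; rewrite big_nil.
    rewrite (_ : (fun _ => _) = fun a => `|ev w a i 0 - ev w s i 0| + \sum_(j <- l) `|(ev w a - ev w s) j 0|).
      apply: cvgD (IH a); apply: cvg_norm; apply: cvgB; last exact: cvg_cst.
      have cw : continuous (fun t => ev w t i 0) by apply: continuous_coord; exact: continuous_ev.
      exact: cw.
    by apply/funext => b; rewrite big_cons !mxE.
  exact: cs.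
have /cvgrPdist_lt/(_ e e0) := cf s; rewrite subrr l1_0.
move=> /nbhs_ballP[r /= r0 hr]; exists r => // a ar.
have := hr a; rewrite /ball /= distrC => /(_ ar).
by rewrite sub0r normrN ger0_norm// l1_ge0.
Qed.

Lemma rat_near s (r : R) : 0 < r -> exists q : rat, `|ratr q - s| < r.
Proof.
move=> r0; have /rat_in_itvoo[q] : s - r < s + r by rewrite ltrBlDr -addrA ltrDl addr_gt0.
by rewrite in_itv /= => /andP[q1 q2]; exists q; rewrite ltr_norml; apply/andP; split; lra.
Qed.

(** The strict inequality leaves room to move both times to nearby rationals. *)
Lemma osc_ub dl w s t : `|s - t| < dl -> ((l1 (ev w s - ev w t))%:E <= osc dl w)%E.
Proof.
move=> st; apply/lee_addgt0Pr => e e0; have e2 : 0 < e / 2 by rewrite divr_gt0.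
have [r1 r10 h1] := ev_l1_continuous w s e2.
have [r2 r20 h2] := ev_l1_continuous w t e2.
have g0 : 0 < (dl - `|s - t|) / 2 by rewrite divr_gt0// subr_gt0.
have m1 : 0 < Num.min r1 ((dl - `|s - t|) / 2) by rewrite lt_min r10.
have m2 : 0 < Num.min r2 ((dl - `|s - t|) / 2) by rewrite lt_min r20.
have [a] := rat_near s m1; have [b] := rat_near t m2.
rewrite !lt_min => /andP[b1 b2] /andP[a1 a2].
have ab : `|ratr a - ratr b : R| <= dl.
  rewrite (_ : _ - _ = (ratr a - s) + (s - t) - (ratr b - t) :> R); last by ring.
  apply: le_trans (ler_normB _ _) _; apply: le_trans (lerD (ler_normD _ _) (lexx _)) _; lra.
have l : l1 (ev w s - ev w t) <= l1 (ev w (ratr a) - ev w (ratr b)) + e.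
  rewrite (_ : ev w s - ev w t = (ev w (ratr a) - ev w (ratr b)) +
    (- (ev w (ratr a) - ev w s) + (ev w (ratr b) - ev w t))); last first.
    rewrite opprB addrACA [ev w (ratr a) + _]addrC subrK; congr (_ + _).
    by rewrite addrA addNr add0r.
  apply: le_trans (l1D _ _) _; rewrite lerD2l; apply: le_trans (l1D _ _) _; rewrite l1N.
  by have := h1 _ a1; have := h2 _ b1; lra.
apply: (@le_trans _ _ (l1 (ev w (ratr a) - ev w (ratr b)) + e)%:E); first by rewrite lee_fin.
by rewrite EFinD; apply: leeD2r; apply: ereal_sup_ubound; exists (a, b).
Qed.

Lemma clamp_dist s t : `|clamp T s - clamp T t| <= `|s - t|.
Proof.
have C a b : a <= b -> `|clamp T a - clamp T b| <= `|a - b|.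
  move=> ab; have cab : clamp T a <= clamp T b.
    by rewrite /clamp ge_max !le_max lexx /=; apply/orP; right; rewrite le_min !ge_min ab lexx !orbT.
  rewrite !ler0_norm ?subr_le0// /clamp /Num.max /Num.min; have := T0'.
  by case: (ltP a T) => ?; case: (ltP b T) => ?; case: ltP => ?; case: ltP => ?; lra.
have [/C//|/ltW/C] := leP s t.
by rewrite distrC [`|t - s|]distrC.
Qed.

(** Uniform continuity of the path on the compact interval; clamping brings arbitrary rational times
    into it without increasing distances. *)
Lemma osc_small w (e : R) : 0 < e -> \forall n \near \oo, (osc n.+1%:R^-1 w <= e%:E)%E.
Proof.
move=> e0; have e2 : 0 < e / 2 by rewrite divr_gt0.
have /compact_near_coveringP cov := @segment_compact R 0 T.
have := cov nat \oo (fun n s => forall t, `|s - t| <= n.+1%:R^-1 -> l1 (ev w s - ev w t) <= e) _.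
case.
  move=> s _; have [r1 r10 h1] := ev_l1_continuous w s e2.
  have r2 : 0 < r1 / 2 by rewrite divr_gt0.
  exists (ball s (r1 / 2), [set n | n.+1%:R^-1 < r1 / 2]).
    split; first exact: nbhsx_ballx.
    have /cvgrPdist_lt/(_ _ r2) := @cvg_harmonic R.
    by apply: filterS => n; rewrite sub0r normrN ger0_norm// invr_ge0.
  move=> [s' n] [/= ss' nn] t st.
  have h : `|s' - s| < r1 by rewrite distrC; move: ss'; rewrite /ball /= => /lt_trans; apply; lra.
  have h' : `|t - s| < r1.
    rewrite (_ : t - s = (s' - s) - (s' - t)); last by ring.
    move: ss'; rewrite /ball /= distrC => ss'.
    apply: le_lt_trans (ler_normB _ _) _; rewrite [ltRHS]splitr; apply: ltrD => //.
    exact: le_lt_trans st nn.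
  rewrite (_ : ev w s' - ev w t = (ev w s' - ev w s) + - (ev w t - ev w s)); last first.
    by rewrite opprB addrA subrK.
  by apply: le_trans (l1D _ _) _; rewrite l1N; have := h1 _ h; have := h1 _ h'; lra.
move=> N _ hN; exists N => // n /hN hn; apply: ge_ereal_sup => _ [q hq ->]; rewrite lee_fin.
rewrite ev_clamp (ev_clamp w (ratr q.2)); apply: hn.
  by rewrite /= in_itv /= clamp_itv.
exact: le_trans (clamp_dist _ _) hq.
Qed.

Lemma osc_dominated : exists2 A : Omega T m -> \bar R,
  P.-integrable setT A & forall dl w, (osc dl w <= A w)%E.
Proof.
have ex (i : 'I_m) : exists A : Omega T m -> \bar R,
    [/\ measurable_fun setT A, forall w, (0 <= A w)%E, (\int[P]_w A w < +oo)%E &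
    forall w t, 0 <= t <= T -> (`|ev w t i 0|%:E <= A w)%E].
  (* A coordinate of the canonical process is the integral of the constant 1, so the maximal
     inequality for blocks provides the dominating function. *)
  pose b := fun _ : 'I_1 => Block 0 T i (cst 1 : Omega T m -> R).
  have vb j : valid (b j).
    by split=> //=; [exact: measurable_cst|exists 1 => w; rewrite normr1].
  have bE t w : 0 <= t <= T -> fint b t w = ev w t i 0.
    move=> /andP[t0 tT]; rewrite /fint big_ord1 /bint /= mul1r /incr (min_l t0) (min_r tT).
    by rewrite ev0 mxE subr0.
  have [A [mA A0 Aub /(_ 1 ltr01) iA]] := fint_sup hP T0 vb; exists A; split=> //.
    apply: le_lt_trans iA _; apply: lte_add_pinfty; first exact: ltry.
    have [_ h] : isL2 P (fint b T) by apply: fint_L2 => //; rewrite T0' lexx.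
    apply: lte_mul_pinfty => //; rewrite ?lee_fin ?invr_ge0 ?mulr_ge0//.
    by apply: lte_mul_pinfty.
  by move=> w t tT; rewrite -(bE t w tT); exact: Aub.
have [A hA] := choice ex.
exists (fun w => \sum_i (A i w + A i w))%E.
  apply: integrable_sum => // i _; have [mA A0 iA _] := hA i.
  have h : P.-integrable setT (A i).
    by apply/integrableP; split => //; under eq_integral do rewrite gee0_abs//.
  exact: integrableD.
move=> dl w; apply: ge_ereal_sup => _ [q hq ->]; rewrite /l1 -sumEFin; apply: lee_sum => i _.
have [mA A0 _ Aub] := hA i; rewrite !mxE ev_clamp (ev_clamp w (ratr q.2)).
have h1 := Aub w _ (clamp_itv (ratr q.1) T0'); have h2 := Aub w _ (clamp_itv (ratr q.2) T0').
by apply: le_trans (leeD h1 h2); rewrite -EFinD lee_fin ler_normB.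
Qed.

Lemma osc_le dl dl' w : dl <= dl' -> (osc dl w <= osc dl' w)%E.
Proof.
move=> dd; apply: ge_ereal_sup => _ [q hq ->]; apply: ereal_sup_ubound; exists q => //.
exact: le_trans dd.
Qed.

Lemma osc_integral (e : R) : 0 < e -> exists2 dl : R, 0 < dl &
  forall dl', 0 < dl' -> dl' <= dl -> (\int[P]_w osc dl' w <= e%:E)%E.
Proof.
move=> e0; have [A iA hA] := osc_dominated.
have o0 n w : (0 <= osc n.+1%:R^-1 w)%E by apply: osc_ge0; rewrite invr_ge0.
have [] := @dominated_convergence _ (Omega T m) R P setT measurableT
  (fun n w => osc n.+1%:R^-1 w) (cst 0%E) A _ _ _ iA _.
- by move=> n; exact: osc_measurable.
- exact: measurable_cst.
- apply/aeW => w _; apply/fine_cvgP; split.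
    have := osc_small w ltr01; apply: filterS => n h.
    by rewrite ge0_fin_numE// (le_lt_trans h)// ltry.
  apply/cvgrPdist_le => x x0; have := osc_small w x0; apply: filterS => n h /=.
  have fo : osc n.+1%:R^-1 w \is a fin_num by rewrite ge0_fin_numE// (le_lt_trans h)// ltry.
  by rewrite sub0r normrN ger0_norm ?fine_ge0// -lee_fin fineK.
- by apply/aeW => w n _; rewrite gee0_abs.
move=> _ _; rewrite integral0 => /(cvge0_le e0)[n _ hn].
exists n.+1%:R^-1; first by rewrite invr_gt0.
move=> dl' d0 dn; apply: le_trans (hn n _) => //=.
by apply: le_integral_pointwise => w _; exact: osc_le.
Qed.

End Oscillation.

(** * The dual value is at most the primal value *)

Section UpperBound.
Context (R : realType) (T : R) (d m : nat) (P : probability (Omega T m) R).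
Hypothesis hP : wiener_measure P.
Hypothesis T0 : 0 < T.
Let T0' : 0 <= T. Proof. exact: ltW. Qed.

Lemma integral_le_moment2 (E : Omega T m -> R) (c x : R) : 0 < c -> isL2 P E ->
  (forall w, 0 <= E w) -> (moment2 P E <= (2 * x)%:E)%E -> (\int[P]_w (E w)%:E <= (c / 2 + x / c)%:E)%E.
Proof.
move=> c0 [mE _] E0 mx.
have := integral_norm_le_moment2 P c0 mE; under eq_integral do rewrite ger0_norm//.
move=> /le_trans; apply; rewrite EFinD; apply: leeD2l.
rewrite (_ : x / c = (2 * c)^-1 * (2 * x)); last by rewrite invfM mulrACA mulVf// mul1r mulrC.
by rewrite (EFinM (2 * c)^-1); apply: lee_wpmul2l => //; rewrite lee_fin invr_ge0 mulr_ge0// ltW.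
Qed.

Variables (n : nat) (ts : nat -> R) (h : R).
Hypothesis hp' : is_partition T n ts h.
Variables (M : nat) (r : nat -> R) (del : R).
Hypothesis hp : is_partition T M r del.
Hypothesis refines : forall i, (i <= n)%N -> exists2 j, (j <= M)%N & ts i = r j.
Variables (q : nat) (c : 'I_q.+1 -> control R d m) (Kc : R).
Hypothesis Kc0 : 0 <= Kc.
Hypothesis c1 : forall j i, `|(c j).1 i 0| <= Kc.
Hypothesis c2 : forall j i k, `|(c j).2 i k| <= Kc.
Variables (g gL : 'cV[R]_d -> R) (L Kg : R).
Hypothesis hgL : blip L Kg gL.
Hypothesis g_le : forall x, g x <= gL x.
Variables (C : R).
Hypothesis C0 : 0 <= C.
Hypothesis moment4 : forall (s t : R) (b : control R d m), 0 <= s -> s <= t -> t <= T ->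
  (forall i, `|b.1 i 0| <= Kc) -> (forall i j, `|b.2 i j| <= Kc) ->
  (\int[P]_w (l1 (inc s t b w) ^+ 4)%:E <= (C * (t - s) ^+ 2)%:E)%E.
Variables (eps : R) (Q : nat) (rho : R).
Hypothesis eps0 : 0 < eps.
Hypothesis rhoE : eps * Q.+1%:R = rho.

Let rho0 : 0 < rho. Proof. by rewrite -rhoE mulr_gt0. Qed.
Let L0 : 0 <= L. Proof. by case: hgL. Qed.
Let U k := value P M r c gL k.
Let V k := smooth eps Q (enum 'I_d) (U k).
Let p k x : 'cV[R]_d := \col_i pd eps i (V k.+1) x.

Let BU k : (k <= M)%N -> blip L Kg (U k). Proof. exact: (blip_value P hp c hgL). Qed.
Let BV k : (k <= M)%N -> blip L Kg (V k). Proof. by move=> kM; exact: (blip_smooth eps Q (enum 'I_d) (BU kM)). Qed.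

Let VU k x : (k <= M)%N -> `|V k x - U k x| <= d%:R * (L * rho).
Proof. by move=> kM; have := smooth_close Q eps0 (enum 'I_d) x (BU kM); rewrite size_enum_ord rhoE. Qed.

Let Bp k i : (k < M)%N -> blip (2 * L / rho) L (fun x => p k x i 0).
Proof.
move=> kM; rewrite (_ : (fun x => _) = pd eps i (V k.+1)); last by apply/funext => x; rewrite mxE.
split; first by rewrite divr_ge0 ?mulr_ge0// ltW.
  by rewrite -rhoE; exact: (pd_lip Q eps0 (BU kM)).
by move=> x; exact: (pd_bound Q eps0 (BU kM)).
Qed.

Let taylor k x z : (k < M)%N ->
  `|V k.+1 (x + z) - V k.+1 x - \sum_i p k x i 0 * z i 0| <= 4 * L / rho * l1 z ^+ 2 + d%:R * (2 * L * eps).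
Proof.
move=> kM; have := smooth_taylor Q eps0 (BU kM) x z; rewrite rhoE.
have -> : \sum_i p k x i 0 * z i 0 = \sum_i pd eps i (V k.+1) x * z i 0; last by [].
by apply: eq_bigr => i _; rewrite /p mxE.
Qed.

Let super k x j : (k < M)%N -> condE P (r k) (r k.+1) (c j) (V k.+1) x <= V k x.
Proof.
move=> kM; have [h1 h2 h3] := rk hp kM.
rewrite (condE_smooth eps Q P (c j) (enum 'I_d) x h1 h2 h3 (BU kM)).
by apply: smooth_mono => y; exact: value_ge_cont.
Qed.

Let gV k x : (k <= M)%N -> gL x <= V k x + d%:R * (L * rho).
Proof.
move=> kM; have v : gL x <= U k x := value_ge P r c gL x kM.
have := VU x kM; rewrite ler_norml => /andP[? _]; lra.
Qed.

Let phi : R -> Omega T d -> 'cV[R]_d := discrete_hedge M r p.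
Let hphi : hedge phi := discrete_hedge_hedge T0 hp BV Bp.

Let e2 := 8 * (2 * (4 * L / rho) ^+ 2 * C * del * T + 2 * (d%:R * (2 * L * eps)) ^+ 2 * M%:R).

Notation Ctl := {ffun 'I_n -> 'I_q.+1}.

(** The discrete hedge is tested against all controls of the coarse grid. There are finitely many,
    so the supremum of their martingale errors is bounded by the sum; [2 * x] bounds each second
    moment, [y] is the weight in Young's inequality, and [dl] exceeds the mesh. *)
Lemma dual_value_le (x y dl : R) (b := d%:R * Kc) : 0 < y -> e2 <= 2 * x -> del < dl ->
  (dual_value P g n ts (range c) <=
    (value P M r c gL 0 0 + 2 * (d%:R * (L * rho)) + L * b * del)%:E +
    (\sum_(u : Ctl) (y / 2 + x / y)%:E + (2 * (L * b))%:E * \int[P]_w osc dl w))%E.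
Proof.
move=> y0 e2x dld.
pose uv (u : Ctl) (i : nat) : control R d m := if (insub i : option 'I_n) is Some j then c (u j) else c ord0.
have N0 u : forall i, (i < n)%N -> range c (uv u i).
  by move=> i _; rewrite /uv; case: insub => [j|]; [exists (u j)|exists ord0].
have [a aP] : exists a : Ctl -> R -> control R d m, forall u, step_control T n ts (range c) (a u) /\
    forall (i : 'I_n) t, ts i <= t < ts i.+1 -> a u t = c (u i).
  have : forall u : Ctl, exists a, step_control T n ts (range c) a /\
      forall (i : 'I_n) t, ts i <= t < ts i.+1 -> a t = c (u i).
    move=> u; have [a a1 a2] := step_control_exists hp' T0 (N0 u); exists a; split=> // i t it.
    by rewrite (a2 i)// /uv; case: insubP => [j _ ji|]; [congr (c (u _)); exact/val_inj|rewrite ltn_ord].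
  by move=> /choice[a aP]; exists a.
pose uf (u : Ctl) k := a u (r k).
have fine u : step_control T M r (range c) (a u) := step_control_refine T0 hp hp' refines (aP u).1.
have ufN u k : (k < M)%N -> exists j, c j = uf u k.
  by move=> kM; have [h1 _ _] := fine u; have [j _ e] := h1 _ (partition_itv hp (ltnW kM)); exists j.
have ufE u k t : (k < M)%N -> r k <= t < r k.+1 -> a u t = uf u k.
  by move=> kM kt; have [_ h1 _] := fine u; exact: h1.
have [C1 eta] : 0 <= 4 * L / rho /\ 0 <= d%:R * (2 * L * eps).
  by split; [rewrite divr_ge0 ?mulr_ge0// ltW|rewrite !mulr_ge0// ltW].
have [E EP] : exists E : Ctl -> Omega T m -> R, forall u, [/\ isL2 P (E u), forall w, 0 <= E u w,
    (moment2 P (E u) <= (2 * x)%:E)%E &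
    {ae P, forall w, forall t, 0 <= t <= T -> exists2 k, (k < M)%N /\ r k <= t <= r k.+1 &
      gL (ev (step_path M r (cst_family (uf u)) w) t) - ev (hedge_gain P hp phi (uf u) w) t 0 0 <=
      V 0 0 + d%:R * (L * rho) + E u w + L * b * del + 2 * (L * b) * l1 (ev w t - ev w (r k))}].
  have : forall u, exists E : Omega T m -> R, [/\ isL2 P E, forall w, 0 <= E w,
    (moment2 P E <= (2 * x)%:E)%E &
    {ae P, forall w, forall t, 0 <= t <= T -> exists2 k, (k < M)%N /\ r k <= t <= r k.+1 &
      gL (ev (step_path M r (cst_family (uf u)) w) t) - ev (hedge_gain P hp phi (uf u) w) t 0 0 <=
      V 0 0 + d%:R * (L * rho) + E w + L * b * del + 2 * (L * b) * l1 (ev w t - ev w (r k))}].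
    move=> u; have [_ gl _] := hgL.
    have u1 k i : (k < M)%N -> `|(uf u k).1 i 0| <= Kc by move=> /(ufN u)[j <-].
    have u2 k i j : (k < M)%N -> `|(uf u k).2 i j| <= Kc by move=> /(ufN u)[j' <-].
    have su k z : (k < M)%N -> condE P (r k) (r k.+1) (uf u k) (V k.+1) z <= V k z.
      by move=> kM; have [j <-] := ufN u k kM; exact: super.
    have [E [LE [E0 mE]] aE] := hedge_error hP T0 hp BV Bp C1 eta Kc0 C0 taylor moment4 u1 u2 su gl gV.
    by exists E; split=> //; apply: (le_trans mE); rewrite lee_fin.
  by move=> /choice[E EP]; exists E.
have aS : {ae P, forall w, forall u : Ctl,
    state P (fun s (_ : Omega T m) => a u s) w = step_path M r (cst_family (uf u)) w}.
  apply: ae_forall_count => u; apply: (state_step hP T0 hp); first exact: cst_family_step.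
  by move=> i t w; exact: ufE.
have aE : {ae P, forall w, forall u : Ctl, forall t, 0 <= t <= T -> exists2 k, (k < M)%N /\ r k <= t <= r k.+1 &
      gL (ev (step_path M r (cst_family (uf u)) w) t) - ev (hedge_gain P hp phi (uf u) w) t 0 0 <=
      V 0 0 + d%:R * (L * rho) + E u w + L * b * del + 2 * (L * b) * l1 (ev w t - ev w (r k))}.
  by apply: ae_forall_count => u; have [] := EP u.
have b0 : 0 <= L * b by rewrite !mulr_ge0.
have dl0 : 0 < dl.
  apply: le_lt_trans dld; have M0 := partition_size_gt0 hp T0.
  have [_ _ _ rd] := hp; have [_ r1 _] := rk hp M0.
  by apply: le_trans (rd 0%N M0); rewrite subr_ge0 ltW.
pose A0 := V 0 0 + d%:R * (L * rho) + L * b * del.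
pose F w : \bar R := ((\sum_(u : Ctl) E u w)%:E + (2 * (L * b))%:E * osc dl w)%E.
have mF1 : measurable_fun setT (fun w => (\sum_(u : Ctl) E u w)%:E).
  by apply/measurable_EFinP; apply: measurable_sum => u; have [[]] := EP u.
have mF2 : measurable_fun setT (fun w : Omega T m => (2 * (L * b))%:E * osc dl w)%E.
  by apply: measurable_funeM; exact: osc_measurable.
have mF : measurable_fun setT F by exact: emeasurable_funD.
have E0 u w : 0 <= E u w by have [] := EP u.
have F10 w : (0 <= (\sum_(u : Ctl) E u w)%:E)%E by rewrite lee_fin sumr_ge0.
have F20 (w : Omega T m) : (0 <= (2 * (L * b))%:E * osc dl w)%E.
  by apply: mule_ge0; [rewrite lee_fin mulr_ge0|exact: osc_ge0 (ltW dl0)].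
have F0 w : (0 <= F w)%E by apply: adde_ge0.
have bound : (\int[P]_w dual_payoff P g n ts (range c) phi w <= \int[P]_w (A0%:E + F w))%E.
  apply: ae_le_integral_r; last by apply: emeasurable_funD => //; exact: measurable_cst.
  apply: ae_mono2 aS aE => w hS hE; apply: ge_ereal_sup => _ [a' [t [sa tT ->]]].
  have sa' := step_control_refine T0 hp hp' refines sa.
  (* The supremum reduces to the finite type [Ctl]: [a'] and [a u] agree on every cell, and this
     determines states and gains. *)
  have [u uE] : exists u : Ctl, forall i : 'I_n, a' (ts i) = c (u i).
    have : forall i : 'I_n, exists j, a' (ts i) = c j.
      move=> i; have [h1 _ _] := sa; have [j _ e] := h1 _ (partition_itv hp' (ltnW (ltn_ord i))).
      by exists j.
    by move=> /choice[f hf]; exists [ffun i => f i] => i; rewrite ffunE.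
  have a'E k s : (k < M)%N -> r k <= s < r k.+1 -> a' s = uf u k.
    move=> kM ks; have [_ h1 _] := sa'; rewrite (h1 k s kM ks) /uf.
    have [g1 g2 g3] := rk hp kM.
    have [|i iN it] := partition_locate_co hp' (t := r k); first by rewrite g1 (lt_le_trans g2).
    have [_ h2 _] := sa; rewrite (h2 i _ iN it) (uE (Ordinal iN)).
    by rewrite ((aP u).2 (Ordinal iN) _ it).
  have -> : state P (fun s (_ : Omega T m) => a' s) = state P (fun s (_ : Omega T m) => a u s).
    exact: (state_ext P hp a'E (ufE u)).
  rewrite /= -(state_ext P hp a'E (ufE u)) (hedge_gainE hP T0 hp hphi a'E) (state_ext P hp a'E (ufE u)) hS.
  have [k [kM /andP[k1 k2]] hk] := hE u t tT.
  have o : ((l1 (ev w t - ev w (r k)))%:E <= osc dl w)%E.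
    apply: osc_ub; rewrite ger0_norm ?subr_ge0//; apply: le_lt_trans dld.
    by have [_ _ _ rd] := hp; apply: le_trans (rd k kM); rewrite lerD2r.
  apply: (@le_trans _ _ (A0 + (\sum_(u' : Ctl) E u' w + 2 * (L * b) * l1 (ev w t - ev w (r k))))%:E).
    rewrite lee_fin (bigD1 u)//=.
    have : 0 <= \sum_(u' | u' != u) E u' w by apply: sumr_ge0.
    have := g_le (ev (step_path M r (cst_family (uf u)) w) t).
    move: hk; rewrite /A0; lra.
  rewrite EFinD; apply: leeD2l; rewrite EFinD; apply: leeD2l; rewrite EFinM.
  by apply: lee_wpmul2l => //; rewrite lee_fin mulr_ge0.
have IE : (\int[P]_w F w <= \sum_(u : Ctl) (y / 2 + x / y)%:E + (2 * (L * b))%:E * \int[P]_w osc dl w)%E.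
  rewrite ge0_integralD//; apply: leeD.
    under eq_integral do rewrite -sumEFin.
    have mE u : measurable_fun setT (fun w => (E u w)%:E).
      by apply/measurable_EFinP; have [[]] := EP u.
    rewrite ge0_integral_sum//; last by move=> u w _; rewrite lee_fin.
    apply: lee_sum => u _; have [LE _ m2E _] := EP u.
    exact: integral_le_moment2.
  rewrite ge0_integralZl//; first exact: osc_measurable.
  - by move=> w _; exact: osc_ge0 (ltW dl0).
  - by rewrite lee_fin mulr_ge0.
apply: (@le_trans _ _ (\int[P]_w dual_payoff P g n ts (range c) phi w)%E).
  by apply: ereal_inf_lbound; exists phi.
apply: (le_trans bound).
(* If the error has an infinite mean, so does its bound, and the claim is trivial; otherwise the
   integral is additive. *)
have [Fy|Fy] := eqVneq (\int[P]_w F w)%E +oo%E.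
  have -> : (\sum_(u : Ctl) (y / 2 + x / y)%:E + (2 * (L * b))%:E * \int[P]_w osc dl w = +oo)%E.
    by apply/eqP; rewrite -leye_eq -Fy.
  by rewrite addey ?leey.
have iF : P.-integrable setT F.
  apply/integrableP; split=> //; under eq_integral do rewrite gee0_abs//.
  by rewrite ltey.
rewrite integralD//; last exact: (isL2_integrable (isL2_cst P A0)).
rewrite integral_cst//= probability_setT mule1; apply: leeD IE; rewrite lee_fin /A0.
have := VU 0 (leq0n M); rewrite ler_norml => /andP[_]; rewrite /U; lra.
Qed.

End UpperBound.

(** * Choice of the parameters and passage to the limit *)

Section Duality.
Context (R : realType) (T : R) (hT : 0 < T) (d m : nat).
Variables (P0 : probability (Omega T m) R) (hP0 : wiener_measure P0).
Variables (A : set (control R d m)) (hA0 : A !=set0) (hA : compact A).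
Variables (n : R -> nat) (t : R -> nat -> R).
Hypothesis ht : forall h, 0 < h -> is_partition T (n h) (t h) h.
Hypothesis hnested : forall h h', 0 < h' -> h' < h ->
  forall i, (i <= n h)%N -> exists2 j, (j <= n h')%N & t h i = t h' j.
Variable N : R -> set (control R d m).
Hypothesis hN : forall h, 0 < h -> finite_net A (N h) h.
Variables (g : 'cV[R]_d -> R) (K : R).
Hypothesis gK : forall x, `|g x| <= K.
Hypothesis gc : unif_continuous g.

Let div_succ_le (a b : R) : 0 <= a -> 0 < b -> a * (b / (a + 1)) <= b.
Proof.
move=> a0 b0; have a1 : 0 < a + 1 by rewrite ltr_wpDl.
by rewrite mulrA ler_pdivrMr// mulrC ler_pM2l// lerDl.
Qed.

(** [h] is fixed and arbitrary: the hedge works on the grid of a smaller [del], which refines that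
    of [h] by nesting, while net and controls are those of [h]. *)
Lemma dual_le_primal (h e : R) : 0 < h -> 0 < e ->
  (dual_value P0 g (n h) (t h) (N h) <= primal_value P0 A g + e%:E)%E.
Proof.
(* Seven shares: one for the Lipschitz majorant, two for the smoothing, one for the drift inside a
   cell, two for the martingale errors, one for the oscillation. *)
move=> h0 e0; pose e1 := e / 7; have e10 : 0 < e1 by rewrite divr_gt0.
have [L [gL [L0 gl g1 g2 gLK]]] := lip_approx gK gc e10.
have BgL : blip L K gL by [].
have [fN NA Nnet] := hN h0.
have N0 : N h !=set0 by have [a0 Aa0] := hA0; have [b Nb _] := Nnet a0 Aa0; exists b.
have [q [c cN]] := finite_enumeration fN N0.
have cA j : A (c j) by apply: NA; rewrite -cN; exists j.
have [Kc Kc0 hKc] := compact_control_bound hA.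
have [C C0 hC] := @moment4_inc _ _ d _ _ hP0 Kc (ltW hT).
pose b := d%:R * Kc; have b0 : 0 <= b by rewrite mulr_ge0.
have Lb0 : 0 <= L * b by rewrite mulr_ge0.
pose v : R := #|{ffun 'I_(n h) -> 'I_q.+1}|%:R; have v0 : 0 <= v by [].
pose y := e1 / (v + 1); have v1 : 0 < v + 1 by rewrite ltr_wpDl.
have y0 : 0 < y by rewrite divr_gt0.
pose x := y * y; have x0 : 0 < x by rewrite mulr_gt0.
have Lb2 : 0 < 2 * (L * b) + 1 by rewrite ltr_wpDl ?mulr_ge0.
have [dl dl0 hdl] := osc_integral hP0 hT (divr_gt0 e10 Lb2).
have dL0 : 0 <= d%:R * L by rewrite mulr_ge0.
have dL1 : 0 < d%:R * L + 1 by rewrite ltr_wpDl.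
pose rho := e1 / (d%:R * L + 1); have rho0 : 0 < rho by rewrite divr_gt0.
(* The coefficient of [del] in the second moment of the maximal error: 16 is Doob's 8 times the 2
   from squaring a sum. *)
pose B := 16 * (4 * L / rho) ^+ 2 * C * T.
have B0 : 0 <= B.
  by apply: mulr_ge0 (ltW hT); apply: mulr_ge0 C0; apply: mulr_ge0; rewrite ?sqr_ge0.
have B1 : 0 < B + 1 by rewrite ltr_wpDl.
have Lb1 : 0 < L * b + 1 by rewrite ltr_wpDl.
pose del := Num.min (Num.min (h / 2) (dl / 2)) (Num.min (x / (B + 1)) (e1 / (L * b + 1))).
have del0 : 0 < del by rewrite !lt_min !divr_gt0.
have delh : del < h by rewrite /del !gt_min; apply/orP; left; apply/orP; left; lra.
have deldl : del < dl by rewrite /del !gt_min; apply/orP; left; apply/orP; right; lra.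
have delx : del <= x / (B + 1) by rewrite /del !ge_min lexx !orbT.
have dele : del <= e1 / (L * b + 1) by rewrite /del !ge_min lexx !orbT.
(* The number of cells is now fixed, and the spacing is chosen after it: dividing [rho] by [Q.+1],
   with [Q] above [Y / x], brings the accumulated Taylor error below [x] without changing [rho]. *)
pose M := n del; pose Y : R := 16 * (d%:R * (2 * L * rho)) ^+ 2 * M%:R.
have Y0 : 0 <= Y by apply: mulr_ge0 => //; apply: mulr_ge0; rewrite ?sqr_ge0.
pose Q := Num.bound (Y / x).
have Qx : Y <= x * Q.+1%:R.
  rewrite mulrC -ler_pdivrMr//; apply: ltW; apply: lt_trans (archi_boundP _) _.
    by rewrite divr_ge0// ltW.
  by rewrite ltr_nat.
pose eps := rho / Q.+1%:R; have eps0 : 0 < eps by rewrite divr_gt0.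
have rhoE : eps * Q.+1%:R = rho by rewrite divfK// pnatr_eq0.
have c1 j i : `|(c j).1 i 0| <= Kc by have [h1 _] := hKc _ (cA j); exact: h1.
have c2 j i k : `|(c j).2 i k| <= Kc by have [_ h2] := hKc _ (cA j); exact: h2.
have main := @dual_value_le _ _ _ _ _ hP0 hT _ _ _ (ht h0) _ _ _ (ht del0) (hnested del0 delh)
  _ c _ Kc0 c1 c2 g gL L K BgL g1 C C0 hC eps Q rho eps0 rhoE x y dl y0 _ deldl.
rewrite cN in main; apply: (le_trans (main _)).
  have s1 : B * del <= x.
    apply: (le_trans (ler_wpM2l B0 delx)); exact: div_succ_le.
  have s2 : 16 * (d%:R * (2 * L * eps)) ^+ 2 * M%:R <= x.
    rewrite (_ : _ * _ = Y / Q.+1%:R / Q.+1%:R); last first.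
      have : Q.+1%:R != 0 :> R by rewrite pnatr_eq0.
      by rewrite /Y /eps; move: (Q.+1%:R : R) => w w0; field.
    rewrite ler_pdivrMr// ler_pdivrMr//; apply: (le_trans Qx).
    by rewrite ler_peMr ?ler1n//; apply: mulr_ge0 => //; exact: ltW.
  by move: s1 s2; rewrite /B -/M; lra.
have vp := value_le_primal hP0 hT (ht del0) BgL cA g2.
rewrite -/M; set U0 := value _ _ _ _ _ _ _ in vp *.
have t1 : d%:R * (L * rho) <= e1 by rewrite mulrA; exact: div_succ_le.
have t2 : L * b * del <= e1 by apply: (le_trans (ler_wpM2l Lb0 dele)); exact: div_succ_le.
have t3 : (\sum_(u : {ffun 'I_(n h) -> 'I_q.+1}) (y / 2 + x / y)%:E <= (2 * e1)%:E)%E.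
  rewrite sumEFin lee_fin sumr_const (_ : x / y = y); last by rewrite /x mulfK// gt_eqF.
  rewrite -(mulr_natl (y / 2 + y)) -/v.
  have := div_succ_le v0 e10; rewrite -/y; have : 0 <= v * y by rewrite mulr_ge0// ltW.
  by rewrite mulrDr; lra.
have t4 : ((2 * (L * b))%:E * \int[P0]_w osc dl w <= e1%:E)%E.
  have Lb20 : 0 <= 2 * (L * b) by rewrite mulr_ge0.
  apply: (@le_trans _ _ ((2 * (L * b))%:E * (e1 / (2 * (L * b) + 1))%:E)%E).
    by apply: lee_wpmul2l; [rewrite lee_fin|exact: hdl].
  by rewrite -EFinM lee_fin; exact: div_succ_le.
apply: (@le_trans _ _ ((U0 + 2 * (d%:R * (L * rho)) + L * b * del)%:E + ((2 * e1)%:E + e1%:E))%E).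
  by apply: leeD2l; exact: leeD.
apply: (@le_trans _ _ ((U0 - e1)%:E + e%:E)%E); last exact: leeD2r.
by rewrite -!EFinD lee_fin; move: t1 t2; rewrite /e1; lra.
Qed.

Lemma primal_fin_num : primal_value P0 A g \is a fin_num.
Proof.
have cstE (k : R) : (\int[P0]_w k%:E = k%:E)%E by rewrite integral_cst//= probability_setT mule1.
have [a0 Aa0] := hA0; have T0' := ltW hT.
apply/fin_numP; split; last first.
  apply/eqP => e; suff : (primal_value P0 A g <= K%:E)%E by rewrite e leye_eq.
  apply: ge_ereal_sup => _ [a [tau [_ _ ->]]]; rewrite unlock -[leRHS]cstE.
  by apply: le_integral_pointwise => w _; rewrite lee_fin (le_trans (ler_norm _)).
apply/eqP => e; suff : ((- K)%:E <= primal_value P0 A g)%E by rewrite e leeNy_eq.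
pose a := fun (_ : R) (_ : Omega T m) => a0.
apply: (@le_trans _ _ ('E_P0[fun w => g (ev (state P0 a w) 0)])%E).
  rewrite unlock -[leLHS]cstE; apply: le_integral_pointwise => w _; rewrite lee_fin.
  by have := gK (ev (state P0 a w) 0); rewrite ler_norml => /andP[].
apply: ereal_sup_ubound; exists a, (fun=> 0); split=> //.
- split=> //.
  + by move=> s _; apply/filt_measurable_Fmeas => i k; exact: measurable_cst.
  + by move=> s _; apply/filt_measurable_Fmeas => i k; exact: measurable_cst.
- split=> [w|s /andP[s0 _]]; first by rewrite lexx.
  by rewrite (_ : [set w | _] = setT); [exact: filtT|apply/seteqP; split].
Qed.

(** The lower bound is available along sequences of meshes, since it rests on dominated convergence;
    a failure arbitrarily close to 0 would produce such a sequence. *)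
Lemma primal_le_dual (e : R) : 0 < e ->
  \forall h \near 0^'+, (primal_value P0 A g <= dual_value P0 g (n h) (t h) (N h) + e%:E)%E.
Proof.
move=> e0; have e2 : 0 < e / 2 by rewrite divr_gt0.
set l := primal_value P0 A g; have lf : l \is a fin_num := primal_fin_num.
pose good h := (l <= dual_value P0 g (n h) (t h) (N h) + e%:E)%E.
have [[j hj]|hn] := pselect (exists j : nat, forall h : R, 0 < h -> h < j.+1%:R^-1 -> good h).
  exists j.+1%:R^-1; first by rewrite /= invr_gt0.
  move=> h /=; rewrite /ball /= sub0r normrN => hh h0; apply: hj => //.
  by rewrite (le_lt_trans (ler_norm _)).
have : forall j : nat, exists h : R, [/\ 0 < h, h < j.+1%:R^-1 & ~ good h].
  move=> j; apply: contrapT => hj; apply: hn; exists j => h h0 hh; apply: contrapT => ng.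
  by apply: hj; exists h.
move=> /choice[hh hhP].
have hh0 j : 0 < hh j by have [] := hhP j.
have chh : hh j @[j --> \oo] --> 0.
  apply: (@squeeze_cvgr _ _ _ _ (cst 0) (@harmonic R)); last 2 first.
  - exact: cvg_cst.
  - exact: cvg_harmonic.
  by apply: nearW => j; have [h1 h2 _] := hhP j; rewrite /= (ltW h1) ltW.
have [_ [a [tau [aA st ->]]] hx] := ub_ereal_sup_adherent e2 lf.
have [j hj] := filter_ex (lower_bound_seq hT hP0 hA0 hA ht hnested hN gK gc aA st e2 hh0 chh).
have [_ _ []] := hhP j; rewrite /good -(fineK lf).
have : ((fine l)%:E - (e / 2)%:E < dual_value P0 g (n (hh j)) (t (hh j)) (N (hh j)) + (e / 2)%:E)%E.
  by apply: lt_le_trans hj; rewrite fineK.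
rewrite lteBlDr// -addeA -EFinD -splitr; exact: ltW.
Qed.

Lemma dual_value_cvg :
  dual_value P0 g (n h) (t h) (N h) @[h --> 0^'+] --> primal_value P0 A g.
Proof.
have lf := primal_fin_num; rewrite -(fineK lf).
have near_both (e : R) : 0 < e -> \forall h \near 0^'+, (primal_value P0 A g - e%:E <=
    dual_value P0 g (n h) (t h) (N h) <= primal_value P0 A g + e%:E)%E.
  move=> e0; have := primal_le_dual e0; have : \forall h \near 0^'+, 0 < h :> R by exact: nbhs_right_gt.
  apply: filterS2 => h h0 hl; apply/andP; split; last exact: dual_le_primal.
  by rewrite leeBlDr.
have fin (h e : R) : (primal_value P0 A g - e%:E <=
    dual_value P0 g (n h) (t h) (N h) <= primal_value P0 A g + e%:E)%E ->
    dual_value P0 g (n h) (t h) (N h) \is a fin_num.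
  rewrite -(fineK lf) => /andP[h1 h2]; rewrite fin_numElt (lt_le_trans _ h1) ?ltNyr//=.
  by rewrite (le_lt_trans h2)// -EFinD ltry.
apply/fine_cvgP; split.
  by have := near_both 1 ltr01; apply: filterS => h; exact: fin.
apply/cvgrPdist_le => e e0; have := near_both e e0; apply: filterS => h hh /=.
have ff := fin _ _ hh; move: hh; rewrite -(fineK lf) -(fineK ff) -EFinB -EFinD !lee_fin /=.
by move=> /andP[h1 h2]; rewrite ler_norml; apply/andP; split; lra.
Qed.

End Duality.

Theorem theorem3p14 (R : realType) (T : R) (hT : 0 < T) (d m : nat)
  (P0 : probability (Omega T m) R) (hP0 : wiener_measure P0)
  (A : set ('cV[R]_d * 'M[R]_(d, m))) (hA0 : A !=set0) (hA : compact A)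
  (n : R -> nat) (t : R -> nat -> R)
  (ht : forall h, 0 < h -> is_partition T (n h) (t h) h)
  (hnested : forall h h', 0 < h' -> h' < h ->
     forall i, (i <= n h)%N -> exists2 j, (j <= n h')%N & t h i = t h' j)
  (N : R -> set ('cV[R]_d * 'M[R]_(d, m)))
  (hN : forall h, 0 < h -> finite_net A (N h) h)
  (g : 'cV[R]_d -> R)
  (hgb : exists K : R, forall x, `|g x| <= K)
  (hgc : unif_continuous g) :
  dual_value P0 g (n h) (t h) (N h) @[h --> 0^'+] --> primal_value P0 A g.
Proof.
by have [K gK] := hgb; exact: (dual_value_cvg hT hP0 hA0 hA ht hnested hN gK hgc).
Qed.
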